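(* Let $a,A,b,B\in\mathbb{C}\setminus\{0\}$, $P(x)=ae^{-2ix}+Ae^{2ix}$, $Q(x)=be^{-2ix}+Be^{2ix}$. The Dirac operator $$Ly=i\begin{pmatrix}1&0\\0&-1\end{pmatrix}\frac{dy}{dx}+\begin{pmatrix}0&P\\Q&0\end{pmatrix}y,\qquad y=\begin{pmatrix} y_1 \\ y_2 \end{pmatrix},$$ on $[0,\pi]$ has, for $n\in\mathbb{Z}$ with $|n|$ large enough, two (counted with algebraic multiplicity) periodic (if $n$ is even) or antiperiodic (if $n$ is odd) eigenvalues $\lambda_n^-,\lambda_n^+$ such that $$\lambda_n^\pm=n+\frac{Ab+aB}{2n}+\frac{aB-Ab}{2n^2}+O\left(1/|n|^3\right).$$ If $n$ is even (and $|n|$ is large enough), then $\gamma_n=\lambda_n^+-\lambda_n^-=0$. For odd $n=\pm(2m+1)$, $m\in\mathbb{N}$, as $m\to\infty$, $$\gamma_{2m+1}=\pm2\,\frac{\sqrt{(Ab)^m(aB)^{m+1}}}{4^{2m}(m!)^2}\left[1+O\left(\frac{\log^2m}{m^2}\right)\right]$$ and $$\gamma_{-(2m+1)}=\pm2\,\frac{\sqrt{(Ab)^{m+1}(aB)^m}}{4^{2m}(m!)^2}\left[1+O\left(\frac{\log^2m}{m^2}\right)\right].$$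
   Context: Periodic boundary conditions: $y(\pi)=y(0)$; antiperiodic: $y(\pi)=-y(0)$. It is known that both boundary value problems have discrete spectra, and there is $N_0$ such that for $|n|>N_0$ the disc $\{|\lambda-n|<1/2\}$ contains exactly two (counted with algebraic multiplicity) periodic (if $n$ is even) or antiperiodic (if $n$ is odd) eigenvalues. These are denoted $\lambda_n^-,\lambda_n^+$, ordered so that $\operatorname{Re}\lambda_n^-<\operatorname{Re}\lambda_n^+$, or $\operatorname{Re}\lambda_n^-=\operatorname{Re}\lambda_n^+$ and $\operatorname{Im}\lambda_n^-\le\operatorname{Im}\lambda_n^+$; and $\gamma_n=\lambda_n^+-\lambda_n^-$. In the formulas for $\gamma_{\pm(2m+1)}$, $\sqrt{\cdot}$ denotes a square root of the complex number, and the formula holds with one of the two signs $\pm$, which may depend on $m$. The $O$-constants depend only on $a,A,b,B$. *)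

(* Defs.v *)
From Stdlib Require Import Reals ZArith.
From Coquelicot Require Import Coquelicot.

Open Scope R_scope.

Definition expi (t : R) : C := (cos t, sin t).

Definition trig_pot (c0 c1 : C) (x : R) : C :=
  (c0 * expi (- (2 * x)) + c1 * expi (2 * x))%C.

Definition I0pi (x : R) : Prop := 0 <= x <= PI.

(* [C * C] as a normed space over [R] (inference would not pick this
   structure) and as a vector space over [C]. *)
Definition C2_R : NormedModule R_AbsRing :=
  prod_NormedModule R_AbsRing C_R_NormedModule C_R_NormedModule.
Definition C2_C : ModuleSpace C_Ring :=
  prod_ModuleSpace C_Ring (Ring_ModuleSpace C_Ring) (Ring_ModuleSpace C_Ring).

(* Functions on [0, PI] are represented by functions on [R], of which only the
   values on [0, PI] ever matter; in particular the derivative is one-sided at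
   0 and at PI, and identities between functions are required on [0, PI] only. *)
Definition is_derive_0pi (y dy : R -> C * C) : Prop :=
  forall x, I0pi x ->
    filterdiff (K := R_AbsRing) (U := R_NormedModule) (V := C2_R)
      y (within I0pi (locally x)) (fun h : R => @scal R_AbsRing C2_R h (dy x)).

(* [y] is in the domain of the operator with boundary condition
   y(PI) = s y(0), and L y = f. Since the potential is smooth, the root vectors
   of L are smooth, so taking C^1 functions rather than absolutely continuous
   ones with square-integrable derivative as the domain does not change the
   root spaces. *)
Definition dirac (P Q : R -> C) (s : C) (y f : R -> C * C) : Prop :=
  exists dy : R -> C * C,
    is_derive_0pi y dy /\
    continuous_on I0pi dy /\
    y PI = @scal C_Ring C2_C s (y 0) /\
    forall x, I0pi x ->
      f x = (Ci * fst (dy x) + P x * snd (y x),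
             - Ci * snd (dy x) + Q x * fst (y x))%C.

Definition eigenvalue (P Q : R -> C) (s lam : C) : Prop :=
  exists y : R -> C * C,
    ~ (forall x, I0pi x -> y x = zero) /\
    dirac P Q s y (fun x => @scal C_Ring C2_C lam (y x)).

(* y is in the kernel of (L - lam)^k, with its natural domain. *)
Fixpoint ker_pow (P Q : R -> C) (s lam : C) (k : nat) (y : R -> C * C) : Prop :=
  match k with
  | O => forall x, I0pi x -> y x = zero
  | S k' => exists f : R -> C * C,
      dirac P Q s y f /\
      ker_pow P Q s lam k'
        (fun x => @minus C2_C (f x) (@scal C_Ring C2_C lam (y x)))
  end.

Definition root_vector (P Q : R -> C) (s lam : C) (y : R -> C * C) : Prop :=
  exists k : nat, ker_pow P Q s lam k y.

Definition lin_comb (d : nat) (c : nat -> C) (e : nat -> R -> C * C) (x : R)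
  : C * C :=
  @sum_n_m C2_C (fun j => @scal C_Ring C2_C (c j) (e j x)) 1 d.

(* [e 1], ..., [e d] is a basis of the root space. *)
Definition alg_mult (P Q : R -> C) (s lam : C) (d : nat) : Prop :=
  exists e : nat -> R -> C * C,
    (forall j, (1 <= j <= d)%nat -> root_vector P Q s lam (e j)) /\
    (forall c : nat -> C,
       (forall x, I0pi x -> lin_comb d c e x = zero) ->
       forall j, (1 <= j <= d)%nat -> c j = 0) /\
    (forall y, root_vector P Q s lam y ->
       exists c : nat -> C, forall x, I0pi x -> y x = lin_comb d c e x).

(* Periodic boundary condition for even n, antiperiodic for odd n. *)
Definition bc (n : Z) : C := if Z.even n then 1 else (- 1)%C.

(* [lm] and [lp] are the eigenvalues lambda_n^- and lambda_n^+: the disc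
   |lam - n| < 1/2 contains no other eigenvalue, and they exhaust it with
   total algebraic multiplicity two. *)
Definition eigen_pair (P Q : R -> C) (n : Z) (lm lp : C) : Prop :=
  Cmod (lm - IZR n) < 1 / 2 /\
  Cmod (lp - IZR n) < 1 / 2 /\
  (forall lam : C, Cmod (lam - IZR n) < 1 / 2 ->
     eigenvalue P Q (bc n) lam -> lam = lm \/ lam = lp) /\
  (lm <> lp ->
     alg_mult P Q (bc n) lm 1 /\ alg_mult P Q (bc n) lp 1) /\
  (lm = lp -> alg_mult P Q (bc n) lm 2) /\
  (Re lm < Re lp \/ (Re lm = Re lp /\ Im lm <= Im lp)).

Definition lambda_approx (a A b B : C) (n : Z) : C :=
  (IZR n + (A * b + a * B) / (2 * IZR n)
         + (a * B - A * b) / (2 * IZR n ^ 2))%C.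

(* gamma = +- 2 sqrt(D) / (4^(2m) (m!)^2) * (1 + r) with |r| <= eps, for one of
   the two signs, whichever square root of D is taken. *)
Definition gap_formula (gamma D : C) (m : nat) (eps : R) : Prop :=
  forall w : C, (w ^ 2)%C = D ->
    exists r : C, Cmod r <= eps /\
      let g := (2 * (w / (4 ^ (2 * m) * INR (fact m) ^ 2)) * (1 + r))%C in
      gamma = g \/ gamma = (- g)%C.

(* Main.v *)
Require Import Defs.
From Stdlib Require Import Reals ZArith Lra Lia Psatz List ClassicalEpsilon.
From Coquelicot Require Import Coquelicot.
Open Scope R_scope.

(** Put lam = n + z and y = exp (- i n x) sum_j (X_j, Y_j) exp (2 i j x), an expansion that
    respects the boundary condition. Multiplication by P and Q shifts the index by one, and
    L y = lam y becomes
      (z + 2 j) X_j = a Y_(j+1) + A Y_(j-1),   (z + 2 (n - j)) Y_j = b X_(j+1) + B X_(j-1).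
    This system splits into two tridiagonal chains: one carries X at the even and Y at the odd
    nodes, the other one the rest. For |z| <= 1/2 a diagonal entry is small only at the node 0
    of X and at the node n of Y, the resonances. The other ones are bounded away from zero, and
    the product of two neighbouring ones is at least of order |n|. A diagonal change of
    variables makes a chain symmetric, with couplings c and d in turn, where c^2 = a B and
    d^2 = A b.

    On a half chain without resonance the ratio of consecutive entries of a decaying solution
    is a continued fraction. The lower bound on the products makes the fraction converge
    ([ratio_exists]) and depend on z with a small Lipschitz constant ([ratio_lipschitz]), and
    for |n| large every other solution grows faster than a given exponential
    ([tail_tempered_unique]). Two
    half chains joined at a resonance thus yield one scalar equation z = q_0 r_0 + q'_0 r'_0.
    Its right-hand side is a contraction, so there is exactly one root ([root_exists],
    [root_unique]); expanding two levels of the fractions gives its asymptotics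
    ([head_asym], [zeta_asym]).

    If n is even, each chain contains one resonance, and after the reflection j -> n - j of the
    second chain both have the same symmetric form, hence the same root: the eigenvalue is
    double, with two eigenfunctions, and the gap vanishes ([dirac_even]). If n is odd, one chain
    contains no resonance and carries only the zero solution ([no_resonance]); the other one
    contains both and is invariant under j -> n - j. Its solutions split by parity eps = 1, -1,
    and folding at the middle edge, between m and m + 1 for n = 2 m + 1, leaves for each parity
    a chain with one resonance. The two folded chains differ only by the entry - eps q_m on the
    diagonal at m ([fold_res]).

    Green's identity for the two decaying solutions gives the gap
      (z_1 - z_(-1)) (1 + O(1 / n^2)) = 2 q_m g_m h_m   ([gap_green]),
    where g_m and h_m are products of m ratios. To leading order a ratio is a coupling over a
    diagonal entry, and the diagonal entries multiply to 4^m m! ([prod_e]). The relative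
    corrections are of size 1 / (n j), but their sum is much smaller. Consecutive entries add
    up to 2 n - 2 or 2 n + 2, so 1 / (e_j e_(j+1)) is (1 / e_j + 1 / e_(j+1)) / (2 n) up to a
    relative error 1 / n; the sum telescopes against z sum_j 1 / e_j, because z is close to
    (c^2 + d^2) / (2 n) ([relx_model], [telescope], [relx_sum]). The one remaining term of
    order 1 / n, caused by the entry at m, has opposite signs for the two parities and
    disappears in g_m h_m. Second order terms give the error log^2 m / m^2.

    Green's identity for a decaying solution with itself rules out Jordan blocks
    ([root_no_jordan]), so algebraic multiplicities can be read off from the kernels. Negative
    n reduce to positive ones by j -> - j, z -> - z, (c, d) -> (- d, - c) ([modes_flip]).

    The passage between functions and sequences uses that Fourier coefficients of vectors in
    the domain satisfy the system, by integration by parts ([coef_derive]), that a continuous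
    function with zero coefficients vanishes ([coef_complete]), and that exponentially decaying
    coefficients are those of a C^1 function ([synth_exists]). *)

(** * Complex sequences, sums and products *)

Lemma le_of_le_plus_eps (x y : R) : (forall e, 0 < e -> x <= y + e) -> x <= y.
Proof.
  intros H. destruct (Rle_lt_dec x y) as [h | h]; [exact h |].
  specialize (H ((x - y) / 2)). lra.
Qed.

Lemma Ceq_of_small (x y : C) : (forall e, 0 < e -> Cmod (x - y) <= e) -> x = y.
Proof.
  intros H.
  assert (H0 : Cmod (x - y) = 0).
  { apply Rle_antisym; [| apply Cmod_ge_0].
    apply le_of_le_plus_eps. intros e he. rewrite Rplus_0_l. now apply H. }
  apply Cmod_eq_0 in H0. replace x with (x - y + y)%C by ring. rewrite H0. ring.
Qed.

Lemma Cmod_triangle_inv (x y : C) : Cmod x - Cmod y <= Cmod (x + y).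
Proof.
  pose proof (Cmod_triangle (x + y) (- y)) as H. rewrite Cmod_opp in H.
  replace (x + y + - y)%C with x in H by ring. lra.
Qed.

Lemma Cmod_minus_le (x y : C) : Cmod (x - y) <= Cmod x + Cmod y.
Proof. unfold Cminus. rewrite <- (Cmod_opp y). apply Cmod_triangle. Qed.

Lemma Cmod_minus_ge (x y : C) : Cmod x - Cmod y <= Cmod (x - y).
Proof. unfold Cminus. rewrite <- (Cmod_opp y). apply Cmod_triangle_inv. Qed.

Lemma Cmod_minus_sym (x y : C) : Cmod (x - y) = Cmod (y - x).
Proof. rewrite <- Cmod_opp. f_equal. ring. Qed.

Lemma Cmod_dist_trans (x y z : C) : Cmod (x - z) <= Cmod (x - y) + Cmod (y - z).
Proof. replace (x - z)%C with ((x - y) + (y - z))%C by ring. apply Cmod_triangle. Qed.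

Lemma Cmod_div_le (x y : C) (A D : R) :
  0 < D -> Cmod x <= A -> D <= Cmod y -> Cmod (x / y) <= A / D.
Proof.
  intros hD hx hy. rewrite Cmod_div by (apply Cmod_gt_0; lra).
  pose proof (Cmod_ge_0 x).
  apply Rle_trans with (A / Cmod y).
  - apply Rmult_le_compat_r; [| exact hx]. left. apply Rinv_0_lt_compat. lra.
  - apply Rmult_le_compat_l; [lra |]. apply Rinv_le_contravar; lra.
Qed.

Lemma im_le_Cmod (z : C) : Rabs (Im z) <= Cmod z.
Proof. eapply Rle_trans; [apply Rmax_r | apply Rmax_Cmod]. Qed.

Lemma Cmod_le_re_im (z : C) : Cmod z <= Rabs (Re z) + Rabs (Im z).
Proof.
  destruct z as [x y]. simpl.
  replace (x, y) with (RtoC x + Ci * RtoC y)%C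
    by (apply injective_projections; simpl; ring).
  eapply Rle_trans; [apply Cmod_triangle |].
  rewrite Cmod_mult, !Cmod_R, Cmod_Ci. lra.
Qed.

Lemma RtoC_neq_0 (x : R) : x <> 0 -> RtoC x <> 0%C.
Proof. intros H e. apply H. now apply RtoC_inj. Qed.

Lemma pow_small (th K e : R) :
  0 <= th < 1 -> 0 <= K -> 0 < e -> exists N, forall k, (N <= k)%nat -> K * th ^ k <= e.
Proof.
  intros hth hK he.
  destruct (pow_lt_1_zero th) with (y := e / (K + 1)) as [N HN].
  - rewrite Rabs_pos_eq; lra.
  - apply Rdiv_lt_0_compat; lra.
  - exists N. intros k hk. specialize (HN k hk).
    rewrite Rabs_pos_eq in HN by (apply pow_le; lra).
    assert (K * th ^ k <= K * (e / (K + 1))) by (apply Rmult_le_compat_l; lra).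
    assert (K * (e / (K + 1)) <= e).
    { apply Rmult_le_reg_r with (K + 1); [lra |].
      replace (K * (e / (K + 1)) * (K + 1)) with (K * e) by (field; lra). nra. }
    lra.
Qed.

Lemma geom_dist (u : nat -> C) (K th : R) :
  0 <= th < 1 -> (forall k, Cmod (u (S k) - u k) <= K * th ^ k) ->
  forall k p, Cmod (u (k + p)%nat - u k) <= K * th ^ k / (1 - th).
Proof.
  intros hth H k p.
  assert (hK : 0 <= K).
  { specialize (H O). simpl in H. pose proof (Cmod_ge_0 (u 1%nat - u O)). lra. }
  assert (hpk := pow_le th k (proj1 hth)).
  assert (G : Cmod (u (k + p)%nat - u k) <= K * th ^ k * ((1 - th ^ p) / (1 - th))).
  { induction p as [| p IH].
    - rewrite Nat.add_0_r. replace (u k - u k)%C with (RtoC 0) by ring.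
      rewrite Cmod_0. simpl. unfold Rdiv. rewrite Rminus_diag. lra.
    - rewrite Nat.add_succ_r.
      eapply Rle_trans; [apply (Cmod_dist_trans _ (u (k + p)%nat)) |].
      specialize (H (k + p)%nat).
      replace (K * th ^ k * ((1 - th ^ S p) / (1 - th)))
        with (K * th ^ (k + p) + K * th ^ k * ((1 - th ^ p) / (1 - th))).
      + lra.
      + rewrite pow_add. simpl. field. lra. }
  eapply Rle_trans; [exact G |]. unfold Rdiv.
  assert (0 <= th ^ p) by (apply pow_le; lra).
  rewrite (Rmult_assoc _ (th ^ k)), (Rmult_assoc K (th ^ k) (/ (1 - th))).
  apply Rmult_le_compat_l; [lra |]. apply Rmult_le_compat_l; [lra |].
  assert (0 < / (1 - th)) by (apply Rinv_0_lt_compat; lra). nra.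
Qed.

Lemma real_cauchy_geom (u : nat -> R) (K th : R) :
  0 <= th < 1 -> 0 <= K ->
  (forall k p, Rabs (u (k + p)%nat - u k) <= K * th ^ k) ->
  exists l, forall e, 0 < e -> exists N, forall k, (N <= k)%nat -> Rabs (u k - l) <= e.
Proof.
  intros hth hK H.
  destruct (Rcomplete.R_complete u) as [l Hl].
  - intros e he. destruct (pow_small th K (e / 4) hth hK) as [N HN]; [lra |].
    exists N. intros n m hn hm. unfold R_dist.
    specialize (HN N (le_n N)).
    pose proof (H N (n - N)%nat) as H1. pose proof (H N (m - N)%nat) as H2.
    replace (N + (n - N))%nat with n in H1 by lia.
    replace (N + (m - N))%nat with m in H2 by lia.
    replace (u n - u m) with ((u n - u N) - (u m - u N)) by ring.
    eapply Rle_lt_trans; [apply Rabs_triang |]. rewrite Rabs_Ropp. lra.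
  - exists l. intros e he. destruct (Hl e he) as [N HN]. exists N.
    intros k hk. left. apply HN. exact hk.
Qed.

(** The limit comes with its rate, because all limits of the continued fractions and of the
    Fourier series are used through uniform error bounds. *)
Lemma geom_lim (u : nat -> C) (K th : R) :
  0 <= th < 1 -> (forall k, Cmod (u (S k) - u k) <= K * th ^ k) ->
  exists l, forall k, Cmod (u k - l) <= K / (1 - th) * th ^ k.
Proof.
  intros hth H.
  pose proof (geom_dist u K th hth H) as G.
  assert (hK : 0 <= K / (1 - th)).
  { specialize (H O). simpl in H. pose proof (Cmod_ge_0 (u 1%nat - u O)).
    apply Rmult_le_pos; [lra |]. left. apply Rinv_0_lt_compat. lra. }
  assert (G' : forall k p, Cmod (u (k + p)%nat - u k) <= K / (1 - th) * th ^ k).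
  { intros k p. replace (K / (1 - th) * th ^ k) with (K * th ^ k / (1 - th))
      by (field; lra). apply G. }
  destruct (real_cauchy_geom (fun k => Re (u k)) (K / (1 - th)) th hth hK) as [lr Hr].
  { intros k p. eapply Rle_trans; [| apply (G' k p)].
    apply (re_le_Cmod (u (k + p)%nat - u k)). }
  destruct (real_cauchy_geom (fun k => Im (u k)) (K / (1 - th)) th hth hK) as [li Hi].
  { intros k p. eapply Rle_trans; [| apply (G' k p)].
    apply (im_le_Cmod (u (k + p)%nat - u k)). }
  exists (lr, li). intros k. apply le_of_le_plus_eps. intros e he.
  destruct (Hr (e / 2)) as [N1 H1]; [lra |]. destruct (Hi (e / 2)) as [N2 H2]; [lra |].
  set (p := (N1 + N2)%nat).
  eapply Rle_trans; [apply (Cmod_dist_trans _ (u (k + p)%nat)) |].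
  apply Rplus_le_compat.
  - rewrite Cmod_minus_sym. apply G'.
  - eapply Rle_trans; [apply Cmod_le_re_im |].
    specialize (H1 (k + p)%nat ltac:(unfold p; lia)).
    specialize (H2 (k + p)%nat ltac:(unfold p; lia)).
    unfold Re, Im in *. simpl in *. unfold Rminus in *. lra.
Qed.

Fixpoint csum (f : nat -> C) (n : nat) : C :=
  match n with O => RtoC 0 | S k => (csum f k + f k)%C end.

Fixpoint rsum (f : nat -> R) (n : nat) : R :=
  match n with O => 0 | S k => rsum f k + f k end.

Fixpoint cprod (f : nat -> C) (n : nat) : C :=
  match n with O => RtoC 1 | S k => (cprod f k * f k)%C end.

Lemma csum_ext (f g : nat -> C) n :
  (forall k, (k < n)%nat -> f k = g k) -> csum f n = csum g n.
Proof.
  induction n as [| n IH]; intros H; [reflexivity |]. simpl.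
  rewrite IH, H by (intros; try apply H; lia). reflexivity.
Qed.

Lemma csum_plus (f g : nat -> C) n :
  csum (fun k => (f k + g k)%C) n = (csum f n + csum g n)%C.
Proof. induction n as [| n IH]; simpl; [ring |]. rewrite IH. ring. Qed.

Lemma csum_scal (c : C) (f : nat -> C) n :
  csum (fun k => (c * f k)%C) n = (c * csum f n)%C.
Proof. induction n as [| n IH]; simpl; [ring |]. rewrite IH. ring. Qed.

Lemma Cmod_csum_le (f : nat -> C) (g : nat -> R) n :
  (forall k, (k < n)%nat -> Cmod (f k) <= g k) -> Cmod (csum f n) <= rsum g n.
Proof.
  induction n as [| n IH]; intros H; simpl; [rewrite Cmod_0; lra |].
  eapply Rle_trans; [apply Cmod_triangle |].
  apply Rplus_le_compat; [apply IH; intros; apply H; lia | apply H; lia].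
Qed.

Lemma rsum_le (f g : nat -> R) n :
  (forall k, (k < n)%nat -> f k <= g k) -> rsum f n <= rsum g n.
Proof.
  induction n as [| n IH]; intros H; simpl; [lra |].
  apply Rplus_le_compat; [apply IH; intros; apply H; lia | apply H; lia].
Qed.

Lemma rsum_scal (c : R) (f : nat -> R) n : rsum (fun k => c * f k) n = c * rsum f n.
Proof. induction n as [| n IH]; simpl; [ring |]. rewrite IH. ring. Qed.

Lemma rsum_geom (K th : R) n :
  0 <= th < 1 -> 0 <= K -> rsum (fun k => K * th ^ k) n <= K / (1 - th).
Proof.
  intros hth hK.
  assert (E : rsum (fun k => K * th ^ k) n = K / (1 - th) - K / (1 - th) * th ^ n).
  { induction n as [| n IH]; simpl; [field; lra |]. rewrite IH. field. lra. }
  rewrite E. assert (0 <= K / (1 - th) * th ^ n); [| lra].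
  apply Rmult_le_pos; [| apply pow_le; lra].
  apply Rmult_le_pos; [lra |]. left. apply Rinv_0_lt_compat. lra.
Qed.

(** * Half chains and their continued fractions *)

(** A half chain is the tridiagonal system with equation
    (z + E_(j+1)) f_(j+1) = q_(j+1) f_(j+2) + q_j f_j at the nodes 1, 2, ...; the node 0 carries
    a free boundary value. In the application kap grows like |n| whereas single entries of E
    stay bounded: every smallness below comes from the product of two neighbours. *)
Record tail_ok (M kap : R) (E q : nat -> C) : Prop := {
  tail_M : 1 <= M;
  tail_kap : 24 * M ^ 2 <= kap;
  tail_q : forall j, Cmod (q j) <= M;
  tail_E : forall j, 3 / 2 <= Cmod (E (S j));
  tail_EE : forall j, kap <= Cmod (E (S j)) * Cmod (E (S (S j)))
}.

Arguments tail_M {M kap E q}.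
Arguments tail_kap {M kap E q}.
Arguments tail_q {M kap E q}.
Arguments tail_E {M kap E q}.
Arguments tail_EE {M kap E q}.

Definition tail_res (E q : nat -> C) (z : C) (f : nat -> C) (j : nat) : C :=
  ((z + E (S j)) * f (S j) - q (S j) * f (S (S j)) - q j * f j)%C.

(** The quotient f_(j+1) / f_j along a decaying solution f, written without division.
    The bound singles out the decaying solution. *)
Definition is_ratio (M : R) (E q : nat -> C) (z : C) (r : nat -> C) : Prop :=
  forall j, Cmod (r j) <= 2 * M / Cmod (E (S j)) /\
    (r j * (z + E (S j) - q (S j) * r (S j)) = q j)%C.

Section Tail.
Context (M kap : R) (E q : nat -> C) (T : tail_ok M kap E q).

Let e (j : nat) : R := Cmod (E (S j)).

Lemma tail_div_EE (j : nat) (A : R) :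
  0 <= A -> A / Cmod (E (S (S j))) <= A / kap * Cmod (E (S j)).
Proof.
  intros hA.
  pose proof (tail_E T j). pose proof (tail_E T (S j)).
  pose proof (tail_EE T j). pose proof (tail_kap T).
  pose proof (tail_M T).
  assert (0 < kap) by nra.
  set (x := Cmod (E (S j))) in *. set (y := Cmod (E (S (S j)))) in *.
  apply Rmult_le_reg_r with y; [lra |].
  replace (A / y * y) with A by (field; lra).
  apply Rmult_le_reg_r with kap; [lra |].
  replace (A / kap * x * y * kap) with (A * (x * y)) by (field; lra).
  nra.
Qed.

(** The correction q r is at most 2 M^2 / |E_(j+2)|, which the product bound turns into a small
    fraction of |E_(j+1)|; so the denominators of the continued fraction do not degenerate. *)
Lemma tail_den (z r : C) (j : nat) :
  Cmod z <= 1 / 2 -> Cmod r <= 2 * M / Cmod (E (S (S j))) ->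
  Cmod (E (S j)) / 2 <= Cmod (z + E (S j) - q (S j) * r).
Proof.
  intros hz hr.
  pose proof (tail_E T j) as h1. pose proof (tail_q T (S j)) as h2.
  pose proof (tail_kap T) as h3. pose proof (tail_M T) as h4.
  pose proof (tail_div_EE j (2 * M) ltac:(lra)) as h5.
  pose proof (Cmod_minus_ge (z + E (S j)) (q (S j) * r)) as h6.
  pose proof (Cmod_triangle_inv (E (S j)) z) as h7.
  rewrite (Cplus_comm (E (S j)) z) in h7.
  rewrite Cmod_mult in h6.
  pose proof (Cmod_ge_0 (q (S j))). pose proof (Cmod_ge_0 r).
  assert (h8 : Cmod (q (S j)) * Cmod r <= M * (2 * M / kap * Cmod (E (S j)))).
  { apply Rmult_le_compat; lra. }
  assert (h9 : M * (2 * M / kap * Cmod (E (S j))) <= Cmod (E (S j)) / 12).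
  { replace (M * (2 * M / kap * Cmod (E (S j))))
      with ((24 * M ^ 2 / kap) * (Cmod (E (S j)) / 12)) by (field; nra).
    rewrite <- (Rmult_1_l (Cmod (E (S j)) / 12)) at 2.
    apply Rmult_le_compat_r; [lra |].
    apply Rmult_le_reg_r with kap; [nra |].
    replace (24 * M ^ 2 / kap * kap) with (24 * M ^ 2) by (field; nra). lra. }
  lra.
Qed.

Lemma tail_den_neq (z r : C) (j : nat) :
  Cmod z <= 1 / 2 -> Cmod r <= 2 * M / Cmod (E (S (S j))) ->
  (z + E (S j) - q (S j) * r)%C <> 0%C.
Proof.
  intros hz hr. apply Cmod_gt_0. pose proof (tail_den z r j hz hr).
  pose proof (tail_E T j). lra.
Qed.

(** The continued fraction for f_(j+1) / f_j, cut off after k levels. *)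
Fixpoint trunc_ratio (z : C) (k : nat) (j : nat) : C :=
  match k with
  | O => RtoC 0
  | S k' => (q j / (z + E (S j) - q (S j) * trunc_ratio z k' (S j)))%C
  end.

Lemma trunc_ratio_bound (z : C) (k : nat) :
  Cmod z <= 1 / 2 -> forall j, Cmod (trunc_ratio z k j) <= 2 * M / Cmod (E (S j)).
Proof.
  intros hz. induction k as [| k IH]; intros j; simpl.
  - rewrite Cmod_0. pose proof (tail_E T j). pose proof (tail_M T).
    left. apply Rdiv_lt_0_compat; lra.
  - pose proof (tail_E T j).
    replace (2 * M / Cmod (E (S j))) with (M / (Cmod (E (S j)) / 2)) by (field; lra).
    apply Cmod_div_le; [lra | apply (tail_q T) |].
    now apply tail_den.
Qed.

(** One level of the continued fraction. The factor 1 / |E_(j+1)|^2 need not be small; it becomes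
    a contraction once differences at node j are measured in units of 1 / |E_(j+1)|, again by
    the product bound. *)
Lemma ratio_diff (z z' r r' : C) (j : nat) :
  Cmod z <= 1 / 2 -> Cmod z' <= 1 / 2 ->
  Cmod r <= 2 * M / Cmod (E (S (S j))) -> Cmod r' <= 2 * M / Cmod (E (S (S j))) ->
  Cmod (q j / (z + E (S j) - q (S j) * r) - q j / (z' + E (S j) - q (S j) * r'))
  <= 4 * M * (Cmod (z - z') + M * Cmod (r - r')) / Cmod (E (S j)) ^ 2.
Proof.
  intros hz hz' hr hr'.
  pose proof (tail_den z r j hz hr) as d1. pose proof (tail_den z' r' j hz' hr') as d2.
  pose proof (tail_den_neq z r j hz hr) as n1.
  pose proof (tail_den_neq z' r' j hz' hr') as n2.
  pose proof (tail_E T j) as hE. pose proof (tail_M T) as hM.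
  set (D1 := (z + E (S j) - q (S j) * r)%C) in *.
  set (D2 := (z' + E (S j) - q (S j) * r')%C) in *.
  replace (q j / D1 - q j / D2)%C with
    (q j * ((z' - z) - q (S j) * (r' - r)) / (D1 * D2))%C
    by (unfold D1, D2 in *; field; split; assumption).
  replace (4 * M * (Cmod (z - z') + M * Cmod (r - r')) / Cmod (E (S j)) ^ 2) with
    ((M * (Cmod (z - z') + M * Cmod (r - r'))) / ((Cmod (E (S j)) / 2) * (Cmod (E (S j)) / 2)))
    by (field; lra).
  apply Cmod_div_le.
  - nra.
  - rewrite Cmod_mult. apply Rmult_le_compat; try apply Cmod_ge_0.
    + apply (tail_q T).
    + eapply Rle_trans; [apply Cmod_minus_le |]. rewrite Cmod_mult.
      rewrite (Cmod_minus_sym z' z), (Cmod_minus_sym r' r).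
      apply Rplus_le_compat_l. apply Rmult_le_compat_r; [apply Cmod_ge_0 |].
      apply (tail_q T).
  - rewrite Cmod_mult. apply Rmult_le_compat; lra.
Qed.

Lemma trunc_ratio_cauchy (z : C) (k : nat) :
  Cmod z <= 1 / 2 -> forall j,
  Cmod (trunc_ratio z (S k) j - trunc_ratio z k j) <= 2 * M / Cmod (E (S j)) * (1 / 2) ^ k.
Proof.
  intros hz. pose proof (tail_M T) as hM. pose proof (tail_kap T) as hk.
  induction k as [| k IH]; intros j.
  - change (trunc_ratio z 0 j) with (RtoC 0).
    replace (trunc_ratio z 1 j - RtoC 0)%C with (trunc_ratio z 1 j) by ring.
    rewrite pow_O, Rmult_1_r. now apply trunc_ratio_bound.
  - change (trunc_ratio z (S (S k)) j) with
      (q j / (z + E (S j) - q (S j) * trunc_ratio z (S k) (S j)))%C.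
    change (trunc_ratio z (S k) j) with
      (q j / (z + E (S j) - q (S j) * trunc_ratio z k (S j)))%C at 1.
    eapply Rle_trans.
    { apply ratio_diff; try assumption; now apply trunc_ratio_bound. }
    replace (z - z)%C with (RtoC 0) by ring. rewrite Cmod_0, Rplus_0_l.
    specialize (IH (S j)).
    pose proof (tail_E T j) as hE.
    pose proof (tail_div_EE j (2 * M) ltac:(lra)) as h5.
    assert (hp : 0 < (1 / 2) ^ k) by (apply pow_lt; lra).
    set (x := Cmod (E (S j))) in *.
    set (d := Cmod (trunc_ratio z (S k) (S j) - trunc_ratio z k (S j))) in *.
    assert (hd : d <= 2 * M / kap * x * (1 / 2) ^ k).
    { eapply Rle_trans; [exact IH |]. apply Rmult_le_compat_r; lra. }
    assert (h6 : 2 * M / kap * M <= 1 / 12).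
    { apply Rmult_le_reg_r with kap; [nra |].
      replace (2 * M / kap * M * kap) with (2 * M ^ 2) by (field; nra). lra. }
    assert (h7 : M * d <= 1 / 12 * x * (1 / 2) ^ k).
    { apply Rle_trans with (M * (2 * M / kap * x * (1 / 2) ^ k)).
      - apply Rmult_le_compat_l; lra.
      - replace (M * (2 * M / kap * x * (1 / 2) ^ k))
          with ((2 * M / kap * M) * (x * (1 / 2) ^ k)) by ring.
        rewrite (Rmult_assoc (1 / 12)). apply Rmult_le_compat_r; [nra | lra]. }
    apply Rle_trans with (4 * M * (1 / 12 * x * (1 / 2) ^ k) / x ^ 2).
    + apply Rmult_le_compat_r; [left; apply Rinv_0_lt_compat; nra |].
      apply Rmult_le_compat_l; lra.
    + simpl pow.
      replace (4 * M * (1 / 12 * x * (1 / 2) ^ k) / (x * (x * 1)))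
        with (1 / 3 * (M / x * (1 / 2) ^ k)) by (field; lra).
      replace (2 * M / x * (1 / 2 * (1 / 2) ^ k)) with (M / x * (1 / 2) ^ k) by (field; lra).
      assert (0 < M / x * (1 / 2) ^ k); [| lra].
      apply Rmult_lt_0_compat; [apply Rdiv_lt_0_compat |]; lra.
Qed.

Lemma ratio_exists (z : C) :
  Cmod z <= 1 / 2 -> exists r, is_ratio M E q z r.
Proof.
  intros hz. pose proof (tail_M T) as hM.
  assert (H : forall j, exists l, forall k,
    Cmod (trunc_ratio z k j - l) <= 2 * M / Cmod (E (S j)) / (1 - 1 / 2) * (1 / 2) ^ k).
  { intros j. apply geom_lim; [lra |]. intros k. now apply trunc_ratio_cauchy. }
  exists (fun j => proj1_sig (constructive_indefinite_description _ (H j))).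
  set (r := fun j => proj1_sig (constructive_indefinite_description _ (H j))).
  assert (Hr : forall j k, Cmod (trunc_ratio z k j - r j)
    <= 2 * M / Cmod (E (S j)) / (1 - 1 / 2) * (1 / 2) ^ k).
  { intros j. exact (proj2_sig (constructive_indefinite_description _ (H j))). }
  assert (Hs : forall j e, 0 < e -> exists N, forall k, (N <= k)%nat ->
            Cmod (trunc_ratio z k j - r j) <= e).
  { intros j e' he. pose proof (tail_E T j).
    destruct (pow_small (1 / 2) (2 * M / Cmod (E (S j)) / (1 - 1 / 2)) e') as [N HN];
      try lra.
    - apply Rmult_le_pos; [| lra]. left. apply Rdiv_lt_0_compat; lra.
    - exists N. intros k hk. eapply Rle_trans; [apply Hr | now apply HN]. }
  assert (Hb : forall j, Cmod (r j) <= 2 * M / Cmod (E (S j))).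
  { intros j. apply le_of_le_plus_eps. intros e' he.
    destruct (Hs j e' he) as [N HN]. specialize (HN N (le_n N)).
    pose proof (trunc_ratio_bound z N hz j).
    pose proof (Cmod_minus_ge (r j) (trunc_ratio z N j)).
    rewrite Cmod_minus_sym in HN. lra. }
  fold r. intros j. split; [apply Hb |].
  assert (E1 : (r j = q j / (z + E (S j) - q (S j) * r (S j)))%C).
  { apply Ceq_of_small. intros e' he.
    pose proof (tail_E T j) as hE.
    destruct (Hs j (e' / 2)) as [N1 H1]; [lra |].
    set (x := Cmod (E (S j))) in *.
    destruct (Hs (S j) (e' / 2 / (4 * M * M / x ^ 2))) as [N2 H2].
    { apply Rdiv_lt_0_compat; [lra |]. apply Rdiv_lt_0_compat; nra. }
    set (k := (N1 + N2)%nat).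
    eapply Rle_trans; [apply (Cmod_dist_trans _ (trunc_ratio z (S k) j)) |].
    rewrite (Cmod_minus_sym (r j)).
    specialize (H1 (S k) ltac:(unfold k; lia)). specialize (H2 k ltac:(unfold k; lia)).
    assert (h : Cmod (trunc_ratio z (S k) j - q j / (z + E (S j) - q (S j) * r (S j)))
              <= e' / 2); [| lra].
    change (trunc_ratio z (S k) j) with
      (q j / (z + E (S j) - q (S j) * trunc_ratio z k (S j)))%C.
    eapply Rle_trans.
    { apply ratio_diff; try assumption; [now apply trunc_ratio_bound | apply Hb]. }
    replace (z - z)%C with (RtoC 0) by ring. rewrite Cmod_0, Rplus_0_l. fold x.
    replace (4 * M * (M * Cmod (trunc_ratio z k (S j) - r (S j))) / x ^ 2)
      with ((4 * M * M / x ^ 2) * Cmod (trunc_ratio z k (S j) - r (S j))) by (field; nra).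
    apply Rle_trans with ((4 * M * M / x ^ 2) * (e' / 2 / (4 * M * M / x ^ 2))).
    - apply Rmult_le_compat_l; [| exact H2]. left. apply Rdiv_lt_0_compat; nra.
    - right. field. split; nra. }
  rewrite E1 at 1. field. apply tail_den_neq; [exact hz | apply Hb].
Qed.

Lemma ratio_eq (z : C) r j :
  Cmod z <= 1 / 2 -> is_ratio M E q z r ->
  (r j = q j / (z + E (S j) - q (S j) * r (S j)))%C.
Proof.
  intros hz Hr. destruct (Hr j) as [_ H]. destruct (Hr (S j)) as [H' _].
  rewrite <- H. field. now apply tail_den_neq.
Qed.

(** Iterating the contraction k times leaves an error of order 2^(-k) from the trivial bound
    on r - r'. *)
Lemma ratio_lipschitz (z z' : C) r r' :
  Cmod z <= 1 / 2 -> Cmod z' <= 1 / 2 ->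
  is_ratio M E q z r -> is_ratio M E q z' r' ->
  forall j, Cmod (r j - r' j) <= 4 * M / Cmod (E (S j)) * Cmod (z - z').
Proof.
  intros hz hz' Hr Hr'.
  pose proof (tail_M T) as hM. pose proof (tail_kap T) as hk.
  assert (G : forall k j, Cmod (r j - r' j)
            <= 4 * M / Cmod (E (S j)) * (Cmod (z - z') + (1 / 2) ^ k)).
  { induction k as [| k IH]; intros j.
    - pose proof (tail_E T j) as hE.
      eapply Rle_trans; [apply Cmod_minus_le |].
      pose proof (proj1 (Hr j)). pose proof (proj1 (Hr' j)).
      pose proof (Cmod_ge_0 (z - z')).
      assert (0 < 2 * M / Cmod (E (S j))) by (apply Rdiv_lt_0_compat; lra).
      simpl pow.
      replace (4 * M / Cmod (E (S j))) with (2 * (2 * M / Cmod (E (S j)))) by (field; lra).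
      nra.
    - rewrite (ratio_eq z r j hz Hr), (ratio_eq z' r' j hz' Hr').
      eapply Rle_trans.
      { apply ratio_diff; try assumption; [apply (Hr (S j)) | apply (Hr' (S j))]. }
      specialize (IH (S j)).
      pose proof (tail_E T j) as hE.
      pose proof (tail_div_EE j (4 * M) ltac:(lra)) as h5.
      assert (hp : 0 < (1 / 2) ^ k) by (apply pow_lt; lra).
      pose proof (Cmod_ge_0 (z - z')) as hd0.
      set (x := Cmod (E (S j))) in *. set (dz := Cmod (z - z')) in *.
      set (d := Cmod (r (S j) - r' (S j))) in *.
      assert (hd : M * d <= 1 / 6 * x * (dz + (1 / 2) ^ k)).
      { assert (h6 : M * (4 * M / kap) <= 1 / 6).
        { apply Rmult_le_reg_r with kap; [nra |].
          replace (M * (4 * M / kap) * kap) with (4 * M ^ 2) by (field; nra). lra. }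
        apply Rle_trans with (M * (4 * M / kap * x * (dz + (1 / 2) ^ k))).
        - apply Rmult_le_compat_l; [lra |]. eapply Rle_trans; [exact IH |].
          apply Rmult_le_compat_r; lra.
        - replace (M * (4 * M / kap * x * (dz + (1 / 2) ^ k)))
            with ((M * (4 * M / kap)) * (x * (dz + (1 / 2) ^ k))) by ring.
          rewrite (Rmult_assoc (1 / 6)). apply Rmult_le_compat_r; nra. }
      apply Rle_trans with (4 * M * (2 / 3 * x * dz + 1 / 6 * x * (dz + (1 / 2) ^ k)) / x ^ 2).
      + apply Rmult_le_compat_r; [left; apply Rinv_0_lt_compat; nra |].
        apply Rmult_le_compat_l; nra.
      + simpl pow.
        replace (4 * M * (2 / 3 * x * dz + 1 / 6 * x * (dz + (1 / 2) ^ k)) / (x * (x * 1)))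
          with (4 * M / x * (5 / 6 * dz + 1 / 6 * (1 / 2) ^ k)) by (field; lra).
        apply Rmult_le_compat_l; [left; apply Rdiv_lt_0_compat |]; lra. }
  intros j. apply le_of_le_plus_eps. intros e' he.
  pose proof (tail_E T j) as hE.
  destruct (pow_small (1 / 2) (4 * M / Cmod (E (S j))) e') as [N HN]; try lra.
  { left. apply Rdiv_lt_0_compat; lra. }
  specialize (HN N (le_n N)). specialize (G N j). lra.
Qed.

Lemma ratio_sol_res (z : C) r j :
  is_ratio M E q z r -> tail_res E q z (cprod r) j = 0%C.
Proof.
  intros Hr. unfold tail_res. simpl. destruct (Hr j) as [_ H].
  replace ((z + E (S j)) * (cprod r j * r j) - q (S j) * (cprod r j * r j * r (S j))
    - q j * cprod r j)%C with (cprod r j * (r j * (z + E (S j) - q (S j) * r (S j)) - q j))%C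
    by ring.
  rewrite H. ring.
Qed.

Lemma ratio_pair (z : C) r j :
  is_ratio M E q z r -> Cmod (r j) * Cmod (r (S j)) <= 4 * M ^ 2 / kap.
Proof.
  intros Hr. destruct (Hr j) as [H1 _]. destruct (Hr (S j)) as [H2 _].
  pose proof (tail_M T) as hM. pose proof (tail_kap T) as hk.
  pose proof (tail_E T j) as e1. pose proof (tail_E T (S j)) as e2.
  pose proof (tail_EE T j) as e3.
  eapply Rle_trans.
  { apply Rmult_le_compat; [apply Cmod_ge_0 | apply Cmod_ge_0 | exact H1 | exact H2]. }
  set (x := Cmod (E (S j))) in *. set (y := Cmod (E (S (S j)))) in *.
  replace (2 * M / x * (2 * M / y)) with (4 * M ^ 2 / (x * y)) by (field; lra).
  apply Rmult_le_compat_l; [nra |]. apply Rinv_le_contravar; nra.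
Qed.

(** A single ratio need not be small, but two successive ones have a product of order 1 / kap.
    The rate th is therefore gained over two steps at a time. *)
Lemma ratio_sol_decay (z : C) r th :
  0 < th <= 1 -> 4 * M ^ 2 <= th ^ 2 * kap ->
  is_ratio M E q z r ->
  forall G, Cmod (r O) <= G -> 4 * M ^ 2 / kap <= G * th ->
  forall j, Cmod (cprod r (S j)) <= G * th ^ j.
Proof.
  intros hth hk Hr G hG hG2.
  pose proof (tail_M T) as hM. pose proof (tail_kap T) as hk'.
  assert (h4 : 4 * M ^ 2 / kap <= th ^ 2).
  { apply Rmult_le_reg_r with kap; [nra |].
    replace (4 * M ^ 2 / kap * kap) with (4 * M ^ 2) by (field; nra). lra. }
  assert (P : forall j, Cmod (cprod r (S j)) <= G * th ^ j /\
                        Cmod (cprod r (S (S j))) <= G * th ^ (S j)).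
  { induction j as [| j [IH1 IH2]].
    - simpl. rewrite !Cmult_1_l, Cmod_mult, !Rmult_1_r. split; [exact hG |].
      pose proof (ratio_pair z r 0 Hr). lra.
    - split; [exact IH2 |].
      change (cprod r (S (S (S j)))) with (cprod r (S j) * r (S j) * r (S (S j)))%C.
      rewrite !Cmod_mult, Rmult_assoc.
      pose proof (ratio_pair z r (S j) Hr) as h5.
      replace (G * th ^ S (S j)) with (G * th ^ j * th ^ 2) by (simpl; ring).
      apply Rmult_le_compat; try apply Cmod_ge_0; try assumption.
      + apply Rmult_le_pos; apply Cmod_ge_0.
      + lra. }
  intros j. apply P.
Qed.

(** The defect w_j = f_(j+1) - r_j f_j satisfies a first order recursion, which multiplies it by
    something of order kap over two steps. As kap exceeds the square of the growth rate allowed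
    for f, the defect has to vanish. *)
Lemma tail_tempered_unique (z : C) r (f : nat -> C) (K rho : R) :
  Cmod z <= 1 / 2 -> is_ratio M E q z r ->
  1 <= rho -> 16 * M ^ 2 * rho ^ 2 <= kap ->
  (forall j, Cmod (f j) <= K * rho ^ j) ->
  (forall j, tail_res E q z f j = 0%C) ->
  forall j, f j = (f O * cprod r j)%C.
Proof.
  intros hz Hr hrho hk Hf Hres.
  pose proof (tail_M T) as hM.
  assert (hK : 0 <= K).
  { specialize (Hf O). simpl in Hf. pose proof (Cmod_ge_0 (f O)). lra. }
  set (w := fun j => (f (S j) - r j * f j)%C).
  assert (Hw : forall j, (w j * (z + E (S j) - q (S j) * r (S j)) = q (S j) * w (S j))%C).
  { intros j. specialize (Hres j). unfold tail_res in Hres. destruct (Hr j) as [_ h].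
    unfold w.
    replace ((f (S j) - r j * f j) * (z + E (S j) - q (S j) * r (S j)))%C
      with ((z + E (S j)) * f (S j) - q (S j) * f (S (S j)) - q j * f j
            + q (S j) * (f (S (S j)) - r (S j) * f (S j))
            + f j * (q j - r j * (z + E (S j) - q (S j) * r (S j))))%C by ring.
    rewrite Hres, h. ring. }
  assert (Hw1 : forall j, Cmod (w j) <= 2 * M / Cmod (E (S j)) * Cmod (w (S j))).
  { intros j. pose proof (tail_E T j) as hE.
    pose proof (tail_den z (r (S j)) j hz (proj1 (Hr (S j)))) as hd.
    pose proof (f_equal Cmod (Hw j)) as h. rewrite !Cmod_mult in h.
    pose proof (tail_q T (S j)) as hq.
    pose proof (Cmod_ge_0 (w j)). pose proof (Cmod_ge_0 (w (S j))).
    apply Rmult_le_reg_r with (Cmod (E (S j)) / 2); [lra |].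
    replace (2 * M / Cmod (E (S j)) * Cmod (w (S j)) * (Cmod (E (S j)) / 2))
      with (M * Cmod (w (S j))) by (field; lra).
    apply Rle_trans with (Cmod (w j) * Cmod (z + E (S j) - q (S j) * r (S j))).
    - apply Rmult_le_compat_l; lra.
    - rewrite h. apply Rmult_le_compat_r; lra. }
  assert (Hw2 : forall j, Cmod (w j) <= 1 / (4 * rho ^ 2) * Cmod (w (S (S j)))).
  { intros j. eapply Rle_trans; [apply Hw1 |].
    pose proof (tail_E T j) as e1. pose proof (tail_E T (S j)) as e2.
    pose proof (tail_EE T j) as e3. pose proof (Cmod_ge_0 (w (S (S j)))).
    set (x := Cmod (E (S j))) in *. set (y := Cmod (E (S (S j)))) in *.
    apply Rle_trans with (2 * M / x * (2 * M / y * Cmod (w (S (S j))))).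
    - apply Rmult_le_compat_l; [left; apply Rdiv_lt_0_compat; lra | apply (Hw1 (S j))].
    - rewrite <- Rmult_assoc. apply Rmult_le_compat_r; [assumption |].
      replace (2 * M / x * (2 * M / y)) with (16 * M ^ 2 * rho ^ 2 / (x * y) * (1 / (4 * rho ^ 2)))
        by (field; repeat split; lra).
      assert (0 < 1 / (4 * rho ^ 2)) by (apply Rdiv_lt_0_compat; nra).
      rewrite <- (Rmult_1_l (1 / (4 * rho ^ 2))) at 2.
      apply Rmult_le_compat_r; [lra |].
      apply Rmult_le_reg_r with (x * y); [nra |].
      replace (16 * M ^ 2 * rho ^ 2 / (x * y) * (x * y)) with (16 * M ^ 2 * rho ^ 2)
        by (field; lra). lra. }
  (* A crude bound on w, to be beaten by iterating the gain of a factor 1 / (4 rho^2). *)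
  set (K' := K * rho + 2 * M * K).
  assert (Hw3 : forall j, Cmod (w j) <= K' * rho ^ j).
  { intros j. unfold w. eapply Rle_trans; [apply Cmod_minus_le |]. rewrite Cmod_mult.
    pose proof (Hf j) as h1. pose proof (Hf (S j)) as h2. simpl in h2.
    pose proof (proj1 (Hr j)) as h3. pose proof (tail_E T j) as hE.
    assert (h4 : Cmod (r j) <= 2 * M).
    { eapply Rle_trans; [exact h3 |]. apply Rmult_le_reg_r with (Cmod (E (S j))); [lra |].
      replace (2 * M / Cmod (E (S j)) * Cmod (E (S j))) with (2 * M) by (field; lra). nra. }
    assert (Cmod (r j) * Cmod (f j) <= 2 * M * (K * rho ^ j))
      by (apply Rmult_le_compat; try apply Cmod_ge_0; lra).
    unfold K'. nra. }
  assert (Hw4 : forall k j, Cmod (w j) <= K' * rho ^ j * (1 / 4) ^ k).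
  { induction k as [| k IH]; intros j.
    - rewrite pow_O, Rmult_1_r. apply Hw3.
    - eapply Rle_trans; [apply Hw2 |].
      apply Rle_trans with (1 / (4 * rho ^ 2) * (K' * rho ^ S (S j) * (1 / 4) ^ k)).
      + apply Rmult_le_compat_l; [left; apply Rdiv_lt_0_compat; nra | apply IH].
      + right. simpl. field. lra. }
  assert (Hw5 : forall j, w j = 0%C).
  { intros j. apply Cmod_eq_0. apply Rle_antisym; [| apply Cmod_ge_0].
    apply le_of_le_plus_eps. intros e' he.
    destruct (pow_small (1 / 4) (K' * rho ^ j) e') as [N HN]; try lra.
    - pose proof (Hw3 j). pose proof (Cmod_ge_0 (w j)). lra.
    - specialize (HN N (le_n N)). specialize (Hw4 N j). lra. }
  induction j as [| j IH]; simpl; [ring |].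
  specialize (Hw5 j). unfold w in Hw5.
  replace (f (S j)) with (f (S j) - r j * f j + r j * f j)%C by ring.
  rewrite Hw5, IH. ring.
Qed.

End Tail.

(** Summation by parts: the chain is symmetric, so pairing a residual with a solution leaves only
    boundary terms. *)
Lemma green_finite (E q : nat -> C) (z : C) (f g : nat -> C) (J : nat) :
  (forall j, tail_res E q z g j = 0%C) ->
  csum (fun j => (tail_res E q z f j * g (S j))%C) J
  = (q O * (f 1%nat * g O - f O * g 1%nat)
     - q J * (f (S J) * g J - f J * g (S J)))%C.
Proof.
  intros Hg. induction J as [| J IH]; [simpl; ring |].
  simpl csum. rewrite IH.
  specialize (Hg J). unfold tail_res in *.
  replace (((z + E (S J)) * f (S J) - q (S J) * f (S (S J)) - q J * f J) * g (S J))%C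
    with (((z + E (S J)) * f (S J) - q (S J) * f (S (S J)) - q J * f J) * g (S J)
     - f (S J) * ((z + E (S J)) * g (S J) - q (S J) * g (S (S J)) - q J * g J))%C
    by (rewrite Hg; ring).
  ring.
Qed.

(** The boundary term at infinity disappears because the decay of g outweighs the growth of f. *)
Lemma green_limit (E q : nat -> C) (z : C) (f g : nat -> C) (M K rho G th : R) :
  (forall j, Cmod (q j) <= M) ->
  (forall j, tail_res E q z g j = 0%C) -> 
  1 <= rho -> 0 < th -> th * rho <= 1 / 2 -> 0 <= K -> 0 <= G ->
  (forall j, Cmod (f j) <= K * rho ^ j) -> (forall j, Cmod (g j) <= G * th ^ j) ->
  forall e, 0 < e -> exists N, forall J, (N <= J)%nat ->
  Cmod (csum (fun j => (tail_res E q z f j * g (S j))%C) J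
        - q O * (f 1%nat * g O - f O * g 1%nat)) <= e.
Proof.
  intros Hq Hg hrho hth htr hK hG Hf Hgd e he.
  assert (hM : 0 <= M) by (eapply Rle_trans; [apply Cmod_ge_0 | apply (Hq O)]).
  set (D := M * (K * rho * G + K * (G * th))).
  assert (hD : 0 <= D).
  { unfold D. apply Rmult_le_pos; [lra |]. 
    apply Rplus_le_le_0_compat; repeat apply Rmult_le_pos; lra. }
  destruct (pow_small (1 / 2) D e) as [N HN]; try lra.
  exists N. intros J hJ. rewrite (green_finite _ _ _ _ _ _ Hg).
  match goal with |- Cmod ?x <= _ =>
    replace x with (- (q J * (f (S J) * g J - f J * g (S J))))%C by ring end.
  rewrite Cmod_opp, Cmod_mult.
  specialize (HN J hJ). eapply Rle_trans; [| exact HN].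
  assert (hb : Cmod (f (S J) * g J - f J * g (S J))
     <= (K * rho * G + K * (G * th)) * (rho ^ J * th ^ J)).
  { eapply Rle_trans; [apply Cmod_minus_le |]. rewrite !Cmod_mult.
    pose proof (Hf J) as f1. pose proof (Hf (S J)) as f2.
    pose proof (Hgd J) as g1. pose proof (Hgd (S J)) as g2.
    assert (Cmod (f (S J)) * Cmod (g J) <= K * rho ^ S J * (G * th ^ J))
      by (apply Rmult_le_compat; try apply Cmod_ge_0; assumption).
    assert (Cmod (f J) * Cmod (g (S J)) <= K * rho ^ J * (G * th ^ S J))
      by (apply Rmult_le_compat; try apply Cmod_ge_0; assumption).
    simpl in *. nra. }
  assert (hp : rho ^ J * th ^ J <= (1 / 2) ^ J).
  { rewrite <- Rpow_mult_distr. apply pow_incr. split; [nra | lra]. }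
  unfold D. rewrite (Rmult_assoc M).
  apply Rmult_le_compat; try apply Cmod_ge_0; [apply Hq |].
  eapply Rle_trans; [exact hb |].
  apply Rmult_le_compat_l; [| exact hp].
  apply Rplus_le_le_0_compat; repeat apply Rmult_le_pos; lra.
Qed.

(** * Two half chains joined at a resonance *)

(** Two half chains share the node 0, whose diagonal entry is the bare parameter z. The rate th
    is the decay of the solutions that are constructed, rho the growth within which they are
    unique; both need kap th^2 to be large. *)
Record rooted_ok (M kap th rho : R) (E q E' q' : nat -> C) : Prop := {
  ro_tail : tail_ok M kap E q;
  ro_tail' : tail_ok M kap E' q';
  ro_E1 : kap <= Cmod (E 1%nat);
  ro_E1' : kap <= Cmod (E' 1%nat);
  ro_th : 0 < th <= 1 / 2;
  ro_rho : 1 <= rho;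
  ro_th_rho : th * rho <= 1 / 2;
  ro_kap : 100 * M ^ 2 <= kap * th ^ 2
}.

Arguments ro_tail {M kap th rho E q E' q'}.
Arguments ro_tail' {M kap th rho E q E' q'}.
Arguments ro_E1 {M kap th rho E q E' q'}.
Arguments ro_E1' {M kap th rho E q E' q'}.
Arguments ro_th {M kap th rho E q E' q'}.
Arguments ro_rho {M kap th rho E q E' q'}.
Arguments ro_th_rho {M kap th rho E q E' q'}.
Arguments ro_kap {M kap th rho E q E' q'}.

(** The unprimed and the primed sequences live on the two sides and agree at the common node;
    h and h' are the residuals of f and f'. *)
Definition chain_res (E q E' q' : nat -> C) (z : C) (f f' h h' : nat -> C) : Prop :=
  f O = f' O /\ h O = h' O /\
  (z * f O - q O * f 1%nat - q' O * f' 1%nat = h O)%C /\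
  (forall j, tail_res E q z f j = h (S j)) /\
  (forall j, tail_res E' q' z f' j = h' (S j)).

(** The equation at the common node after the decaying solutions have been inserted on both sides. *)
Definition is_root (M : R) (E q E' q' : nat -> C) (z : C) (r r' : nat -> C) : Prop :=
  is_ratio M E q z r /\ is_ratio M E' q' z r' /\ (z = q O * r O + q' O * r' O)%C.

Lemma cprod_small_sum (r s : nat -> C) (G th : R) :
  0 < th <= 1 / 2 -> 0 <= G ->
  (forall j, Cmod (cprod r (S j)) <= G * th ^ j) ->
  (forall j, Cmod (cprod s (S j)) <= G * th ^ j) ->
  forall J, Cmod (csum (fun j => (cprod r (S j) * cprod s (S j))%C) J) <= 2 * G ^ 2.
Proof.
  intros hth hG Hr Hs J.
  eapply Rle_trans.
  { apply (Cmod_csum_le _ (fun j => G ^ 2 * (1 / 2) ^ j)). intros k _.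
    rewrite Cmod_mult. specialize (Hr k). specialize (Hs k).
    assert (h : th ^ k <= 1) by (rewrite <- (pow1 k); apply pow_incr; lra).
    assert (h2 : th ^ k <= (1 / 2) ^ k) by (apply pow_incr; lra).
    assert (h0 : 0 <= th ^ k) by (apply pow_le; lra).
    apply Rle_trans with ((G * th ^ k) * (G * th ^ k)).
    - apply Rmult_le_compat; try apply Cmod_ge_0; assumption.
    - replace (G * th ^ k * (G * th ^ k)) with (G ^ 2 * (th ^ k * th ^ k)) by ring.
      apply Rmult_le_compat_l; nra. }
  eapply Rle_trans; [apply rsum_geom; nra |]. lra.
Qed.

Lemma cprod_decay (th G : R) r : 0 < th <= 1 / 2 -> 0 <= G ->
  (forall j, Cmod (cprod r (S j)) <= G * th ^ j) ->
  forall j, Cmod (cprod r j) <= (1 + G / th) * th ^ j.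
Proof.
  intros hth hG Hs [| j].
  - simpl. rewrite Cmod_1. assert (0 <= G / th) by (apply Rmult_le_pos; [lra |];
      left; apply Rinv_0_lt_compat; lra). lra.
  - eapply Rle_trans; [apply Hs |]. simpl.
    replace ((1 + G / th) * (th * th ^ j)) with (th * th ^ j + G * th ^ j) by (field; lra).
    assert (0 < th ^ j) by (apply pow_lt; lra). nra.
Qed.

Section Rooted.
Context (M kap th rho : R) (E q E' q' : nat -> C)
  (W : rooted_ok M kap th rho E q E' q').

Let T := ro_tail W.
Let T' := ro_tail' W.

Lemma rooted_kap : 100 * M ^ 2 <= kap /\ 1 <= M.
Proof.
  pose proof (tail_M T) as hM. pose proof (ro_th W).
  pose proof (ro_kap W).
  pose proof (tail_kap T). split; [| exact hM].
  assert (th ^ 2 <= 1) by nra. nra.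
Qed.

Lemma root_ratio_small (z : C) r :
  is_ratio M E q z r -> Cmod (r O) <= 2 * M / kap.
Proof.
  intros Hr. eapply Rle_trans; [apply (Hr O) |].
  pose proof rooted_kap. pose proof (ro_E1 W).
  apply Rmult_le_compat_l; [lra |]. apply Rinv_le_contravar; [nra | lra].
Qed.

Lemma root_decay (z : C) r :
  is_ratio M E q z r ->
  forall j, Cmod (cprod r (S j)) <= 4 * M ^ 2 / (kap * th) * th ^ j.
Proof.
  intros Hr. pose proof rooted_kap as [h1 h2]. pose proof (ro_th W) as h3.
  pose proof (ro_kap W) as h4.
  apply (ratio_sol_decay M kap E q T z r th); try lra; try assumption.
  - nra.
  - eapply Rle_trans; [now apply (root_ratio_small z) |].
    apply Rmult_le_reg_r with (kap * th); [nra |].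
    replace (2 * M / kap * (kap * th)) with (2 * M * th) by (field; nra).
    replace (4 * M ^ 2 / (kap * th) * (kap * th)) with (4 * M ^ 2) by (field; nra). nra.
  - right. field. nra.
Qed.

End Rooted.

Lemma rooted_sym (M kap th rho : R) (E q E' q' : nat -> C) :
  rooted_ok M kap th rho E q E' q' -> rooted_ok M kap th rho E' q' E q.
Proof. intros [? ? ? ? ? ? ? ?]. constructor; assumption. Qed.

Arguments rooted_kap {M kap th rho E q E' q'}.
Arguments root_ratio_small {M kap th rho E q E' q'}.
Arguments root_decay {M kap th rho E q E' q'}.
Arguments rooted_sym {M kap th rho E q E' q'}.

Lemma root_decay_all M kap th rho E q E' q' z r r' :
  rooted_ok M kap th rho E q E' q' -> is_root M E q E' q' z r r' ->
  exists K, (forall j, Cmod (cprod r j) <= K * th ^ j) /\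
            (forall j, Cmod (cprod r' j) <= K * th ^ j).
Proof.
  intros W [Hr [Hr' _]]. pose proof (ro_th W) as hth.
  pose proof (rooted_kap W) as [h1 h2].
  assert (hG : 0 <= 4 * M ^ 2 / (kap * th)).
  { left. apply Rdiv_lt_0_compat; [nra | apply Rmult_lt_0_compat; nra]. }
  exists (1 + 4 * M ^ 2 / (kap * th) / th). split; apply cprod_decay; try assumption.
  - now apply (root_decay W z).
  - now apply (root_decay (rooted_sym W) z).
Qed.

Section Rooted2.
Context (M kap th rho : R) (E q E' q' : nat -> C)
  (W : rooted_ok M kap th rho E q E' q').

Let T := ro_tail W.
Let T' := ro_tail' W.

Lemma root_map_bound (z : C) r r' :
  is_ratio M E q z r -> is_ratio M E' q' z r' ->
  Cmod (q O * r O + q' O * r' O) <= 4 * M ^ 2 / kap.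
Proof.
  intros Hr Hr'. pose proof (rooted_kap W) as [h1 h2].
  eapply Rle_trans; [apply Cmod_triangle |]. rewrite !Cmod_mult.
  pose proof (root_ratio_small W z r Hr) as h3.
  pose proof (root_ratio_small (rooted_sym W) z r' Hr') as h4.
  pose proof (tail_q T O) as h5. pose proof (tail_q T' O) as h6.
  assert (Cmod (q O) * Cmod (r O) <= M * (2 * M / kap))
    by (apply Rmult_le_compat; try apply Cmod_ge_0; assumption).
  assert (Cmod (q' O) * Cmod (r' O) <= M * (2 * M / kap))
    by (apply Rmult_le_compat; try apply Cmod_ge_0; assumption).
  replace (4 * M ^ 2 / kap) with (M * (2 * M / kap) + M * (2 * M / kap)) by (field; nra).
  lra.
Qed.

(** Both neighbours of the common node have diagonal entries at least kap, so the Lipschitz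
    constant of the ratios at 0 is of order M / kap. *)
Lemma root_map_contracts (z1 z2 : C) r1 r1' r2 r2' :
  Cmod z1 <= 1 / 2 -> Cmod z2 <= 1 / 2 ->
  is_ratio M E q z1 r1 -> is_ratio M E' q' z1 r1' ->
  is_ratio M E q z2 r2 -> is_ratio M E' q' z2 r2' ->
  Cmod (q O * r1 O + q' O * r1' O - (q O * r2 O + q' O * r2' O)) <= 1 / 2 * Cmod (z1 - z2).
Proof.
  intros hz1 hz2 H1 H1' H2 H2'.
  pose proof (rooted_kap W) as [h1 h2].
  pose proof (ratio_lipschitz M kap E q T z1 z2 r1 r2 hz1 hz2 H1 H2 O) as L.
  pose proof (ratio_lipschitz M kap E' q' T' z1 z2 r1' r2' hz1 hz2 H1' H2' O) as L'.
  replace (q O * r1 O + q' O * r1' O - (q O * r2 O + q' O * r2' O))%C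
    with (q O * (r1 O - r2 O) + q' O * (r1' O - r2' O))%C by ring.
  eapply Rle_trans; [apply Cmod_triangle |]. rewrite !Cmod_mult.
  pose proof (tail_q T O) as h5. pose proof (tail_q T' O) as h6.
  pose proof (Cmod_ge_0 (z1 - z2)) as hd.
  assert (G : forall e, kap <= Cmod e ->
     M * (4 * M / Cmod e * Cmod (z1 - z2)) <= 1 / 4 * Cmod (z1 - z2)).
  { intros e he. rewrite <- Rmult_assoc. apply Rmult_le_compat_r; [assumption |].
    apply Rmult_le_reg_r with (Cmod e); [nra |].
    replace (M * (4 * M / Cmod e) * Cmod e) with (4 * M ^ 2) by (field; nra). nra. }
  pose proof (G _ (ro_E1 W)). pose proof (G _ (ro_E1' W)).
  assert (Cmod (q O) * Cmod (r1 O - r2 O) <= M * (4 * M / Cmod (E 1%nat) * Cmod (z1 - z2)))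
    by (apply Rmult_le_compat; try apply Cmod_ge_0; assumption).
  assert (Cmod (q' O) * Cmod (r1' O - r2' O) <= M * (4 * M / Cmod (E' 1%nat) * Cmod (z1 - z2)))
    by (apply Rmult_le_compat; try apply Cmod_ge_0; assumption).
  lra.
Qed.

Lemma root_small (z : C) r r' :
  is_root M E q E' q' z r r' -> Cmod z <= 4 * M ^ 2 / kap.
Proof. intros [H1 [H2 H3]]. rewrite H3. now apply root_map_bound with z. Qed.

Lemma kap_small : 4 * M ^ 2 / kap <= 1 / 25.
Proof.
  pose proof (rooted_kap W) as [h1 h2].
  apply Rmult_le_reg_r with kap; [nra |].
  replace (4 * M ^ 2 / kap * kap) with (4 * M ^ 2) by (field; nra). lra.
Qed.

Lemma root_exists : exists z r r', is_root M E q E' q' z r r'.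
Proof.
  assert (H : forall z, exists p : (nat -> C) * (nat -> C), Cmod z <= 1 / 2 ->
     is_ratio M E q z (fst p) /\ is_ratio M E' q' z (snd p)).
  { intros z. destruct (Rle_dec (Cmod z) (1 / 2)) as [h | h].
    - destruct (ratio_exists M kap E q T z h) as [r Hr].
      destruct (ratio_exists M kap E' q' T' z h) as [r' Hr'].
      exists (r, r'). intros _. now split.
    - exists (fun _ => RtoC 0, fun _ => RtoC 0). intros h'. contradiction. }
  set (p := fun z => proj1_sig (constructive_indefinite_description _ (H z))).
  assert (Hp : forall z, Cmod z <= 1 / 2 ->
     is_ratio M E q z (fst (p z)) /\ is_ratio M E' q' z (snd (p z))).
  { intros z. exact (proj2_sig (constructive_indefinite_description _ (H z))). }
  clearbody p.
  set (Phi := fun z => (q O * fst (p z) O + q' O * snd (p z) O)%C).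
  set (u := fun k : nat => Nat.iter k Phi (RtoC 0)).
  pose proof kap_small as hk.
  assert (Hu : forall k, Cmod (u k) <= 1 / 25).
  { induction k as [| k IH]; [simpl; rewrite Cmod_0; lra |].
    change (u (S k)) with (Phi (u k)). destruct (Hp (u k)) as [h1 h2]; [lra |].
    eapply Rle_trans; [apply (root_map_bound (u k)); assumption | exact hk]. }
  assert (Hc : forall k, Cmod (u (S k) - u k) <= 1 * (1 / 2) ^ k).
  { induction k as [| k IH].
    - simpl. replace (Phi 0 - 0)%C with (u 1%nat) by (simpl; ring).
      pose proof (Hu 1%nat). lra.
    - change (u (S (S k))) with (Phi (u (S k))). change (u (S k)) with (Phi (u k)) at 2.
      destruct (Hp (u k)) as [h1 h2]; [pose proof (Hu k); lra |].
      destruct (Hp (u (S k))) as [h3 h4]; [pose proof (Hu (S k)); lra |].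
      eapply Rle_trans.
      { apply (root_map_contracts (u (S k)) (u k)); try assumption.
        - pose proof (Hu (S k)); lra.
        - pose proof (Hu k); lra. }
      simpl pow. lra. }
  destruct (geom_lim u 1 (1 / 2) ltac:(lra) Hc) as [z Hz].
  assert (Hlim : forall e, 0 < e -> exists k, Cmod (u k - z) <= e /\ Cmod (u (S k) - z) <= e).
  { intros e he. destruct (pow_small (1 / 2) (1 / (1 - 1 / 2)) e) as [N HN]; try lra.
    exists N. pose proof (HN N (le_n N)). pose proof (HN (S N) (le_S _ _ (le_n N))).
    pose proof (Hz N). pose proof (Hz (S N)). lra. }
  assert (Hzs : Cmod z <= 1 / 2).
  { destruct (Hlim (1 / 4)) as [k [h _]]; [lra |].
    pose proof (Cmod_minus_ge z (u k)) as h'. rewrite Cmod_minus_sym in h.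
    pose proof (Hu k). lra. }
  destruct (Hp z Hzs) as [h1 h2].
  exists z, (fst (p z)), (snd (p z)). split; [exact h1 |]. split; [exact h2 |].
  apply Ceq_of_small. intros e he. destruct (Hlim (e / 2)) as [k [g1 g2]]; [lra |].
  eapply Rle_trans; [apply (Cmod_dist_trans _ (u (S k))) |].
  rewrite (Cmod_minus_sym z).
  change (u (S k)) with (q O * fst (p (u k)) O + q' O * snd (p (u k)) O)%C at 2.
  destruct (Hp (u k)) as [h3 h4]; [pose proof (Hu k); lra |].
  pose proof (root_map_contracts (u k) z _ _ _ _ ltac:(pose proof (Hu k); lra) Hzs h3 h4 h1 h2).
  lra.
Qed.

Lemma rho_kap : 16 * M ^ 2 * rho ^ 2 <= kap.
Proof.
  pose proof (ro_kap W). pose proof (ro_th_rho W).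
  pose proof (ro_rho W). pose proof (ro_th W).
  pose proof (rooted_kap W) as [h1 h2].
  assert (h : th ^ 2 * rho ^ 2 <= 1 / 4).
  { replace (th ^ 2 * rho ^ 2) with ((th * rho) * (th * rho)) by ring.
    replace (1 / 4) with (1 / 2 * (1 / 2)) by lra. apply Rmult_le_compat; nra. }
  apply Rmult_le_reg_r with (th ^ 2); [nra |].
  replace (16 * M ^ 2 * rho ^ 2 * th ^ 2) with (16 * M ^ 2 * (th ^ 2 * rho ^ 2)) by ring.
  nra.
Qed.

(** On each side a solution of moderate growth is a multiple of the decaying one. If its value at
    the common node is nonzero, the equation there makes z' a fixed point of the contraction. *)
Lemma root_unique (z z' : C) r r' (f f' : nat -> C) (K : R) :
  is_root M E q E' q' z r r' -> Cmod z' <= 1 / 2 ->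
  (forall j, Cmod (f j) <= K * rho ^ j) -> (forall j, Cmod (f' j) <= K * rho ^ j) ->
  chain_res E q E' q' z' f f' (fun _ => RtoC 0) (fun _ => RtoC 0) ->
  (forall j, f j = (0 : C) /\ f' j = (0 : C)) \/
  z' = z /\ (forall j, f j = (f O * cprod r j)%C /\ f' j = (f O * cprod r' j)%C).
Proof.
  intros Hroot hz' Hf Hf' [e0 [_ [e1 [e2 e3]]]].
  pose proof (root_small _ _ _ Hroot) as hz. pose proof kap_small as hk.
  destruct Hroot as [Hr [Hr' Hz]].
  destruct (ratio_exists M kap E q T z' hz') as [s Hs].
  destruct (ratio_exists M kap E' q' T' z' hz') as [s' Hs'].
  pose proof rho_kap as hrk. pose proof (ro_rho W) as hrho.
  pose proof (tail_tempered_unique M kap E q T z' s f K rho hz' Hs hrho hrk Hf e2) as F.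
  pose proof (tail_tempered_unique M kap E' q' T' z' s' f' K rho hz' Hs' hrho hrk Hf' e3) as F'.
  destruct (excluded_middle_informative (f O = (0 : C))) as [h0 | h0].
  { left. intros j. rewrite F, F', <- e0, h0. split; ring. }
  right.
  assert (Hz' : z' = (q O * s O + q' O * s' O)%C).
  { rewrite (F 1%nat), (F' 1%nat), <- e0 in e1. simpl in e1.
    assert (e4 : (f O * (z' - (q O * s O + q' O * s' O)) = 0)%C).
    { replace (RtoC 0) with (z' * f O - q O * (f O * (1 * s O)) - q' O * (f O * (1 * s' O)))%C
        by exact e1. ring. }
    replace z' with ((f O * (z' - (q O * s O + q' O * s' O))) / f O + (q O * s O + q' O * s' O))%C
      at 1 by (field; exact h0).
    rewrite e4. field. exact h0. }
  assert (Ez : z' = z).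
  { assert (L : Cmod (z' - z) <= 1 / 2 * Cmod (z' - z)).
    { rewrite Hz' at 1. rewrite Hz at 1. 
      apply (root_map_contracts z' z); try assumption. lra. }
    pose proof (Cmod_ge_0 (z' - z)).
    apply Ceq_of_small. intros e he. lra. }
  split; [exact Ez |]. clear Hz'. subst z'.
  assert (Ers : forall j, s j = r j /\ s' j = r' j).
  { intros j. 
    pose proof (ratio_lipschitz M kap E q T z z s r hz' hz' Hs Hr j) as L.
    pose proof (ratio_lipschitz M kap E' q' T' z z s' r' hz' hz' Hs' Hr' j) as L'.
    replace (z - z)%C with (RtoC 0) in L, L' by ring. rewrite Cmod_0, Rmult_0_r in L, L'.
    split; apply Ceq_of_small; intros e he; lra. }
  assert (Ep : forall j, cprod s j = cprod r j /\ cprod s' j = cprod r' j).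
  { induction j as [| j [IH1 IH2]]; [split; reflexivity |]. simpl.
    destruct (Ers j) as [-> ->]. now rewrite IH1, IH2. }
  intros j. destruct (Ep j) as [p1 p2]. rewrite <- p1, <- p2. split; [apply F |].
  rewrite F', <- e0. reflexivity.
Qed.

(** Solvability condition: the residual is orthogonal to the decaying solution for the bilinear
    pairing. The boundary terms of the two sides cancel against the equation at the common node. *)
Lemma root_green (z : C) r r' (f f' h h' : nat -> C) (K : R) :
  is_root M E q E' q' z r r' ->
  (forall j, Cmod (f j) <= K * rho ^ j) -> (forall j, Cmod (f' j) <= K * rho ^ j) ->
  chain_res E q E' q' z f f' h h' ->
  forall e, 0 < e -> exists N, forall J, (N <= J)%nat ->
  Cmod (h O + csum (fun j => (h (S j) * cprod r (S j))%C) J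
            + csum (fun j => (h' (S j) * cprod r' (S j))%C) J) <= e.
Proof.
  intros [Hr [Hr' Hz]] Hf Hf' [e0 [_ [e1 [e2 e3]]]] e he.
  pose proof (ro_th W) as h1. pose proof (ro_rho W) as h2.
  pose proof (ro_th_rho W) as h3.
  pose proof (rooted_kap W) as [h4 h5].
  pose proof (ro_kap W) as h7.
  assert (hK : 0 <= K).
  { specialize (Hf O). simpl in Hf. pose proof (Cmod_ge_0 (f O)). lra. }
  set (G := 4 * M ^ 2 / (kap * th)).
  assert (hG : 0 < G) by (apply Rdiv_lt_0_compat; nra).
  assert (hG' : 0 <= 1 + G / th) by (assert (0 < G / th) by (apply Rdiv_lt_0_compat; lra); lra).
  destruct (green_limit E q z f (cprod r) M K rho (1 + G / th) th
    (tail_q T)) with (e := e / 2) as [N1 H1]; try lra; try assumption.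
  { intros j. now apply (ratio_sol_res M). }
  { apply cprod_decay; [exact h1 | lra |]. apply (root_decay W z r Hr). }
  destruct (green_limit E' q' z f' (cprod r') M K rho (1 + G / th) th
    (tail_q T')) with (e := e / 2) as [N2 H2]; try lra; try assumption.
  { intros j. now apply (ratio_sol_res M). }
  { apply cprod_decay; [exact h1 | lra |].
    apply (root_decay (rooted_sym W) z r' Hr'). }
  exists (N1 + N2)%nat. intros J hJ.
  specialize (H1 J ltac:(lia)). specialize (H2 J ltac:(lia)).
  rewrite (csum_ext (fun j => (h (S j) * cprod r (S j))%C)
    (fun j => (tail_res E q z f j * cprod r (S j))%C)) by (intros; now rewrite e2).
  rewrite (csum_ext (fun j => (h' (S j) * cprod r' (S j))%C)
    (fun j => (tail_res E' q' z f' j * cprod r' (S j))%C)) by (intros; now rewrite e3).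
  set (s1 := csum _ J) in *. set (s2 := csum (fun j => (tail_res E' _ _ _ _ * _)%C) J) in *.
  replace (h O + s1 + s2)%C with
    ((s1 - q O * (f 1%nat * cprod r 0 - f O * cprod r 1)) +
     (s2 - q' O * (f' 1%nat * cprod r' 0 - f' O * cprod r' 1)))%C.
  - eapply Rle_trans; [apply Cmod_triangle |]. lra.
  - rewrite <- e1, <- e0. simpl. rewrite Hz. ring.
Qed.

Lemma root_sums_small (z z1 : C) r r1 :
  is_ratio M E q z r -> is_ratio M E q z1 r1 ->
  forall J, Cmod (csum (fun j => (cprod r (S j) * cprod r1 (S j))%C) J)
     <= 2 * (4 * M ^ 2 / (kap * th)) ^ 2.
Proof.
  intros Hr Hr1 J. 
  pose proof (ro_th W) as h1. 
  pose proof (rooted_kap W) as [h4 h5].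
  apply cprod_small_sum with th; [exact h1 | | |].
  - left. apply Rdiv_lt_0_compat; [nra | apply Rmult_lt_0_compat; nra].
  - apply (root_decay W z r Hr).
  - apply (root_decay W z1 r1 Hr1).
Qed.

Lemma root_G_small : 2 * (4 * M ^ 2 / (kap * th)) ^ 2 <= 1 / 8.
Proof.
  pose proof (ro_th W) as h1. 
  pose proof (rooted_kap W) as [h4 h5].
  pose proof (ro_kap W) as h7.
  assert (h : 4 * M ^ 2 / (kap * th) <= 1 / 25).
  { apply Rmult_le_reg_r with (kap * th); [nra |].
    replace (4 * M ^ 2 / (kap * th) * (kap * th)) with (4 * M ^ 2) by (field; nra).
    assert (0 <= kap * th) by nra.
    replace (kap * th ^ 2) with (kap * th * th) in h7 by ring. nra. }
  assert (0 <= 4 * M ^ 2 / (kap * th))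
    by (left; apply Rdiv_lt_0_compat; [nra | apply Rmult_lt_0_compat; nra]).
  nra.
Qed.

End Rooted2.

Arguments root_decay_all {M kap th rho E q E' q'}.
Arguments root_small {M kap th rho E q E' q'}.
Arguments kap_small {M kap th rho E q E' q'}.
Arguments root_exists {M kap th rho E q E' q'}.
Arguments root_unique {M kap th rho E q E' q'}.
Arguments root_green {M kap th rho E q E' q'}.
Arguments root_sums_small {M kap th rho E q E' q'}.
Arguments root_G_small {M kap th rho E q E' q'}.

(** Pairing the residual k g with g itself gives k times the sum of the squares of the entries of
    g. Such a sum of complex squares could vanish in general; here the entry g_0 = 1 dominates. *)
Lemma root_no_jordan (M kap th rho : R) (E q E' q' : nat -> C) 
  (z : C) r r' (f f' : nat -> C) (K : R) (k : C) :
  rooted_ok M kap th rho E q E' q' -> is_root M E q E' q' z r r' ->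
  (forall j, Cmod (f j) <= K * rho ^ j) -> (forall j, Cmod (f' j) <= K * rho ^ j) ->
  chain_res E q E' q' z f f' (fun j => (k * cprod r j)%C) (fun j => (k * cprod r' j)%C) ->
  k = (0 : C).
Proof.
  intros W Hroot Hf Hf' Hc.
  pose proof (root_green W z r r' f f' _ _ K Hroot Hf Hf' Hc) as G.
  destruct Hroot as [Hr [Hr' Hz]].
  assert (H : 3 / 4 * Cmod k <= 0); [| apply Cmod_eq_0; pose proof (Cmod_ge_0 k); lra].
  apply le_of_le_plus_eps. intros e he. rewrite Rplus_0_l.
  destruct (G e he) as [N HN]. specialize (HN N (le_n N)). cbv beta in HN.
  rewrite (csum_ext _ (fun j => (k * (cprod r (S j) * cprod r (S j)))%C)) in HN
    by (intros; ring).
  rewrite (csum_ext (fun j => (k * cprod r' (S j) * cprod r' (S j))%C)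
    (fun j => (k * (cprod r' (S j) * cprod r' (S j)))%C)) in HN by (intros; ring).
  rewrite !csum_scal in HN.
  pose proof (root_sums_small W z z r r Hr Hr N) as S1.
  pose proof (root_sums_small (rooted_sym W)
     z z r' r' Hr' Hr' N) as S2.
  pose proof (root_G_small W) as S3.
  set (s1 := csum _ N) in *. set (s2 := csum (fun j => (cprod r' (S j) * _)%C) N) in *.
  replace (k * cprod r 0 + k * s1 + k * s2)%C with (k * (1 + (s1 + s2)))%C in HN
    by (simpl; ring).
  rewrite Cmod_mult in HN.
  pose proof (Cmod_triangle_inv 1 (s1 + s2)) as h. rewrite Cmod_1 in h.
  pose proof (Cmod_triangle s1 s2). pose proof (Cmod_ge_0 k). nra.
Qed.

Arguments root_no_jordan {M kap th rho E q E' q'}.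

(** * The half chains of the Dirac operator *)

Definition par (c d : C) (j : nat) : C := if Nat.even j then c else d.

(** Diagonal entries at the nodes j and - j of the chain for n = N: from the resonance at 0 the
    first half chain runs towards the second resonance, the other one away from it. *)
Definition e_in (N j : nat) : R :=
  if Nat.even j then 2 * INR j else 2 * (INR N - INR j).
Definition e_out (N j : nat) : R :=
  if Nat.even j then - (2 * INR j) else 2 * (INR N + INR j).

Definition E_in (N j : nat) : C := RtoC (e_in N j).
Definition E_out (N j : nat) : C := RtoC (e_out N j).

(** For N = 2 m + 1, sequences with v_(N-j) = eps v_j are determined by the nodes up to m, and
    v_(m+1) = eps v_m turns the edge between m and m + 1 into the correction - eps q_m of the
    diagonal. Past m the chain is continued by uncoupled nodes with the entry N, which makes the
    theory of infinite half chains applicable and forces the decaying solution to be zero there. *)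
Definition E_fold (c d eps : C) (N m j : nat) : C :=
  if (j <? m)%nat then RtoC (e_in N j)
  else if (j =? m)%nat then (e_in N m - eps * par c d m)%C else RtoC (INR N).
Definition q_fold (c d : C) (m j : nat) : C :=
  if (j <? m)%nat then par c d j else RtoC 0.

Lemma par_S c d j : par c d (S j) = par d c j.
Proof. unfold par. rewrite Nat.even_succ, <- Nat.negb_even. now destruct (Nat.even j). Qed.

Lemma par_bound c d M j : Cmod c <= M -> Cmod d <= M -> Cmod (par c d j) <= M.
Proof. unfold par. now destruct (Nat.even j). Qed.

Lemma parity_cases (j : nat) :
  (exists i, j = (2 * i)%nat /\ Nat.even j = true) \/
  (exists i, j = (2 * i + 1)%nat /\ Nat.even j = false).
Proof.
  destruct (Nat.even j) eqn:H.
  - left. apply Nat.even_spec in H. destruct H as [i Hi]. now exists i.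
  - right. rewrite <- Nat.negb_odd in H. apply Bool.negb_false_iff in H.
    apply Nat.odd_spec in H. destruct H as [i Hi]. now exists i.
Qed.

Ltac inr :=
  repeat (rewrite mult_INR in * || rewrite plus_INR in * || rewrite S_INR in *);
  try change (INR 0) with 0 in *.

(** The entry 2 (N - j) is small only near j = N, where its neighbours 2 (j - 1) and 2 (j + 1)
    are of order N; it does not vanish because j is odd and N even. *)
Lemma e_in_even_N (p j : nat) : (2 <= p)%nat ->
  2 <= Rabs (e_in (2 * p) (S j)) /\
  INR (2 * p) <= Rabs (e_in (2 * p) (S j)) * Rabs (e_in (2 * p) (S (S j))).
Proof.
  intros hp.
  assert (hp' : 2 <= INR p) by (apply (le_INR 2 p); lia).
  assert (O : forall i, 2 <= Rabs (2 * (INR (2 * p) - INR (2 * i + 1)))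
    /\ ((i < p)%nat -> Rabs (2 * (INR (2 * p) - INR (2 * i + 1))) = 4 * INR (p - i) - 2)
    /\ ((p <= i)%nat -> Rabs (2 * (INR (2 * p) - INR (2 * i + 1))) = 4 * INR (i - p) + 2)).
  { intros i. destruct (le_lt_dec p i) as [h | h].
    - assert (h0 : 0 <= INR (i - p)) by apply pos_INR.
      assert (E : Rabs (2 * (INR (2 * p) - INR (2 * i + 1))) = 4 * INR (i - p) + 2).
      { rewrite (minus_INR i p h) in *. inr. rewrite Rabs_left1; lra. }
      rewrite E. repeat split; intros; try lra. lia.
    - assert (h0 : 1 <= INR (p - i)) by (apply (le_INR 1); lia).
      assert (E : Rabs (2 * (INR (2 * p) - INR (2 * i + 1))) = 4 * INR (p - i) - 2).
      { rewrite (minus_INR p i) in * by lia. inr. rewrite Rabs_pos_eq; lra. }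
      rewrite E. repeat split; intros; solve [lra | exfalso; lia]. }
  assert (P : forall i k, (k = i \/ k = S i)%nat ->
      INR (2 * p) <= Rabs (2 * INR (2 * (S i))) * Rabs (2 * (INR (2 * p) - INR (2 * k + 1)))).
  { intros i k hik. destruct (O k) as [_ [O1 O2]].
    assert (hi : 0 <= INR i) by apply pos_INR.
    rewrite (Rabs_pos_eq (2 * INR (2 * S i))) by (inr; lra).
    destruct (le_lt_dec p k) as [h | h].
    - rewrite O2 by exact h. assert (h0 : 0 <= INR (k - p)) by apply pos_INR.
      assert (h1 : INR p <= INR (S i)) by (apply le_INR; lia).
      inr. nra.
    - rewrite O1 by exact h. assert (h0 : 1 <= INR (p - k)) by (apply (le_INR 1); lia).
      assert (h1 : INR p <= INR (p - k) + INR (S i)).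
      { rewrite <- plus_INR. apply le_INR. lia. }
      inr. nra. }
  unfold e_in. destruct (parity_cases (S j)) as [[i [h1 h2]] | [i [h1 h2]]].
  - assert (h3 : Nat.even (S (S j)) = false)
      by (rewrite Nat.even_succ, <- Nat.negb_even, h2; reflexivity).
    rewrite h2, h3. destruct i as [| i]; [lia |]. rewrite h1.
    replace (S (2 * S i)) with (2 * (S i) + 1)%nat by lia. split.
    + assert (0 <= INR i) by apply pos_INR. inr. rewrite Rabs_pos_eq; lra.
    + apply P. lia.
  - assert (h3 : Nat.even (S (S j)) = true)
      by (rewrite Nat.even_succ, <- Nat.negb_even, h2; reflexivity).
    rewrite h2, h3, h1.
    replace (S (2 * i + 1)) with (2 * (S i))%nat by lia. split.
    + apply O.
    + rewrite Rmult_comm. apply P. lia.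
Qed.

Lemma e_out_bounds (N j : nat) : (4 <= N)%nat ->
  2 <= Rabs (e_out N (S j)) /\
  INR N <= Rabs (e_out N (S j)) * Rabs (e_out N (S (S j))).
Proof.
  intros hN. assert (hN' : 4 <= INR N) by (replace 4 with (INR 4) by (simpl; lra); apply le_INR; lia).
  assert (hj : 0 <= INR j) by apply pos_INR.
  unfold e_out. rewrite (Nat.even_succ (S j)), <- (Nat.negb_even (S j)).
  destruct (Nat.even (S j)) eqn:H; simpl negb; cbv iota.
  - destruct j as [| j]; [discriminate |]. rewrite Rabs_Ropp.
    rewrite !S_INR in *. assert (0 <= INR j) by apply pos_INR.
    rewrite !Rabs_pos_eq by lra. split; nra.
  - rewrite Rabs_Ropp. rewrite !S_INR in *.
    rewrite !Rabs_pos_eq by lra. split; nra.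
Qed.

Section Bounds.
Context (m N : nat) (hN : N = (2 * m + 1)%nat).

Lemma e_in_ge (j : nat) : (1 <= j <= m)%nat -> 2 * INR j <= e_in N j.
Proof.
  intros hj. unfold e_in. destruct (Nat.even j); [lra |].
  assert (INR j <= INR m) by (apply le_INR; lia). rewrite hN. inr. lra.
Qed.

Lemma e_in_prod (j : nat) (t : R) : (1 <= j < m)%nat ->
  0 <= t -> t <= INR m - 1 / 2 ->
  INR N * INR j <= e_in N j * (e_in N (S j) - (if (S j =? m)%nat then t else 0)).
Proof.
  intros hj ht htm.
  assert (h1 : 1 <= INR j) by (apply (le_INR 1); lia).
  assert (h2 : INR j + 1 <= INR m) by (rewrite <- S_INR; apply le_INR; lia).
  destruct (Nat.eqb_spec (S j) m) as [h | h].
  - pose proof (e_in_ge j ltac:(lia)) as h3. pose proof (e_in_ge (S j) ltac:(lia)) as h4.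
    rewrite h in h4 at 1.
    assert (INR N = 2 * INR m + 1) by (rewrite hN; inr; lra).
    apply Rle_trans with (2 * INR j * (INR m + 1 / 2)); [nra |].
    apply Rmult_le_compat; lra.
  - rewrite Rminus_0_r. unfold e_in. rewrite Nat.even_succ, <- Nat.negb_even.
    assert (INR N = 2 * INR m + 1) by (rewrite hN; inr; lra).
    destruct (Nat.even j); simpl negb; cbv iota; rewrite S_INR; nra.
Qed.
End Bounds.

Lemma Efold_lt c d eps N m j : (j < m)%nat -> E_fold c d eps N m j = E_in N j.
Proof. intros h. unfold E_fold. apply Nat.ltb_lt in h. now rewrite h. Qed.

Lemma Efold_eq c d eps N m : E_fold c d eps N m m = (E_in N m - eps * par c d m)%C.
Proof. unfold E_fold. now rewrite Nat.ltb_irrefl, Nat.eqb_refl. Qed.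

Lemma Efold_gt c d eps N m j : (m < j)%nat -> E_fold c d eps N m j = RtoC (INR N).
Proof.
  intros h. unfold E_fold.
  destruct (Nat.ltb_spec j m); [lia |]. destruct (Nat.eqb_spec j m); [lia | reflexivity].
Qed.

Lemma qfold_lt c d m j : (j < m)%nat -> q_fold c d m j = par c d j.
Proof. intros h. unfold q_fold. apply Nat.ltb_lt in h. now rewrite h. Qed.

Lemma qfold_ge c d m j : (m <= j)%nat -> q_fold c d m j = RtoC 0.
Proof. intros h. unfold q_fold. destruct (Nat.ltb_spec j m); [lia | reflexivity]. Qed.

(** Besides N, the product of neighbours gains the position j. This is the source of the harmonic
    sums in the error of the gap. *)
Lemma Efold_prod c d eps M N m j :
  N = (2 * m + 1)%nat -> Cmod c <= M -> Cmod d <= M -> Cmod eps = 1 ->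
  0 <= M -> M <= INR m - 1 / 2 -> (1 <= j < m)%nat ->
  INR N * INR j <= e_in N j * Cmod (E_fold c d eps N m (S j)).
Proof.
  intros hN hc hd heps hM0 hM hj.
  assert (h1 : 1 <= INR j) by (apply (le_INR 1); lia).
  pose proof (e_in_ge m N hN j ltac:(lia)) as h2.
  eapply Rle_trans; [apply (e_in_prod m N hN j M hj hM0 hM) |].
  apply Rmult_le_compat_l; [lra |].
  destruct (Nat.eqb_spec (S j) m) as [h | h].
  - rewrite h. rewrite Efold_eq.
    eapply Rle_trans; [| apply Cmod_minus_ge].
    pose proof (par_bound c d M m hc hd).
    rewrite Cmod_mult, heps, Rmult_1_l. unfold E_in. rewrite Cmod_R.
    pose proof (Rle_abs (e_in N m)). lra.
  - rewrite Efold_lt by lia. unfold E_in. rewrite Cmod_R, Rminus_0_r. apply Rle_abs.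
Qed.

Lemma fold_tail_ok c d eps M N m :
  N = (2 * m + 1)%nat -> Cmod c <= M -> Cmod d <= M -> Cmod eps = 1 ->
  1 <= M -> M <= INR m - 1 / 2 -> 24 * M ^ 2 <= INR N -> (2 <= m)%nat ->
  tail_ok M (INR N) (E_fold c d eps N m) (q_fold c d m).
Proof.
  intros hN hc hd heps hM1 hM hMN hm.
  assert (hm' : 2 <= INR m) by (apply (le_INR 2); lia).
  assert (hNm : INR N = 2 * INR m + 1) by (rewrite hN; inr; lra).
  assert (hEm : INR m + 1 / 2 <= Cmod (E_fold c d eps N m m)).
  { rewrite Efold_eq. eapply Rle_trans; [| apply Cmod_minus_ge].
    pose proof (par_bound c d M m hc hd).
    rewrite Cmod_mult, heps, Rmult_1_l. unfold E_in. rewrite Cmod_R.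
    pose proof (Rle_abs (e_in N m)). pose proof (e_in_ge m N hN m ltac:(lia)). lra. }
  constructor; try assumption.
  - intros j. destruct (le_lt_dec m j) as [h | h].
    + rewrite qfold_ge by exact h. rewrite Cmod_0. lra.
    + rewrite qfold_lt by exact h. now apply par_bound.
  - intros j. destruct (lt_eq_lt_dec (S j) m) as [[h | h] | h].
    + rewrite Efold_lt by exact h. unfold E_in. rewrite Cmod_R.
      pose proof (e_in_ge m N hN (S j) ltac:(lia)) as h1. 
      assert (1 <= INR (S j)) by (apply (le_INR 1); lia).
      pose proof (Rle_abs (e_in N (S j))). lra.
    + rewrite h. lra.
    + rewrite Efold_gt by exact h. rewrite Cmod_R, Rabs_pos_eq; lra.
  - intros j. destruct (lt_eq_lt_dec (S j) m) as [[h | h] | h].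
    + assert (h1 : 1 <= INR (S j)) by (apply (le_INR 1); lia).
      pose proof (Efold_prod c d eps M N m (S j) hN hc hd heps ltac:(lra) hM ltac:(lia)) as h2.
      rewrite Efold_lt by exact h. unfold E_in. rewrite Cmod_R.
      pose proof (Rle_abs (e_in N (S j))) as h3.
      pose proof (Cmod_ge_0 (E_fold c d eps N m (S (S j)))). nra.
    + rewrite h. rewrite (Efold_gt c d eps N m (S m)) by lia.
      rewrite Cmod_R, Rabs_pos_eq by lra. nra.
    + rewrite !Efold_gt by lia. rewrite Cmod_R, Rabs_pos_eq by lra. nra.
Qed.

Lemma out_tail_ok c d M N :
  Cmod c <= M -> Cmod d <= M -> 1 <= M -> 24 * M ^ 2 <= INR N -> (4 <= N)%nat ->
  tail_ok M (INR N) (E_out N) (par d c).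
Proof.
  intros hc hd hM hMN hN. constructor; try assumption.
  - intros j. now apply par_bound.
  - intros j. unfold E_out. rewrite Cmod_R. pose proof (e_out_bounds N j hN). lra.
  - intros j. unfold E_out. rewrite !Cmod_R. apply (e_out_bounds N j hN).
Qed.

Lemma in_tail_ok c d M p :
  Cmod c <= M -> Cmod d <= M -> 1 <= M -> 24 * M ^ 2 <= INR (2 * p) -> (2 <= p)%nat ->
  tail_ok M (INR (2 * p)) (E_in (2 * p)) (par c d).
Proof.
  intros hc hd hM hMN hN. constructor; try assumption.
  - intros j. now apply par_bound.
  - intros j. unfold E_in. rewrite Cmod_R. pose proof (e_in_even_N p j hN). lra.
  - intros j. unfold E_in. rewrite !Cmod_R. apply (e_in_even_N p j hN).
Qed.

(** One threshold on N that makes all half chains of the operator admissible for given rates. *)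
Record big (M th rho : R) (N : nat) : Prop := {
  big_M : 1 <= M;
  big_th : 0 < th <= 1 / 2;
  big_rho : 1 <= rho;
  big_th_rho : th * rho <= 1 / 2;
  big_N : 100 * M ^ 2 <= INR N * th ^ 2
}.

Arguments big_M {M th rho N}.
Arguments big_th {M th rho N}.
Arguments big_rho {M th rho N}.
Arguments big_th_rho {M th rho N}.
Arguments big_N {M th rho N}.

Lemma big_N100 M th rho N : big M th rho N -> 400 * M ^ 2 <= INR N.
Proof.
  intros [? ? ? ? ?]. assert (th ^ 2 <= 1 / 4) by nra.
  assert (0 <= INR N) by apply pos_INR. nra.
Qed.

Arguments big_N100 {M th rho N}.

Lemma even_rooted_ok c d M th rho p :
  big M th rho (2 * p) -> Cmod c <= M -> Cmod d <= M ->
  rooted_ok M (INR (2 * p)) th rho (E_in (2 * p)) (par c d) (E_out (2 * p)) (par d c).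
Proof.
  intros hb hc hd. pose proof (big_N100 hb) as h. destruct hb as [? ? ? ? ?].
  assert (hp : (200 <= p)%nat).
  { apply INR_le. replace (INR 200) with 200 by (simpl; lra). inr. nra. }
  constructor; try assumption.
  - apply in_tail_ok; try assumption; [nra | lia].
  - apply out_tail_ok; try assumption; [nra | lia].
  - unfold E_in, e_in. rewrite Cmod_R. simpl Nat.even. cbv iota. simpl (INR 1).
    rewrite Rabs_pos_eq; nra.
  - unfold E_out, e_out. rewrite Cmod_R. simpl Nat.even. cbv iota. simpl (INR 1).
    rewrite Rabs_pos_eq; nra.
Qed.

Lemma odd_rooted_ok c d eps M th rho m :
  big M th rho (2 * m + 1) -> Cmod c <= M -> Cmod d <= M -> Cmod eps = 1 ->
  rooted_ok M (INR (2 * m + 1)) th rho (E_fold c d eps (2 * m + 1) m) (q_fold c d m)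
    (E_out (2 * m + 1)) (par d c).
Proof.
  intros hb hc hd he. pose proof (big_N100 hb) as h. destruct hb as [? ? ? ? ?].
  assert (hp : (100 <= m)%nat).
  { apply INR_le. replace (INR 100) with 100 by (simpl; lra). inr. nra. }
  assert (hp' : 100 <= INR m) by (replace 100 with (INR 100) by (simpl; lra); apply le_INR; lia).
  constructor; try assumption.
  - apply fold_tail_ok; try assumption; try reflexivity; [inr; nra | nra | lia].
  - apply out_tail_ok; try assumption; [nra | lia].
  - rewrite Efold_lt by lia.
    unfold E_in, e_in. rewrite Cmod_R. simpl Nat.even. cbv iota. simpl (INR 1).
    rewrite Rabs_pos_eq; nra.
  - unfold E_out, e_out. rewrite Cmod_R. simpl Nat.even. cbv iota. simpl (INR 1).
    rewrite Rabs_pos_eq; nra.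
Qed.

(** * Expansion of the root up to third order *)

(** Two levels of the continued fraction, inward for tau = 1 and outward for tau = -1. The first
    denominator is 2 (N - tau), the second one only 4 tau; hence the coupling q1 enters already
    at order 1 / N^2. The contribution of the third level is w2. *)
Lemma head_asym (M N tau : R) (q0 q1 w2 zeta r0 r1 : C) :
  1 <= M -> 400 * M ^ 4 <= N -> tau = 1 \/ tau = -1 ->
  Cmod q0 <= M -> Cmod q1 <= M ->
  Cmod zeta <= 4 * M ^ 2 / N -> Cmod w2 <= 2 * M ^ 2 / N ->
  r1 = (q1 / (zeta + RtoC (4 * tau) - w2))%C ->
  r0 = (q0 / (zeta + RtoC (2 * (N - tau)) - q1 * r1))%C ->
  Cmod (q0 * r0 - (q0 ^ 2 / (2 * N) + tau * q0 ^ 2 / (2 * N ^ 2)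
     + tau * (q0 ^ 2 * q1 ^ 2) / (16 * N ^ 2))) <= 14 * M ^ 10 / N ^ 3.
Proof.
  intros hM hN htau h0 h1 hz hw hr1 hr0.
  assert (hM2 : 1 <= M ^ 2) by nra.
  assert (hM4 : M ^ 2 <= M ^ 4) by (replace (M ^ 4) with (M ^ 2 * M ^ 2) by ring; nra).
  assert (hM6 : M ^ 4 <= M ^ 6) by (replace (M ^ 6) with (M ^ 4 * M ^ 2) by ring; nra).
  assert (hM10 : M ^ 6 <= M ^ 10) by (replace (M ^ 10) with (M ^ 6 * M ^ 4) by ring; nra).
  assert (hNp : 0 < N) by lra.
  set (w1 := (zeta - w2)%C).
  assert (hi : M ^ 2 / N <= 1 / 400).
  { apply Rmult_le_reg_r with N; [lra |].
    replace (M ^ 2 / N * N) with (M ^ 2) by (field; lra). lra. }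
  assert (hi4 : M ^ 4 / N <= 1 / 400).
  { apply Rmult_le_reg_r with N; [lra |].
    replace (M ^ 4 / N * N) with (M ^ 4) by (field; lra). lra. }
  assert (hw1 : Cmod w1 <= 6 * (M ^ 2 / N)).
  { unfold w1. eapply Rle_trans; [apply Cmod_minus_le |].
    replace (4 * M ^ 2 / N) with (4 * (M ^ 2 / N)) in hz by (field; lra).
    replace (2 * M ^ 2 / N) with (2 * (M ^ 2 / N)) in hw by (field; lra). lra. }
  set (D1 := (RtoC (4 * tau) + w1)%C).
  assert (hD1 : 3 <= Cmod D1).
  { unfold D1. eapply Rle_trans; [| apply Cmod_triangle_inv]. rewrite Cmod_R.
    assert (Rabs (4 * tau) = 4) by (destruct htau; subst tau; unfold Rabs; destruct Rcase_abs; lra).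
    lra. }
  assert (nD1 : D1 <> 0%C) by (apply Cmod_gt_0; lra).
  (* d1 is the error of q1 r1 against its limit tau q1^2 / 4, and dl the resulting error of the
     first denominator. *)
  set (d1 := (- (tau * q1 ^ 2 * w1 / (4 * D1)))%C).
  assert (hy : (q1 * r1 = tau * q1 ^ 2 / 4 + d1)%C).
  { rewrite hr1. unfold d1.
    replace (zeta + RtoC (4 * tau) - w2)%C with D1 by (unfold D1, w1; ring).
    replace w1 with (D1 - RtoC (4 * tau))%C by (unfold D1; ring).
    clear - nD1 htau. clearbody D1.
    destruct htau; subst tau; field_simplify_eq; try assumption;
    rewrite ?RtoC_mult; ring. }
  assert (hq1 : Cmod (q1 ^ 2) <= M ^ 2)
    by (rewrite Cmod_pow; apply pow_incr; split; [apply Cmod_ge_0 | assumption]).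
  assert (hq0 : Cmod (q0 ^ 2) <= M ^ 2)
    by (rewrite Cmod_pow; apply pow_incr; split; [apply Cmod_ge_0 | assumption]).
  assert (htm : Cmod tau = 1).
  { rewrite Cmod_R. destruct htau; subst tau; unfold Rabs; destruct Rcase_abs; lra. }
  assert (hd1 : Cmod d1 <= M ^ 4 / (2 * N)).
  { unfold d1. rewrite Cmod_opp.
    replace (M ^ 4 / (2 * N)) with ((M ^ 2 * (6 * (M ^ 2 / N))) / 12) by (field; lra).
    apply Cmod_div_le; [lra | |].
    - rewrite !Cmod_mult, htm, Rmult_1_l.
      apply Rmult_le_compat; try apply Cmod_ge_0; assumption.
    - rewrite Cmod_mult, Cmod_R, Rabs_pos_eq by lra. lra. }
  set (v := (RtoC (- 2 * tau) + zeta - q1 * r1)%C).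
  set (dl := (zeta - d1)%C).
  assert (hdl : Cmod dl <= 5 * M ^ 4 / N).
  { unfold dl. eapply Rle_trans; [apply Cmod_minus_le |].
    assert (0 < / N) by (apply Rinv_0_lt_compat; lra).
    replace (M ^ 4 / (2 * N)) with (M ^ 4 / 2 * / N) in hd1 by (field; lra).
    unfold Rdiv in *. nra. }
  assert (hv : (v = RtoC (- 2 * tau) - tau * q1 ^ 2 / 4 + dl)%C).
  { unfold v, dl. rewrite hy. ring. }
  assert (hvb : Cmod v <= 7 * M ^ 2).
  { rewrite hv. eapply Rle_trans; [apply Cmod_triangle |].
    assert (Cmod (RtoC (- 2 * tau) - tau * q1 ^ 2 / 4) <= 2 + M ^ 2 / 4).
    { eapply Rle_trans; [apply Cmod_minus_le |]. apply Rplus_le_compat.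
      - rewrite Cmod_R. destruct htau; subst tau; unfold Rabs; destruct Rcase_abs; lra.
      - apply Cmod_div_le; [lra | | rewrite Cmod_R, Rabs_pos_eq; lra].
        rewrite Cmod_mult, htm. lra. }
    assert (5 * M ^ 4 / N <= 1) by (unfold Rdiv in *; lra). lra. }
  set (D0 := (RtoC (2 * N) + v)%C).
  assert (hD0 : N <= Cmod D0).
  { unfold D0. eapply Rle_trans; [| apply Cmod_triangle_inv].
    rewrite Cmod_R, Rabs_pos_eq by lra. nra. }
  assert (nD0 : D0 <> 0%C) by (apply Cmod_gt_0; lra).
  assert (hr0' : (r0 = q0 / D0)%C).
  { rewrite hr0. f_equal. f_equal. unfold D0, v. rewrite !RtoC_mult, RtoC_minus. 
    ring. }
  assert (nN : RtoC N <> 0%C) by (apply RtoC_neq_0; lra).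
  replace (q0 * r0 - (q0 ^ 2 / (2 * N) + tau * q0 ^ 2 / (2 * N ^ 2)
     + tau * (q0 ^ 2 * q1 ^ 2) / (16 * N ^ 2)))%C
   with (q0 ^ 2 * v ^ 2 / (4 * N ^ 2 * D0) - q0 ^ 2 * dl / (4 * N ^ 2))%C.
  - assert (h4N : Cmod (4 * N ^ 2) = 4 * N ^ 2).
    { rewrite Cmod_mult, Cmod_pow, !Cmod_R, !Rabs_pos_eq by lra. reflexivity. }
    eapply Rle_trans; [apply Cmod_minus_le |].
    apply Rle_trans with (M ^ 2 * (7 * M ^ 2) ^ 2 / (4 * N ^ 2 * N)
       + M ^ 2 * (5 * M ^ 4 / N) / (4 * N ^ 2)).
    + apply Rplus_le_compat.
      * apply Cmod_div_le; [nra | |].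
        -- rewrite Cmod_mult. apply Rmult_le_compat; try apply Cmod_ge_0; [assumption |].
           rewrite Cmod_pow. apply pow_incr. split; [apply Cmod_ge_0 | assumption].
        -- rewrite Cmod_mult, h4N. apply Rmult_le_compat_l; nra.
      * apply Cmod_div_le; [nra | |].
        -- rewrite Cmod_mult. apply Rmult_le_compat; try apply Cmod_ge_0; assumption.
        -- lra.
    + replace (M ^ 2 * (7 * M ^ 2) ^ 2 / (4 * N ^ 2 * N)
       + M ^ 2 * (5 * M ^ 4 / N) / (4 * N ^ 2)) with ((54 / 4 * M ^ 6) / N ^ 3) by (field; lra).
      apply Rmult_le_compat_r; [left; apply Rinv_0_lt_compat, pow_lt; lra | lra].
  - rewrite hr0'. replace dl with (v - RtoC (- 2 * tau) + tau * q1 ^ 2 / 4)%C by (rewrite hv; ring).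
    replace v with (D0 - RtoC (2 * N))%C by (unfold D0; ring).
    rewrite !RtoC_mult. clearbody D0. field. repeat split; assumption.
Qed.

(** The terms with c^2 d^2 have opposite signs on the two sides of the resonance and cancel. *)
Lemma zeta_asym (M N : R) (c d zeta r0 s0 : C) :
  1 <= M -> 400 * M ^ 4 <= N ->
  (zeta = c * r0 + d * s0)%C ->
  Cmod (c * r0 - (c ^ 2 / (2 * N) + 1 * c ^ 2 / (2 * N ^ 2)
     + 1 * (c ^ 2 * d ^ 2) / (16 * N ^ 2))) <= 14 * M ^ 10 / N ^ 3 ->
  Cmod (d * s0 - (d ^ 2 / (2 * N) + (-1) * d ^ 2 / (2 * N ^ 2)
     + (-1) * (d ^ 2 * c ^ 2) / (16 * N ^ 2))) <= 14 * M ^ 10 / N ^ 3 ->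
  Cmod (zeta - ((c ^ 2 + d ^ 2) / (2 * N) + (c ^ 2 - d ^ 2) / (2 * N ^ 2)))
    <= 28 * M ^ 10 / N ^ 3.
Proof.
  intros hM hN hz H1 H2.
  assert (hM4 : 1 <= M ^ 4) by (rewrite <- (pow1 4); apply pow_incr; lra).
  assert (nN : RtoC N <> 0%C) by (apply RtoC_neq_0; lra).
  replace (28 * M ^ 10 / N ^ 3) with (14 * M ^ 10 / N ^ 3 + 14 * M ^ 10 / N ^ 3) by (field; lra).
  eapply Rle_trans; [| apply (Rplus_le_compat _ _ _ _ H1 H2)].
  eapply Rle_trans; [| apply Cmod_triangle]. right. f_equal. rewrite hz. field. assumption.
Qed.

Lemma tail_head_asym (M N tau : R) (E q : nat -> C) (z : C) (r : nat -> C) :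
  400 * M ^ 4 <= N -> tau = 1 \/ tau = -1 -> tail_ok M N E q ->
  E 1%nat = RtoC (2 * (N - tau)) -> E 2%nat = RtoC (4 * tau) -> N <= Cmod (E 3%nat) ->
  Cmod z <= 4 * M ^ 2 / N -> is_ratio M E q z r ->
  Cmod (q O * r O - (q O ^ 2 / (2 * N) + tau * q O ^ 2 / (2 * N ^ 2)
     + tau * (q O ^ 2 * q 1%nat ^ 2) / (16 * N ^ 2))) <= 14 * M ^ 10 / N ^ 3.
Proof.
  intros hN htau T E1 E2 E3 hz Hr.
  pose proof (tail_M T) as hM. pose proof (tail_kap T) as hk.
  assert (hN0 : 24 <= N) by nra.
  assert (hz2 : Cmod z <= 1 / 2).
  { eapply Rle_trans; [exact hz |]. apply Rmult_le_reg_r with N; [nra |].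
    replace (4 * M ^ 2 / N * N) with (4 * M ^ 2) by (field; lra). lra. }
  apply (head_asym M N tau (q O) (q 1%nat) (q 2%nat * r 2%nat) z (r O) (r 1%nat));
    try assumption.
  - apply (tail_q T).
  - apply (tail_q T).
  - rewrite Cmod_mult. replace (2 * M ^ 2 / N) with (M * (2 * M / N)) by (field; lra).
    apply Rmult_le_compat; try apply Cmod_ge_0; [apply (tail_q T) |].
    eapply Rle_trans; [apply (Hr 2%nat) |]. apply Rmult_le_compat_l; [lra |].
    apply Rinv_le_contravar; [nra | assumption].
  - rewrite <- E2. now apply (ratio_eq M N E q T).
  - rewrite <- E1. now apply (ratio_eq M N E q T).
Qed.

Lemma out_head c d M N z r :
  Cmod c <= M -> Cmod d <= M -> 400 * M ^ 4 <= INR N -> 1 <= M ->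
  tail_ok M (INR N) (E_out N) (par d c) ->
  Cmod z <= 4 * M ^ 2 / INR N -> is_ratio M (E_out N) (par d c) z r ->
  Cmod (d * r O - (d ^ 2 / (2 * INR N) + (-1) * d ^ 2 / (2 * INR N ^ 2)
     + (-1) * (d ^ 2 * c ^ 2) / (16 * INR N ^ 2))) <= 14 * M ^ 10 / INR N ^ 3.
Proof.
  intros hc hd hN hM T hz Hr.
  assert (hM4 : 1 <= M ^ 4) by (rewrite <- (pow1 4); apply pow_incr; lra).
  apply (tail_head_asym M (INR N) (-1) (E_out N) (par d c) z r); try assumption.
  - now right.
  - unfold E_out, e_out. simpl. f_equal. ring.
  - unfold E_out, e_out. simpl. f_equal. ring.
  - unfold E_out, e_out. rewrite Cmod_R. simpl Nat.even. cbv iota.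
    replace (INR 3) with 3 by (simpl; lra). rewrite Rabs_pos_eq; lra.
Qed.

Lemma even_zeta_asym c d M th rho p z r r' :
  big M th rho (2 * p) -> Cmod c <= M -> Cmod d <= M -> 400 * M ^ 4 <= INR (2 * p) ->
  is_root M (E_in (2 * p)) (par c d) (E_out (2 * p)) (par d c) z r r' ->
  Cmod (z - ((c ^ 2 + d ^ 2) / (2 * INR (2 * p)) + (c ^ 2 - d ^ 2) / (2 * INR (2 * p) ^ 2)))
    <= 28 * M ^ 10 / INR (2 * p) ^ 3.
Proof.
  intros hb hc hd hN Hroot. pose proof (even_rooted_ok c d M th rho p hb hc hd) as W.
  pose proof (root_small W _ _ _ Hroot) as hz.
  pose proof (big_M hb) as hM. destruct Hroot as [Hr [Hr' Hz]].
  assert (hM4 : 1 <= M ^ 4) by (rewrite <- (pow1 4); apply pow_incr; lra).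
  apply (zeta_asym M (INR (2 * p)) c d z (r O) (r' O)); try assumption.
  - apply (tail_head_asym M (INR (2 * p)) 1 (E_in (2 * p)) (par c d) z r); try assumption.
    + now left.
    + apply (ro_tail W).
    + unfold E_in, e_in. simpl Nat.even. cbv iota. f_equal.
    + unfold E_in, e_in. simpl Nat.even. cbv iota. simpl (INR 2). f_equal. ring.
    + unfold E_in, e_in. rewrite Cmod_R. simpl Nat.even. cbv iota.
      replace (INR 3) with 3 by (simpl; lra). rewrite Rabs_pos_eq; lra.
  - apply (out_head c d M (2 * p) z r'); try assumption. apply (ro_tail' W).
Qed.

Lemma odd_zeta_asym c d eps M th rho m z r r' :
  big M th rho (2 * m + 1) -> Cmod c <= M -> Cmod d <= M -> Cmod eps = 1 ->
  400 * M ^ 4 <= INR (2 * m + 1) ->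
  is_root M (E_fold c d eps (2 * m + 1) m) (q_fold c d m)
    (E_out (2 * m + 1)) (par d c) z r r' ->
  Cmod (z - ((c ^ 2 + d ^ 2) / (2 * INR (2 * m + 1))
      + (c ^ 2 - d ^ 2) / (2 * INR (2 * m + 1) ^ 2)))
    <= 28 * M ^ 10 / INR (2 * m + 1) ^ 3.
Proof.
  intros hb hc hd he hN Hroot. pose proof (odd_rooted_ok c d eps M th rho m hb hc hd he) as W.
  pose proof (root_small W _ _ _ Hroot) as hz.
  pose proof (big_M hb) as hM. destruct Hroot as [Hr [Hr' Hz]].
  assert (hM4 : 1 <= M ^ 4) by (rewrite <- (pow1 4); apply pow_incr; lra).
  assert (hm : (100 <= m)%nat).
  { apply INR_le. replace (INR 100) with 100 by (simpl; lra). inr. lra. }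
  assert (q0 : q_fold c d m 0 = c) by (rewrite qfold_lt by lia; reflexivity).
  assert (q1 : q_fold c d m 1 = d) by (rewrite qfold_lt by lia; reflexivity).
  rewrite q0 in Hz.
  apply (zeta_asym M (INR (2 * m + 1)) c d z (r O) (r' O)); try assumption.
  - pose proof (tail_head_asym M (INR (2 * m + 1)) 1 (E_fold c d eps (2 * m + 1) m)
      (q_fold c d m) z r hN (or_introl eq_refl)
      (ro_tail W)) as H. rewrite q0, q1 in H. apply H; try assumption.
    + rewrite Efold_lt by lia. unfold E_in, e_in. simpl Nat.even. cbv iota. f_equal.
    + rewrite Efold_lt by lia. unfold E_in, e_in. simpl Nat.even. cbv iota.
      simpl (INR 2). f_equal. ring.
    + rewrite Efold_lt by lia. unfold E_in, e_in. rewrite Cmod_R. simpl Nat.even. cbv iota.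
      replace (INR 3) with 3 by (simpl; lra). rewrite Rabs_pos_eq; lra.
  - apply (out_head c d M (2 * m + 1) z r'); try assumption. apply (ro_tail' W).
Qed.

(** * Relative corrections to the ratios *)

Lemma rsum_nonneg (g : nat -> R) n : (forall k, 0 <= g k) -> 0 <= rsum g n.
Proof. intros H. induction n as [| n IH]; simpl; [lra |]. specialize (H n). lra. Qed.

(** The first order sum is kept, since in the application it is small by cancellation only and
    not term by term. *)
Lemma cprod_first_order (x : nat -> C) (g : nat -> R) n :
  (forall k, (k < n)%nat -> Cmod (x k) <= g k) -> (forall k, 0 <= g k) -> rsum g n <= 1 / 2 ->
  Cmod (cprod (fun k => (1 + x k)%C) n - 1 - csum x n) <= 2 * rsum g n ^ 2.
Proof.
  intros Hx Hg HS.
  assert (P : forall k, (k <= n)%nat -> rsum g k <= 1 / 2 /\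
    Cmod (cprod (fun k => (1 + x k)%C) k - 1) <= 2 * rsum g k /\
    Cmod (cprod (fun k => (1 + x k)%C) k - 1 - csum x k) <= 2 * rsum g k ^ 2).
  { assert (Hmono : forall k, (k <= n)%nat -> rsum g k <= rsum g n).
    { intros k hk. induction hk as [| n' hk IH]; [lra |]. simpl in *.
      assert (rsum g k <= rsum g n') .
      { apply IH; [intros; apply Hx; lia |]. specialize (Hg n'). lra. }
      specialize (Hg n'). lra. }
    induction k as [| k IH]; intros hk.
    - simpl. replace (1 - 1)%C with (RtoC 0) by ring.
      replace (0 - 0)%C with (RtoC 0) by ring. rewrite Cmod_0. lra.
    - destruct (IH ltac:(lia)) as [I1 [I2 I3]]. pose proof (Hmono (S k) hk) as I4.
      pose proof (rsum_nonneg g k Hg) as I5. pose proof (Hx k hk) as I6.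
      pose proof (Hg k) as I7. pose proof (Cmod_ge_0 (x k)) as I8.
      simpl in *. split; [lra |].
      set (p := cprod (fun k => (1 + x k)%C) k) in *. set (s := rsum g k) in *. split.
      + replace (p * (1 + x k) - 1)%C with ((p - 1) + (x k * (p - 1) + x k))%C by ring.
        eapply Rle_trans; [apply Cmod_triangle |].
        assert (Cmod (x k * (p - 1) + x k) <= g k * (2 * s) + g k).
        { eapply Rle_trans; [apply Cmod_triangle |]. rewrite Cmod_mult.
          apply Rplus_le_compat; [| lra].
          apply Rmult_le_compat; try apply Cmod_ge_0; lra. }
        nra.
      + replace (p * (1 + x k) - 1 - (csum x k + x k))%C
          with ((p - 1 - csum x k) + x k * (p - 1))%C by ring.
        eapply Rle_trans; [apply Cmod_triangle |].
        assert (Cmod (x k * (p - 1)) <= g k * (2 * s)).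
        { rewrite Cmod_mult. apply Rmult_le_compat; try apply Cmod_ge_0; lra. }
        nra. }
  apply P. lia.
Qed.

Lemma cprod_mult (x y : nat -> C) n :
  cprod (fun k => (x k * y k)%C) n = (cprod x n * cprod y n)%C.
Proof. induction n as [| n IH]; simpl; [ring |]. rewrite IH. ring. Qed.

Lemma cprod_ext (x y : nat -> C) n :
  (forall k, (k < n)%nat -> x k = y k) -> cprod x n = cprod y n.
Proof.
  induction n as [| n IH]; intros H; simpl; [reflexivity |].
  rewrite IH, H; [reflexivity | lia | intros; apply H; lia].
Qed.

Lemma cprod_neq_0 (x : nat -> C) n :
  (forall k, (k < n)%nat -> x k <> 0%C) -> cprod x n <> 0%C.
Proof.
  induction n as [| n IH]; intros H; simpl; [apply RtoC_neq_0; lra |].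
  apply Cmult_neq_0; [apply IH; intros; apply H; lia | apply H; lia].
Qed.

Lemma csum_S f n : csum f (S n) = (csum f n + f n)%C.
Proof. reflexivity. Qed.

Definition harm (m : nat) : R := rsum (fun i => / INR (S i)) m.

Lemma harm_S m : harm (S m) = harm m + / INR (S m).
Proof. reflexivity. Qed.

Lemma harm_ge_1 m : (1 <= m)%nat -> 1 <= harm m.
Proof.
  induction m as [| m IH]; intros h; [lia |]. rewrite harm_S.
  destruct m as [| m]; [unfold harm; simpl; lra |].
  assert (0 < / INR (S (S m))) by (apply Rinv_0_lt_compat, lt_0_INR; lia).
  specialize (IH ltac:(lia)). lra.
Qed.

Lemma harm_le_sqrt m : harm m <= 2 * sqrt (INR m).
Proof.
  induction m as [| m IH]; [unfold harm; simpl; rewrite sqrt_0; lra |].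
  rewrite harm_S.
  assert (h0 : 0 <= INR m) by apply pos_INR. rewrite S_INR.
  set (x := INR m) in *.
  assert (hx : 0 <= sqrt x) by apply sqrt_pos.
  assert (hy : 1 <= sqrt (x + 1)) by (rewrite <- sqrt_1 at 1; apply sqrt_le_1; lra).
  assert (ex : sqrt x * sqrt x = x) by (apply sqrt_sqrt; lra).
  assert (ey : sqrt (x + 1) * sqrt (x + 1) = x + 1) by (apply sqrt_sqrt; lra).
  assert (hxy : sqrt x <= sqrt (x + 1)) by (apply sqrt_le_1; lra).
  assert (/ (x + 1) <= 2 * (sqrt (x + 1) - sqrt x)); [| lra].
  replace (/ (x + 1)) with (/ sqrt (x + 1) * / sqrt (x + 1))
    by (rewrite <- Rinv_mult, ey; reflexivity).
  assert (hi : / sqrt (x + 1) * sqrt (x + 1) = 1) by (field; lra).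
  assert (hip : 0 < / sqrt (x + 1)) by (apply Rinv_0_lt_compat; lra).
  apply Rmult_le_reg_r with (sqrt (x + 1) * sqrt (x + 1)); [nra |].
  replace (/ sqrt (x + 1) * / sqrt (x + 1) * (sqrt (x + 1) * sqrt (x + 1))) with 1 by (field; lra).
  set (u := sqrt x) in *. set (v := sqrt (x + 1)) in *.
  assert (hd : (v - u) * (v + u) = 1) by (ring_simplify; nra).
  assert (v + u <= 2 * (v * v)) by nra.
  assert (0 <= v - u) by lra. nra.
Qed.

Lemma harm_le_ln m : (1 <= m)%nat -> harm m <= 1 + ln (INR m).
Proof.
  induction m as [| m IH]; intros h; [lia |].
  destruct m as [| m].
  - unfold harm. simpl. rewrite ln_1. lra.
  - rewrite harm_S. specialize (IH ltac:(lia)).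
    set (x := INR (S m)) in *.
    assert (hx : 1 <= x) by (apply (le_INR 1); lia).
    replace (INR (S (S m))) with (x + 1) by (unfold x; rewrite !S_INR; ring).
    assert (hl : ln (x / (x + 1)) <= x / (x + 1) - 1).
    { assert (hp : 0 < x / (x + 1)) by (apply Rdiv_lt_0_compat; lra).
      pose proof (exp_ineq1_le (ln (x / (x + 1)))) as e. rewrite exp_ln in e by exact hp. lra. }
    unfold Rdiv at 1 in hl. rewrite ln_mult, ln_Rinv in hl by (try apply Rinv_0_lt_compat; lra).
    assert (hy : x / (x + 1) - 1 = - / (x + 1)) by (field; lra). 
    lra.
Qed.

Section Gap.
Context (c d : C) (M th rho : R) (m : nat).
Let N := (2 * m + 1)%nat.
Let n := INR N.
Context (hb : big M th rho N) (hc : Cmod c <= M) (hd : Cmod d <= M)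
  (hbig : 3000 * M ^ 10 <= n).

Let hM : 1 <= M := big_M hb.

Lemma gap_facts : 400 * M ^ 4 <= n /\ (100 <= m)%nat /\ 100 <= INR m /\ n = 2 * INR m + 1 /\
  1 <= M ^ 2 <= M ^ 4 /\ M ^ 4 <= M ^ 10 /\ 3000 <= n /\ M <= M ^ 2 /\ M <= INR m - 1 / 2.
Proof.
  assert (hM2 : 1 <= M ^ 2) by nra.
  assert (hM4 : M ^ 2 <= M ^ 4) by (replace (M ^ 4) with (M ^ 2 * M ^ 2) by ring; nra).
  assert (hM6 : M ^ 4 <= M ^ 6) by (replace (M ^ 6) with (M ^ 4 * M ^ 2) by ring; nra).
  assert (hM10 : M ^ 6 <= M ^ 10) by (replace (M ^ 10) with (M ^ 6 * M ^ 4) by ring; nra).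
  assert (hn : n = 2 * INR m + 1) by (unfold n, N; inr; lra).
  assert (hm : 100 <= INR m) by lra.
  repeat split; try lra; try nra.
  apply INR_le. replace (INR 100) with 100 by (simpl; lra). lra.
Qed.

Let e (i : nat) : R := e_in N (S i).

Lemma e_pos i : (i < m)%nat -> 2 * INR (S i) <= e i /\ 2 <= e i.
Proof.
  intros hi. pose proof (e_in_ge m N eq_refl (S i) ltac:(lia)) as h.
  assert (1 <= INR (S i)) by (apply (le_INR 1); lia). unfold e. split; lra.
Qed.

Lemma e_consec i : (S i < m)%nat -> n * INR (S i) <= e i * e (S i).
Proof.
  intros hi. destruct gap_facts as [_ [_ [hm _]]].
  pose proof (e_in_prod m N eq_refl (S i) 0 ltac:(lia) ltac:(lra) ltac:(lra)) as h.
  unfold e. destruct (S (S i) =? m)%nat; unfold n; lra.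
Qed.

Lemma e_sum i : e i + e (S i) = 2 * n - 2 \/ e i + e (S i) = 2 * n + 2.
Proof.
  unfold e, e_in. rewrite (Nat.even_succ (S i)), <- (Nat.negb_even (S i)).
  fold n. rewrite (S_INR (S i)).
  destruct (Nat.even (S i)); simpl negb; cbv iota; [left | right]; ring.
Qed.

Section OneSign.
Context (eps : C) (heps : Cmod eps = 1) (z : C) (r r' : nat -> C)
  (Hroot : is_root M (E_fold c d eps N m) (q_fold c d m) (E_out N) (par d c) z r r').

Let W := odd_rooted_ok c d eps M th rho m hb hc hd heps.

(** Relative deviation of the denominator of the ratio from the bare diagonal entry. *)
Definition relx (i : nat) : C :=
  ((z + E_fold c d eps N m (S i) - q_fold c d m (S i) * r (S i)) / e i - 1)%C.

Lemma gap_z : Cmod z <= 4 * M ^ 2 / n.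
Proof. exact (root_small W _ _ _ Hroot). Qed.

Lemma eC_neq i : (i < m)%nat -> RtoC (e i) <> 0%C.
Proof. intros hi. apply RtoC_neq_0. pose proof (e_pos i hi). lra. Qed.

Lemma relx_eq i : (i < m)%nat -> (r i * (e i * (1 + relx i)) = par c d i)%C.
Proof.
  intros hi. destruct Hroot as [Hr _]. destruct (Hr i) as [_ h].
  rewrite (qfold_lt c d m i hi) in h. rewrite <- h. unfold relx. field. now apply eC_neq.
Qed.

Lemma relx_bulk i : (S i < m)%nat ->
  (relx i = (z - par c d (S i) * r (S i)) / e i)%C.
Proof.
  intros hi. unfold relx. rewrite Efold_lt, qfold_lt by exact hi.
  unfold E_in. fold (e i). field. apply eC_neq. lia.
Qed.

Lemma relx_last i : S i = m -> (relx i = (z - eps * par c d m) / e i)%C.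
Proof.
  intros hi. unfold relx. rewrite hi, Efold_eq, qfold_ge by lia.
  unfold E_in. rewrite <- hi. fold (e i). field. apply eC_neq. lia.
Qed.

Lemma ratio_over_e i : (S i < m)%nat ->
  Cmod (par c d (S i) * r (S i)) / e i <= 2 * M ^ 2 / (n * INR (S i)).
Proof.
  intros hi. destruct gap_facts as [_ [_ [hm [hn [hM2 [_ [_ [_ hMm]]]]]]]].
  pose proof (Efold_prod c d eps M N m (S i) eq_refl hc hd heps ltac:(lra) hMm ltac:(lia)) as h.
  fold (e i) in h. fold n in h.
  destruct Hroot as [Hr _]. pose proof (proj1 (Hr (S i))) as h2.
  pose proof (e_pos i ltac:(lia)) as [h3 h4].
  assert (h5 : 1 <= INR (S i)) by (apply (le_INR 1); lia).
  pose proof (tail_E (ro_tail W) (S i)) as h6. fold N in h6.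
  set (x := Cmod (E_fold c d eps N m (S (S i)))) in *.
  rewrite Cmod_mult.
  assert (h7 : Cmod (par c d (S i)) * Cmod (r (S i)) <= M * (2 * M / x)).
  { apply Rmult_le_compat; try apply Cmod_ge_0; [now apply par_bound | exact h2]. }
  apply Rle_trans with (M * (2 * M / x) / e i).
  - apply Rmult_le_compat_r; [left; apply Rinv_0_lt_compat; lra | exact h7].
  - replace (M * (2 * M / x) / e i) with (2 * M ^ 2 / (e i * x)) by (field; lra).
    apply Rmult_le_compat_l; [nra |]. apply Rinv_le_contravar; [nra | exact h].
Qed.

Lemma relx_bound i : (S i < m)%nat -> Cmod (relx i) <= 4 * M ^ 2 / n * / INR (S i).
Proof.
  intros hi. rewrite relx_bulk by exact hi.
  destruct gap_facts as [_ [_ [hm [hn [hM2 _]]]]].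
  pose proof (e_pos i ltac:(lia)) as [h3 h4].
  assert (h5 : 1 <= INR (S i)) by (apply (le_INR 1); lia).
  pose proof (ratio_over_e i hi) as h6. pose proof gap_z as h7.
  rewrite Cmod_div by (apply eC_neq; lia). rewrite Cmod_R, (Rabs_pos_eq (e i)) by lra.
  apply Rle_trans with (Cmod z / e i + Cmod (par c d (S i) * r (S i)) / e i).
  - unfold Rdiv. rewrite <- Rmult_plus_distr_r.
    apply Rmult_le_compat_r; [left; apply Rinv_0_lt_compat; lra | apply Cmod_minus_le].
  - assert (h8 : Cmod z / e i <= 2 * M ^ 2 / (n * INR (S i))).
    { apply Rle_trans with (4 * M ^ 2 / n / (2 * INR (S i))).
      - apply Rmult_le_compat; [apply Cmod_ge_0 | | exact h7 |].
        + left. apply Rinv_0_lt_compat; lra.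
        + apply Rinv_le_contravar; lra.
      - right. field. split; lra. }
    replace (4 * M ^ 2 / n * / INR (S i))
      with (2 * M ^ 2 / (n * INR (S i)) + 2 * M ^ 2 / (n * INR (S i))) by (field; lra).
    lra.
Qed.

Lemma relx_bound_last i : S i = m -> Cmod (relx i) <= 4 * M ^ 2 / n.
Proof.
  intros hi. rewrite relx_last by exact hi.
  destruct gap_facts as [hN4 [_ [hm [hn [hM2 [h410 [h3000 [hMM hMm]]]]]]]].
  pose proof (e_pos i ltac:(lia)) as [h3 h4]. rewrite hi in h3.
  pose proof gap_z as h7.
  assert (h8 : 4 * M ^ 2 / n <= 1 / 100).
  { apply Rmult_le_reg_r with n; [lra |].
    replace (4 * M ^ 2 / n * n) with (4 * M ^ 2) by (field; lra). lra. }
  apply Rle_trans with ((1 / 100 + M) / (2 * INR m)).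
  - apply Cmod_div_le; [lra | | rewrite Cmod_R, Rabs_pos_eq; lra].
    eapply Rle_trans; [apply Cmod_minus_le |]. rewrite Cmod_mult, heps, Rmult_1_l.
    pose proof (par_bound c d M m hc hd). lra.
  - apply Rmult_le_reg_r with (n * (2 * INR m)); [nra |].
    replace ((1 / 100 + M) / (2 * INR m) * (n * (2 * INR m))) with ((1 / 100 + M) * n)
      by (field; lra).
    replace (4 * M ^ 2 / n * (n * (2 * INR m))) with (8 * M ^ 2 * INR m) by (field; lra).
    nra.
Qed.

Lemma relx_bound_all i : (i < m)%nat -> Cmod (relx i) <= 4 * M ^ 2 / n.
Proof.
  intros hi. destruct (Nat.eq_dec (S i) m) as [h | h]; [now apply relx_bound_last |].
  eapply Rle_trans; [apply relx_bound; lia |].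
  destruct gap_facts as [_ [_ [hm [hn [hM2 _]]]]].
  assert (h5 : 1 <= INR (S i)) by (apply (le_INR 1); lia).
  rewrite <- (Rmult_1_r (4 * M ^ 2 / n)) at 2.
  apply Rmult_le_compat_l; [left; apply Rdiv_lt_0_compat; lra |].
  rewrite <- Rinv_1. apply Rinv_le_contravar; lra.
Qed.

(** Inserting the formula for the next ratio shows that relx i is z / e_i - q^2 / (e_i e_(i+1))
    up to an error of order 1 / (n^2 i). As e_i + e_(i+1) is 2 n - 2 or 2 n + 2, the reciprocal
    of the product is (1 / e_i + 1 / e_(i+1)) / (2 n) up to a relative error 1 / n. *)
Lemma relx_model i : (S i < m)%nat ->
  Cmod (relx i - (z / e i - par c d (S i) ^ 2 * (/ e i + / e (S i)) / (2 * n)))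
   <= 9 * M ^ 4 / n ^ 2 * / INR (S i).
Proof.
  intros hi. destruct gap_facts as [hN4 [_ [hm [hn [hM2 [h410 [h3000 [hMM hMm]]]]]]]].
  pose proof (e_pos i ltac:(lia)) as [a1 a2]. pose proof (e_pos (S i) ltac:(lia)) as [a3 a4].
  pose proof (e_consec i hi) as a5.
  assert (h5 : 1 <= INR (S i)) by (apply (le_INR 1); lia).
  pose proof (relx_bound_all (S i) hi) as hx.
  assert (h8 : 4 * M ^ 2 / n <= 1 / 100).
  { apply Rmult_le_reg_r with n; [lra |].
    replace (4 * M ^ 2 / n * n) with (4 * M ^ 2) by (field; lra). lra. }
  set (x := relx (S i)) in *. set (q := par c d (S i)) in *.
  assert (hx1 : 99 / 100 <= Cmod (1 + x)).
  { eapply Rle_trans; [| apply Cmod_triangle_inv]. rewrite Cmod_1. lra. }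
  assert (nx : (1 + x)%C <> 0%C) by (apply Cmod_gt_0; lra).
  pose proof (eC_neq i ltac:(lia)) as n1. pose proof (eC_neq (S i) hi) as n2.
  assert (nn : RtoC n <> 0%C) by (apply RtoC_neq_0; lra).
  assert (Hr1 : r (S i) = (q / (e (S i) * (1 + x)))%C).
  { pose proof (relx_eq (S i) hi) as h. fold x in h. fold q in h. rewrite <- h. field.
    split; assumption. }
  set (u := (q ^ 2 / (e i * e (S i)))%C).
  assert (hu : Cmod u <= M ^ 2 / n * / INR (S i)).
  { unfold u. replace (M ^ 2 / n * / INR (S i)) with (M ^ 2 / (n * INR (S i))) by (field; lra).
    apply Cmod_div_le; [nra | |].
    - rewrite Cmod_pow. apply pow_incr. split; [apply Cmod_ge_0 | now apply par_bound].
    - rewrite <- RtoC_mult, Cmod_R, Rabs_pos_eq by nra. exact a5. }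
  assert (hs : exists s, (s = 1 \/ s = -1) /\ (e i + e (S i) = 2 * n + 2 * s)).
  { destruct (e_sum i) as [h | h]; [exists (-1) | exists 1]; split; try lra; auto. }
  destruct hs as [s [hs1 hs2]].
  replace (relx i - (z / e i - q ^ 2 * (/ e i + / e (S i)) / (2 * n)))%C
    with (u * (s / n) + u * (x / (1 + x)))%C.
  - eapply Rle_trans; [apply Cmod_triangle |]. rewrite !(Cmod_mult u).
    assert (h1 : Cmod (s / n) <= / n).
    { rewrite Cmod_div by assumption. rewrite !Cmod_R.
      rewrite (Rabs_pos_eq n) by lra. unfold Rdiv.
      rewrite <- (Rmult_1_l (/ n)) at 2. apply Rmult_le_compat_r.
      - left; apply Rinv_0_lt_compat; lra.
      - destruct hs1; subst s; unfold Rabs; destruct Rcase_abs; lra. }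
    assert (h2 : Cmod (x / (1 + x)) <= 8 * M ^ 2 / n).
    { eapply Rle_trans; [apply (Cmod_div_le _ _ (4 * M ^ 2 / n) (99 / 100)); lra |].
      assert (0 < M ^ 2 / n) by (apply Rdiv_lt_0_compat; lra).
      unfold Rdiv in *. lra. }
    pose proof (Cmod_ge_0 u).
    replace (9 * M ^ 4 / n ^ 2 * / INR (S i))
      with (M ^ 2 / n * / INR (S i) * (M ^ 2 / n) + M ^ 2 / n * / INR (S i) * (8 * M ^ 2 / n))
      by (field; lra).
    assert (/ n <= M ^ 2 / n).
    { unfold Rdiv. rewrite <- (Rmult_1_l (/ n)) at 1. apply Rmult_le_compat_r; [| lra].
      left; apply Rinv_0_lt_compat; lra. }
    apply Rplus_le_compat; apply Rmult_le_compat; try apply Cmod_ge_0; lra.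
  - rewrite relx_bulk by exact hi. fold q. rewrite Hr1.
    assert (hs3 : (RtoC (e (S i)) = 2 * n + 2 * s - e i)%C).
    { replace (e (S i)) with (2 * n + 2 * s - e i) by lra.
      now rewrite RtoC_minus, RtoC_plus, !RtoC_mult. }
    assert (E1 : (q ^ 2 * (/ e i + / e (S i)) / (2 * n) = u * ((2 * n + 2 * s) / (2 * n)))%C).
    { unfold u. replace (2 * n + 2 * s)%C with (RtoC (e i) + RtoC (e (S i)))%C
        by (rewrite hs3; ring). field. repeat split; assumption. }
    rewrite E1.
    replace ((z - q * (q / (e (S i) * (1 + x)))) / e i)%C with (z / e i - u / (1 + x))%C
      by (unfold u; field; repeat split; assumption).
    field. repeat split; assumption.
Qed.

(** The squares of the couplings are c^2 and d^2 in turn, so that each 1 / e_i collects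
    c^2 + d^2. *)
Lemma telescope k : (k < m)%nat ->
  csum (fun i => (par c d (S i) ^ 2 * (/ e i + / e (S i)))%C) k
  = ((c ^ 2 + d ^ 2) * csum (fun i => (/ e i)%C) k - c ^ 2 / e O + par c d k ^ 2 / e k)%C.
Proof.
  induction k as [| k IH]; intros hk.
  - simpl. unfold par. simpl. field. apply eC_neq. exact hk.
  - rewrite !csum_S. rewrite IH by lia.
    assert (E : (par c d (S k) ^ 2 = c ^ 2 + d ^ 2 - par c d k ^ 2)%C).
    { rewrite par_S. unfold par. destruct (Nat.even k); ring. }
    replace (par c d (S k) ^ 2 * (/ e k + / e (S k)))%C with
      ((c ^ 2 + d ^ 2 - par c d k ^ 2) * / e k + par c d (S k) ^ 2 / e (S k))%C
      by (rewrite <- E; field; split; apply eC_neq; lia).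
    field. repeat split; apply eC_neq; lia.
Qed.

Lemma csum_minus (f g : nat -> C) k :
  csum (fun i => (f i - g i)%C) k = (csum f k - csum g k)%C.
Proof. induction k as [| k IH]; simpl; [ring |]. rewrite IH. ring. Qed.

(** The root is (c^2 + d^2) / (2 n) up to order 1 / n^2, and therefore the sum of z / e_i cancels
    the telescoped sum. The diagonal correction at the last node is the only term of order 1 / n,
    and it is odd in eps. *)
Lemma relx_sum k : S k = m ->
  Cmod (csum relx (S k) + eps * par c d m / e k) <= 32 * M ^ 10 / n ^ 2 * harm m.
Proof.
  intros hk.
  destruct gap_facts as [hN4 [hm100 [hm [hn [hM2 [h410 [h3000 [hMM hMm]]]]]]]].
  assert (hH : 1 <= harm m) by (apply harm_ge_1; lia).
  rewrite csum_S. rewrite relx_last by lia.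
  pose proof (eC_neq k ltac:(lia)) as nk. pose proof (eC_neq O ltac:(lia)) as n0.
  assert (nn : RtoC n <> 0%C) by (apply RtoC_neq_0; lra).
  set (md := fun i => (z / e i - par c d (S i) ^ 2 * (/ e i + / e (S i)) / (2 * n))%C).
  assert (Herr : Cmod (csum relx k - csum md k) <= 9 * M ^ 4 / n ^ 2 * harm k).
  { rewrite <- csum_minus. unfold harm. rewrite <- rsum_scal.
    apply Cmod_csum_le. intros i hi. apply relx_model. lia. }
  set (I := csum (fun i => (/ e i)%C) k).
  assert (Hmd : csum md k = ((z - (c ^ 2 + d ^ 2) / (2 * n)) * I
     + (c ^ 2 / e O - par c d k ^ 2 / e k) / (2 * n))%C).
  { rewrite (csum_ext md (fun i => z * / e i - / (2 * n) *
      (par c d (S i) ^ 2 * (/ e i + / e (S i))))%C).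
    - rewrite csum_minus, !csum_scal. rewrite telescope by lia. fold I. field. repeat split; assumption.
    - intros i hi. unfold md. field. repeat split; try assumption; apply eC_neq; lia. }
  assert (hI : Cmod I <= 1 / 2 * harm k).
  { unfold I, harm. rewrite <- rsum_scal. apply Cmod_csum_le. intros i hi.
    pose proof (e_pos i ltac:(lia)) as [a1 a2].
    assert (0 < INR (S i)) by (apply lt_0_INR; lia).
    rewrite Cmod_inv by (apply eC_neq; lia). rewrite Cmod_R, Rabs_pos_eq by lra.
    replace (1 / 2 * / INR (S i)) with (/ (2 * INR (S i))) by (field; lra).
    apply Rinv_le_contravar; lra. }
  assert (hz : Cmod (z - (c ^ 2 + d ^ 2) / (2 * n)) <= 29 * M ^ 10 / n ^ 2).
  { pose proof (odd_zeta_asym c d eps M th rho m z r r' hb hc hd heps hN4 Hroot) as h.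
    fold N in h. fold n in h.
    replace (z - (c ^ 2 + d ^ 2) / (2 * n))%C with
      ((z - ((c ^ 2 + d ^ 2) / (2 * n) + (c ^ 2 - d ^ 2) / (2 * n ^ 2)))
        + (c ^ 2 - d ^ 2) / (2 * n ^ 2))%C by (field; assumption).
    eapply Rle_trans; [apply Cmod_triangle |].
    assert (h1 : Cmod ((c ^ 2 - d ^ 2) / (2 * n ^ 2)) <= (M ^ 2 + M ^ 2) / (2 * n ^ 2)).
    { apply Cmod_div_le; [nra | |].
      - eapply Rle_trans; [apply Cmod_minus_le |]. rewrite !Cmod_pow.
        apply Rplus_le_compat; apply pow_incr; (split; [apply Cmod_ge_0 | assumption]).
      - rewrite Cmod_mult, Cmod_pow, !Cmod_R, !Rabs_pos_eq by lra. lra. }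
    assert (h2 : 28 * M ^ 10 / n ^ 3 <= 28 / 3000 * M ^ 10 / n ^ 2).
    { replace (28 * M ^ 10 / n ^ 3) with (28 * M ^ 10 / n ^ 2 * / n) by (field; lra).
      replace (28 / 3000 * M ^ 10 / n ^ 2) with (28 * M ^ 10 / n ^ 2 * / 3000) by (field; lra).
      apply Rmult_le_compat_l; [left; apply Rdiv_lt_0_compat; nra |].
      apply Rinv_le_contravar; lra. }
    replace ((M ^ 2 + M ^ 2) / (2 * n ^ 2)) with (M ^ 2 * / n ^ 2) in h1 by (field; lra).
    assert (hn2 : 0 < / n ^ 2) by (apply Rinv_0_lt_compat; nra).
    unfold Rdiv in *. nra. }
  replace (csum relx k + (z - eps * par c d m) / e k + eps * par c d m / e k)%C
   with ((csum relx k - csum md k) + (csum md k + z / e k))%C by (field; assumption).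
  assert (hik : harm k <= harm m).
  { rewrite <- hk, harm_S. assert (0 < / INR (S k)) by (apply Rinv_0_lt_compat, lt_0_INR; lia).
    lra. }
  assert (hhk : 0 <= harm k) by (apply rsum_nonneg; intros; left; apply Rinv_0_lt_compat, lt_0_INR; lia).
  assert (hn2 : 0 < / n ^ 2) by (apply Rinv_0_lt_compat; nra).
  assert (hB : Cmod (csum md k + z / e k) <= (29 / 2 * M ^ 10 * harm m + 8 * M ^ 2) * / n ^ 2).
  { rewrite Hmd.
    match goal with |- Cmod (?a * ?b + ?x / ?y + ?t) <= _ =>
      replace (a * b + x / y + t)%C with (a * b + (x / y + t))%C by ring end.
    eapply Rle_trans; [apply Cmod_triangle |].
    rewrite Rmult_plus_distr_r. apply Rplus_le_compat.
    - rewrite Cmod_mult.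
      replace (29 / 2 * M ^ 10 * harm m * / n ^ 2) with (29 * M ^ 10 / n ^ 2 * (1 / 2 * harm m))
        by (field; lra).
      apply Rmult_le_compat; try apply Cmod_ge_0; lra.
    - pose proof (e_pos k ltac:(lia)) as [b1 b2]. rewrite hk in b1.
      assert (e0 : e O = 2 * (n - 1)).
      { unfold e, e_in. simpl Nat.even. cbv iota. reflexivity. }
      assert (t1 : Cmod (c ^ 2 / e O - par c d k ^ 2 / e k) <= 3 * M ^ 2 / n).
      { eapply Rle_trans; [apply Cmod_minus_le |].
        assert (Cmod (c ^ 2 / e O) <= M ^ 2 / n).
        { apply Cmod_div_le; [lra | |].
          - rewrite Cmod_pow; apply pow_incr; (split; [apply Cmod_ge_0 | assumption]).
          - rewrite e0, Cmod_R, Rabs_pos_eq; lra. }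
        assert (Cmod (par c d k ^ 2 / e k) <= M ^ 2 / (n / 2)).
        { apply Cmod_div_le; [lra | |].
          - rewrite Cmod_pow; apply pow_incr; (split; [apply Cmod_ge_0 | now apply par_bound]).
          - rewrite Cmod_R, Rabs_pos_eq; lra. }
        replace (M ^ 2 / (n / 2)) with (2 * M ^ 2 / n) in * by (field; lra).
        unfold Rdiv in *. lra. }
      assert (t2 : Cmod ((c ^ 2 / e O - par c d k ^ 2 / e k) / (2 * n)) <= 3 * M ^ 2 / n / (2 * n)).
      { apply Cmod_div_le; [lra | exact t1 |].
        rewrite Cmod_mult, !Cmod_R, !Rabs_pos_eq by lra. lra. }
      assert (t3 : Cmod (z / e k) <= 4 * M ^ 2 / n / (2 / 3 * n)).
      { apply Cmod_div_le; [lra | apply gap_z |].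
        rewrite Cmod_R, Rabs_pos_eq; lra. }
      eapply Rle_trans; [apply Cmod_triangle |].
      replace (3 * M ^ 2 / n / (2 * n)) with (3 / 2 * M ^ 2 * / n ^ 2) in t2 by (field; lra).
      replace (4 * M ^ 2 / n / (2 / 3 * n)) with (6 * M ^ 2 * / n ^ 2) in t3 by (field; lra).
      nra. }
  eapply Rle_trans; [apply Cmod_triangle |].
  eapply Rle_trans; [apply (Rplus_le_compat _ _ _ _ Herr hB) |].
  apply Rle_trans with ((9 * M ^ 4 * harm m + (29 / 2 * M ^ 10 * harm m + 8 * M ^ 2)) * / n ^ 2).
  - rewrite (Rmult_plus_distr_r (9 * M ^ 4 * harm m)). apply Rplus_le_compat_r.
    replace (9 * M ^ 4 / n ^ 2 * harm k) with (9 * M ^ 4 * harm k * / n ^ 2) by (field; lra).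
    apply Rmult_le_compat_r; [lra |]. apply Rmult_le_compat_l; lra.
  - replace (32 * M ^ 10 / n ^ 2 * harm m) with (32 * M ^ 10 * harm m * / n ^ 2) by (field; lra).
    apply Rmult_le_compat_r; [lra |].
    assert (0 <= M ^ 10 - M ^ 4) by lra. nra.
Qed.

Lemma relx_abs_sum k : S k = m ->
  exists g : nat -> R, (forall i, 0 <= g i) /\ (forall i, (i < m)%nat -> Cmod (relx i) <= g i) /\ rsum g m <= 8 * M ^ 2 / n * harm m.
Proof.
  intros hk. destruct gap_facts as [hN4 [hm100 [hm [hn [hM2 [h410 [h3000 [hMM hMm]]]]]]]].
  assert (hH : 1 <= harm m) by (apply harm_ge_1; lia).
  assert (hp : 0 < 4 * M ^ 2 / n) by (apply Rdiv_lt_0_compat; lra).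
  exists (fun i => if (S i =? m)%nat then 4 * M ^ 2 / n else 4 * M ^ 2 / n * / INR (S i)).
  assert (hpos : forall i, 0 < / INR (S i)) by (intros; apply Rinv_0_lt_compat, lt_0_INR; lia).
  split; [| split].
  - intros i. specialize (hpos i). destruct (S i =? m)%nat; nra.
  - intros i hi. destruct (Nat.eqb_spec (S i) m) as [h | h].
    + now apply relx_bound_last.
    + apply relx_bound. lia.
  - set (F := fun i => if (S i =? m)%nat then 4 * M ^ 2 / n else 4 * M ^ 2 / n * / INR (S i)).
    assert (EF : rsum F m = rsum F k + 4 * M ^ 2 / n).
    { rewrite <- hk at 1. change (rsum F (S k)) with (rsum F k + F k). unfold F at 2.
      now rewrite hk, Nat.eqb_refl. }
    rewrite EF.
    assert (rsum F k <= 4 * M ^ 2 / n * harm k).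
    { unfold harm, F. rewrite <- rsum_scal. apply rsum_le. intros i hi.
      destruct (Nat.eqb_spec (S i) m); [lia | lra]. }
    assert (harm k <= harm m) by (rewrite <- hk, harm_S; specialize (hpos k); lra).
    replace (8 * M ^ 2 / n) with (2 * (4 * M ^ 2 / n)) by (field; lra). nra.
Qed.

End OneSign.
End Gap.

(** * The gap between the two folded roots *)

Lemma fact_S_R k : INR (fact (S k)) = INR (S k) * INR (fact k).
Proof. rewrite fact_simpl. apply mult_INR. Qed.

(** The odd positions contribute 4 m, 4 (m - 1), ... and the even ones 4, 8, ..., so that in the
    end each 4 k with k <= m occurs once. *)
Lemma prod_e_even (m i : nat) : (2 * i <= m)%nat ->
  (cprod (fun k => RtoC (e_in (2 * m + 1) (S k))) (2 * i) * INR (fact (m - i))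
   = 4 ^ (2 * i) * INR (fact i) * INR (fact m))%C.
Proof.
  induction i as [| i IH]; intros hi.
  - rewrite Nat.mul_0_r, Nat.sub_0_r. simpl. ring.
  - replace (2 * S i)%nat with (S (S (2 * i))) by lia.
    change (cprod ?f (S (S ?k))) with (cprod f k * f k * f (S k))%C.
    specialize (IH ltac:(lia)).
    assert (e1 : e_in (2 * m + 1) (S (2 * i)) = 4 * INR (m - i)).
    { unfold e_in. replace (Nat.even (S (2 * i))) with false
        by (rewrite Nat.even_succ, Nat.odd_mul; reflexivity).
      rewrite minus_INR by lia. inr. ring. }
    assert (e2 : e_in (2 * m + 1) (S (S (2 * i))) = 4 * INR (S i)).
    { unfold e_in. replace (Nat.even (S (S (2 * i)))) with true
        by (change (Nat.even (S (S (2 * i)))) with (Nat.even (2 * i)); rewrite Nat.even_mul; reflexivity).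
      inr. ring. }
    cbv beta. rewrite e1, e2.
    replace (m - i)%nat with (S (m - S i)) in * by lia.
    rewrite !fact_S_R in *. rewrite !RtoC_mult in *.
    set (P := cprod _ (2 * i)) in *. simpl Cpow.
    replace (P * (4 * INR (S (m - S i))) * (4 * INR (S i)) * INR (fact (m - S i)))%C with
      (16 * INR (S i) * (P * (INR (S (m - S i)) * INR (fact (m - S i)))))%C by ring.
    rewrite IH. replace (2 * i)%nat with (i + i)%nat by lia. rewrite Nat.add_0_r. ring.
Qed.

Lemma prod_e (m : nat) :
  (cprod (fun k => RtoC (e_in (2 * m + 1) (S k))) m = 4 ^ m * INR (fact m))%C.
Proof.
  assert (F : forall k, RtoC (INR (fact k)) <> 0%C)
    by (intros k; apply RtoC_neq_0, INR_fact_neq_0).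
  destruct (parity_cases m) as [[i [hi _]] | [i [hi _]]].
  - pose proof (prod_e_even m i ltac:(lia)) as H.
    replace (m - i)%nat with i in H by lia. rewrite <- hi in H.
    set (P := cprod _ m) in *.
    replace P with (P * INR (fact i) / INR (fact i))%C by (field; apply F).
    rewrite H. field. apply F.
  - pose proof (prod_e_even m i ltac:(lia)) as H.
    replace (m - i)%nat with (S i) in H by lia.
    assert (E : forall f, cprod f m = (cprod f (2 * i) * f (2 * i)%nat)%C).
    { intros f. rewrite hi. replace (2 * i + 1)%nat with (S (2 * i)) by lia. reflexivity. }
    rewrite E.
    assert (e1 : e_in (2 * m + 1) (S (2 * i)) = 4 * INR (S i)).
    { unfold e_in. replace (Nat.even (S (2 * i))) with false
        by (rewrite Nat.even_succ, Nat.odd_mul; reflexivity).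
      rewrite hi. inr. ring. }
    rewrite e1. rewrite fact_S_R, RtoC_mult in H. rewrite RtoC_mult.
    set (P := cprod _ (2 * i)) in *.
    replace (P * (4 * INR (S i)))%C with (4 * (P * (INR (S i) * INR (fact i))) / INR (fact i))%C
      by (field; apply F).
    rewrite H. replace (4 ^ m)%C with (4 * 4 ^ (2 * i))%C
      by (rewrite hi, Nat.add_comm; reflexivity).
    field. apply F.
Qed.

Lemma prod_par (c d : C) (m : nat) :
  (par c d m * cprod (fun i => par c d i ^ 2) m = c ^ (m + 1) * d ^ m)%C.
Proof.
  assert (E : forall i, cprod (fun i => (par c d i ^ 2)%C) (2 * i) = (c ^ (2 * i) * d ^ (2 * i))%C).
  { induction i as [| i IH]; [simpl; ring |].
    replace (2 * S i)%nat with (S (S (2 * i))) by lia.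
    change (cprod ?f (S (S ?k))) with (cprod f k * f k * f (S k))%C. rewrite IH.
    cbv beta. rewrite par_S. unfold par. rewrite Nat.even_mul. simpl orb. cbv iota.
    simpl. ring. }
  destruct (parity_cases m) as [[i [hi h]] | [i [hi h]]].
  - unfold par at 1. rewrite h, hi, E, Nat.add_comm. simpl. ring.
  - unfold par at 1. rewrite h, hi. replace (2 * i + 1)%nat with (S (2 * i)) by lia.
    change (cprod ?f (S ?k)) with (cprod f k * f k)%C. rewrite E.
    unfold par. rewrite Nat.even_mul. simpl orb. cbv iota.
    rewrite (Nat.add_comm (S (2 * i))). simpl. ring.
Qed.

Lemma csum_single (v : C) (m J : nat) : (1 <= m <= J)%nat ->
  csum (fun j => if (S j =? m)%nat then v else RtoC 0) J = v.
Proof.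
  intros h. replace J with (m + (J - m))%nat by lia. induction (J - m)%nat as [| k IH].
  - rewrite Nat.add_0_r. destruct m as [| m]; [lia |]. rewrite csum_S, Nat.eqb_refl.
    replace (csum (fun j => if (S j =? S m)%nat then v else RtoC 0) m) with (RtoC 0); [ring |].
    assert (G : forall l, (l <= m)%nat ->
       csum (fun j => if (S j =? S m)%nat then v else RtoC 0) l = RtoC 0).
    { induction l as [| l IH]; intros hl; [reflexivity |]. rewrite csum_S, IH by lia.
      destruct (Nat.eqb_spec (S l) (S m)); [lia | ring]. }
    symmetry. now apply G.
  - rewrite Nat.add_succ_r, csum_S, IH.
    destruct (Nat.eqb_spec (S (m + k)) m); [lia | ring].
Qed.

Section GapFormula.
Context (c d : C) (M th rho : R) (m : nat).
Let N := (2 * m + 1)%nat.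
Let n := INR N.
Context (hb : big M th rho N) (hc : Cmod c <= M) (hd : Cmod d <= M)
  (hbig : 3000 * M ^ 10 <= n).

Let one_eps : Cmod 1 = 1 := Cmod_1.
Let mone_eps : Cmod (- (1)) = 1 := Cmod_m1.

Context (zp zm : C) (rp rp' rm rm' : nat -> C)
  (Hp : is_root M (E_fold c d 1 N m) (q_fold c d m) (E_out N) (par d c) zp rp rp')
  (Hm : is_root M (E_fold c d (- (1)) N m) (q_fold c d m) (E_out N) (par d c) zm rm rm').

Let Wp := odd_rooted_ok c d 1 M th rho m hb hc hd one_eps.
Let Wm := odd_rooted_ok c d (- (1)) M th rho m hb hc hd mone_eps.

Let G := 4 * M ^ 2 / (n * th).

Lemma gap_G : 0 < G /\ 2 * G ^ 2 <= 1 / 8 /\ G <= 1 / 4.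
Proof.
  pose proof (root_G_small Wp) as h. fold N in h. fold n in h. fold G in h.
  pose proof (big_M hb). pose proof (big_th hb).
  destruct (gap_facts M th rho m hb hbig) as [h1 [_ [_ [_ [_ [_ [h2 _]]]]]]].
  fold N in h1, h2. fold n in h1, h2.
  assert (0 < G) by (apply Rdiv_lt_0_compat; nra).
  repeat split; try assumption. nra.
Qed.

(** The two folded chains differ by 2 q_m on the diagonal at the node m. Inserted into the chain
    of zp, the decaying solution for zm has as residual zp - zm times itself and one more term at
    m; pairing with the decaying solution for zp gives the gap. *)
Lemma gap_green :
  Cmod ((zp - zm) - 2 * par c d m * (cprod rm m * cprod rp m)) <= 4 * G ^ 2 * Cmod (zp - zm).
Proof.
  pose proof (big_M hb) as hM. pose proof (big_th hb) as hth.
  pose proof (big_rho hb) as hrho.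
  destruct (gap_facts M th rho m hb hbig) as [_ [hm100 _]].
  destruct gap_G as [G0 [G1 G2]].
  set (h := fun j => match j with O => (zp - zm)%C
    | S i => tail_res (E_fold c d 1 N m) (q_fold c d m) zp (cprod rm) i end).
  set (h' := fun j => match j with O => (zp - zm)%C
    | S i => tail_res (E_out N) (par d c) zp (cprod rm') i end).
  assert (T : forall j, Cmod (cprod rm j) <= 1 * rho ^ j).
  { intros j. assert (1 <= rho ^ j) by (apply pow_R1_Rle; exact hrho).
    destruct j as [| j]; [simpl; rewrite Cmod_1; lra |].
    pose proof (root_decay Wm zm rm (proj1 Hm) j) as D.
    fold N in D. fold n in D. fold G in D.
    assert (th ^ j <= 1) by (rewrite <- (pow1 j); apply pow_incr; lra).
    assert (0 <= th ^ j) by (apply pow_le; lra). nra. }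
  assert (T' : forall j, Cmod (cprod rm' j) <= 1 * rho ^ j).
  { intros j. assert (1 <= rho ^ j) by (apply pow_R1_Rle; exact hrho).
    destruct j as [| j]; [simpl; rewrite Cmod_1; lra |].
    pose proof (root_decay (rooted_sym Wm) zm rm'
      (proj1 (proj2 Hm)) j) as D.
    fold N in D. fold n in D. fold G in D.
    assert (th ^ j <= 1) by (rewrite <- (pow1 j); apply pow_incr; lra).
    assert (0 <= th ^ j) by (apply pow_le; lra). nra. }
  assert (Hc : chain_res (E_fold c d 1 N m) (q_fold c d m) (E_out N) (par d c) zp
     (cprod rm) (cprod rm') h h').
  { repeat split.
    simpl cprod. unfold h. rewrite (proj2 (proj2 Hm)). ring. }
  pose proof (root_green Wp zp rp rp' _ _ h h' 1 Hp T T' Hc) as Gr.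
  apply le_of_le_plus_eps. intros e he.
  destruct (Gr e he) as [J0 HJ]. specialize (HJ (J0 + m)%nat ltac:(lia)).
  set (J := (J0 + m)%nat) in *.
  set (v := (- (2) * par c d m * (cprod rm m * cprod rp m))%C).
  rewrite (csum_ext (fun j => (h (S j) * cprod rp (S j))%C)
    (fun j => ((zp - zm) * (cprod rm (S j) * cprod rp (S j))
               + (if (S j =? m)%nat then v else RtoC 0))%C)) in HJ.
  2: { intros j _. unfold h.
       assert (Hz : tail_res (E_fold c d (- (1)) N m) (q_fold c d m) zm (cprod rm) j = 0%C)
         by (apply (ratio_sol_res M), Hm).
       assert (E1 : tail_res (E_fold c d 1 N m) (q_fold c d m) zp (cprod rm) j =
         (((zp - zm) + (E_fold c d 1 N m (S j) - E_fold c d (- (1)) N m (S j))) * cprod rm (S j))%C).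
       { replace (tail_res (E_fold c d 1 N m) (q_fold c d m) zp (cprod rm) j)
          with (tail_res (E_fold c d 1 N m) (q_fold c d m) zp (cprod rm) j
            - tail_res (E_fold c d (- (1)) N m) (q_fold c d m) zm (cprod rm) j)%C
           by (rewrite Hz; ring). unfold tail_res. ring. }
       rewrite E1. destruct (Nat.eqb_spec (S j) m) as [e1 | e1].
       - unfold v. rewrite e1, !Efold_eq. ring.
       - assert (E2 : E_fold c d 1 N m (S j) = E_fold c d (- (1)) N m (S j)).
         { destruct (lt_eq_lt_dec (S j) m) as [[l | l] | l]; [| lia |].
           - now rewrite !Efold_lt.
           - now rewrite !Efold_gt. }
         rewrite E2. ring. }
  rewrite (csum_ext (fun j => (h' (S j) * cprod rp' (S j))%C)
    (fun j => ((zp - zm) * (cprod rm' (S j) * cprod rp' (S j)))%C)) in HJ.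
  2: { intros j _. unfold h'.
       assert (Hz : tail_res (E_out N) (par d c) zm (cprod rm') j = 0%C)
         by (apply (ratio_sol_res M), Hm).
       replace (tail_res (E_out N) (par d c) zp (cprod rm') j) with
         (tail_res (E_out N) (par d c) zp (cprod rm') j
          - tail_res (E_out N) (par d c) zm (cprod rm') j)%C by (rewrite Hz; ring).
       unfold tail_res. ring. }
  rewrite csum_plus, !csum_scal, csum_single in HJ by (unfold J; lia).
  assert (S1 : Cmod (csum (fun j => (cprod rm (S j) * cprod rp (S j))%C) J) <= 2 * G ^ 2).
  { pose proof (root_decay Wm zm rm (proj1 Hm)) as D1.
    pose proof (root_decay Wp zp rp (proj1 Hp)) as D2.
    apply cprod_small_sum with th; try assumption. lra. }
  assert (S2 : Cmod (csum (fun j => (cprod rm' (S j) * cprod rp' (S j))%C) J) <= 2 * G ^ 2).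
  { pose proof (root_decay (rooted_sym Wm) zm rm'
      (proj1 (proj2 Hm))) as D1.
    pose proof (root_decay (rooted_sym Wp) zp rp'
      (proj1 (proj2 Hp))) as D2.
    apply cprod_small_sum with th; try assumption. lra. }
  set (s1 := csum _ J) in *. set (s2 := csum (fun j => (cprod rm' (S j) * _)%C) J) in *.
  change (h O) with (zp - zm)%C in HJ.
  replace (zp - zm - 2 * par c d m * (cprod rm m * cprod rp m))%C with
    ((zp - zm + ((zp - zm) * s1 + v) + (zp - zm) * s2) - (zp - zm) * (s1 + s2))%C
    by (unfold v; ring).
  eapply Rle_trans; [apply Cmod_minus_le |]. rewrite Cmod_mult.
  pose proof (Cmod_triangle s1 s2). pose proof (Cmod_ge_0 (zp - zm)).
  assert (Cmod (zp - zm) * Cmod (s1 + s2) <= Cmod (zp - zm) * (4 * G ^ 2))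
    by (apply Rmult_le_compat_l; lra).
  lra.
Qed.

Let Hm1 : exists k, S k = m.
Proof.
  destruct (gap_facts M th rho m hb hbig) as [_ [hm100 _]].
  exists (m - 1)%nat. lia.
Qed.

Let xp := relx c d m 1 zp rp.
Let xm := relx c d m (- (1)) zm rm.

(** In the product of the two solutions the terms of order 1 / n at the last node cancel. What
    remains of the first order is O(log m / n^2), and the second order terms are
    O(log^2 m / n^2). *)
Lemma prods_close :
  Cmod (cprod (fun i => (1 + xp i)%C) m * cprod (fun i => (1 + xm i)%C) m - 1)
   <= 576 * M ^ 10 * (harm m ^ 2 / n ^ 2) /\ 576 * M ^ 10 * (harm m ^ 2 / n ^ 2) <= 1 / 2.
Proof.
  destruct Hm1 as [k hk].
  destruct (gap_facts M th rho m hb hbig)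
    as [hN4 [hm100 [hm [hn [hM2 [h410 [h3000 [hMM hMm]]]]]]]].
  change (INR (2 * m + 1)) with n in hN4, hn, h3000.
  pose proof (relx_sum c d M th rho m hb hc hd hbig 1 one_eps zp rp rp' Hp k hk) as Sp.
  pose proof (relx_sum c d M th rho m hb hc hd hbig (- (1)) mone_eps zm rm rm' Hm k hk) as Sm.
  destruct (relx_abs_sum c d M th rho m hb hc hd hbig 1 one_eps zp rp rp' Hp k hk)
    as [gp [gp1 [gp2 gp3]]].
  destruct (relx_abs_sum c d M th rho m hb hc hd hbig (- (1)) mone_eps zm rm rm' Hm k hk)
    as [gm [gm1 [gm2 gm3]]].
  rewrite hk in Sp, Sm. change (INR (2 * m + 1)) with n in Sp, Sm, gp3, gm3.
  change (2 * m + 1)%nat with N in Sp, Sm. fold xp in Sp, gp2. fold xm in Sm, gm2.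
  change ((fun i : nat => e_in N (S i)) k) with (e_in N (S k)) in Sp, Sm.
  set (e := e_in N (S k)) in *.
  assert (hH1 : 1 <= harm m) by (apply harm_ge_1; lia).
  assert (hH2 : harm m ^ 2 <= 2 * n).
  { pose proof (harm_le_sqrt m) as h.
    assert (s : sqrt (INR m) * sqrt (INR m) = INR m) by (apply sqrt_sqrt; lra).
    assert (0 <= sqrt (INR m)) by apply sqrt_pos. nra. }
  set (H := harm m) in *.
  assert (hq : H ^ 2 / n ^ 2 <= 2 / n).
  { replace (2 / n) with ((2 * n) / n ^ 2) by (field; lra).
    apply Rmult_le_compat_r; [left; apply Rinv_0_lt_compat; nra | lra]. }
  assert (hq2 : M ^ 10 * (H ^ 2 / n ^ 2) <= 2 / 3000).
  { apply Rle_trans with (M ^ 10 * (2 / n)); [apply Rmult_le_compat_l; lra |].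
    apply Rmult_le_reg_r with n; [lra |].
    replace (M ^ 10 * (2 / n) * n) with (2 * M ^ 10) by (field; lra). lra. }
  assert (hq0 : 0 <= H ^ 2 / n ^ 2) by (apply Rmult_le_pos; [nra | left; apply Rinv_0_lt_compat; nra]).
  set (S := 8 * M ^ 2 / n * H) in *.
  assert (hS2 : S ^ 2 = 64 * M ^ 4 * (H ^ 2 / n ^ 2)) by (unfold S; field; lra).
  assert (hS3 : S ^ 2 <= 64 * M ^ 10 * (H ^ 2 / n ^ 2)).
  { rewrite hS2. apply Rmult_le_compat_r; lra. }
  assert (hS0 : 0 <= S).
  { unfold S. apply Rmult_le_pos; [left; apply Rdiv_lt_0_compat; lra | lra]. }
  assert (hS : S <= 1 / 2) by nra.
  split; [| lra].
  pose proof (rsum_nonneg gp m gp1) as gp0. pose proof (rsum_nonneg gm m gm1) as gm0.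
  pose proof (cprod_first_order xp gp m gp2 gp1 ltac:(lra)) as Fp.
  pose proof (cprod_first_order xm gm m gm2 gm1 ltac:(lra)) as Fm.
  pose proof (Cmod_csum_le xp gp m gp2) as Ap. pose proof (Cmod_csum_le xm gm m gm2) as Am.
  set (Pp := cprod (fun i => (1 + xp i)%C) m) in *.
  set (Pm := cprod (fun i => (1 + xm i)%C) m) in *.
  set (sp := csum xp m) in *. set (sm := csum xm m) in *.
  assert (Fp2 : Cmod (Pp - 1 - sp) <= 2 * S ^ 2) by nra.
  assert (Fm2 : Cmod (Pm - 1 - sm) <= 2 * S ^ 2) by nra.
  assert (Bp : Cmod (Pp - 1) <= 2 * S).
  { replace (Pp - 1)%C with ((Pp - 1 - sp) + sp)%C by ring.
    eapply Rle_trans; [apply Cmod_triangle |]. nra. }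
  assert (Bm : Cmod (Pm - 1) <= 2 * S).
  { replace (Pm - 1)%C with ((Pm - 1 - sm) + sm)%C by ring.
    eapply Rle_trans; [apply Cmod_triangle |]. nra. }
  assert (Bs : Cmod (sp + sm) <= 64 * M ^ 10 * (H ^ 2 / n ^ 2)).
  { replace (sp + sm)%C with ((sp + 1 * par c d m / e) + (sm + - (1) * par c d m / e))%C
      by (unfold Cdiv; ring).
    eapply Rle_trans; [apply Cmod_triangle |].
    eapply Rle_trans; [apply (Rplus_le_compat _ _ _ _ Sp Sm) |].
    replace (32 * M ^ 10 / n ^ 2 * H + 32 * M ^ 10 / n ^ 2 * H)
      with (64 * M ^ 10 * (H / n ^ 2)) by (field; lra).
    apply Rmult_le_compat_l; [lra |].
    apply Rmult_le_compat_r; [left; apply Rinv_0_lt_compat; nra | nra]. }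
  (* 576 = 64 + 8 * 64: the first order sums and the quadratic terms. *)
  replace (Pp * Pm - 1)%C with
    ((sp + sm) + ((Pp - 1 - sp) + (Pm - 1 - sm) + (Pp - 1) * (Pm - 1)))%C by ring.
  eapply Rle_trans; [apply Cmod_triangle |].
  assert (Cmod (Pp - 1 - sp + (Pm - 1 - sm) + (Pp - 1) * (Pm - 1)) <= 8 * S ^ 2).
  { eapply Rle_trans; [apply Cmod_triangle |].
    pose proof (Cmod_triangle (Pp - 1 - sp) (Pm - 1 - sm)).
    assert (Cmod ((Pp - 1) * (Pm - 1)) <= (2 * S) * (2 * S)).
    { rewrite Cmod_mult. apply Rmult_le_compat; try apply Cmod_ge_0; assumption. }
    nra. }
  nra.
Qed.

(** At the node m each solution is a product of m ratios, with the couplings as numerators. *)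
Lemma prods_exact :
  (2 * par c d m * (cprod rm m * cprod rp m) *
    (cprod (fun i => (1 + xp i)%C) m * cprod (fun i => (1 + xm i)%C) m)
   = 2 * (c ^ (m + 1) * d ^ m / (4 ^ (2 * m) * INR (fact m) ^ 2)))%C.
Proof.
  assert (Ep : (cprod rp m * (cprod (fun k => RtoC (e_in N (S k))) m
      * cprod (fun i => (1 + xp i)%C) m) = cprod (par c d) m)%C).
  { rewrite <- !cprod_mult. apply cprod_ext. intros i hi.
    apply (relx_eq c d M m 1 zp rp rp' Hp i hi). }
  assert (Em : (cprod rm m * (cprod (fun k => RtoC (e_in N (S k))) m
      * cprod (fun i => (1 + xm i)%C) m) = cprod (par c d) m)%C).
  { rewrite <- !cprod_mult. apply cprod_ext. intros i hi.
    apply (relx_eq c d M m (- (1)) zm rm rm' Hm i hi). }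
  unfold N in Ep, Em. rewrite prod_e in Ep, Em.
  assert (nF : RtoC (INR (fact m)) <> 0%C) by (apply RtoC_neq_0, INR_fact_neq_0).
  assert (n4 : (4 ^ m)%C <> 0%C) by (apply Cpow_nz, RtoC_neq_0; lra).
  rewrite <- prod_par.
  rewrite (cprod_ext (fun i => (par c d i ^ 2)%C) (fun i => (par c d i * par c d i)%C))
    by (intros; simpl; ring).
  rewrite cprod_mult. rewrite <- Ep at 1. rewrite <- Em.
  replace (4 ^ (2 * m))%C with (4 ^ m * 4 ^ m)%C
    by (replace (2 * m)%nat with (m + m)%nat by lia; now rewrite Cpow_add_r).
  field. split; assumption.
Qed.

(** The main term is nonzero because c and d are, so the roots differ and the two relative errors,
    from the identity and from the products, can be collected in one factor 1 + r. *)
Lemma gap_main :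
  c <> 0%C -> d <> 0%C ->
  zp <> zm /\
  exists r : C,
    Cmod r <= (6 * (64 * M ^ 4 / th ^ 2 + 576 * M ^ 10)) * (harm m ^ 2 / n ^ 2) /\
    (zp - zm = 2 * (c ^ (m + 1) * d ^ m / (4 ^ (2 * m) * INR (fact m) ^ 2)) * (1 + r))%C.
Proof.
  intros nc nd.
  pose proof gap_green as Gr. pose proof prods_exact as Ex. destruct prods_close as [Pc Ps].
  destruct gap_G as [G0 [G1 G2]].
  set (X := (2 * par c d m * (cprod rm m * cprod rp m))%C) in *.
  set (P := (cprod (fun i => (1 + xp i)%C) m * cprod (fun i => (1 + xm i)%C) m)%C) in *.
  set (g0 := (2 * (c ^ (m + 1) * d ^ m / (4 ^ (2 * m) * INR (fact m) ^ 2)))%C) in *.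
  destruct (gap_facts M th rho m hb hbig)
    as [hN4 [hm100 [hm [hn [hM2 [h410 [h3000 [hMM hMm]]]]]]]].
  change (INR (2 * m + 1)) with n in hN4, hn, h3000. pose proof (big_th hb) as hth.
  assert (nF : RtoC (INR (fact m)) <> 0%C) by (apply RtoC_neq_0, INR_fact_neq_0).
  assert (n4 : RtoC 4 <> 0%C) by (apply RtoC_neq_0; lra).
  assert (n2 : RtoC 2 <> 0%C) by (apply RtoC_neq_0; lra).
  assert (ng0 : g0 <> 0%C).
  { unfold g0, Cdiv. repeat apply Cmult_neq_0; try assumption; try now apply Cpow_nz.
    intros h. assert (D : (4 ^ (2 * m) * INR (fact m) ^ 2)%C <> 0%C)
      by (apply Cmult_neq_0; now apply Cpow_nz).
    apply (f_equal (fun x => (x * (4 ^ (2 * m) * INR (fact m) ^ 2))%C)) in h.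
    rewrite Cinv_l in h by exact D. rewrite Cmult_0_l in h. 
    apply (RtoC_neq_0 1); [lra | exact h]. }
  assert (nX : X <> 0%C) by (intros h; apply ng0; rewrite <- Ex, h; ring).
  assert (nz : (zp - zm)%C <> 0%C).
  { intros h. rewrite h, Cmod_0, Rmult_0_r in Gr. apply nX.
    replace (0 - X)%C with (- X)%C in Gr by ring. rewrite Cmod_opp in Gr.
    apply Cmod_eq_0. pose proof (Cmod_ge_0 X). lra. }
  split; [intros h; apply nz; rewrite h; ring |].
  set (g := (zp - zm)%C) in *.
  set (s := (X / g - 1)%C).
  assert (hs : Cmod s <= 4 * G ^ 2).
  { unfold s. replace (X / g - 1)%C with (- (g - X) / g)%C by (field; exact nz).
    replace (4 * G ^ 2) with (4 * G ^ 2 * Cmod g / Cmod g)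
      by (field; apply Rgt_not_eq, Cmod_gt_0; exact nz).
    apply Cmod_div_le; [now apply Cmod_gt_0 | now rewrite Cmod_opp | lra]. }
  set (p := (P - 1)%C) in *.
  assert (hX : X = (g * (1 + s))%C) by (unfold s; field; exact nz).
  assert (hP : P = (1 + p)%C) by (unfold p; ring).
  assert (h1s : 1 / 2 <= Cmod (1 + s)).
  { eapply Rle_trans; [| apply Cmod_triangle_inv]. rewrite Cmod_1. lra. }
  assert (h1p : 1 / 2 <= Cmod (1 + p)).
  { eapply Rle_trans; [| apply Cmod_triangle_inv]. rewrite Cmod_1. lra. }
  assert (n1s : (1 + s)%C <> 0%C) by (apply Cmod_gt_0; lra).
  assert (n1p : (1 + p)%C <> 0%C) by (apply Cmod_gt_0; lra).
  exists (/ ((1 + s) * (1 + p)) - 1)%C. split.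
  - replace (/ ((1 + s) * (1 + p)) - 1)%C with (- (s + p + s * p) / ((1 + s) * (1 + p)))%C
      by (field; split; assumption).
    apply Rle_trans with ((3 / 2 * (4 * G ^ 2 + 576 * M ^ 10 * (harm m ^ 2 / n ^ 2))) / (1 / 4)).
    + apply Cmod_div_le; [lra | |].
      * rewrite Cmod_opp. eapply Rle_trans; [apply Cmod_triangle |]. rewrite Cmod_mult.
        pose proof (Cmod_triangle s p). pose proof (Cmod_ge_0 s). pose proof (Cmod_ge_0 p).
        nra.
      * rewrite Cmod_mult. replace (1 / 4) with (1 / 2 * (1 / 2)) by lra.
        apply Rmult_le_compat; lra.
    + assert (hH1 : 1 <= harm m) by (apply harm_ge_1; lia).
      assert (E : 4 * G ^ 2 = 64 * M ^ 4 / th ^ 2 * (1 / n ^ 2)) by (unfold G; field; split; lra).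
      rewrite E.
      assert (1 / n ^ 2 <= harm m ^ 2 / n ^ 2).
      { apply Rmult_le_compat_r; [left; apply Rinv_0_lt_compat; nra | nra]. }
      assert (0 < 64 * M ^ 4 / th ^ 2) by (apply Rdiv_lt_0_compat; nra).
      nra.
  - rewrite <- Ex, hX, hP. field. split; assumption.
Qed.

End GapFormula.

(** * Symmetric chains on Z and their modes *)

Definition e_Z (n j : Z) : R := if Z.even j then 2 * IZR j else 2 * (IZR n - IZR j).
Definition q_Z (c d : C) (j : Z) : C := if Z.even j then c else d.

(** Residual of the symmetric chain, with coupling q_Z c d j on the edge between j and j + 1. *)
Definition zres (c d : C) (n : Z) (z : C) (v : Z -> C) (j : Z) : C :=
  ((z + e_Z n j) * v j - q_Z c d j * v (j + 1)%Z - q_Z c d (j - 1) * v (j - 1)%Z)%C.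

Definition growth (rho : R) (v : Z -> C) : Prop :=
  exists K, forall j, Cmod (v j) <= K * rho ^ Z.abs_nat j.

(** The last clause excludes Jordan blocks: no nonzero multiple of g is in the range of the chain
    operator on sequences of growth rate rho. *)
Record mode (c d : C) (th rho : R) (n : Z) (z : C) (g : Z -> C) : Prop := {
  mode_z : Cmod z < 1 / 2;
  mode_0 : g 0%Z = RtoC 1;
  mode_decay : growth th g;
  mode_eq : forall j, zres c d n z g j = RtoC 0;
  mode_simple : forall f k, growth rho f -> (forall j, zres c d n z f j = (k * g j)%C) ->
    k = RtoC 0
}.

Arguments mode_z {c d th rho n z g}.
Arguments mode_0 {c d th rho n z g}.
Arguments mode_decay {c d th rho n z g}.
Arguments mode_eq {c d th rho n z g}.
Arguments mode_simple {c d th rho n z g}.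

(** Uniqueness is claimed among sequences of growth rate rho, since symmetrising a chain turns
    bounded sequences into exponentially growing ones. *)
Definition modes (c d : C) (th rho : R) (n : Z) (L : list (C * (Z -> C))) : Prop :=
  (forall z g, In (z, g) L -> mode c d th rho n z g) /\
  (forall z v, Cmod z <= 1 / 2 -> growth rho v -> (forall j, zres c d n z v j = RtoC 0) ->
    (forall j, v j = RtoC 0) \/
    exists g, In (z, g) L /\ forall j, v j = (v 0%Z * g j)%C).

Lemma zres_ext c d n z v w j : (forall i, v i = w i) -> zres c d n z v j = zres c d n z w j.
Proof. intros H. unfold zres. now rewrite !H. Qed.

Lemma zres_lin c d n z (v w : Z -> C) (a b : C) j :
  zres c d n z (fun i => (a * v i + b * w i)%C) j
  = (a * zres c d n z v j + b * zres c d n z w j)%C.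
Proof. unfold zres. ring. Qed.

Lemma q_Z_of_nat c d j : q_Z c d (Z.of_nat j) = par c d j.
Proof.
  unfold q_Z, par. replace (Z.even (Z.of_nat j)) with (Nat.even j); [reflexivity |].
  induction j as [| j IH]; [reflexivity |].
  rewrite Nat2Z.inj_succ, Z.even_succ, <- Z.negb_even, Nat.even_succ, <- Nat.negb_even.
  now rewrite IH.
Qed.

Lemma q_Z_pred c d j : q_Z c d (j - 1) = q_Z d c j.
Proof.
  unfold q_Z. rewrite Z.sub_1_r, Z.even_pred, <- Z.negb_even. now destruct (Z.even j).
Qed.

Lemma q_Z_opp c d j : q_Z c d (- j) = q_Z c d j.
Proof. unfold q_Z. now rewrite Z.even_opp. Qed.

Lemma e_Z_of_nat N j : e_Z (Z.of_nat N) (Z.of_nat j) = e_in N j.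
Proof.
  pose proof (q_Z_of_nat 1 0 j) as H. unfold q_Z, par in H. unfold e_Z, e_in.
  rewrite <- !INR_IZR_INZ.
  destruct (Z.even (Z.of_nat j)), (Nat.even j); try reflexivity;
    exfalso; apply (RtoC_neq_0 1); try lra; congruence.
Qed.

Lemma e_Z_opp_of_nat N j : e_Z (Z.of_nat N) (- Z.of_nat j) = e_out N j.
Proof.
  pose proof (q_Z_of_nat 1 0 j) as H. unfold q_Z, par in H. unfold e_Z, e_out.
  rewrite Z.even_opp, opp_IZR, <- !INR_IZR_INZ.
  destruct (Z.even (Z.of_nat j)), (Nat.even j); try ring;
    exfalso; apply (RtoC_neq_0 1); try lra; congruence.
Qed.

Lemma zres_pos c d N z v j :
  zres c d (Z.of_nat N) z v (Z.of_nat (S j))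
  = tail_res (E_in N) (par c d) z (fun i => v (Z.of_nat i)) j.
Proof.
  unfold zres, tail_res, E_in. rewrite e_Z_of_nat, q_Z_of_nat.
  replace (Z.of_nat (S j) - 1)%Z with (Z.of_nat j) by lia.
  replace (Z.of_nat (S j) + 1)%Z with (Z.of_nat (S (S j))) by lia.
  now rewrite q_Z_of_nat.
Qed.

Lemma zres_neg c d N z v j :
  zres c d (Z.of_nat N) z v (- Z.of_nat (S j))
  = tail_res (E_out N) (par d c) z (fun i => v (- Z.of_nat i)%Z) j.
Proof.
  unfold zres, tail_res, E_out. rewrite e_Z_opp_of_nat, q_Z_pred, !q_Z_opp, !q_Z_of_nat.
  replace (- Z.of_nat (S j) - 1)%Z with (- Z.of_nat (S (S j)))%Z by lia.
  replace (- Z.of_nat (S j) + 1)%Z with (- Z.of_nat j)%Z by lia.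
  rewrite (par_S c d j). ring.
Qed.

Lemma zres_zero c d n z v :
  zres c d n z v 0 = (z * v 0%Z - c * v 1%Z - d * v (-1)%Z)%C.
Proof. unfold zres, e_Z, q_Z. simpl. replace (2 * 0) with 0 by ring. ring. Qed.

Definition zjoin (f f' : nat -> C) (j : Z) : C :=
  match j with
  | Z0 => f O
  | Zpos p => f (Pos.to_nat p)
  | Zneg p => f' (Pos.to_nat p)
  end.

Lemma zjoin_pos f f' j : zjoin f f' (Z.of_nat j) = f j.
Proof.
  destruct j as [| j]; [reflexivity |]. simpl. now rewrite SuccNat2Pos.id_succ.
Qed.

Lemma zjoin_neg f f' j : f O = f' O -> zjoin f f' (- Z.of_nat j) = f' j.
Proof.
  intros h. destruct j as [| j]; [exact h |]. simpl. now rewrite SuccNat2Pos.id_succ.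
Qed.

Lemma Z_pos_neg_cases (P : Z -> Prop) :
  (forall j : nat, P (Z.of_nat j)) -> (forall j : nat, P (- Z.of_nat j)%Z) -> forall j, P j.
Proof.
  intros H1 H2 j. destruct (Z_le_gt_dec 0 j) as [h | h].
  - replace j with (Z.of_nat (Z.to_nat j)) by lia. apply H1.
  - replace j with (- Z.of_nat (Z.to_nat (- j)))%Z by lia. apply H2.
Qed.

Lemma growth_zjoin r f f' K :
  (forall j, Cmod (f j) <= K * r ^ j) -> (forall j, Cmod (f' j) <= K * r ^ j) ->
  f O = f' O -> growth r (zjoin f f').
Proof.
  intros H1 H2 h0. exists K. apply Z_pos_neg_cases; intros j.
  - rewrite zjoin_pos. replace (Z.abs_nat (Z.of_nat j)) with j by lia. apply H1.
  - rewrite zjoin_neg by exact h0. replace (Z.abs_nat (- Z.of_nat j)) with j by lia. apply H2.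
Qed.

Lemma growth_shift_ge1 r v n : 1 <= r -> growth r v -> growth r (fun j => v (n - j)%Z).
Proof.
  intros hr [K H]. exists (K * r ^ Z.abs_nat n). intros j. eapply Rle_trans; [apply H |].
  assert (hK : 0 <= K).
  { specialize (H 0%Z). simpl in H. pose proof (Cmod_ge_0 (v 0%Z)). lra. }
  rewrite Rmult_assoc, <- pow_add. apply Rmult_le_compat_l; [exact hK |].
  apply Rle_pow; [exact hr | lia].
Qed.

Lemma growth_shift_le1 r v n : 0 < r <= 1 -> growth r v -> growth r (fun j => v (n - j)%Z).
Proof.
  intros hr [K H]. exists (K * (/ r) ^ Z.abs_nat n). intros j. eapply Rle_trans; [apply H |].
  assert (hK : 0 <= K).
  { specialize (H 0%Z). simpl in H. pose proof (Cmod_ge_0 (v 0%Z)). lra. }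
  rewrite Rmult_assoc. apply Rmult_le_compat_l; [exact hK |].
  assert (hp : 0 < r ^ Z.abs_nat n) by (apply pow_lt; lra).
  apply Rmult_le_reg_l with (r ^ Z.abs_nat n); [exact hp |].
  rewrite pow_inv.
  replace (r ^ Z.abs_nat n * (/ r ^ Z.abs_nat n * r ^ Z.abs_nat j)) with (r ^ Z.abs_nat j)
    by (field; lra).
  rewrite <- pow_add.
  replace (Z.abs_nat n + Z.abs_nat (n - j))%nat
    with (Z.abs_nat j + (Z.abs_nat n + Z.abs_nat (n - j) - Z.abs_nat j))%nat by lia.
  rewrite pow_add. rewrite <- (Rmult_1_r (r ^ Z.abs_nat j)) at 2.
  apply Rmult_le_compat_l; [apply pow_le; lra |].
  rewrite <- (pow1 (Z.abs_nat n + Z.abs_nat (n - j) - Z.abs_nat j)). apply pow_incr. lra.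
Qed.

Lemma growth_lin r v w (a b : C) : 0 <= r ->
  growth r v -> growth r w -> growth r (fun j => (a * v j + b * w j)%C).
Proof.
  intros hr [K H] [K' H']. exists (Cmod a * K + Cmod b * K'). intros j.
  eapply Rle_trans; [apply Cmod_triangle |]. rewrite !Cmod_mult, Rmult_plus_distr_r.
  rewrite !Rmult_assoc.
  apply Rplus_le_compat; apply Rmult_le_compat_l; auto using Cmod_ge_0.
Qed.

Lemma growth_half r v K : (forall j, Cmod (v j) <= K * r ^ Z.abs_nat j) ->
  (forall j : nat, Cmod (v (Z.of_nat j)) <= K * r ^ j) /\
  (forall j : nat, Cmod (v (- Z.of_nat j)%Z) <= K * r ^ j).
Proof.
  intros H. split; intros j.
  - specialize (H (Z.of_nat j)). now replace (Z.abs_nat (Z.of_nat j)) with j in H by lia.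
  - specialize (H (- Z.of_nat j)%Z). now replace (Z.abs_nat (- Z.of_nat j)) with j in H by lia.
Qed.

Lemma chain_res_Z c d N z v h :
  (forall j, zres c d (Z.of_nat N) z v j = h j) ->
  chain_res (E_in N) (par c d) (E_out N) (par d c) z
    (fun i => v (Z.of_nat i)) (fun i => v (- Z.of_nat i)%Z)
    (fun i => h (Z.of_nat i)) (fun i => h (- Z.of_nat i)%Z).
Proof.
  intros H. repeat split.
  - change (z * v 0%Z - c * v 1%Z - d * v (-1)%Z = h 0%Z)%C.
    rewrite <- H. symmetry. apply zres_zero.
  - intros j. now rewrite <- zres_pos.
  - intros j. now rewrite <- zres_neg.
Qed.

(** For even n the node 0 is the only resonance of the chain, and the nodes on its two sides form
    a pair of joined half chains. *)
Lemma modes_even (c d : C) (M th rho : R) (p : nat) :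
  big M th rho (2 * p) -> Cmod c <= M -> Cmod d <= M -> 400 * M ^ 4 <= INR (2 * p) ->
  exists z g, modes c d th rho (Z.of_nat (2 * p)) ((z, g) :: nil) /\
    Cmod (z - ((c ^ 2 + d ^ 2) / (2 * INR (2 * p)) + (c ^ 2 - d ^ 2) / (2 * INR (2 * p) ^ 2)))
    <= 28 * M ^ 10 / INR (2 * p) ^ 3.
Proof.
  intros hb hc hd hN. pose proof (even_rooted_ok c d M th rho p hb hc hd) as W.
  set (N := (2 * p)%nat) in *.
  destruct (root_exists W) as [z [r [r' Hroot]]].
  set (g := zjoin (cprod r) (cprod r')).
  exists z, g. split; [| now apply (even_zeta_asym c d M th rho p z r r')].
  destruct (root_decay_all z r r' W Hroot) as [K [D D']].
  assert (gp : forall j, g (Z.of_nat j) = cprod r j) by (intros; apply zjoin_pos).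
  assert (gn : forall j, g (- Z.of_nat j)%Z = cprod r' j) by (intros; now apply zjoin_neg).
  assert (heq : forall j, zres c d (Z.of_nat N) z g j = RtoC 0).
  { apply Z_pos_neg_cases; intros [| j].
    - simpl Z.of_nat. rewrite (zres_zero c d (Z.of_nat N) z g).
      change 1%Z with (Z.of_nat 1). change (-1)%Z with (- Z.of_nat 1)%Z.
      change 0%Z with (Z.of_nat 0). rewrite !gp, gn. simpl.
      destruct Hroot as [_ [_ Hz]]. rewrite Hz. unfold par. simpl. ring.
    - rewrite zres_pos. unfold tail_res. rewrite !gp.
      apply (ratio_sol_res M), Hroot.
    - simpl Z.of_nat. simpl Z.opp. rewrite (zres_zero c d (Z.of_nat N) z g).
      change 1%Z with (Z.of_nat 1). change (-1)%Z with (- Z.of_nat 1)%Z.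
      change 0%Z with (Z.of_nat 0). rewrite !gp, gn. simpl.
      destruct Hroot as [_ [_ Hz]]. rewrite Hz. unfold par. simpl. ring.
    - rewrite zres_neg. unfold tail_res. rewrite !gn.
      apply (ratio_sol_res M), Hroot. }
  split.
  - intros z0 g0 [E | []]. injection E as <- <-. constructor.
    + pose proof (root_small W _ _ _ Hroot).
      pose proof (kap_small W). lra.
    + reflexivity.
    + now apply growth_zjoin with K.
    + exact heq.
    + intros f k [K' Hf] Hk. destruct (growth_half _ _ _ Hf) as [F F'].
      pose proof (chain_res_Z c d N z f _ Hk) as Hc.
      refine (root_no_jordan z r r' _ _ K' k W Hroot F F' _).
      destruct Hc as [c0 [c1 [c2 [c3 c4]]]]. repeat split.
      * rewrite c2. change (Z.of_nat 0) with 0%Z. reflexivity.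
      * intros j. now rewrite c3, gp.
      * intros j. now rewrite c4, gn.
  - intros z' v hz' [K' Hv] Heq. destruct (growth_half _ _ _ Hv) as [F F'].
    destruct (root_unique W z z' r r' _ _ K' Hroot hz' F F'
      (chain_res_Z c d N z' v _ Heq)) as [H | [H1 H2]].
    + left. apply Z_pos_neg_cases; intros j; apply (H j).
    + right. exists g. split; [left; now rewrite H1 |].
      apply Z_pos_neg_cases; intros j; destruct (H2 j) as [H3 H4].
      * rewrite H3, gp. reflexivity.
      * rewrite H4, gn. reflexivity.
Qed.

(** * Reflections: odd n and negative n *)

(** For odd n the reflection maps the edge between j and j + 1 to the one between n - j - 1 and
    n - j, and j has the parity of n - j - 1; so the couplings are preserved. *)
Lemma zres_refl c d n z v j : Z.odd n = true ->
  zres c d n z (fun i => v (n - i)%Z) j = zres c d n z v (n - j).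
Proof.
  intros hn. unfold zres.
  assert (hq : forall a b, q_Z a b (n - j) = q_Z b a j).
  { intros a b. unfold q_Z. rewrite Z.even_sub, <- (Z.negb_odd n), hn.
    now destruct (Z.even j). }
  assert (he : e_Z n (n - j) = e_Z n j).
  { unfold e_Z. rewrite Z.even_sub, <- (Z.negb_odd n), hn, minus_IZR.
    destruct (Z.even j); simpl; ring. }
  rewrite !q_Z_pred, !hq, he.
  replace (n - (j + 1))%Z with (n - j - 1)%Z by lia.
  replace (n - (j - 1))%Z with (n - j + 1)%Z by lia. ring.
Qed.

Section Fold.
Context (c d eps : C) (M th rho : R) (m : nat).
Let N := (2 * m + 1)%nat.
Let n := Z.of_nat N.
Context (hb : big M th rho N) (hc : Cmod c <= M) (hd : Cmod d <= M)
  (heps2 : (eps * eps = 1)%C) (heps : Cmod eps = 1)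
  (z : C) (r r' : nat -> C)
  (Hroot : is_root M (E_fold c d eps N m) (q_fold c d m) (E_out N) (par d c) z r r').

Let W := odd_rooted_ok c d eps M th rho m hb hc hd heps.

Let n_odd : Z.odd n = true.
Proof. unfold n, N. replace (Z.of_nat (2 * m + 1)) with (1 + 2 * Z.of_nat m)%Z by lia.
  now rewrite Z.odd_add_mul_2. Qed.

Definition fold_fun (v : Z -> C) (j : nat) : C :=
  if (j <=? m)%nat then v (Z.of_nat j) else RtoC 0.

Lemma fold_fun_le v j : (j <= m)%nat -> fold_fun v j = v (Z.of_nat j).
Proof. intros h. unfold fold_fun. apply Nat.leb_le in h. now rewrite h. Qed.

Lemma fold_fun_gt v j : (m < j)%nat -> fold_fun v j = RtoC 0.
Proof. intros h. unfold fold_fun. destruct (Nat.leb_spec j m); [lia | reflexivity]. Qed.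

(** At the node m the neighbour m + 1 is the mirror image of m, which produces the corrected
    diagonal entry. *)
Lemma fold_res z' v j :
  (forall i, v (n - i)%Z = (eps * v i)%C) ->
  tail_res (E_fold c d eps N m) (q_fold c d m) z' (fold_fun v) j
  = fold_fun (zres c d n z' v) (S j).
Proof.
  intros Hv. destruct (lt_eq_lt_dec (S j) m) as [[h | h] | h].
  - rewrite (fold_fun_le (zres c d n z' v)) by lia. unfold n. rewrite zres_pos.
    unfold tail_res. rewrite Efold_lt, !qfold_lt by lia. rewrite !fold_fun_le by lia. reflexivity.
  - rewrite (fold_fun_le (zres c d n z' v)) by lia. unfold n. rewrite zres_pos.
    unfold tail_res. rewrite h, Efold_eq, (qfold_ge c d m m), (qfold_lt c d m j) by lia.
    rewrite (fold_fun_gt v (S m)), !fold_fun_le by lia.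
    specialize (Hv (Z.of_nat m)). replace (n - Z.of_nat m)%Z with (Z.of_nat (S m)) in Hv
      by (unfold n, N; lia).
    rewrite Hv. ring.
  - rewrite (fold_fun_gt (zres c d n z' v)) by lia. unfold tail_res.
    rewrite (fold_fun_gt v (S j)), (fold_fun_gt v (S (S j))) by lia.
    destruct (Nat.eq_dec j m) as [e | e].
    + rewrite (qfold_ge c d m j) by lia. ring.
    + rewrite (fold_fun_gt v j) by lia. ring.
Qed.

Let m_pos : (1 <= m)%nat.
Proof.
  pose proof (big_N100 hb) as h. pose proof (big_M hb).
  destruct m; [| lia]. unfold N in h. simpl INR in h. nra.
Qed.

Lemma fold_chain z' v h :
  (forall i, v (n - i)%Z = (eps * v i)%C) ->
  (forall j, zres c d n z' v j = h j) ->
  chain_res (E_fold c d eps N m) (q_fold c d m) (E_out N) (par d c) z'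
    (fold_fun v) (fun i => v (- Z.of_nat i)%Z)
    (fold_fun h) (fun i => h (- Z.of_nat i)%Z).
Proof.
  intros Hv H. repeat split.
  - rewrite !fold_fun_le by lia. rewrite <- H. symmetry. simpl Z.of_nat.
    rewrite (zres_zero c d n z' v). rewrite qfold_lt by lia. reflexivity.
  - intros j. rewrite fold_res by exact Hv. unfold fold_fun. now rewrite H.
  - intros j. rewrite <- H. symmetry. apply zres_neg.
Qed.

Definition unfold_fun (f f' : nat -> C) (j : Z) : C :=
  if (j <=? Z.of_nat m)%Z then zjoin f f' j else (eps * zjoin f f' (n - j))%C.

Lemma unfold_refl f f' j : unfold_fun f f' (n - j)%Z = (eps * unfold_fun f f' j)%C.
Proof.
  unfold unfold_fun.
  destruct (Z.leb_spec j (Z.of_nat m)), (Z.leb_spec (n - j) (Z.of_nat m));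
    try (unfold n, N in *; lia).
  - replace (n - (n - j))%Z with j by lia. reflexivity.
  - rewrite Cmult_assoc, heps2. ring.
Qed.

Let g := unfold_fun (cprod r) (cprod r').

Lemma g_pos j : (j <= m)%nat -> g (Z.of_nat j) = cprod r j.
Proof.
  intros h. unfold g, unfold_fun. destruct (Z.leb_spec (Z.of_nat j) (Z.of_nat m)); [| lia].
  apply zjoin_pos.
Qed.

Lemma g_neg j : g (- Z.of_nat j)%Z = cprod r' j.
Proof.
  unfold g, unfold_fun. destruct (Z.leb_spec (- Z.of_nat j) (Z.of_nat m)); [| lia].
  now apply zjoin_neg.
Qed.

Lemma cprod_fold_zero j : (m < j)%nat -> cprod r j = RtoC 0.
Proof.
  intros h. destruct j as [| j]; [lia |]. induction j as [| j IH]; [lia |].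
  assert (hz : Cmod z <= 1 / 2).
  { pose proof (root_small W _ _ _ Hroot).
    pose proof (kap_small W). unfold N in *. lra. }
  assert (E : r (S j) = RtoC 0).
  { rewrite (ratio_eq M (INR N) _ _ (ro_tail W) z r (S j) hz (proj1 Hroot)).
    rewrite qfold_ge by lia. unfold Cdiv. ring. }
  change (cprod r (S (S j))) with (cprod r (S j) * r (S j))%C. rewrite E. ring.
Qed.

Lemma g_fold j : fold_fun g j = cprod r j.
Proof.
  destruct (le_lt_dec j m) as [h | h].
  - rewrite fold_fun_le by exact h. now apply g_pos.
  - rewrite fold_fun_gt by exact h. now rewrite cprod_fold_zero.
Qed.

Lemma g_eq j : zres c d n z g j = RtoC 0.
Proof.
  assert (P : forall j, (j <= Z.of_nat m)%Z -> zres c d n z g j = RtoC 0).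
  { apply (Z_pos_neg_cases (fun j => (j <= Z.of_nat m)%Z -> zres c d n z g j = RtoC 0)).
    - intros [| i] hi.
      + change (Z.of_nat 0) with 0%Z. rewrite (zres_zero c d n z g).
        change 1%Z with (Z.of_nat 1). change (-1)%Z with (- Z.of_nat 1)%Z.
        change 0%Z with (Z.of_nat 0). rewrite !g_pos, g_neg by lia. simpl.
        destruct Hroot as [_ [_ Hz]]. rewrite Hz. rewrite qfold_lt by lia.
        unfold par. simpl. ring.
      + rewrite <- (fold_fun_le (zres c d n z g)) by lia.
        rewrite <- fold_res by apply unfold_refl. unfold tail_res. rewrite !g_fold.
        apply (ratio_sol_res M), Hroot.
    - intros [| i] hi.
      + change (- Z.of_nat 0)%Z with 0%Z. rewrite (zres_zero c d n z g).
        change 1%Z with (Z.of_nat 1). change (-1)%Z with (- Z.of_nat 1)%Z.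
        change 0%Z with (Z.of_nat 0). rewrite !g_pos, g_neg by lia. simpl.
        destruct Hroot as [_ [_ Hz]]. rewrite Hz. rewrite qfold_lt by lia.
        unfold par. simpl. ring.
      + unfold n. rewrite zres_neg. unfold tail_res. rewrite !g_neg.
        apply (ratio_sol_res M), Hroot. }
  destruct (Z_le_gt_dec j (Z.of_nat m)) as [h | h]; [now apply P |].
  replace j with (n - (n - j))%Z by lia. rewrite <- zres_refl by exact n_odd.
  rewrite (zres_ext c d n z _ (fun i => (eps * g i + 0 * g i)%C)).
  - rewrite zres_lin, P by (unfold n, N in *; lia). ring.
  - intros i. unfold g. rewrite unfold_refl. ring.
Qed.

Lemma fold_growth rr v K : 1 <= rr ->
  (forall j, Cmod (v j) <= K * rr ^ Z.abs_nat j) ->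
  forall j, Cmod (fold_fun v j) <= K * rr ^ j.
Proof.
  intros hrr H j. destruct (growth_half _ _ _ H) as [H1 _].
  destruct (le_lt_dec j m) as [h | h].
  - rewrite fold_fun_le by exact h. apply H1.
  - rewrite fold_fun_gt by exact h. rewrite Cmod_0.
    apply Rle_trans with (Cmod (v (Z.of_nat j))); [apply Cmod_ge_0 | apply H1].
Qed.

Lemma fold_ext v w :
  (forall i, v (n - i)%Z = (eps * v i)%C) -> (forall i, w (n - i)%Z = (eps * w i)%C) ->
  (forall j, fold_fun v j = fold_fun w j) ->
  (forall j : nat, v (- Z.of_nat j)%Z = w (- Z.of_nat j)%Z) -> forall j, v j = w j.
Proof.
  intros Hv Hw H1 H2.
  assert (P : forall j, (j <= Z.of_nat m)%Z -> v j = w j).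
  { apply (Z_pos_neg_cases (fun j => (j <= Z.of_nat m)%Z -> v j = w j)).
    - intros j hj. specialize (H1 j). rewrite !fold_fun_le in H1 by lia. exact H1.
    - intros j _. apply H2. }
  intros j. destruct (Z_le_gt_dec j (Z.of_nat m)) as [h | h]; [now apply P |].
  replace j with (n - (n - j))%Z by lia. rewrite Hv, Hw.
  rewrite P; [reflexivity | unfold n, N in *; lia].
Qed.

Lemma fold_unique z' v : Cmod z' <= 1 / 2 -> growth rho v ->
  (forall i, v (n - i)%Z = (eps * v i)%C) ->
  (forall j, zres c d n z' v j = RtoC 0) ->
  (forall j, v j = RtoC 0) \/ (z' = z /\ forall j, v j = (v 0%Z * g j)%C).
Proof.
  intros hz' [K HK] Hv Heq.
  pose proof (fold_chain z' v (fun _ => RtoC 0) Hv Heq) as Hc.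
  assert (Hc' : chain_res (E_fold c d eps N m) (q_fold c d m) (E_out N) (par d c) z'
    (fold_fun v) (fun i => v (- Z.of_nat i)%Z) (fun _ => RtoC 0) (fun _ => RtoC 0)).
  { destruct Hc as [c0 [c1 [c2 [c3 c4]]]].
    assert (F0 : forall j, fold_fun (fun _ => RtoC 0) j = RtoC 0).
    { intros j. unfold fold_fun. now destruct (j <=? m)%nat. }
    rewrite F0 in c2. repeat split; try assumption. intros j. now rewrite c3, F0. }
  pose proof (big_rho hb) as hrho.
  destruct (root_unique W z z' r r' _ _ K Hroot hz'
    (fold_growth rho v K hrho HK) (proj2 (growth_half _ _ _ HK)) Hc') as [H | [H1 H2]].
  - left. apply (fold_ext v (fun _ => RtoC 0) Hv).
    + intros; ring.
    + intros j. rewrite (proj1 (H j)). unfold fold_fun. now destruct (j <=? m)%nat.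
    + intros j. apply (proj2 (H j)).
  - right. split; [exact H1 |]. rewrite fold_fun_le in H2 by lia. simpl Z.of_nat in H2.
    apply (fold_ext v (fun j => (v 0%Z * g j)%C) Hv).
    + intros i. unfold g. rewrite unfold_refl. ring.
    + intros j. rewrite (proj1 (H2 j)).
      replace (fold_fun (fun j0 => (v 0%Z * g j0)%C) j) with (v 0%Z * fold_fun g j)%C
        by (unfold fold_fun; destruct (j <=? m)%nat; ring).
      now rewrite g_fold.
    + intros j. rewrite (proj2 (H2 j)). now rewrite g_neg.
Qed.

(** Simplicity: if f has the residual k g, its part of parity eps has the residual 2 k g, because
    g has this parity itself; so the statement for the folded chain applies. *)
Lemma fold_mode : mode c d th rho n z g.
Proof.
  pose proof (big_rho hb) as hrho. pose proof (big_th hb) as hth.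
  assert (nz2 : RtoC 2 <> 0%C) by (apply RtoC_neq_0; lra).
  constructor.
  - pose proof (root_small W _ _ _ Hroot).
    pose proof (kap_small W). unfold N in *. lra.
  - change 0%Z with (Z.of_nat 0). rewrite g_pos by lia. reflexivity.
  - destruct (root_decay_all z r r' W Hroot) as [K [D D']].
    assert (G1 : growth th (zjoin (cprod r) (cprod r'))) by now apply growth_zjoin with K.
    pose proof (growth_shift_le1 th _ n ltac:(lra) G1) as G2.
    destruct G1 as [K1 G1]. destruct G2 as [K2 G2]. exists (K1 + K2). intros j.
    specialize (G1 j). specialize (G2 j). rewrite Rmult_plus_distr_r.
    unfold g, unfold_fun. destruct (j <=? Z.of_nat m)%Z.
    + pose proof (Cmod_ge_0 (zjoin (cprod r) (cprod r') (n - j))). lra.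
    + rewrite Cmod_mult, heps. pose proof (Cmod_ge_0 (zjoin (cprod r) (cprod r') j)). lra.
  - exact g_eq.
  - intros f k Hf Hk.
    set (p := fun j => (1 * f j + eps * f (n - j)%Z)%C).
    assert (Hp : growth rho p).
    { apply growth_lin; [lra | exact Hf | apply growth_shift_ge1; assumption]. }
    assert (Hpr : forall i, p (n - i)%Z = (eps * p i)%C).
    { intros i. unfold p. replace (n - (n - i))%Z with i by lia.
      replace (eps * (1 * f i + eps * f (n - i)%Z))%C
        with (eps * f i + (eps * eps) * f (n - i)%Z)%C by ring. rewrite heps2. ring. }
    assert (Hpe : forall j, zres c d n z p j = (2 * k * g j)%C).
    { intros j. unfold p. rewrite (zres_lin c d n z f (fun j => f (n - j)%Z) 1 eps j).
      rewrite zres_refl by exact n_odd. rewrite !Hk. unfold g. rewrite unfold_refl.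
      replace (eps * (k * (eps * unfold_fun (cprod r) (cprod r') j)))%C
        with ((eps * eps) * (k * unfold_fun (cprod r) (cprod r') j))%C by ring.
      rewrite heps2. ring. }
    destruct Hp as [K HK].
    pose proof (fold_chain z p _ Hpr Hpe) as Hc.
    assert (H2k : (2 * k)%C = RtoC 0).
    { refine (root_no_jordan z r r' _ _ K (2 * k)%C W Hroot
        (fold_growth rho p K hrho HK) (proj2 (growth_half _ _ _ HK)) _).
      destruct Hc as [c0 [c1 [c2 [c3 c4]]]].
      assert (F0 : forall j, fold_fun (fun j => (2 * k * g j)%C) j = (2 * k * cprod r j)%C).
      { intros j. rewrite <- g_fold. unfold fold_fun. destruct (j <=? m)%nat; ring. }
      rewrite F0 in c2. repeat split; try assumption; intros j.
      - now rewrite c3, F0.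
      - now rewrite c4, g_neg. }
    replace k with (2 * k / 2)%C by (field; exact nz2). rewrite H2k. unfold Cdiv. ring.
Qed.

End Fold.

Definition zeta_approx (c d : C) (n : Z) : C :=
  ((c ^ 2 + d ^ 2) / (2 * IZR n) + (c ^ 2 - d ^ 2) / (2 * IZR n ^ 2))%C.

Definition Kgap (M th : R) : R := 6 * (64 * M ^ 4 / th ^ 2 + 576 * M ^ 10).

(** Every solution is half the sum of its two parity parts. As the roots for the two parities
    differ, at most one of the parts is nonzero for a given z. *)
Lemma modes_odd_pos (c d : C) (M th rho : R) (m : nat) :
  big M th rho (2 * m + 1) -> Cmod c <= M -> Cmod d <= M ->
  3000 * M ^ 10 <= INR (2 * m + 1) -> c <> 0%C -> d <> 0%C ->
  exists zp gp zm gm, modes c d th rho (Z.of_nat (2 * m + 1)) ((zp, gp) :: (zm, gm) :: nil) /\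
    zp <> zm /\
    Cmod (zp - zeta_approx c d (Z.of_nat (2 * m + 1))) <= 28 * M ^ 10 / INR (2 * m + 1) ^ 3 /\
    Cmod (zm - zeta_approx c d (Z.of_nat (2 * m + 1))) <= 28 * M ^ 10 / INR (2 * m + 1) ^ 3 /\
    exists r : C,
    Cmod r <= Kgap M th * (harm m ^ 2 / INR (2 * m + 1) ^ 2) /\
    (zp - zm = 2 * (c ^ (m + 1) * d ^ m / (4 ^ (2 * m) * INR (fact m) ^ 2)) * (1 + r))%C.
Proof.
  intros hb hc hd hbig nc nd.
  assert (h1 : Cmod 1 = 1) by apply Cmod_1.
  assert (h1' : Cmod (- (1)) = 1) by apply Cmod_m1.
  pose proof (proj1 (gap_facts M th rho m hb hbig)) as hN4.
  destruct (root_exists (odd_rooted_ok c d 1 M th rho m hb hc hd h1))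
    as [zp [rp [rp' Hp]]].
  destruct (root_exists (odd_rooted_ok c d (- (1)) M th rho m hb hc hd h1'))
    as [zm [rm [rm' Hm]]].
  destruct (gap_main c d M th rho m hb hc hd hbig zp zm rp rp' rm rm' Hp Hm nc nd)
    as [hne hgap].
  assert (e1 : (1 * 1 = 1)%C) by ring. assert (e2 : (- (1) * - (1) = 1)%C) by ring.
  pose proof (fold_mode c d 1 M th rho m hb hc hd e1 h1 zp rp rp' Hp) as Mp.
  pose proof (fold_mode c d (- (1)) M th rho m hb hc hd e2 h1' zm rm rm' Hm) as Mm.
  pose proof (fold_unique c d 1 M th rho m hb hc hd e1 h1 zp rp rp' Hp) as Up.
  pose proof (fold_unique c d (- (1)) M th rho m hb hc hd e2 h1' zm rm rm' Hm) as Um.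
  set (gp := unfold_fun 1 m (cprod rp) (cprod rp')) in *.
  set (gm := unfold_fun (- (1)) m (cprod rm) (cprod rm')) in *.
  set (n := Z.of_nat (2 * m + 1)) in *.
  pose proof (big_rho hb) as hrho.
  exists zp, gp, zm, gm. split; [split | split; [exact hne | split; [| split; [| exact hgap]]]].
  - intros z g [E | [E | []]]; injection E as <- <-; assumption.
  - intros z v hz Hv Heq.
    assert (n_odd : Z.odd n = true).
    { unfold n. replace (Z.of_nat (2 * m + 1)) with (1 + 2 * Z.of_nat m)%Z by lia.
      now rewrite Z.odd_add_mul_2. }
    set (part := fun (s : C) j => (1 * v j + s * v (n - j)%Z)%C).
    assert (G : forall s, growth rho (part s)).
    { intros s. apply growth_lin; [lra | exact Hv | apply growth_shift_ge1; assumption]. }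
    assert (S : forall s, (s * s = 1)%C -> forall i, part s (n - i)%Z = (s * part s i)%C).
    { intros s hs i. unfold part. replace (n - (n - i))%Z with i by lia.
      replace (s * (1 * v i + s * v (n - i)%Z))%C
        with (s * v i + (s * s) * v (n - i)%Z)%C by ring. rewrite hs. ring. }
    assert (Q : forall s j, zres c d n z (part s) j = RtoC 0).
    { intros s j. unfold part. rewrite (zres_lin c d n z v (fun j => v (n - j)%Z) 1 s j).
      rewrite zres_refl by exact n_odd. rewrite !Heq. ring. }
    assert (V : forall j, v j = ((part 1 j + part (- (1))%C j) / 2)%C).
    { intros j. unfold part. field. }
    destruct (Up z (part 1) hz (G _) (S _ e1) (Q _)) as [Zp | [Ep Fp]];
    destruct (Um z (part (- (1))%C) hz (G _) (S _ e2) (Q _)) as [Zm | [Em Fm]].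
    + left. intros j. rewrite V, Zp, Zm. field.
    + right. exists gm. split; [right; left; now rewrite Em |].
      intros j. rewrite (V j), (V 0%Z), !Zp, (Fm j). field.
    + right. exists gp. split; [left; now rewrite Ep |].
      intros j. rewrite (V j), (V 0%Z), !Zm, (Fp j). field.
    + exfalso. apply hne. now rewrite <- Ep.
  - unfold zeta_approx, n. rewrite <- INR_IZR_INZ.
    now apply (odd_zeta_asym c d 1 M th rho m zp rp rp').
  - unfold zeta_approx, n. rewrite <- INR_IZR_INZ.
    now apply (odd_zeta_asym c d (- (1)) M th rho m zm rm rm').
Qed.

(** The diagonal entry at - j for n is minus the one at j for - n, and the reflection exchanges
    the edges that carry c and d. *)
Lemma zres_flip c d n z v j :
  zres (- d) (- c) (- n) (- z) (fun i => v (- i)%Z) j = (- zres c d n z v (- j))%C.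
Proof.
  unfold zres. rewrite !q_Z_pred, !q_Z_opp.
  replace (- (j + 1))%Z with (- j - 1)%Z by lia. replace (- (j - 1))%Z with (- j + 1)%Z by lia.
  assert (he : e_Z (- n) j = - e_Z n (- j)).
  { unfold e_Z. rewrite Z.even_opp, !opp_IZR. destruct (Z.even j); ring. }
  assert (hq : forall a b, q_Z (- a)%C (- b)%C j = (- q_Z a b j)%C).
  { intros a b. unfold q_Z. now destruct (Z.even j). }
  rewrite he, !hq, RtoC_opp. ring.
Qed.

Lemma growth_flip r v : growth r v -> growth r (fun j => v (- j)%Z).
Proof.
  intros [K H]. exists K. intros j. specialize (H (- j)%Z).
  now replace (Z.abs_nat (- j)) with (Z.abs_nat j) in H by lia.
Qed.

Definition flip (x : C * (Z -> C)) : C * (Z -> C) := ((- fst x)%C, fun j => snd x (- j)%Z).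

Lemma mode_flip c d th rho n z g :
  mode c d th rho n z g -> mode (- d) (- c) th rho (- n) (- z) (fun j => g (- j)%Z).
Proof.
  intros [H1 H2 H3 H4 H5]. constructor.
  - now rewrite Cmod_opp.
  - exact H2.
  - now apply growth_flip.
  - intros j. rewrite zres_flip, H4. ring.
  - intros f k Hf Hk. assert (E : (- k)%C = RtoC 0).
    { apply (H5 (fun j => f (- j)%Z)); [now apply growth_flip |].
      intros j. pose proof (zres_flip c d n z (fun j => f (- j)%Z) (- j)) as F.
      rewrite Z.opp_involutive in F.
      rewrite (zres_ext _ _ _ _ _ f) in F by (intros; now rewrite Z.opp_involutive).
      rewrite Hk, Z.opp_involutive in F.
      replace (zres c d n z (fun j0 => f (- j0)%Z) j) with (- - zres c d n z (fun j0 => f (- j0)%Z) j)%C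
        by ring. rewrite <- F. ring. }
    replace k with (- - k)%C by ring. rewrite E. ring.
Qed.

Lemma modes_flip c d th rho n L :
  modes c d th rho n L -> modes (- d) (- c) th rho (- n) (map flip L).
Proof.
  intros [H1 H2]. split.
  - intros z g Hin. apply in_map_iff in Hin. destruct Hin as [[z0 g0] [E Hin]].
    unfold flip in E. simpl in E. injection E as <- <-. now apply mode_flip, H1.
  - intros z v hz Hv Heq.
    destruct (H2 (- z)%C (fun j => v (- j)%Z)) as [Z0 | [g [Hin Hg]]].
    + now rewrite Cmod_opp.
    + now apply growth_flip.
    + intros j. pose proof (zres_flip c d n (- z) (fun j => v (- j)%Z) (- j)) as F.
      replace (- - z)%C with z in F by ring.
      rewrite Z.opp_involutive in F.
      rewrite (zres_ext _ _ _ _ _ v) in F by (intros; now rewrite Z.opp_involutive).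
      rewrite Heq in F.
      match goal with |- ?x = _ => replace x with (- - x)%C by ring end.
      rewrite <- F. ring.
    + left. intros j. specialize (Z0 (- j)%Z). cbv beta in Z0. now rewrite Z.opp_involutive in Z0.
    + right. exists (fun j => g (- j)%Z). split.
      * apply in_map_iff. exists ((- z)%C, g). split; [| exact Hin].
        unfold flip. simpl. f_equal. ring.
      * intros j. specialize (Hg (- j)%Z). cbv beta in Hg. now rewrite Z.opp_involutive in Hg.
Qed.

Lemma zeta_approx_flip c d n : n <> 0%Z ->
  zeta_approx (- d) (- c) (- n) = (- zeta_approx c d n)%C.
Proof.
  intros hn. unfold zeta_approx. rewrite opp_IZR, RtoC_opp.
  assert (RtoC (IZR n) <> 0%C) by (apply RtoC_neq_0; now apply not_0_IZR).
  field. assumption.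
Qed.

(** * Symmetrising gauge, and chains without resonance *)

Lemma Csqrt_exists (w : C) : exists c : C, (c ^ 2 = w)%C.
Proof.
  destruct w as [x y].
  set (r := Cmod (x, y)).
  assert (hr2 : r * r = x * x + y * y).
  { unfold r, Cmod. simpl fst. simpl snd. rewrite sqrt_sqrt; nra. }
  assert (hr0 : 0 <= r) by apply Cmod_ge_0.
  assert (hx : Rabs x <= r) by apply (re_le_Cmod (x, y)).
  assert (h1 : 0 <= (r + x) / 2) by (unfold Rabs in hx; destruct Rcase_abs in hx; lra).
  assert (h2 : 0 <= (r - x) / 2) by (unfold Rabs in hx; destruct Rcase_abs in hx; lra).
  set (u := sqrt ((r + x) / 2)). set (v := sqrt ((r - x) / 2)).
  assert (hu : u * u = (r + x) / 2) by now apply sqrt_sqrt.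
  assert (hv : v * v = (r - x) / 2) by now apply sqrt_sqrt.
  assert (hu0 : 0 <= u) by apply sqrt_pos. assert (hv0 : 0 <= v) by apply sqrt_pos.
  assert (huv : (2 * u * v) * (2 * u * v) = y * y).
  { replace ((2 * u * v) * (2 * u * v)) with (4 * (u * u) * (v * v)) by ring.
    rewrite hu, hv. nra. }
  assert (huv0 : 0 <= 2 * u * v) by nra.
  destruct (Rle_lt_dec 0 y) as [h | h].
  - exists (u, v). apply injective_projections; simpl; [nra |].
    assert (2 * u * v = y) by nra. nra.
  - exists (u, - v). apply injective_projections; simpl; [nra |].
    assert (2 * u * v = - y) by nra. nra.
Qed.

(** A multiplicative primitive of kap. The bounds on it and on its inverse say how much growth is
    gained or lost by the change of variables. *)
Lemma gauge_exists (kap : Z -> C) (R0 : R) :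
  (forall j, kap j <> 0%C) -> (forall j, Cmod (kap j) <= R0) ->
  (forall j, Cmod (/ kap j) <= R0) ->
  exists om : Z -> C, om 0%Z = RtoC 1 /\ (forall j, om j <> 0%C) /\
    (forall j, om (j + 1)%Z = (om j * kap j)%C) /\
    (forall j, Cmod (om j) <= R0 ^ Z.abs_nat j) /\
    (forall j, Cmod (/ om j) <= R0 ^ Z.abs_nat j).
Proof.
  intros Hn Hk Hk'.
  set (f := cprod (fun i => kap (Z.of_nat i))).
  set (f' := cprod (fun i => (/ kap (- Z.of_nat (S i))%Z)%C)).
  assert (nf : forall j, f j <> 0%C) by (intros; apply cprod_neq_0; intros; apply Hn).
  assert (ni : forall j, (/ kap j)%C <> 0%C).
  { intros j h. pose proof (Cinv_l (kap j) (Hn j)) as e. rewrite h in e.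
    apply (RtoC_neq_0 1); [lra |]. rewrite <- e. ring. }
  assert (nf' : forall j, f' j <> 0%C) by (intros; apply cprod_neq_0; intros; apply ni).
  assert (hR : 0 <= R0) by (eapply Rle_trans; [apply Cmod_ge_0 | apply (Hk 0%Z)]).
  assert (bp : forall g, (forall i, Cmod (g i) <= R0) -> forall j, Cmod (cprod g j) <= R0 ^ j).
  { intros g Hg. induction j as [| j IH]; simpl; [rewrite Cmod_1; lra |].
    rewrite Cmod_mult, Rmult_comm. apply Rmult_le_compat; auto using Cmod_ge_0. }
  assert (bi : forall g : nat -> C, (forall i, g i <> 0%C) -> (forall i, Cmod (/ g i) <= R0) ->
     forall j, Cmod (/ cprod g j) <= R0 ^ j).
  { intros g Hg0 Hg. assert (nz : forall j, cprod g j <> 0%C) by (intros; apply cprod_neq_0; intros k _; exact (Hg0 k)).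
    induction j as [| j IH]; simpl.
    - replace (/ 1)%C with (RtoC 1) by field. rewrite Cmod_1. lra.
    - replace (/ (cprod g j * g j))%C with (/ cprod g j * / g j)%C by (field; auto).
      rewrite Cmod_mult, Rmult_comm. apply Rmult_le_compat; auto using Cmod_ge_0. }
  exists (zjoin f f').
  assert (zp : forall j, zjoin f f' (Z.of_nat j) = f j) by (intros; apply zjoin_pos).
  assert (zn : forall j, zjoin f f' (- Z.of_nat j)%Z = f' j) by (intros; apply zjoin_neg; reflexivity).
  repeat split.
  - apply Z_pos_neg_cases; intros j; [rewrite zp | rewrite zn]; auto.
  - apply Z_pos_neg_cases; intros j.
    + replace (Z.of_nat j + 1)%Z with (Z.of_nat (S j)) by lia. rewrite !zp. reflexivity.
    + destruct j as [| j].
      * change (- Z.of_nat 0)%Z with (Z.of_nat 0). change (Z.of_nat 0 + 1)%Z with (Z.of_nat 1).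
        rewrite !zp. reflexivity.
      * replace (- Z.of_nat (S j) + 1)%Z with (- Z.of_nat j)%Z by lia. rewrite !zn.
        change (f' (S j)) with (f' j * / kap (- Z.of_nat (S j))%Z)%C. field. apply Hn.
  - apply Z_pos_neg_cases; intros j.
    + rewrite zp. replace (Z.abs_nat (Z.of_nat j)) with j by lia. apply bp. intros; apply Hk.
    + rewrite zn. replace (Z.abs_nat (- Z.of_nat j)) with j by lia. apply bp. intros; apply Hk'.
  - apply Z_pos_neg_cases; intros j.
    + rewrite zp. replace (Z.abs_nat (Z.of_nat j)) with j by lia.
      apply bi; intros; [apply Hn | apply Hk'].
    + rewrite zn. replace (Z.abs_nat (- Z.of_nat j)) with j by lia.
      apply bi; intros; [apply ni |].
      replace (/ / kap (- Z.of_nat (S i))%Z)%C with (kap (- Z.of_nat (S i))%Z); [apply Hk |].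
      field. apply Hn.
Qed.

(** A chain with couplings s0, s1 to the right and t0, t1 to the left, at even and odd nodes. *)
Definition gres (s0 t0 s1 t1 : C) (n : Z) (z : C) (u : Z -> C) (j : Z) : C :=
  ((z + e_Z n j) * u j - q_Z s0 s1 j * u (j + 1)%Z - q_Z t0 t1 j * u (j - 1)%Z)%C.

Definition zbounded (v : Z -> C) : Prop := exists K, forall j, Cmod (v j) <= K.

(** A diagonal change of variables leaves only the products of the two couplings over an edge,
    s0 t1 and s1 t0, invariant; it can therefore make the two couplings equal to a square root. *)
Lemma symmetrize (s0 t0 s1 t1 c d : C) :
  s0 <> 0%C -> s1 <> 0%C -> c <> 0%C -> d <> 0%C ->
  (c ^ 2 = s0 * t1)%C -> (d ^ 2 = s1 * t0)%C ->
  forall R0, Cmod (c / s0) <= R0 -> Cmod (s0 / c) <= R0 ->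
    Cmod (d / s1) <= R0 -> Cmod (s1 / d) <= R0 ->
  exists om : Z -> C, om 0%Z = RtoC 1 /\ (forall j, om j <> 0%C) /\
    (forall j, Cmod (om j) <= R0 ^ Z.abs_nat j) /\
    (forall j, Cmod (/ om j) <= R0 ^ Z.abs_nat j) /\
    (forall n z v j, gres s0 t0 s1 t1 n z (fun i => (om i * v i)%C) j
       = (om j * zres c d n z v j)%C).
Proof.
  intros n0 n1 nc nd hc2 hd2 R0 h1 h2 h3 h4.
  destruct (gauge_exists (fun j => if Z.even j then (c / s0)%C else (d / s1)%C) R0)
    as [om [o0 [o1 [o2 [o3 o4]]]]].
  - intros j. destruct (Z.even j); apply Cmod_gt_0; rewrite Cmod_div by assumption;
      apply Rdiv_lt_0_compat; now apply Cmod_gt_0.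
  - intros j. destruct (Z.even j); assumption.
  - intros j. destruct (Z.even j).
    + replace (/ (c / s0))%C with (s0 / c)%C by (field; split; assumption). assumption.
    + replace (/ (d / s1))%C with (s1 / d)%C by (field; split; assumption). assumption.
  - exists om. repeat split; try assumption. intros n z v j.
    unfold gres, zres. rewrite q_Z_pred. rewrite o2.
    assert (E : om (j - 1)%Z = (om j * (if Z.even j then s1 / d else s0 / c))%C).
    { pose proof (o2 (j - 1)%Z) as H. replace (j - 1 + 1)%Z with j in H by lia. rewrite H.
      rewrite Z.sub_1_r, Z.even_pred, <- Z.negb_even. destruct (Z.even j); simpl; field; auto. }
    rewrite E. unfold q_Z. destruct (Z.even j).
    + replace (t0 * (om j * (s1 / d) * v (j - 1)%Z))%C
        with (om j * ((s1 * t0) / d * v (j - 1)%Z))%C by (field; assumption).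
      rewrite <- hd2. field. auto.
    + replace (t1 * (om j * (s0 / c) * v (j - 1)%Z))%C
        with (om j * ((s0 * t1) / c * v (j - 1)%Z))%C by (field; assumption).
      rewrite <- hc2. field. auto.
Qed.

(** Each equation bounds u_j by its neighbours with a factor of order 1 / |e_j|. Over two steps
    the factor is of order 1 / |n|, so that any bound on |u| improves to half of itself. *)
Lemma no_resonance (n : Z) (z : C) (u s t : Z -> C) (Ma : R) :
  Z.odd n = true -> Cmod z <= 1 / 2 -> 1 <= Ma -> 200 * Ma ^ 2 <= IZR (Z.abs n) ->
  (forall j, Cmod (s j) <= Ma) -> (forall j, Cmod (t j) <= Ma) -> zbounded u ->
  (forall j, (z + RtoC (if Z.even j then 2 * (IZR n - IZR j) else 2 * IZR j)) * u j
     = s j * u (j + 1)%Z + t j * u (j - 1)%Z)%C ->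
  forall j, u j = RtoC 0.
Proof.
  intros hn hz hMa hN hs ht [K HK] Heq.
  set (e := fun j => if Z.even j then 2 * (IZR n - IZR j) else 2 * IZR j).
  assert (he : forall j, exists k : Z, k <> 0%Z /\ e j = 2 * IZR k /\
     k = (if Z.even j then n - j else j)%Z).
  { intros j. unfold e. destruct (Z.even j) eqn:hj.
    - exists (n - j)%Z. rewrite minus_IZR. repeat split. intros h.
      assert (n = j) by lia. subst j. rewrite <- Z.negb_odd, hn in hj. discriminate.
    - exists j. repeat split. intros h. subst j. discriminate. }
  assert (he2 : forall j, 2 <= Rabs (e j)).
  { intros j. destruct (he j) as [k [h1 [h2 _]]]. rewrite h2, Rabs_mult.
    rewrite (Rabs_pos_eq 2), <- abs_IZR by lra. assert (1 <= IZR (Z.abs k)) by (apply IZR_le; lia). lra. }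
  assert (hee : forall j k, (k = j + 1 \/ k = j - 1)%Z -> IZR (Z.abs n) <= Rabs (e j) * Rabs (e k)).
  { intros j k hk. destruct (he j) as [x [x1 [x2 x3]]]. destruct (he k) as [y [y1 [y2 y3]]].
    rewrite x2, y2, !Rabs_mult, (Rabs_pos_eq 2) by lra. rewrite <- !abs_IZR.
    replace (2 * IZR (Z.abs x) * (2 * IZR (Z.abs y))) with (IZR (4 * (Z.abs x * Z.abs y)))
      by (rewrite !mult_IZR; ring).
    apply IZR_le.
    assert (hsum : (Z.abs n - 1 <= Z.abs x + Z.abs y)%Z).
    { assert (hp : Z.even k = negb (Z.even j)).
      { destruct hk; subst k.
        - now rewrite Z.add_1_r, Z.even_succ, <- Z.negb_even.
        - now rewrite Z.sub_1_r, Z.even_pred, <- Z.negb_even. }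
      rewrite hp in y3. destruct (Z.even j); simpl in y3; lia. }
    assert (200 <= Z.abs n)%Z by (apply le_IZR; nra).
    assert (1 <= Z.abs x)%Z by lia. assert (1 <= Z.abs y)%Z by lia. nia. }
  assert (hstep : forall j, Cmod (u j) <= 4 / 3 * Ma / Rabs (e j)
      * (Cmod (u (j + 1)%Z) + Cmod (u (j - 1)%Z))).
  { intros j. pose proof (he2 j) as h2. specialize (Heq j). fold (e j) in Heq.
    pose proof (f_equal Cmod Heq) as H. rewrite Cmod_mult in H.
    pose proof (Cmod_triangle_inv (e j) z) as h3. rewrite Cmod_R in h3.
    rewrite (Cplus_comm (e j) z) in h3.
    pose proof (Cmod_triangle (s j * u (j + 1)%Z) (t j * u (j - 1)%Z)) as h4.
    rewrite !Cmod_mult in h4.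
    pose proof (hs j). pose proof (ht j). pose proof (Cmod_ge_0 (u (j + 1)%Z)).
    pose proof (Cmod_ge_0 (u (j - 1)%Z)). pose proof (Cmod_ge_0 (u j)).
    apply Rmult_le_reg_r with (3 / 4 * Rabs (e j)); [lra |].
    replace (4 / 3 * Ma / Rabs (e j) * (Cmod (u (j + 1)%Z) + Cmod (u (j - 1)%Z)) * (3 / 4 * Rabs (e j)))
      with (Ma * Cmod (u (j + 1)%Z) + Ma * Cmod (u (j - 1)%Z)) by (field; lra).
    apply Rle_trans with (Cmod (u j) * Cmod (z + e j)); [apply Rmult_le_compat_l; lra |].
    rewrite Rmult_comm, H. nra. }
  assert (hK : 0 <= K) by (eapply Rle_trans; [apply Cmod_ge_0 | apply (HK 0%Z)]).
  assert (hhalf : forall B, 0 <= B -> (forall j, Cmod (u j) <= B) ->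
     forall j, Cmod (u j) <= B * (1 / 2)).
  { intros B0 hB HB j. 
    assert (hnb : forall k, (k = j + 1 \/ k = j - 1)%Z ->
       4 / 3 * Ma / Rabs (e j) * Cmod (u k) <= B0 * (1 / 4)).
    { intros k hk. pose proof (hee j k hk) as h1. pose proof (he2 j) as h2. pose proof (he2 k) as h3.
      pose proof (hstep k) as h4. pose proof (HB (k + 1)%Z). pose proof (HB (k - 1)%Z).
      assert (h5 : Cmod (u k) <= 4 / 3 * Ma / Rabs (e k) * (2 * B0)).
      { eapply Rle_trans; [exact h4 |]. apply Rmult_le_compat_l; [| lra].
        apply Rmult_le_pos; [lra |]. left. apply Rinv_0_lt_compat. lra. }
      apply Rle_trans with (4 / 3 * Ma / Rabs (e j) * (4 / 3 * Ma / Rabs (e k) * (2 * B0))).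
      - apply Rmult_le_compat_l; [| exact h5].
        apply Rmult_le_pos; [lra |]. left. apply Rinv_0_lt_compat. lra.
      - replace (4 / 3 * Ma / Rabs (e j) * (4 / 3 * Ma / Rabs (e k) * (2 * B0)))
          with (B0 * (32 / 9 * Ma ^ 2 / (Rabs (e j) * Rabs (e k)))) by (field; lra).
        apply Rmult_le_compat_l; [exact hB |].
        apply Rmult_le_reg_r with (Rabs (e j) * Rabs (e k)); [nra |].
        replace (32 / 9 * Ma ^ 2 / (Rabs (e j) * Rabs (e k)) * (Rabs (e j) * Rabs (e k)))
          with (32 / 9 * Ma ^ 2) by (field; lra). nra. }
    pose proof (hnb (j + 1)%Z (or_introl eq_refl)). pose proof (hnb (j - 1)%Z (or_intror eq_refl)).
    pose proof (hstep j). lra. }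
  intros j. apply Cmod_eq_0. apply Rle_antisym; [| apply Cmod_ge_0].
  assert (hpow : forall k i, Cmod (u i) <= K * (1 / 2) ^ k).
  { induction k as [| k IH]; intros i; [simpl; rewrite Rmult_1_r; apply HK |].
    simpl. replace (K * (1 / 2 * (1 / 2) ^ k)) with (K * (1 / 2) ^ k * (1 / 2)) by ring.
    apply hhalf; [| exact IH]. apply Rmult_le_pos; [exact hK | apply pow_le; lra]. }
  apply le_of_le_plus_eps. intros ep hep. rewrite Rplus_0_l.
  destruct (pow_small (1 / 2) K ep) as [k0 Hk0]; try lra.
  eapply Rle_trans; [apply (hpow k0) | apply Hk0, le_n].
Qed.

(** * The system of Fourier coefficients *)

(** If X and Y are the Fourier coefficients of a vector y, then hX and hY are those of
    (n + z - L) y. *)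
Definition dsol (a A b B : C) (n : Z) (z : C) (X Y hX hY : Z -> C) : Prop :=
  forall j,
  ((z + RtoC (2 * IZR j)) * X j - a * Y (j + 1)%Z - A * Y (j - 1)%Z = hX j)%C /\
  ((z + RtoC (2 * (IZR n - IZR j))) * Y j - b * X (j + 1)%Z - B * X (j - 1)%Z = hY j)%C.

Definition zero_seq (_ : Z) : C := RtoC 0.

(** X at j is coupled to Y at j - 1 and j + 1 only, so the parity of the node of X separates two
    chains. *)
Definition mixE (X Y : Z -> C) (j : Z) : C := if Z.even j then X j else Y j.
Definition mixO (X Y : Z -> C) (j : Z) : C := if Z.even j then Y j else X j.

Lemma even_succ j : Z.even (j + 1) = negb (Z.even j).
Proof. now rewrite Z.add_1_r, Z.even_succ, <- Z.negb_even. Qed.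

Lemma even_pred j : Z.even (j - 1) = negb (Z.even j).
Proof. now rewrite Z.sub_1_r, Z.even_pred, <- Z.negb_even. Qed.

Lemma bounded_mixE X Y : zbounded X -> zbounded Y -> zbounded (mixE X Y).
Proof.
  intros [K H] [K' H']. exists (Rmax K K'). intros j. unfold mixE.
  destruct (Z.even j); [eapply Rle_trans; [apply H | apply Rmax_l] |
    eapply Rle_trans; [apply H' | apply Rmax_r]].
Qed.

Lemma mixE_gres a A b B n z X Y hX hY j :
  dsol a A b B n z X Y hX hY -> gres a A b B n z (mixE X Y) j = mixE hX hY j.
Proof.
  intros H. destruct (H j) as [H1 H2]. unfold gres, mixE, e_Z, q_Z.
  rewrite even_succ, even_pred. destruct (Z.even j); simpl; assumption.
Qed.

(** The second chain has its resonance at the node n of Y. Reflection moves it to 0 and permutes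
    the four couplings. *)
Lemma mixO_gres a A b B n z X Y hX hY j : Z.even n = true ->
  dsol a A b B n z X Y hX hY ->
  gres B b A a n z (fun i => mixO X Y (n - i)) j = mixO hX hY (n - j).
Proof.
  intros hn H. destruct (H (n - j)%Z) as [H1 H2]. unfold gres, mixO, e_Z, q_Z.
  replace (n - (j + 1))%Z with (n - j - 1)%Z by lia.
  replace (n - (j - 1))%Z with (n - j + 1)%Z by lia.
  rewrite even_succ, even_pred, !Z.even_sub, hn. destruct (Z.even j); simpl.
  - rewrite <- H2, minus_IZR. replace (2 * (IZR n - (IZR n - IZR j))) with (2 * IZR j) by ring. ring.
  - rewrite <- H1, minus_IZR. ring.
Qed.

(** For odd n the second chain meets the diagonal entries 2 j at odd j and 2 (n - j) at even j
    only, none of which vanishes. *)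
Lemma mixO_zero a A b B n z X Y Ma :
  Z.odd n = true -> Cmod z <= 1 / 2 -> 1 <= Ma -> 200 * Ma ^ 2 <= IZR (Z.abs n) ->
  Cmod a <= Ma -> Cmod A <= Ma -> Cmod b <= Ma -> Cmod B <= Ma ->
  zbounded X -> zbounded Y ->
  dsol a A b B n z X Y zero_seq zero_seq -> forall j, mixO X Y j = RtoC 0.
Proof.
  intros hn hz hM hN ha hA hb hB HX HY H.
  apply (no_resonance n z (mixO X Y) (fun j => if Z.even j then b else a)
    (fun j => if Z.even j then B else A) Ma); try assumption.
  - intros j. now destruct (Z.even j).
  - intros j. now destruct (Z.even j).
  - now apply bounded_mixE.
  - intros j. destruct (H j) as [H1 H2]. unfold zero_seq in *. unfold mixO.
    rewrite even_succ, even_pred. destruct (Z.even j); simpl.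
    + replace ((z + RtoC (2 * (IZR n - IZR j))) * Y j)%C with
        ((z + RtoC (2 * (IZR n - IZR j))) * Y j - b * X (j + 1)%Z - B * X (j - 1)%Z
          + b * X (j + 1)%Z + B * X (j - 1)%Z)%C by ring.
      rewrite H2. ring.
    + replace ((z + RtoC (2 * IZR j)) * X j)%C with
        ((z + RtoC (2 * IZR j)) * X j - a * Y (j + 1)%Z - A * Y (j - 1)%Z
          + a * Y (j + 1)%Z + A * Y (j - 1)%Z)%C by ring.
      rewrite H1. ring.
Qed.

Definition keep_even (u : Z -> C) (j : Z) : C := if Z.even j then u j else RtoC 0.
Definition keep_odd (u : Z -> C) (j : Z) : C := if Z.even j then RtoC 0 else u j.

Lemma chain0_dsol a A b B n z u :
  (forall j, gres a A b B n z u j = RtoC 0) ->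
  dsol a A b B n z (keep_even u) (keep_odd u) zero_seq zero_seq.
Proof.
  intros H j. specialize (H j). unfold gres, e_Z, q_Z in H. unfold keep_even, keep_odd, zero_seq.
  rewrite even_succ, even_pred. destruct (Z.even j); simpl; (split; [| try (rewrite <- H; ring)]).
  - exact H.
  - ring.
  - ring.
Qed.

Lemma chain1_dsol a A b B n z w : Z.even n = true ->
  (forall j, gres B b A a n z w j = RtoC 0) ->
  dsol a A b B n z (keep_odd (fun j => w (n - j)%Z)) (keep_even (fun j => w (n - j)%Z))
    zero_seq zero_seq.
Proof.
  intros hn H j. specialize (H (n - j)%Z). unfold gres, e_Z, q_Z in H.
  unfold keep_even, keep_odd, zero_seq.
  rewrite even_succ, even_pred. rewrite Z.even_sub, hn, minus_IZR in H.
  replace (n - (j + 1))%Z with (n - j - 1)%Z by lia.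
  replace (n - (j - 1))%Z with (n - j + 1)%Z by lia.
  destruct (Z.even j); simpl in *; split; try ring.
  - rewrite <- H. ring.
  - rewrite <- H. replace (2 * (IZR n - (IZR n - IZR j))) with (2 * IZR j) by ring. ring.
Qed.

Lemma growth_keep r u : growth r u -> growth r (keep_even u) /\ growth r (keep_odd u).
Proof.
  intros [K H].
  assert (P : forall j, 0 <= K * r ^ Z.abs_nat j)
    by (intros j; eapply Rle_trans; [apply Cmod_ge_0 | apply H]).
  split; exists K; intros j; unfold keep_even, keep_odd; destruct (Z.even j);
    try rewrite Cmod_0; auto.
Qed.

Lemma growth_mult r s u v :
  (forall j, Cmod (u j) <= r ^ Z.abs_nat j) -> growth s v -> 0 <= r ->
  growth (r * s) (fun j => (u j * v j)%C).
Proof.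
  intros H [K H'] hr. exists K. intros j. rewrite Cmod_mult, Rpow_mult_distr.
  replace (K * (r ^ Z.abs_nat j * s ^ Z.abs_nat j))
    with (r ^ Z.abs_nat j * (K * s ^ Z.abs_nat j)) by ring.
  apply Rmult_le_compat; auto using Cmod_ge_0.
Qed.

Lemma bounded_growth v : zbounded v -> growth 1 v.
Proof. intros [K H]. exists K. intros j. now rewrite pow1, Rmult_1_r. Qed.

Lemma bounded_refl v n : zbounded v -> zbounded (fun j => v (n - j)%Z).
Proof. intros [K H]. exists K. intros j. apply H. Qed.

(** A change of variables that symmetrises a chain at the cost of a growth rate R0 in either
    direction. *)
Record gauge (s0 t0 s1 t1 c d : C) (R0 : R) (om : Z -> C) : Prop := {
  ga_0 : om 0%Z = RtoC 1;
  ga_nz : forall j, om j <> 0%C;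
  ga_up : forall j, Cmod (om j) <= R0 ^ Z.abs_nat j;
  ga_dn : forall j, Cmod (/ om j) <= R0 ^ Z.abs_nat j;
  ga_eq : forall n z v j, gres s0 t0 s1 t1 n z (fun i => (om i * v i)%C) j
       = (om j * zres c d n z v j)%C
}.

Arguments ga_0 {s0 t0 s1 t1 c d R0 om}.
Arguments ga_nz {s0 t0 s1 t1 c d R0 om}.
Arguments ga_up {s0 t0 s1 t1 c d R0 om}.
Arguments ga_dn {s0 t0 s1 t1 c d R0 om}.
Arguments ga_eq {s0 t0 s1 t1 c d R0 om}.

Section Transfer.
Context (s0 t0 s1 t1 c d : C) (R0 th : R) (om : Z -> C)
  (Ga : gauge s0 t0 s1 t1 c d R0 om) (hR0 : 1 <= R0) (hth : R0 * th = 1 / 4).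
Context (n : Z) (L : list (C * (Z -> C))) (HL : modes c d th R0 n L).

Lemma gauge_back z u h :
  (forall j, gres s0 t0 s1 t1 n z u j = (om j * h j)%C) ->
  forall j, zres c d n z (fun i => (/ om i * u i)%C) j = h j.
Proof.
  intros H j. pose proof (ga_eq Ga n z (fun i => (/ om i * u i)%C) j) as E.
  pose proof (ga_nz Ga) as nz.
  assert (E2 : gres s0 t0 s1 t1 n z (fun i => (om i * (/ om i * u i))%C) j
    = gres s0 t0 s1 t1 n z u j).
  { unfold gres. assert (F : forall i, (om i * (/ om i * u i))%C = u i) by (intros; field; auto).
    now rewrite !F. }
  cbv beta in E. rewrite E2, H in E.
  replace (zres c d n z (fun i => (/ om i * u i)%C) j)
    with (/ om j * (om j * zres c d n z (fun i => (/ om i * u i)%C) j))%C by (field; auto).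
  rewrite <- E. field. auto.
Qed.

Lemma transfer_bounded u : zbounded u -> growth R0 (fun j => (/ om j * u j)%C).
Proof.
  intros Hu. replace R0 with (R0 * 1) by ring. apply growth_mult; [| now apply bounded_growth | lra].
  apply (ga_dn Ga).
Qed.

(** After the change of variables a bounded sequence grows at most like R0^|j|, which is within
    the range where the modes are the only solutions. *)
Lemma transfer_span z u : Cmod z <= 1 / 2 -> zbounded u ->
  (forall j, gres s0 t0 s1 t1 n z u j = RtoC 0) ->
  (forall j, u j = RtoC 0) \/
  exists g, In (z, g) L /\ forall j, u j = (u 0%Z * (om j * g j))%C.
Proof.
  intros hz Hu Heq. pose proof (ga_nz Ga) as nz.
  assert (F : forall i, u i = (om i * (/ om i * u i))%C) by (intros; field; auto).
  destruct (proj2 HL z (fun j => (/ om j * u j)%C) hz (transfer_bounded u Hu)) as [H | [g [Hin Hg]]].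
  - apply gauge_back. intros j. rewrite Heq. ring.
  - left. intros j. rewrite F, H. ring.
  - right. exists g. split; [exact Hin |]. intros j. rewrite (F j), Hg, (ga_0 Ga).
    field.
Qed.

Lemma transfer_simple z g u k : In (z, g) L -> zbounded u ->
  (forall j, gres s0 t0 s1 t1 n z u j = (k * (om j * g j))%C) -> k = RtoC 0.
Proof.
  intros Hin Hu Heq. apply (mode_simple (proj1 HL z g Hin) (fun j => (/ om j * u j)%C)).
  - now apply transfer_bounded.
  - apply gauge_back. intros j. rewrite Heq. ring.
Qed.

Lemma transfer_mode z g : In (z, g) L ->
  growth (1 / 4) (fun j => (om j * g j)%C) /\
  forall j, gres s0 t0 s1 t1 n z (fun i => (om i * g i)%C) j = RtoC 0.
Proof.
  intros Hin. pose proof (proj1 HL z g Hin) as Hm. split.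
  - rewrite <- hth. apply growth_mult; [| apply (mode_decay Hm) | lra].
    apply (ga_up Ga).
  - intros j. rewrite (ga_eq Ga), (mode_eq Hm). ring.
Qed.

End Transfer.

Arguments transfer_span {s0 t0 s1 t1 c d R0 th om}.
Arguments transfer_simple {s0 t0 s1 t1 c d R0 th om}.
Arguments transfer_mode {s0 t0 s1 t1 c d R0 th om}.

Section Dirac.
Context (a A b B c d : C) (R0 th Ma : R) (om om' : Z -> C)
  (Ga : gauge a A b B c d R0 om) (Ga' : gauge B b A a c d R0 om')
  (hR0 : 1 <= R0) (hth : R0 * th = 1 / 4)
  (hMa : 1 <= Ma) (ha : Cmod a <= Ma) (hA : Cmod A <= Ma) (hb : Cmod b <= Ma) (hB : Cmod B <= Ma).

Definition dmode (n : Z) (z : C) (X Y : Z -> C) : Prop :=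
  growth (1 / 4) X /\ growth (1 / 4) Y /\ dsol a A b B n z X Y zero_seq zero_seq.

(** No nonzero bounded vector of the kernel is the image of a bounded vector, so there are no
    root vectors of rank two. *)
Definition dsimple (n : Z) (z : C) : Prop :=
  forall X Y hX hY, zbounded X -> zbounded Y -> zbounded hX -> zbounded hY ->
    dsol a A b B n z hX hY zero_seq zero_seq -> dsol a A b B n z X Y hX hY ->
    forall j, hX j = RtoC 0 /\ hY j = RtoC 0.

(** Both chains have the same symmetric form and hence the same root; the two modes live on
    disjoint sets of nodes and are told apart by the values of X at 0 and of Y at n. *)
Lemma dirac_even (n : Z) (z : C) (g : Z -> C) : Z.even n = true ->
  modes c d th R0 n ((z, g) :: nil) ->
  exists X1 Y1 X2 Y2, dmode n z X1 Y1 /\ dmode n z X2 Y2 /\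
    X1 0%Z = RtoC 1 /\ Y1 n = RtoC 0 /\ X2 0%Z = RtoC 0 /\ Y2 n = RtoC 1 /\
    (forall z' X Y, Cmod z' <= 1 / 2 -> zbounded X -> zbounded Y ->
      dsol a A b B n z' X Y zero_seq zero_seq ->
      (forall j, X j = RtoC 0 /\ Y j = RtoC 0) \/
      z' = z /\ forall j, X j = (X 0%Z * X1 j + Y n * X2 j)%C /\
                          Y j = (X 0%Z * Y1 j + Y n * Y2 j)%C) /\
    dsimple n z.
Proof.
  intros hn HL.
  assert (Hin : In (z, g) ((z, g) :: nil)) by now left.
  destruct (transfer_mode Ga hR0 hth n _ HL z g Hin) as [G1 E1].
  destruct (transfer_mode Ga' hR0 hth n _ HL z g Hin) as [G2 E2].
  pose proof (mode_0 (proj1 HL z g Hin)) as g0.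
  pose proof (mode_z (proj1 HL z g Hin)) as hz.
  set (u1 := fun j => (om j * g j)%C) in *. set (w2 := fun j => (om' j * g j)%C) in *.
  set (u2 := fun j => w2 (n - j)%Z).
  assert (G2' : growth (1 / 4) u2)
    by (apply (growth_shift_le1 (1 / 4) w2 n); [split; lra | exact G2]).
  assert (u10 : u1 0%Z = RtoC 1) by (unfold u1; rewrite (ga_0 Ga), g0; ring).
  assert (u2n : u2 n = RtoC 1)
    by (unfold u2, w2; rewrite Z.sub_diag, (ga_0 Ga'), g0; ring).
  assert (Span : forall z' X Y, Cmod z' <= 1 / 2 -> zbounded X -> zbounded Y ->
      dsol a A b B n z' X Y zero_seq zero_seq ->
      (forall j, X j = RtoC 0 /\ Y j = RtoC 0) \/
      z' = z /\ forall j, mixE X Y j = (X 0%Z * u1 j)%C /\ mixO X Y j = (Y n * u2 j)%C).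
  { intros z' X Y hz' HX HY H.
    assert (R1 : forall j, gres a A b B n z' (mixE X Y) j = RtoC 0).
    { intros j. rewrite (mixE_gres _ _ _ _ _ _ _ _ _ _ _ H). unfold mixE, zero_seq.
      now destruct (Z.even j). }
    assert (R2 : forall j, gres B b A a n z' (fun i => mixO X Y (n - i)) j = RtoC 0).
    { intros j. rewrite (mixO_gres _ _ _ _ _ _ _ _ _ _ _ hn H). unfold mixO, zero_seq.
      now destruct (Z.even (n - j)). }
    assert (B1 : zbounded (mixE X Y)) by now apply bounded_mixE.
    assert (B2 : zbounded (fun i => mixO X Y (n - i)%Z))
      by (apply (bounded_refl (mixO X Y)); now apply bounded_mixE).
    assert (X0 : mixE X Y 0%Z = X 0%Z) by reflexivity.
    assert (Yn : mixO X Y n = Y n) by (unfold mixO; now rewrite hn).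
    assert (Sub : (z' = z -> forall j, mixO X Y j = (Y n * u2 j)%C) /\
        ((forall j, mixO X Y j = RtoC 0) \/ z' = z)).
    { destruct (transfer_span Ga' hR0 n _ HL z' _ hz' B2 R2)
        as [Z2 | [g2 [[E|[]] H2]]].
      - assert (Z2' : forall j, mixO X Y j = RtoC 0).
        { intros j. replace j with (n - (n - j))%Z by lia. apply Z2. }
        split; [| now left]. intros _ j. rewrite <- Yn, !Z2'. ring.
      - injection E as <- <-. split; [| now right]. intros _ j.
        specialize (H2 (n - j)%Z). cbv beta in H2. replace (n - (n - j))%Z with j in H2 by lia.
        rewrite H2, Z.sub_0_r, Yn. reflexivity. }
    destruct Sub as [S1 S2].
    destruct (transfer_span Ga hR0 n _ HL z' _ hz' B1 R1)
        as [Z1 | [g1 [[E|[]] H1]]].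
    - destruct S2 as [Z2 | Ez].
      + left. intros j. specialize (Z1 j). specialize (Z2 j). unfold mixE in Z1. unfold mixO in Z2.
        destruct (Z.even j); split; assumption.
      + right. split; [exact Ez |]. intros j. split; [| now apply S1].
        rewrite <- X0, !Z1. ring.
    - injection E as Ez Eg. right. split; [now symmetry |]. subst z' g1. intros j.
      split; [| now apply S1]. rewrite H1, X0. reflexivity. }
  exists (keep_even u1), (keep_odd u1), (keep_odd u2), (keep_even u2).
  split; [| split; [| split; [| split; [| split; [| split; [| split]]]]]].
  - destruct (growth_keep _ _ G1). repeat split; try assumption; now apply (chain0_dsol a A b B n z u1).
  - destruct (growth_keep _ _ G2'). repeat split; try assumption;
      now apply (chain1_dsol a A b B n z w2).
  - exact u10.
  - unfold keep_odd. now rewrite hn.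
  - reflexivity.
  - unfold keep_even. now rewrite hn.
  - intros z' X Y hz' HX HY H. destruct (Span z' X Y hz' HX HY H) as [S | [Ez S]]; [now left |].
    right. split; [exact Ez |]. intros j. destruct (S j) as [H1 H2].
    unfold mixE in H1. unfold mixO in H2. unfold keep_even, keep_odd.
    destruct (Z.even j); rewrite H1, H2; split; ring.
  - intros X Y hX hY HX HY HhX HhY H0 H.
    destruct (Span z hX hY ltac:(lra) HhX HhY H0) as [S | [_ S]]; [exact S |].
    assert (k1 : hX 0%Z = RtoC 0).
    { apply (transfer_simple Ga hR0 n _ HL z g (mixE X Y) _ Hin).
      - now apply bounded_mixE.
      - intros j. rewrite (mixE_gres _ _ _ _ _ _ _ _ _ _ _ H). apply S. }
    assert (k2 : hY n = RtoC 0).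
    { apply (transfer_simple Ga' hR0 n _ HL z g (fun i => mixO X Y (n - i)%Z) _ Hin).
      - apply (bounded_refl (mixO X Y)). now apply bounded_mixE.
      - intros j. rewrite (mixO_gres _ _ _ _ _ _ _ _ _ _ _ hn H). rewrite (proj2 (S (n - j)%Z)).
        unfold u2, w2. replace (n - (n - j))%Z with j by lia. reflexivity. }
    intros j. destruct (S j) as [H1 H2]. rewrite k1 in H1. rewrite k2 in H2.
    unfold mixE in H1. unfold mixO in H2. destruct (Z.even j); rewrite H1, H2; split; ring.
Qed.

(** The chain without resonance contributes nothing, and the other one has a simple mode for each
    of its two roots. *)
Lemma dirac_odd (n : Z) (zp zm : C) (gp gm : Z -> C) : Z.odd n = true ->
  200 * Ma ^ 2 <= IZR (Z.abs n) -> zp <> zm ->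
  modes c d th R0 n ((zp, gp) :: (zm, gm) :: nil) ->
  exists Xp Yp Xm Ym, dmode n zp Xp Yp /\ dmode n zm Xm Ym /\
    Xp 0%Z = RtoC 1 /\ Xm 0%Z = RtoC 1 /\
    (forall z' X Y, Cmod z' <= 1 / 2 -> zbounded X -> zbounded Y ->
      dsol a A b B n z' X Y zero_seq zero_seq ->
      (forall j, X j = RtoC 0 /\ Y j = RtoC 0) \/
      (z' = zp /\ forall j, X j = (X 0%Z * Xp j)%C /\ Y j = (X 0%Z * Yp j)%C) \/
      (z' = zm /\ forall j, X j = (X 0%Z * Xm j)%C /\ Y j = (X 0%Z * Ym j)%C)) /\
    dsimple n zp /\ dsimple n zm.
Proof.
  intros hn hN hne HL.
  set (L := (zp, gp) :: (zm, gm) :: nil) in *.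
  assert (Hp : In (zp, gp) L) by now left. assert (Hm : In (zm, gm) L) by (right; now left).
  destruct (transfer_mode Ga hR0 hth n _ HL zp gp Hp) as [G1 E1].
  destruct (transfer_mode Ga hR0 hth n _ HL zm gm Hm) as [G2 E2].
  pose proof (mode_0 (proj1 HL zp gp Hp)) as g0p.
  pose proof (mode_0 (proj1 HL zm gm Hm)) as g0m.
  assert (Span : forall z' X Y, Cmod z' <= 1 / 2 -> zbounded X -> zbounded Y ->
      dsol a A b B n z' X Y zero_seq zero_seq ->
      (forall j, mixO X Y j = RtoC 0) /\
      ((forall j, mixE X Y j = RtoC 0) \/
      exists g, In (z', g) L /\ forall j, mixE X Y j = (X 0%Z * (om j * g j))%C)).
  { intros z' X Y hz' HX HY H. split.
    - now apply (mixO_zero a A b B n z' X Y Ma).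
    - assert (R1 : forall j, gres a A b B n z' (mixE X Y) j = RtoC 0).
      { intros j. rewrite (mixE_gres _ _ _ _ _ _ _ _ _ _ _ H). unfold mixE, zero_seq.
        now destruct (Z.even j). }
      assert (B1 : zbounded (mixE X Y)) by now apply bounded_mixE.
      apply (transfer_span Ga hR0 n _ HL z' _ hz' B1 R1). }
  assert (Recover : forall X Y (k : C) u, (forall j, mixO X Y j = RtoC 0) ->
     (forall j, mixE X Y j = (k * u j)%C) ->
     forall j, X j = (k * keep_even u j)%C /\ Y j = (k * keep_odd u j)%C).
  { intros X Y k u H1 H2 j. specialize (H1 j). specialize (H2 j).
    unfold mixE in H2. unfold mixO in H1. unfold keep_even, keep_odd.
    destruct (Z.even j); rewrite H1, H2; split; ring. }
  assert (Simple : forall z g, In (z, g) L -> (forall g', In (z, g') L -> g' = g) ->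
     dsimple n z).
  { intros z g Hin Huniq X Y hX hY HX HY HhX HhY H0 H.
    pose proof (mode_z (proj1 HL z g Hin)) as hz.
    destruct (Span z hX hY ltac:(lra) HhX HhY H0) as [S1 [S2 | [g' [Hin' S2]]]].
    - intros j. specialize (S1 j). specialize (S2 j). unfold mixE in S2. unfold mixO in S1.
      destruct (Z.even j); split; assumption.
    - rewrite (Huniq g' Hin') in S2.
      assert (k1 : hX 0%Z = RtoC 0).
      { apply (transfer_simple Ga hR0 n _ HL z g (mixE X Y) _ Hin).
        - now apply bounded_mixE.
        - intros j. rewrite (mixE_gres _ _ _ _ _ _ _ _ _ _ _ H). apply S2. }
      intros j. destruct (Recover hX hY _ _ S1 S2 j) as [F1 F2]. rewrite F1, F2, k1.
      split; ring. }
  exists (keep_even (fun j => (om j * gp j)%C)), (keep_odd (fun j => (om j * gp j)%C)),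
    (keep_even (fun j => (om j * gm j)%C)), (keep_odd (fun j => (om j * gm j)%C)).
  split; [| split; [| split; [| split; [| split; [| split]]]]].
  - destruct (growth_keep _ _ G1). repeat split; try assumption; now apply (chain0_dsol a A b B n zp _).
  - destruct (growth_keep _ _ G2). repeat split; try assumption; now apply (chain0_dsol a A b B n zm _).
  - unfold keep_even. simpl. rewrite (ga_0 Ga), g0p. ring.
  - unfold keep_even. simpl. rewrite (ga_0 Ga), g0m. ring.
  - intros z' X Y hz' HX HY H.
    destruct (Span z' X Y hz' HX HY H) as [S1 [S2 | [g' [Hin' S2]]]].
    + left. intros j. specialize (S1 j). specialize (S2 j). unfold mixE in S2. unfold mixO in S1.
      destruct (Z.even j); split; assumption.
    + right. destruct Hin' as [E | [E | []]]; injection E as Ez Eg; subst z' g';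
        [left | right]; (split; [reflexivity |]); intros j;
        apply (Recover X Y (X 0%Z) _ S1 S2).
  - apply (Simple zp gp Hp). intros g' [E | [E | []]].
    + now injection E.
    + exfalso. apply hne. now injection E.
  - apply (Simple zm gm Hm). intros g' [E | [E | []]].
    + exfalso. apply hne. now injection E.
    + now injection E.
Qed.

End Dirac.

(** * Calculus on [0, pi] *)

(** As u is confined to the interval, the derivative is one-sided at the end points. *)
Definition cderiv (f df : R -> C) : Prop :=
  forall x, I0pi x -> forall e, 0 < e -> exists del, 0 < del /\
    forall u, I0pi u -> Rabs (u - x) < del ->
      Cmod (f u - f x - (u - x)%R * df x) <= e * Rabs (u - x).

Definition ccont (f : R -> C) : Prop :=
  forall x, I0pi x -> forall e, 0 < e -> exists del, 0 < del /\
    forall u, I0pi u -> Rabs (u - x) < del -> Cmod (f u - f x) <= e.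

Lemma norm_C (z : C) : @norm R_AbsRing C_R_NormedModule z = Cmod z.
Proof.
  destruct z as [x y]. unfold Cmod. simpl.
  change (sqrt (Rabs x ^ 2 + Rabs y ^ 2) = sqrt (x * (x * 1) + y * (y * 1))).
  f_equal. rewrite !pow2_abs. ring.
Qed.

Lemma norm_C2 (p : C2_R) :
  @norm R_AbsRing C2_R p = sqrt (Cmod (fst p) ^ 2 + Cmod (snd p) ^ 2).
Proof.
  destruct p as [u v]. rewrite <- !norm_C. reflexivity.
Qed.

Lemma norm_C2_ge (p : C2_R) :
  Cmod (fst p) <= @norm R_AbsRing C2_R p /\ Cmod (snd p) <= @norm R_AbsRing C2_R p.
Proof.
  rewrite norm_C2. pose proof (Cmod_ge_0 (fst p)). pose proof (Cmod_ge_0 (snd p)).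
  split.
  - rewrite <- (sqrt_pow2 (Cmod (fst p))) at 1 by assumption. apply sqrt_le_1_alt. nra.
  - rewrite <- (sqrt_pow2 (Cmod (snd p))) at 1 by assumption. apply sqrt_le_1_alt. nra.
Qed.

Lemma norm_C2_le (p : C2_R) :
  @norm R_AbsRing C2_R p <= Cmod (fst p) + Cmod (snd p).
Proof.
  rewrite norm_C2. pose proof (Cmod_ge_0 (fst p)). pose proof (Cmod_ge_0 (snd p)).
  rewrite <- (sqrt_pow2 (Cmod (fst p) + Cmod (snd p))) by lra. apply sqrt_le_1_alt. nra.
Qed.

Lemma scal_C_R (r : R) (z : C) : @scal R_AbsRing C_R_NormedModule r z = (RtoC r * z)%C.
Proof.
  destruct z as [x y]. apply injective_projections; simpl;
  unfold scal; simpl; unfold mult; simpl; ring.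
Qed.

Lemma rem_fst (y : R -> C * C) (d : C * C) (x u : R) :
  fst (@minus C2_R (@minus C2_R (y u) (y x)) (@scal R_AbsRing C2_R (u - x) d))
  = (fst (y u) - fst (y x) - (u - x)%R * fst d)%C.
Proof. rewrite <- scal_C_R. reflexivity. Qed.

Lemma rem_snd (y : R -> C * C) (d : C * C) (x u : R) :
  snd (@minus C2_R (@minus C2_R (y u) (y x)) (@scal R_AbsRing C2_R (u - x) d))
  = (snd (y u) - snd (y x) - (u - x)%R * snd d)%C.
Proof. rewrite <- scal_C_R. reflexivity. Qed.

(** The norm of C x C lies between the moduli of the components and their sum. Conversely, a
    limit point of the filter of neighbourhoods of x is x itself, so differentiability there is
    the estimate at x. *)
Lemma is_derive_0pi_cderiv (y dy : R -> C * C) :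
  is_derive_0pi y dy <->
  cderiv (fun x => fst (y x)) (fun x => fst (dy x)) /\
  cderiv (fun x => snd (y x)) (fun x => snd (dy x)).
Proof.
  split.
  - intros H.
    assert (G : forall x, I0pi x -> forall e, 0 < e -> exists del, 0 < del /\
      forall u, I0pi u -> Rabs (u - x) < del ->
      @norm R_AbsRing C2_R (@minus C2_R (@minus C2_R (y u) (y x))
         (@scal R_AbsRing C2_R (u - x) (dy x))) <= e * Rabs (u - x)).
    { intros x hx e he. destruct (H x hx) as [_ H2].
      assert (hl : @is_filter_lim R_UniformSpace (within I0pi (locally x)) x).
      { intros P HP. unfold within. destruct HP as [d Hd]. exists d. intros u hu _. now apply Hd. }
      specialize (H2 x hl (mkposreal e he)). unfold within in H2. destruct H2 as [d Hd].
      exists d. split; [apply cond_pos |]. intros u hu hux. apply (Hd u hux hu). }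
    split; intros x hx e he; destruct (G x hx e he) as [d [hd Hd]]; exists d;
      (split; [exact hd |]); intros u hu hux; specialize (Hd u hu hux).
    + rewrite <- rem_fst. eapply Rle_trans; [apply norm_C2_ge | exact Hd].
    + rewrite <- rem_snd. eapply Rle_trans; [apply norm_C2_ge | exact Hd].
  - intros [H1 H2] x hx. split; [apply is_linear_scal_l |].
    intros x' hx' e.
    assert (Ex : x = x').
    { assert (hP : forall d : posreal, Rabs (x - x') <= d).
      { intros d. 
        assert (L : @locally R_UniformSpace x' (fun u => Rabs (u - x') < d / 2)).
        { assert (hd2 : 0 < d / 2) by (pose proof (cond_pos d); lra).
          exists (mkposreal _ hd2). intros u hu. exact hu. }
        specialize (hx' _ L). unfold within in hx'. destruct hx' as [d' Hd'].
        specialize (Hd' x (ball_center x d') hx). pose proof (cond_pos d). lra. }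
      destruct (Req_dec x x') as [h | h]; [exact h | exfalso].
      assert (hp : 0 < Rabs (x - x') / 2) by (pose proof (Rabs_pos_lt (x - x')); lra).
      specialize (hP (mkposreal _ hp)). simpl in hP. lra. }
    subst x'.
    destruct (H1 x hx (e / 2)) as [d1 [hd1 D1]]; [pose proof (cond_pos e); lra |].
    destruct (H2 x hx (e / 2)) as [d2 [hd2 D2]]; [pose proof (cond_pos e); lra |].
    assert (hd : 0 < Rmin d1 d2) by now apply Rmin_glb_lt.
    unfold within. exists (mkposreal _ hd). intros u hu hI.
    change (Rabs (u - x) < Rmin d1 d2) in hu.
    specialize (D1 u hI (Rlt_le_trans _ _ _ hu (Rmin_l _ _))).
    specialize (D2 u hI (Rlt_le_trans _ _ _ hu (Rmin_r _ _))).
    change (@norm R_AbsRing C2_R (@minus C2_R (@minus C2_R (y u) (y x))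
         (@scal R_AbsRing C2_R (u - x) (dy x))) <= e * Rabs (u - x)).
    eapply Rle_trans; [apply norm_C2_le |]. rewrite rem_fst, rem_snd. lra.
Qed.

Lemma ball_C (x : C) (e : R) (y : C) : 0 < e ->
  Cmod (y - x) < e -> @ball C_UniformSpace x e y.
Proof.
  intros he h. split.
  - eapply Rle_lt_trans; [apply (re_le_Cmod (y - x)) | exact h].
  - eapply Rle_lt_trans; [apply (im_le_Cmod (y - x)) | exact h].
Qed.

Lemma ball_C_inv (x : C) (e : R) (y : C) :
  @ball C_UniformSpace x e y -> Cmod (y - x) <= 2 * e.
Proof.
  intros [h1 h2]. eapply Rle_trans; [apply Cmod_le_re_im |].
  change (Rabs (fst y - fst x) < e) in h1. change (Rabs (snd y - snd x) < e) in h2.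
  unfold Re, Im. simpl. unfold Rminus in *. lra.
Qed.

Lemma continuous_on_ccont (y : R -> C * C) :
  @continuous_on R_UniformSpace (prod_UniformSpace C_UniformSpace C_UniformSpace) I0pi y <->
  ccont (fun x => fst (y x)) /\ ccont (fun x => snd (y x)).
Proof.
  split.
  - intros H.
    assert (G : forall x, I0pi x -> forall e, 0 < e -> exists del, 0 < del /\
      forall u, I0pi u -> Rabs (u - x) < del ->
      Cmod (fst (y u) - fst (y x)) <= e /\ Cmod (snd (y u) - snd (y x)) <= e).
    { intros x hx e he. assert (he2 : 0 < e / 2) by lra.
      assert (L : @locally (prod_UniformSpace C_UniformSpace C_UniformSpace) (y x)
         (fun p => Cmod (fst p - fst (y x)) <= e /\ Cmod (snd p - snd (y x)) <= e)).
      { exists (mkposreal _ he2). intros p [h1 h2].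
        apply ball_C_inv in h1. apply ball_C_inv in h2. 
        change (pos (mkposreal (e / 2) he2)) with (e / 2) in h1, h2.
        split; [eapply Rle_trans; [exact h1 | lra] | eapply Rle_trans; [exact h2 | lra]]. }
      specialize (H x hx _ L). unfold filtermap, within in H. destruct H as [d Hd].
      exists d. split; [apply cond_pos |]. intros u hu hux. apply (Hd u hux hu). }
    split; intros x hx e he; destruct (G x hx e he) as [d [hd Hd]]; exists d;
      (split; [exact hd |]); intros u hu hux; apply (Hd u hu hux).
  - intros [H1 H2] x hx P [e He].
    destruct (H1 x hx (e / 2)) as [d1 [hd1 D1]]; [pose proof (cond_pos e); lra |].
    destruct (H2 x hx (e / 2)) as [d2 [hd2 D2]]; [pose proof (cond_pos e); lra |].
    assert (hd : 0 < Rmin d1 d2) by now apply Rmin_glb_lt.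
    exists (mkposreal _ hd). intros u hu hI.
    change (Rabs (u - x) < Rmin d1 d2) in hu. apply He.
    specialize (D1 u hI (Rlt_le_trans _ _ _ hu (Rmin_l _ _))).
    specialize (D2 u hI (Rlt_le_trans _ _ _ hu (Rmin_r _ _))).
    pose proof (cond_pos e).
    split; (apply ball_C; [lra |]); (eapply Rle_lt_trans; [eassumption | lra]).
Qed.

Lemma ccont_const (c : C) : ccont (fun _ => c).
Proof.
  intros x hx e he. exists 1. split; [lra |]. intros u _ _.
  replace (c - c)%C with (RtoC 0) by ring. rewrite Cmod_0. lra.
Qed.

Lemma ccont_plus f g : ccont f -> ccont g -> ccont (fun x => (f x + g x)%C).
Proof.
  intros Hf Hg x hx e he.
  destruct (Hf x hx (e / 2)) as [d1 [hd1 D1]]; [lra |].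
  destruct (Hg x hx (e / 2)) as [d2 [hd2 D2]]; [lra |].
  exists (Rmin d1 d2). split; [now apply Rmin_glb_lt |]. intros u hu hux.
  specialize (D1 u hu (Rlt_le_trans _ _ _ hux (Rmin_l _ _))).
  specialize (D2 u hu (Rlt_le_trans _ _ _ hux (Rmin_r _ _))).
  replace (f u + g u - (f x + g x))%C with ((f u - f x) + (g u - g x))%C by ring.
  eapply Rle_trans; [apply Cmod_triangle | lra].
Qed.

Lemma ccont_mult f g : ccont f -> ccont g -> ccont (fun x => (f x * g x)%C).
Proof.
  intros Hf Hg x hx e he.
  set (F := Cmod (f x)). set (G := Cmod (g x)).
  assert (hF : 0 <= F) by apply Cmod_ge_0. assert (hG : 0 <= G) by apply Cmod_ge_0.
  set (k := Rmin 1 (e / (F + G + 1))).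
  assert (hk : 0 < k) by (apply Rmin_glb_lt; [lra | apply Rdiv_lt_0_compat; lra]).
  assert (hk1 : k <= 1) by apply Rmin_l.
  assert (hk2 : k * (F + G + 1) <= e).
  { apply Rle_trans with (e / (F + G + 1) * (F + G + 1)); [| right; field; lra].
    apply Rmult_le_compat_r; [lra | apply Rmin_r]. }
  destruct (Hf x hx k hk) as [d1 [hd1 D1]]. destruct (Hg x hx k hk) as [d2 [hd2 D2]].
  exists (Rmin d1 d2). split; [now apply Rmin_glb_lt |]. intros u hu hux.
  specialize (D1 u hu (Rlt_le_trans _ _ _ hux (Rmin_l _ _))).
  specialize (D2 u hu (Rlt_le_trans _ _ _ hux (Rmin_r _ _))).
  replace (f u * g u - f x * g x)%C with
    ((f u - f x) * (g u - g x) + ((f u - f x) * g x + f x * (g u - g x)))%C by ring.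
  eapply Rle_trans; [apply Cmod_triangle |].
  pose proof (Cmod_triangle ((f u - f x) * g x) (f x * (g u - g x))) as h.
  rewrite !Cmod_mult in *. fold F in h. fold G in h.
  pose proof (Cmod_ge_0 (f u - f x)). pose proof (Cmod_ge_0 (g u - g x)). nra.
Qed.

Lemma ccont_ext f g : (forall x, I0pi x -> f x = g x) -> ccont f -> ccont g.
Proof.
  intros E H x hx e he. destruct (H x hx e he) as [d [hd D]]. exists d.
  split; [exact hd |]. intros u hu hux. rewrite <- !E by assumption. now apply D.
Qed.

Lemma cderiv_ccont f df : cderiv f df -> ccont f.
Proof.
  intros H x hx e he. destruct (H x hx 1 ltac:(lra)) as [d [hd D]].
  set (K := Cmod (df x) + 1). assert (hK : 1 <= K) by (pose proof (Cmod_ge_0 (df x)); unfold K; lra).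
  exists (Rmin d (e / K)). split.
  { apply Rmin_glb_lt; [lra | apply Rdiv_lt_0_compat; lra]. }
  intros u hu hux.
  specialize (D u hu (Rlt_le_trans _ _ _ hux (Rmin_l _ _))).
  assert (h : Rabs (u - x) <= e / K) by (left; eapply Rlt_le_trans; [exact hux | apply Rmin_r]).
  replace (f u - f x)%C with ((f u - f x - (u - x)%R * df x) + (u - x)%R * df x)%C by ring.
  eapply Rle_trans; [apply Cmod_triangle |]. rewrite Cmod_mult, Cmod_R.
  apply Rle_trans with (K * Rabs (u - x)); [unfold K; lra |].
  apply Rle_trans with (K * (e / K)); [apply Rmult_le_compat_l; lra | right; field; lra].
Qed.

Lemma cderiv_mult f df g dg : cderiv f df -> cderiv g dg ->
  cderiv (fun x => (f x * g x)%C) (fun x => (df x * g x + f x * dg x)%C).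
Proof.
  intros Hf Hg x hx e he.
  set (F := Cmod (f x)). set (G := Cmod (dg x)). set (H := Cmod (g x)).
  assert (hF : 0 <= F) by apply Cmod_ge_0. assert (hG : 0 <= G) by apply Cmod_ge_0.
  assert (hH : 0 <= H) by apply Cmod_ge_0.
  set (k := Rmin 1 (e / (F + G + H + 2))).
  assert (hk : 0 < k) by (apply Rmin_glb_lt; [lra | apply Rdiv_lt_0_compat; lra]).
  assert (hk1 : k <= 1) by apply Rmin_l.
  assert (hk2 : k * (F + G + H + 2) <= e).
  { apply Rle_trans with (e / (F + G + H + 2) * (F + G + H + 2)); [| right; field; lra].
    apply Rmult_le_compat_r; [lra | apply Rmin_r]. }
  destruct (Hf x hx k hk) as [d1 [hd1 D1]]. destruct (Hg x hx k hk) as [d2 [hd2 D2]].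
  destruct (cderiv_ccont f df Hf x hx k hk) as [d3 [hd3 D3]].
  exists (Rmin d1 (Rmin d2 d3)). split; [repeat apply Rmin_glb_lt; assumption |]. intros u hu hux.
  assert (hx1 : Rabs (u - x) < d1) by (eapply Rlt_le_trans; [exact hux | apply Rmin_l]).
  assert (hx2 : Rabs (u - x) < d2).
  { eapply Rlt_le_trans; [exact hux |]. eapply Rle_trans; [apply Rmin_r | apply Rmin_l]. }
  assert (hx3 : Rabs (u - x) < d3).
  { eapply Rlt_le_trans; [exact hux |]. eapply Rle_trans; [apply Rmin_r | apply Rmin_r]. }
  specialize (D1 u hu hx1). specialize (D2 u hu hx2). specialize (D3 u hu hx3).
  set (rf := (f u - f x - (u - x)%R * df x)%C) in *.
  set (rg := (g u - g x - (u - x)%R * dg x)%C) in *.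
  replace (f u * g u - f x * g x - (u - x)%R * (df x * g x + f x * dg x))%C with
    ((f u - f x) * rg + f x * rg + (rf * g x + (f u - f x) * ((u - x)%R * dg x)))%C
    by (unfold rf, rg; ring).
  set (t := Rabs (u - x)) in *. assert (ht : 0 <= t) by apply Rabs_pos.
  eapply Rle_trans; [apply Cmod_triangle |].
  pose proof (Cmod_triangle ((f u - f x) * rg) (f x * rg)) as h1.
  pose proof (Cmod_triangle (rf * g x) ((f u - f x) * ((u - x)%R * dg x))) as h2.
  rewrite !Cmod_mult, ?Cmod_R in *. fold F in h1. fold G in h2. fold H in h2. fold t in h2.
  assert (b1 : Cmod (f u - f x) * Cmod rg <= 1 * (k * t))
    by (apply Rmult_le_compat; try apply Cmod_ge_0; lra).
  assert (b2 : F * Cmod rg <= F * (k * t)) by (apply Rmult_le_compat_l; lra).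
  assert (b3 : Cmod rf * H <= k * t * H) by (apply Rmult_le_compat_r; lra).
  assert (b4 : Cmod (f u - f x) * (t * G) <= k * (t * G))
    by (apply Rmult_le_compat_r; [nra | lra]).
  apply Rle_trans with (k * (F + G + H + 2) * t); [nra |].
  apply Rmult_le_compat_r; lra.
Qed.

Lemma cderiv_quad f df K :
  (forall x u, I0pi x -> I0pi u -> Cmod (f u - f x - (u - x)%R * df x) <= K * (u - x) ^ 2) ->
  cderiv f df.
Proof.
  intros H x hx e he. set (K' := Rabs K + 1).
  assert (hK' : 0 < K') by (unfold K'; pose proof (Rabs_pos K); lra).
  exists (e / K'). split; [now apply Rdiv_lt_0_compat |]. intros u hu hux.
  eapply Rle_trans; [apply (H x u hx hu) |].
  set (t := Rabs (u - x)) in *. assert (ht : 0 <= t) by apply Rabs_pos.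
  replace ((u - x) ^ 2) with (t * t) by (unfold t; rewrite <- (pow2_abs (u - x)); ring).
  assert (K <= K') by (unfold K'; pose proof (Rle_abs K); lra).
  apply Rle_trans with (K' * (t * t)); [apply Rmult_le_compat_r; nra |].
  assert (K' * t <= e).
  { apply Rle_trans with (K' * (e / K')); [apply Rmult_le_compat_l; lra | right; field; lra]. }
  nra.
Qed.

Lemma expi_plus s t : expi (s + t) = (expi s * expi t)%C.
Proof.
  unfold expi. rewrite cos_plus, sin_plus. apply injective_projections; simpl; ring.
Qed.

Lemma expi_0 : expi 0 = RtoC 1.
Proof. unfold expi. now rewrite cos_0, sin_0. Qed.

Lemma Cmod_expi t : Cmod (expi t) = 1.
Proof.
  unfold expi, Cmod. simpl fst. simpl snd.
  pose proof (sin2_cos2 t) as h. unfold Rsqr in h.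
  replace (cos t ^ 2 + sin t ^ 2) with 1 by (simpl; lra). apply sqrt_1.
Qed.

Lemma sin_abs_le t : Rabs (sin t) <= Rabs t.
Proof.
  assert (P : forall t, 0 <= t -> Rabs (sin t) <= t).
  { intros s hs. destruct (Rle_lt_dec s 1) as [h | h].
    - destruct (Req_dec s 0) as [-> | hn]; [rewrite sin_0, Rabs_R0; lra |].
      pose proof (sin_lt_x s ltac:(lra)). 
      assert (0 <= sin s) by (apply sin_ge_0; pose proof PI2_1; lra).
      rewrite Rabs_pos_eq; lra.
    - pose proof (SIN_bound s). unfold Rabs. destruct Rcase_abs; lra. }
  destruct (Rle_lt_dec 0 t) as [h | h].
  - rewrite (Rabs_pos_eq t) by exact h. now apply P.
  - rewrite (Rabs_left t) by exact h. rewrite <- Rabs_Ropp, <- sin_neg. apply P. lra.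
Qed.

Lemma one_minus_cos t : 0 <= 1 - cos t <= t ^ 2 / 2.
Proof.
  pose proof (COS_bound t). split; [lra |].
  replace t with (2 * (t / 2)) at 1 by field. rewrite cos_2a_sin.
  pose proof (sin_abs_le (t / 2)) as h.
  assert (sin (t / 2) * sin (t / 2) <= (t / 2) * (t / 2)).
  { rewrite <- !(Rsqr_def). apply Rsqr_le_abs_1. exact h. }
  lra.
Qed.

Lemma sin_minus_id t : Rabs (sin t - t) <= t ^ 2.
Proof.
  destruct (MVT_gen (fun s => sin s - s) 0 t (fun s => cos s - 1)) as [c [hc E]].
  - intros x _. auto_derive; [trivial | ring].
  - intros x _. apply continuity_pt_minus; [apply continuity_sin | apply derivable_continuous, derivable_id].
  - rewrite sin_0 in E. replace (sin t - t) with ((cos c - 1) * (t - 0)) by lra.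
    rewrite Rminus_0_r, Rabs_mult.
    assert (hct : Rabs c <= Rabs t).
    { unfold Rmin, Rmax in hc. destruct (Rle_dec 0 t) in hc;
      unfold Rabs; destruct (Rcase_abs c), (Rcase_abs t); lra. }
    pose proof (one_minus_cos c) as h. pose proof (COS_bound c).
    assert (h1 : Rabs (cos c - 1) <= Rabs t).
    { rewrite <- Rabs_Ropp, Rabs_pos_eq by lra.
      assert (c ^ 2 <= Rabs t ^ 2).
      { rewrite <- (pow2_abs c). apply pow_incr. split; [apply Rabs_pos | exact hct]. }
      pose proof (Rabs_pos t). destruct (Rle_lt_dec (Rabs t) 2); nra. }
    replace (t ^ 2) with (Rabs t * Rabs t) by (rewrite <- pow2_abs; ring).
    apply Rmult_le_compat_r; [apply Rabs_pos | exact h1].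
Qed.

Lemma expi_taylor t : Cmod (expi t - 1 - Ci * t) <= 2 * t ^ 2.
Proof.
  eapply Rle_trans; [apply Cmod_le_re_im |].
  replace (Re (expi t - 1 - Ci * t)) with (- (1 - cos t)) by (unfold Re; simpl; ring).
  replace (Im (expi t - 1 - Ci * t)) with (sin t - t) by (unfold Im; simpl; ring).
  rewrite Rabs_Ropp. pose proof (one_minus_cos t) as h. pose proof (sin_minus_id t).
  rewrite Rabs_pos_eq by lra. nra.
Qed.

Lemma expi_quad mu x u :
  Cmod (expi (mu * u) - expi (mu * x) - (u - x)%R * (Ci * mu * expi (mu * x)))
  <= 2 * mu ^ 2 * (u - x) ^ 2.
Proof.
  replace (mu * u) with (mu * x + mu * (u - x)) by ring. rewrite expi_plus.
  replace (expi (mu * x) * expi (mu * (u - x)) - expi (mu * x)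
     - (u - x)%R * (Ci * mu * expi (mu * x)))%C
   with (expi (mu * x) * (expi (mu * (u - x)) - 1 - Ci * (mu * (u - x))%R))%C
   by (rewrite RtoC_mult; ring).
  rewrite Cmod_mult, Cmod_expi, Rmult_1_l. eapply Rle_trans; [apply expi_taylor |].
  right. ring.
Qed.

Lemma cderiv_expi mu : cderiv (fun x => expi (mu * x)) (fun x => (Ci * mu * expi (mu * x))%C).
Proof. apply cderiv_quad with (2 * mu ^ 2). intros x u _ _. apply expi_quad. Qed.

Lemma ccont_expi mu : ccont (fun x => expi (mu * x)).
Proof. apply (cderiv_ccont _ _ (cderiv_expi mu)). Qed.

(** * Integrals and Fourier coefficients *)

(** A retraction of R onto [0, pi]: composing with it extends a function on the interval
    continuously to R, where the integral of continuous functions is available. *)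
Definition clamp (x : R) : R := Rmax 0 (Rmin x PI).

Lemma clamp_I x : I0pi (clamp x).
Proof.
  pose proof PI_RGT_0. unfold I0pi, clamp. split; [apply Rmax_l |].
  apply Rmax_lub; [lra | apply Rmin_r].
Qed.

Lemma clamp_id x : I0pi x -> clamp x = x.
Proof. intros [h1 h2]. unfold clamp. rewrite Rmin_left, Rmax_right; lra. Qed.

Lemma clamp_lip u x : Rabs (clamp u - clamp x) <= Rabs (u - x).
Proof.
  pose proof PI_RGT_0.
  unfold clamp, Rmax, Rmin. repeat destruct Rle_dec; unfold Rabs; repeat destruct Rcase_abs; lra.
Qed.

Lemma ccont_clamp f : ccont f ->
  (forall x, continuous (fun t => Re (f (clamp t))) x) /\
  (forall x, continuous (fun t => Im (f (clamp t))) x).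
Proof.
  intros H. split; intros x P [e He];
    destruct (H (clamp x) (clamp_I x) (e / 2)) as [d [hd D]];
    try (pose proof (cond_pos e); lra);
    exists (mkposreal d hd); intros u hu; apply He;
    (change (Rabs (u - x) < d) in hu);
    specialize (D (clamp u) (clamp_I u) (Rle_lt_trans _ _ _ (clamp_lip u x) hu));
    pose proof (cond_pos e).
  - eapply Rle_lt_trans; [apply (re_le_Cmod (f (clamp u) - f (clamp x))) | lra].
  - eapply Rle_lt_trans; [apply (im_le_Cmod (f (clamp u) - f (clamp x))) | lra].
Qed.

Lemma ccont_ex f a b : ccont f ->
  ex_RInt (fun t => Re (f (clamp t))) a b /\ ex_RInt (fun t => Im (f (clamp t))) a b.
Proof.
  intros H. destruct (ccont_clamp f H) as [H1 H2].
  split; apply (ex_RInt_continuous (V := R_CompleteNormedModule)); intros; auto.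
Qed.

Definition Cint (f : R -> C) : C :=
  (RInt (fun t => Re (f (clamp t))) 0 PI, RInt (fun t => Im (f (clamp t))) 0 PI).

Lemma Cint_ext f g : (forall x, I0pi x -> f x = g x) -> Cint f = Cint g.
Proof.
  intros H. unfold Cint. f_equal; apply RInt_ext; intros x _; now rewrite H by apply clamp_I.
Qed.

Lemma Cint_plus f g : ccont f -> ccont g -> Cint (fun x => (f x + g x)%C) = (Cint f + Cint g)%C.
Proof.
  intros Hf Hg. destruct (ccont_ex f 0 PI Hf) as [f1 f2]. destruct (ccont_ex g 0 PI Hg) as [g1 g2].
  apply injective_projections; simpl.
  - apply (RInt_plus (V := R_CompleteNormedModule) _ _ 0 PI f1 g1).
  - apply (RInt_plus (V := R_CompleteNormedModule) _ _ 0 PI f2 g2).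
Qed.

Lemma RInt_lin (f g : R -> R) (x y : R) : ex_RInt f 0 PI -> ex_RInt g 0 PI ->
  RInt (fun t => x * f t + y * g t) 0 PI = x * RInt f 0 PI + y * RInt g 0 PI.
Proof.
  intros Hf Hg.
  pose proof (RInt_plus (V := R_CompleteNormedModule) (fun t => x * f t) (fun t => y * g t) 0 PI
    (ex_RInt_scal (V := R_NormedModule) f 0 PI x Hf) (ex_RInt_scal (V := R_NormedModule) g 0 PI y Hg)) as E.
  pose proof (RInt_scal (V := R_CompleteNormedModule) f 0 PI x Hf) as E1.
  pose proof (RInt_scal (V := R_CompleteNormedModule) g 0 PI y Hg) as E2.
  unfold scal, plus in *; simpl in *. unfold mult in *. simpl in *. rewrite <- E1, <- E2. exact E.
Qed.

Lemma Cint_scal (c : C) f : ccont f -> Cint (fun x => (c * f x)%C) = (c * Cint f)%C.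
Proof.
  intros Hf. destruct (ccont_ex f 0 PI Hf) as [f1 f2].
  pose proof (RInt_lin _ _ (fst c) (- snd c) f1 f2) as E1.
  pose proof (RInt_lin _ _ (snd c) (fst c) f1 f2) as E2.
  apply injective_projections; cbn [fst snd Cint Cmult].
  - transitivity (fst c * RInt (fun t => Re (f (clamp t))) 0 PI
      + - snd c * RInt (fun t => Im (f (clamp t))) 0 PI); [| ring].
    rewrite <- E1. apply RInt_ext. intros x _. unfold Re, Im. simpl. ring.
  - transitivity (snd c * RInt (fun t => Re (f (clamp t))) 0 PI
      + fst c * RInt (fun t => Im (f (clamp t))) 0 PI); [| ring].
    rewrite <- E2. apply RInt_ext. intros x _. unfold Re, Im. simpl. ring.
Qed.

Lemma Cint_bound f K : ccont f -> (forall x, I0pi x -> Cmod (f x) <= K) ->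
  Cmod (Cint f) <= 2 * PI * K.
Proof.
  intros Hf HK. destruct (ccont_ex f 0 PI Hf) as [f1 f2]. pose proof PI_RGT_0 as hpi.
  eapply Rle_trans; [apply Cmod_le_re_im |].
  assert (B1 : Rabs (Re (Cint f)) <= (PI - 0) * K).
  { apply abs_RInt_le_const; [lra | exact f1 |]. intros t _.
    eapply Rle_trans; [apply re_le_Cmod |]. apply HK, clamp_I. }
  assert (B2 : Rabs (Im (Cint f)) <= (PI - 0) * K).
  { apply abs_RInt_le_const; [lra | exact f2 |]. intros t _.
    eapply Rle_trans; [apply im_le_Cmod |]. apply HK, clamp_I. }
  lra.
Qed.

Lemma ccont_bounded f : ccont f -> exists K, forall x, I0pi x -> Cmod (f x) <= K.
Proof.
  intros Hf. destruct (ccont_clamp f Hf) as [H1 H2]. pose proof PI_RGT_0 as hpi.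
  assert (B : forall h : R -> R, (forall x, continuous h x) ->
     exists K, forall x, 0 <= x <= PI -> Rabs (h x) <= K).
  { intros h Hh. 
    destruct (continuity_ab_maj h 0 PI) as [M [HM _]]; [lra | |].
    - intros c _. apply continuity_pt_filterlim, Hh.
    - destruct (continuity_ab_min h 0 PI) as [m [Hm _]]; [lra | |].
      + intros c _. apply continuity_pt_filterlim, Hh.
      + exists (Rabs (h M) + Rabs (h m)). intros x hx. specialize (HM x hx). specialize (Hm x hx).
        unfold Rabs. repeat destruct Rcase_abs; lra. }
  destruct (B _ H1) as [K1 B1]. destruct (B _ H2) as [K2 B2].
  exists (K1 + K2). intros x hx. specialize (B1 x hx). specialize (B2 x hx).
  rewrite clamp_id in B1, B2 by exact hx.
  eapply Rle_trans; [apply Cmod_le_re_im | lra].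
Qed.

(** Differentiability is required in the open interval only, because the extension of a function
    by its end values has corners at 0 and pi. *)
Lemma real_FTC (F G : R -> R) :
  (forall x, continuous F x) -> (forall x, continuous G x) ->
  (forall x, 0 < x < PI -> is_derive F x (G x)) -> RInt G 0 PI = F PI - F 0.
Proof.
  intros HF HG HD. pose proof PI_RGT_0 as hpi.
  assert (DI : forall x, is_derive (fun t => RInt G 0 t) x (G x)).
  { intros x. apply (is_derive_RInt (V := R_NormedModule) G (fun t => RInt G 0 t) 0 x).
    - exists (mkposreal 1 Rlt_0_1). intros t _. apply (RInt_correct (V := R_CompleteNormedModule)).
      apply (ex_RInt_continuous (V := R_CompleteNormedModule)); intros; apply HG.
    - apply HG. }
  destruct (MVT_gen (fun t => F t - RInt G 0 t) 0 PI (fun _ => 0)) as [c [_ E]].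
  - rewrite Rmin_left, Rmax_right by lra. intros x hx.
    pose proof (is_derive_minus (V := R_NormedModule) F (fun t => RInt G 0 t) x _ _ (HD x hx) (DI x))
      as E.
    rewrite minus_eq_zero in E. exact E.
  - intros x _. apply continuity_pt_filterlim.
    apply (continuous_minus (V := R_NormedModule) F (fun t => RInt G 0 t)); [apply HF |].
    apply ex_derive_continuous. eexists. apply DI.
  - rewrite RInt_point in E. unfold zero in E. simpl in E. lra.
Qed.

Lemma Cint_FTC f df : cderiv f df -> ccont df -> Cint df = (f PI - f 0)%C.
Proof.
  intros HD Hc. pose proof PI_RGT_0 as hpi.
  destruct (ccont_clamp f (cderiv_ccont _ _ HD)) as [F1 F2].
  destruct (ccont_clamp df Hc) as [G1 G2].
  assert (D : forall x, 0 < x < PI -> forall e, 0 < e -> exists d, 0 < d /\ forall u, Rabs (u - x) < d ->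
     Cmod (f (clamp u) - f (clamp x) - (u - x)%R * df (clamp x)) <= e * Rabs (u - x)).
  { intros x hx e he. assert (hI : I0pi x) by (unfold I0pi; lra).
    destruct (HD x hI e he) as [d [hd Hd]].
    exists (Rmin d (Rmin x (PI - x))). split; [repeat apply Rmin_glb_lt; lra |].
    intros u hu.
    assert (h1 : Rabs (u - x) < d) by (eapply Rlt_le_trans; [exact hu | apply Rmin_l]).
    assert (h2 : Rabs (u - x) < x).
    { eapply Rlt_le_trans; [exact hu |]. eapply Rle_trans; [apply Rmin_r | apply Rmin_l]. }
    assert (h3 : Rabs (u - x) < PI - x).
    { eapply Rlt_le_trans; [exact hu |]. eapply Rle_trans; [apply Rmin_r | apply Rmin_r]. }
    assert (hu' : I0pi u) by (unfold I0pi; unfold Rabs in h2, h3; destruct Rcase_abs; lra).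
    rewrite !clamp_id by assumption. now apply Hd. }
  assert (L : forall (h : R -> R) (l x : R), 0 < x < PI ->
    (forall e, 0 < e -> exists d, 0 < d /\ forall u, Rabs (u - x) < d ->
       Rabs (h u - h x - (u - x) * l) <= e * Rabs (u - x)) -> is_derive h x l).
  { intros h l x hx H. split; [apply is_linear_scal_l |].
    intros x' hx' e.
    apply (is_filter_lim_locally_unique (V := AbsRing_NormedModule R_AbsRing)) in hx'. subst x'.
    destruct (H e (cond_pos e)) as [d [hd Hd]]. exists (mkposreal d hd). intros u hu.
    apply (Hd u hu). }
  apply injective_projections; simpl.
  - rewrite (real_FTC (fun t => Re (f (clamp t)))); try assumption.
    + rewrite !clamp_id by (unfold I0pi; lra). reflexivity.
    + intros x hx. apply L; [exact hx |]. intros e he. destruct (D x hx e he) as [d [hd Hd]].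
      exists d. split; [exact hd |]. intros u hu. eapply Rle_trans; [| apply (Hd u hu)].
      eapply Rle_trans; [| apply re_le_Cmod]. right. f_equal. unfold Re. simpl. ring.
  - rewrite (real_FTC (fun t => Im (f (clamp t)))); try assumption.
    + rewrite !clamp_id by (unfold I0pi; lra). reflexivity.
    + intros x hx. apply L; [exact hx |]. intros e he. destruct (D x hx e he) as [d [hd Hd]].
      exists d. split; [exact hd |]. intros u hu. eapply Rle_trans; [| apply (Hd u hu)].
      eapply Rle_trans; [| apply im_le_Cmod]. right. f_equal. unfold Im. simpl. ring.
Qed.

(** The exponentials with these frequencies are those, of period 2 pi, that satisfy the boundary
    condition belonging to the parity of n. *)
Definition freq (n j : Z) : R := 2 * IZR j - IZR n.

Definition coef (n : Z) (f : R -> C) (j : Z) : C :=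
  Cint (fun x => (f x * expi (- freq n j * x))%C).

Lemma ccont_coef n f j : ccont f -> ccont (fun x => (f x * expi (- freq n j * x))%C).
Proof. intros H. apply ccont_mult; [exact H | apply ccont_expi]. Qed.

Lemma coef_ext n f g j : (forall x, I0pi x -> f x = g x) -> coef n f j = coef n g j.
Proof. intros H. apply Cint_ext. intros x hx. now rewrite H. Qed.

Lemma coef_plus n f g j : ccont f -> ccont g ->
  coef n (fun x => (f x + g x)%C) j = (coef n f j + coef n g j)%C.
Proof.
  intros Hf Hg. unfold coef. rewrite <- Cint_plus by now apply ccont_coef.
  apply Cint_ext. intros; ring.
Qed.

Lemma coef_scal n (c : C) f j : ccont f -> coef n (fun x => (c * f x)%C) j = (c * coef n f j)%C.
Proof.
  intros Hf. unfold coef. rewrite <- Cint_scal by now apply ccont_coef.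
  apply Cint_ext. intros; ring.
Qed.

Lemma coef_bounded n f : ccont f -> exists K, forall j, Cmod (coef n f j) <= K.
Proof.
  intros Hf. destruct (ccont_bounded f Hf) as [K HK]. exists (2 * PI * K). intros j.
  apply Cint_bound; [now apply ccont_coef |]. intros x hx. rewrite Cmod_mult, Cmod_expi, Rmult_1_r.
  now apply HK.
Qed.

Lemma coef_shift n f j k :
  coef n (fun x => (expi (2 * IZR k * x) * f x)%C) j = coef n f (j - k).
Proof.
  apply Cint_ext. intros x _.
  replace (- freq n (j - k) * x) with (2 * IZR k * x + - freq n j * x)
    by (unfold freq; rewrite minus_IZR; ring).
  rewrite expi_plus. ring.
Qed.

Lemma expi_period_even j : expi (2 * IZR j * PI) = RtoC 1.
Proof.
  assert (P : forall k : nat, expi (2 * INR k * PI) = RtoC 1).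
  { intros k. unfold expi. rewrite <- (Rplus_0_l (2 * INR k * PI)).
    rewrite cos_period, sin_period, cos_0, sin_0. reflexivity. }
  destruct (Z_le_gt_dec 0 j) as [h | h].
  - replace j with (Z.of_nat (Z.to_nat j)) by lia. rewrite <- INR_IZR_INZ. apply P.
  - pose proof (P (Z.to_nat (- j))) as E. rewrite INR_IZR_INZ, Z2Nat.id, opp_IZR in E by lia.
    assert (E2 : (expi (2 * - IZR j * PI) * expi (2 * IZR j * PI) = 1)%C).
    { rewrite <- expi_plus. replace (2 * - IZR j * PI + 2 * IZR j * PI) with 0 by ring. apply expi_0. }
    rewrite E in E2. rewrite <- E2. ring.
Qed.

Lemma expi_PI : expi PI = (- (1))%C.
Proof. unfold expi. rewrite cos_PI, sin_PI. apply injective_projections; simpl; ring. Qed.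

Lemma expi_freq_PI n j : expi (- freq n j * PI) = bc n.
Proof.
  unfold freq, bc. destruct (Z.even n) eqn:E.
  - apply Z.even_spec in E. destruct E as [k ->].
    replace (- (2 * IZR j - IZR (2 * k)) * PI) with (2 * IZR (k - j) * PI)
      by (rewrite minus_IZR, mult_IZR; ring). apply expi_period_even.
  - rewrite <- Z.negb_odd in E. apply Bool.negb_false_iff, Z.odd_spec in E. destruct E as [k ->].
    replace (- (2 * IZR j - IZR (2 * k + 1)) * PI) with (2 * IZR (k - j) * PI + PI)
      by (rewrite minus_IZR, plus_IZR, mult_IZR; ring).
    rewrite expi_plus, expi_period_even, expi_PI. ring.
Qed.

Lemma bc_sq n : (bc n * bc n = 1)%C.
Proof. unfold bc. destruct (Z.even n); ring. Qed.

(** Integration by parts. The boundary terms cancel since f and the exponential change by the same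
    factor, 1 or -1, over the interval. *)
Lemma coef_derive n f df j : cderiv f df -> ccont df -> f PI = (bc n * f 0)%C ->
  coef n df j = (Ci * freq n j * coef n f j)%C.
Proof.
  intros HD Hc Hbc. pose proof (cderiv_ccont _ _ HD) as Hf.
  assert (HD2 : cderiv (fun x => (f x * expi (- freq n j * x))%C)
    (fun x => (df x * expi (- freq n j * x) + f x * (Ci * (- freq n j)%R * expi (- freq n j * x)))%C))
    by (apply cderiv_mult; [exact HD | apply cderiv_expi]).
  assert (C1 : ccont (fun x => (df x * expi (- freq n j * x))%C)) by now apply ccont_coef.
  assert (C2 : ccont (fun x => ((- (Ci * freq n j)) * (f x * expi (- freq n j * x)))%C))
    by (apply ccont_mult; [apply ccont_const | now apply ccont_coef]).
  pose proof (Cint_FTC _ _ HD2) as E.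
  rewrite (Cint_ext _ (fun x => (df x * expi (- freq n j * x)
     + (- (Ci * freq n j)) * (f x * expi (- freq n j * x)))%C)) in E
    by (intros x _; rewrite RtoC_opp; ring).
  rewrite Cint_plus, Cint_scal in E by (try assumption; now apply ccont_coef).
  fold (coef n df j) in E. fold (coef n f j) in E. cbv beta in E.
  rewrite expi_freq_PI, Rmult_0_r, expi_0, Hbc in E.
  assert (E' : (coef n df j + - (Ci * freq n j) * coef n f j)%C = RtoC 0).
  { rewrite E; [replace (bc n * f 0 * bc n)%C with (bc n * bc n * f 0)%C by ring;
      rewrite bc_sq; ring |].
    apply ccont_ext with (f := fun x => (df x * expi (- freq n j * x)
     + (- (Ci * freq n j)) * (f x * expi (- freq n j * x)))%C).
    - intros x _. rewrite RtoC_opp. ring.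
    - now apply ccont_plus. }
  replace (coef n df j) with (coef n df j + - (Ci * freq n j) * coef n f j
    + Ci * freq n j * coef n f j)%C by ring. rewrite E'. ring.
Qed.

(** * Completeness of the exponentials *)

Lemma RInt_ge_const (f : R -> R) (a b m : R) :
  a <= b -> (forall x, continuous f x) -> (forall x, a < x < b -> m <= f x) ->
  (b - a) * m <= RInt f a b.
Proof.
  intros hab Hc H.
  replace ((b - a) * m) with (RInt (fun _ => m) a b)
    by (rewrite RInt_const; unfold scal; simpl; unfold mult; simpl; ring).
  apply RInt_le; [exact hab | apply ex_RInt_const | | exact H].
  apply (ex_RInt_continuous (V := R_CompleteNormedModule)); intros; apply Hc.
Qed.

(** For kap = 1 - cos (2 del) the function kap + cos (2 (x - x0)) is above 1 at distance less than
    del from x0 and at most 1 in modulus on the rest of [0, pi]. High powers therefore concentrate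
    the integral where h is positive. *)
Lemma kernel_detects (h : R -> R) (x0 : R) :
  (forall x, continuous h x) -> 0 < x0 < PI -> 0 < h x0 ->
  exists (kap : R) (k : nat),
    0 < RInt (fun x => h x * (kap + cos (2 * (x - x0))) ^ k) 0 PI.
Proof.
  intros Hc hx0 hpos. pose proof PI_RGT_0 as hpi.
  set (eta := h x0 / 2). assert (heta : 0 < eta) by (unfold eta; lra).
  assert (HD : exists d, 0 < d /\ forall x, Rabs (x - x0) < d -> eta <= h x).
  { destruct (Hc x0 (fun v => eta <= v)) as [d Hd].
    - exists (mkposreal eta heta). intros v hv. change (Rabs (v - h x0) < eta) in hv.
      unfold Rabs in hv. destruct Rcase_abs in hv; unfold eta in *; lra.
    - exists d. split; [apply cond_pos |]. intros x hx. now apply (Hd x). }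
  destruct HD as [d0 [hd0 Hd0]].
  set (del := Rmin (d0 / 2) (Rmin (x0 / 2) ((PI - x0) / 2))).
  assert (hdel : 0 < del) by (repeat apply Rmin_glb_lt; lra).
  assert (hd1 : del <= d0 / 2) by apply Rmin_l.
  assert (hd2 : del <= x0 / 2) by (eapply Rle_trans; [apply Rmin_r | apply Rmin_l]).
  assert (hd3 : del <= (PI - x0) / 2) by (eapply Rle_trans; [apply Rmin_r | apply Rmin_r]).
  set (kap := 1 - cos (2 * del)). set (beta := cos del - cos (2 * del)).
  assert (hbeta : 0 < beta).
  { unfold beta. pose proof (cos_decreasing_1 del (2 * del)). lra. }
  pose proof (COS_bound (2 * del)) as hcd.
  set (c := fun x => kap + cos (2 * (x - x0))).
  assert (heven : forall x, cos (2 * (x - x0)) = cos (2 * Rabs (x - x0))).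
  { intros x. unfold Rabs. destruct Rcase_abs; [| reflexivity].
    rewrite <- cos_neg. f_equal. ring. }
  assert (C1 : forall x, Rabs (x - x0) <= del -> 1 <= c x).
  { intros x hx. unfold c, kap. rewrite heven.
    pose proof (cos_decr_1 (2 * Rabs (x - x0)) (2 * del)). pose proof (Rabs_pos (x - x0)). lra. }
  assert (C2 : forall x, Rabs (x - x0) <= del / 2 -> 1 + beta <= c x).
  { intros x hx. unfold c, kap, beta. rewrite heven.
    pose proof (cos_decr_1 (2 * Rabs (x - x0)) del). pose proof (Rabs_pos (x - x0)). lra. }
  assert (C3 : forall x, 0 <= x <= PI -> del <= Rabs (x - x0) -> Rabs (c x) <= 1).
  { intros x hx hxd. assert (hcos : cos (2 * (x - x0)) <= cos (2 * del)).
    { rewrite heven. assert (hu : Rabs (x - x0) <= PI - del)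
        by (unfold Rabs; destruct Rcase_abs; lra).
      destruct (Rle_lt_dec (2 * Rabs (x - x0)) PI) as [g | g].
      - apply cos_decr_1; lra.
      - replace (cos (2 * Rabs (x - x0))) with (cos (2 * PI - 2 * Rabs (x - x0))).
        + apply cos_decr_1; lra.
        + rewrite <- cos_neg. replace (- (2 * PI - 2 * Rabs (x - x0)))
            with (2 * Rabs (x - x0) + 2 * INR 1 * (- PI)) by (simpl; ring).
          rewrite <- (cos_period _ 1). f_equal. simpl. ring. }
    pose proof (COS_bound (2 * (x - x0))). unfold c, kap.
    apply Rabs_le. lra. }
  assert (HK : exists K, 0 <= K /\ forall x, 0 <= x <= PI -> Rabs (h x) <= K).
  { destruct (ccont_bounded (fun x => RtoC (h x))) as [K HK].
    - intros x hx e he. destruct (Hc x (fun v => Rabs (v - h x) < e)) as [d Hd].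
      + exists (mkposreal e he). intros v hv. exact hv.
      + exists d. split; [apply cond_pos |]. intros u hu hux.
        rewrite <- RtoC_minus, Cmod_R. left. now apply (Hd u).
    - exists K. split.
      + eapply Rle_trans; [apply Cmod_ge_0 | apply (HK 0)]. unfold I0pi. lra.
      + intros x hx. rewrite <- Cmod_R. now apply HK. }
  destruct HK as [K [hK0 HK]].
  destruct (INR_unbounded (PI * K / (del * eta * beta))) as [k hk].
  exists kap, k. fold c.
  change (0 < RInt (fun x => h x * c x ^ k) 0 PI).
  assert (Hc2 : forall x, continuous (fun x => h x * c x ^ k) x).
  { intros x. apply (continuous_mult (K := R_AbsRing) h (fun x => c x ^ k)); [apply Hc |].
    apply continuity_pt_filterlim. unfold c. apply derivable_continuous_pt.
    apply ex_derive_Reals_0. auto_derive. trivial. }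
  assert (Hex : forall a b, ex_RInt (fun x => h x * c x ^ k) a b).
  { intros a b. apply (ex_RInt_continuous (V := R_CompleteNormedModule)); intros; apply Hc2. }
  rewrite <- (RInt_Chasles (V := R_CompleteNormedModule) _ 0 (x0 - del / 2) PI (Hex _ _) (Hex _ _)).
  rewrite <- (RInt_Chasles (V := R_CompleteNormedModule) _ (x0 - del / 2) (x0 + del / 2) PI
    (Hex _ _) (Hex _ _)).
  unfold plus. simpl.
  assert (Out : forall x, 0 <= x <= PI -> - K <= h x * c x ^ k).
  { intros x hx. destruct (Rle_lt_dec (Rabs (x - x0)) del) as [g | g].
    - assert (0 <= h x) by (specialize (Hd0 x ltac:(lra)); lra).
      assert (0 <= c x ^ k) by (apply pow_le; specialize (C1 x g); lra). nra.
    - assert (B : Rabs (h x * c x ^ k) <= K * 1).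
      { rewrite Rabs_mult, <- RPow_abs. apply Rmult_le_compat; try apply Rabs_pos.
        - apply pow_le, Rabs_pos.
        - now apply HK.
        - rewrite <- (pow1 k). apply pow_incr. split; [apply Rabs_pos | apply C3; lra]. }
      unfold Rabs in B. destruct Rcase_abs in B; lra. }
  (* The integrand is at least - K everywhere, and at least eta (1 + beta)^k near x0; Bernoulli's
     inequality bounds the latter below by eta (1 + k beta). *)
  assert (I1 : (x0 - del / 2 - 0) * - K <= RInt (fun x => h x * c x ^ k) 0 (x0 - del / 2)).
  { apply RInt_ge_const; [lra | exact Hc2 |]. intros x hx. apply Out. lra. }
  assert (I3 : (PI - (x0 + del / 2)) * - K <= RInt (fun x => h x * c x ^ k) (x0 + del / 2) PI).
  { apply RInt_ge_const; [lra | exact Hc2 |]. intros x hx. apply Out. lra. }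
  assert (I2 : (x0 + del / 2 - (x0 - del / 2)) * (eta * (1 + INR k * beta))
     <= RInt (fun x => h x * c x ^ k) (x0 - del / 2) (x0 + del / 2)).
  { apply RInt_ge_const; [lra | exact Hc2 |]. intros x hx.
    assert (g : Rabs (x - x0) <= del / 2) by (apply Rabs_le; lra).
    apply Rmult_le_compat.
    - lra.
    - pose proof (pos_INR k). nra.
    - apply Hd0. lra.
    - eapply Rle_trans; [apply (poly k beta hbeta) |]. apply pow_incr.
      specialize (C2 x g). lra. }
  assert (hfin : PI * K < del * eta * beta * INR k).
  { assert (hp : 0 < del * eta * beta) by (apply Rmult_lt_0_compat; [apply Rmult_lt_0_compat |]; assumption).
    apply (Rmult_lt_compat_l (del * eta * beta)) in hk; [| exact hp].
    replace (del * eta * beta * (PI * K / (del * eta * beta))) with (PI * K) in hk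
      by (field; lra). exact hk. }
  assert (0 < del * eta) by nra.
  assert (0 <= del * K) by nra.
  nra.
Qed.

Lemma cos_expi t : RtoC (cos t) = ((expi t + expi (- t)) / 2)%C.
Proof.
  unfold expi. rewrite cos_neg, sin_neg. apply injective_projections; simpl; field.
Qed.

(** Multiplication by cos (2 (x - x0)) turns a coefficient into a combination of the two
    neighbouring ones. *)
Lemma coef_kernel n f x0 kap k : ccont f -> (forall j, coef n f j = RtoC 0) ->
  forall j, coef n (fun x => (f x * RtoC ((kap + cos (2 * (x - x0))) ^ k))%C) j = RtoC 0.
Proof.
  intros Hf H0.
  assert (P : ccont (fun x => (f x * RtoC ((kap + cos (2 * (x - x0))) ^ k))%C) /\
    forall j, coef n (fun x => (f x * RtoC ((kap + cos (2 * (x - x0))) ^ k))%C) j = RtoC 0);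
    [| apply P].
  induction k as [| k [IH1 IH2]].
  - split.
    + apply ccont_ext with (f := f); [| exact Hf]. intros x _. simpl. ring.
    + intros j. rewrite <- (H0 j). apply coef_ext. intros x _. simpl. ring.
  - set (g := fun x => (f x * RtoC ((kap + cos (2 * (x - x0))) ^ k))%C) in *.
    assert (E : forall x, (f x * RtoC ((kap + cos (2 * (x - x0))) ^ S k))%C =
      (kap * g x + ((expi (- 2 * x0) / 2) * (expi (2 * 1 * x) * g x)
        + (expi (2 * x0) / 2) * (expi (2 * (-1) * x) * g x)))%C).
    { intros x. unfold g. simpl pow. rewrite RtoC_mult, RtoC_plus, cos_expi.
      replace (2 * (x - x0)) with (- 2 * x0 + 2 * 1 * x) by ring.
      replace (- (- 2 * x0 + 2 * 1 * x)) with (2 * x0 + 2 * (-1) * x) by ring.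
      rewrite !expi_plus. field. }
    assert (C1 : ccont (fun x => (expi (2 * 1 * x) * g x)%C))
      by (apply ccont_mult; [apply ccont_expi | exact IH1]).
    assert (C2 : ccont (fun x => (expi (2 * (-1) * x) * g x)%C))
      by (apply ccont_mult; [apply ccont_expi | exact IH1]).
    assert (C1' : ccont (fun x => ((expi (- 2 * x0) / 2) * (expi (2 * 1 * x) * g x))%C))
      by (apply ccont_mult; [apply ccont_const | exact C1]).
    assert (C2' : ccont (fun x => ((expi (2 * x0) / 2) * (expi (2 * (-1) * x) * g x))%C))
      by (apply ccont_mult; [apply ccont_const | exact C2]).
    assert (C0 : ccont (fun x => (kap * g x)%C))
      by (apply ccont_mult; [apply ccont_const | exact IH1]).
    split.
    + apply ccont_ext with (f := fun x => (kap * g x + ((expi (- 2 * x0) / 2) * (expi (2 * 1 * x) * g x)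
        + (expi (2 * x0) / 2) * (expi (2 * (-1) * x) * g x)))%C); [intros; now rewrite E |].
      apply ccont_plus; [exact C0 | now apply ccont_plus].
    + intros j. rewrite (coef_ext n _ _ j (fun x _ => E x)).
      rewrite coef_plus, coef_plus, !coef_scal by (try assumption; now apply ccont_plus).
      pose proof (coef_shift n g j 1) as S1. pose proof (coef_shift n g j (-1)) as S2.
      simpl IZR in S1, S2. rewrite S1, S2, !IH2. ring.
Qed.

(** If f is nonzero at an inner point, rotating its phase gives a positive real part there; a power
    of the kernel makes the integral of this real part positive, although it is that of a zero
    coefficient. The end points follow by continuity. *)
Theorem coef_complete n f : ccont f -> (forall j, coef n f j = RtoC 0) ->
  forall x, I0pi x -> f x = RtoC 0.
Proof.
  intros Hf H0. pose proof PI_RGT_0 as hpi.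
  assert (Int : forall x0, 0 < x0 < PI -> f x0 = RtoC 0).
  { intros x0 hx0. destruct (Req_dec (Cmod (f x0)) 0) as [h | h]; [now apply Cmod_eq_0 | exfalso].
    set (F := fun x => (f x * expi (- freq n 0 * x))%C).
    assert (HF : ccont F) by now apply ccont_coef.
    set (w := Cconj (F x0)).
    assert (HwF : ccont (fun x => (w * F x)%C)) by (apply ccont_mult; [apply ccont_const | exact HF]).
    destruct (ccont_clamp _ HwF) as [Hre _].
    assert (hI : I0pi x0) by (unfold I0pi; lra).
    destruct (kernel_detects (fun t => Re (w * F (clamp t))) x0 Hre hx0) as [kap [k Hk]].
    - rewrite clamp_id by exact hI. unfold w. rewrite Cmult_comm, <- Cmod2_conj. 
      assert (hm : Cmod (F x0) = Cmod (f x0)).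
      { unfold F. now rewrite Cmod_mult, Cmod_expi, Rmult_1_r. }
      rewrite hm. pose proof (Cmod_ge_0 (f x0)).
      change (0 < Cmod (f x0) ^ 2). nra.
    - pose proof (coef_kernel n f x0 kap k Hf H0 0) as Z0.
      set (T := fun x => (kap + cos (2 * (x - x0))) ^ k) in *.
      assert (E : Cint (fun x => (w * (f x * RtoC (T x) * expi (- freq n 0 * x)))%C) = RtoC 0).
      { rewrite Cint_scal; [unfold coef in Z0; unfold T; rewrite Z0; ring |].
        apply ccont_coef. apply ccont_mult; [exact Hf |].
        intros x hx e he.
        assert (Hcx : continuous T x).
        { apply continuity_pt_filterlim, derivable_continuous_pt, ex_derive_Reals_0.
          unfold T. auto_derive. trivial. }
        destruct (Hcx (fun v => Rabs (v - T x) < e)) as [d Hd].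
        - exists (mkposreal e he). intros v hv. exact hv.
        - exists d. split; [apply cond_pos |]. intros u hu hux.
          rewrite <- RtoC_minus, Cmod_R. left. now apply (Hd u). }
      apply (f_equal fst) in E. unfold Cint in E. cbn [fst RtoC] in E.
      apply (Rlt_irrefl 0). eapply Rlt_le_trans; [exact Hk |]. right. rewrite <- E at 2.
      apply RInt_ext. intros x hx. rewrite Rmin_left, Rmax_right in hx by lra.
      rewrite clamp_id by (unfold I0pi; lra). unfold F, T, Re. simpl. ring. }
  intros x hx. destruct (Req_dec x 0) as [e0 | n0]; [| destruct (Req_dec x PI) as [e1 | n1]].
  - apply Ceq_of_small. intros e he. destruct (Hf x hx e he) as [d [hd D]].
    set (u := Rmin (d / 2) (PI / 2)).
    assert (hu : 0 < u) by (apply Rmin_glb_lt; lra).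
    assert (hu1 : u <= d / 2) by apply Rmin_l. assert (hu2 : u <= PI / 2) by apply Rmin_r.
    specialize (D u). rewrite Int, Cmod_minus_sym in D by lra. apply D; [unfold I0pi; lra |].
    rewrite e0, Rminus_0_r, Rabs_pos_eq; lra.
  - apply Ceq_of_small. intros e he. destruct (Hf x hx e he) as [d [hd D]].
    set (u := Rmin (d / 2) (PI / 2)).
    assert (hu : 0 < u) by (apply Rmin_glb_lt; lra).
    assert (hu1 : u <= d / 2) by apply Rmin_l. assert (hu2 : u <= PI / 2) by apply Rmin_r.
    specialize (D (PI - u)). rewrite Int, Cmod_minus_sym in D by lra.
    apply D; [unfold I0pi; lra |].
    rewrite e1. replace (PI - u - PI) with (- u) by ring. rewrite Rabs_Ropp, Rabs_pos_eq; lra.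
  - apply Int. destruct hx. lra.
Qed.

(** * Functions with prescribed coefficients *)

Lemma expi_lip t : Cmod (expi t - 1) <= 2 * Rabs t.
Proof.
  eapply Rle_trans; [apply Cmod_le_re_im |].
  replace (Re (expi t - 1)) with (- (1 - cos t)) by (unfold Re; simpl; ring).
  replace (Im (expi t - 1)) with (sin t) by (unfold Im; simpl; ring).
  rewrite Rabs_Ropp. pose proof (one_minus_cos t) as h. pose proof (sin_abs_le t).
  pose proof (COS_bound t). rewrite Rabs_pos_eq by lra.
  rewrite <- (pow2_abs t) in h. pose proof (Rabs_pos t).
  destruct (Rle_lt_dec (Rabs t) 2); nra.
Qed.

Lemma csum_geom_lim (a : nat -> C) (K th : R) :
  0 <= th < 1 -> (forall k, Cmod (a k) <= K * th ^ k) ->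
  exists l, forall N, Cmod (csum a N - l) <= K / (1 - th) * th ^ N.
Proof.
  intros hth H. apply geom_lim; [exact hth |]. intros k. simpl.
  replace (csum a k + a k - csum a k)%C with (a k) by ring. apply H.
Qed.

(** The second order remainder of exp (i mu x) is at most 2 mu^2 (u - x)^2. It is summable against
    the coefficients, so that the series inherits a quadratic remainder. *)
Lemma trig_series (a : nat -> C) (mu : nat -> R) (K th : R) :
  0 <= th < 1 -> (forall k, Cmod (a k) * (1 + mu k ^ 2) <= K * th ^ k) ->
  exists f df : R -> C,
    (forall x N, Cmod (csum (fun k => (a k * expi (mu k * x))%C) N - f x)
        <= K / (1 - th) * th ^ N) /\
    cderiv f df /\ ccont df.
Proof.
  intros hth H.
  assert (hmu : forall k, Rabs (mu k) <= 1 + mu k ^ 2).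
  { intros k. rewrite <- (pow2_abs (mu k)). pose proof (Rabs_pos (mu k)). nra. }
  assert (B0 : forall x k, Cmod (a k * expi (mu k * x)) <= K * th ^ k).
  { intros x k. rewrite Cmod_mult, Cmod_expi, Rmult_1_r. eapply Rle_trans; [| apply H].
    pose proof (Cmod_ge_0 (a k)). pose proof (pow2_ge_0 (mu k)). nra. }
  assert (B1 : forall x k, Cmod (a k * (Ci * mu k * expi (mu k * x))) <= K * th ^ k).
  { intros x k. rewrite !Cmod_mult, Cmod_expi, Cmod_Ci, Cmod_R, Rmult_1_r, Rmult_1_l.
    eapply Rle_trans; [| apply H]. apply Rmult_le_compat_l; [apply Cmod_ge_0 | apply hmu]. }
  set (f := fun x => proj1_sig (constructive_indefinite_description _
     (csum_geom_lim _ K th hth (B0 x)))).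
  set (df := fun x => proj1_sig (constructive_indefinite_description _
     (csum_geom_lim _ K th hth (B1 x)))).
  assert (F : forall x N, Cmod (csum (fun k => (a k * expi (mu k * x))%C) N - f x)
        <= K / (1 - th) * th ^ N).
  { intros x. exact (proj2_sig (constructive_indefinite_description _
     (csum_geom_lim _ K th hth (B0 x)))). }
  assert (DF : forall x N, Cmod (csum (fun k => (a k * (Ci * mu k * expi (mu k * x)))%C) N - df x)
        <= K / (1 - th) * th ^ N).
  { intros x. exact (proj2_sig (constructive_indefinite_description _
     (csum_geom_lim _ K th hth (B1 x)))). }
  clearbody f df.
  assert (hK : 0 <= K).
  { specialize (H O). simpl in H. pose proof (Cmod_ge_0 (a O)). pose proof (pow2_ge_0 (mu O)).
    simpl in *. nra. }
  assert (hK2 : 0 <= K / (1 - th)).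
  { apply Rmult_le_pos; [exact hK |]. left. apply Rinv_0_lt_compat. lra. }
  exists f, df. split; [exact F | split].
  - apply cderiv_quad with (2 * (K / (1 - th))). intros x u _ _.
    apply le_of_le_plus_eps. intros e he.
    set (D := Rabs (u - x) + 2). assert (hD : 2 <= D) by (unfold D; pose proof (Rabs_pos (u - x)); lra).
    destruct (pow_small th (K / (1 - th)) (e / D) hth hK2) as [N HN];
      [apply Rdiv_lt_0_compat; lra |]. specialize (HN N (le_n N)).
    pose proof (F u N) as f1. pose proof (F x N) as f2. pose proof (DF x N) as f3.
    set (Su := csum (fun k => (a k * expi (mu k * u))%C) N) in *.
    set (Sx := csum (fun k => (a k * expi (mu k * x))%C) N) in *.
    set (Dx := csum (fun k => (a k * (Ci * mu k * expi (mu k * x)))%C) N) in *.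
    assert (Hfin : Cmod (Su - Sx - (u - x)%R * Dx) <= 2 * (K / (1 - th)) * (u - x) ^ 2).
    { unfold Su, Sx, Dx.
      replace (csum (fun k => (a k * expi (mu k * u))%C) N - csum (fun k => (a k * expi (mu k * x))%C) N
         - (u - x)%R * csum (fun k => (a k * (Ci * mu k * expi (mu k * x)))%C) N)%C
        with (csum (fun k => (a k * (expi (mu k * u) - expi (mu k * x)
            - (u - x)%R * (Ci * mu k * expi (mu k * x))))%C) N).
      - eapply Rle_trans.
        + apply (Cmod_csum_le _ (fun k => 2 * (u - x) ^ 2 * (K * th ^ k))). intros k _.
          rewrite Cmod_mult. pose proof (expi_quad (mu k) x u) as hq.
          apply Rle_trans with (Cmod (a k) * (2 * mu k ^ 2 * (u - x) ^ 2)).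
          * apply Rmult_le_compat_l; [apply Cmod_ge_0 | exact hq].
          * pose proof (H k) as hk. pose proof (Cmod_ge_0 (a k)). pose proof (pow2_ge_0 (u - x)).
            pose proof (pow2_ge_0 (mu k)).
            replace (Cmod (a k) * (2 * mu k ^ 2 * (u - x) ^ 2))
              with (2 * (u - x) ^ 2 * (Cmod (a k) * mu k ^ 2)) by ring.
            apply Rmult_le_compat_l; nra.
        + rewrite rsum_scal. pose proof (rsum_geom K th N hth hK). pose proof (pow2_ge_0 (u - x)). nra.
      - clear. induction N as [| N IH]; simpl; [ring |]. rewrite IH. ring. }
    replace (f u - f x - (u - x)%R * df x)%C with
      ((Su - Sx - (u - x)%R * Dx) + ((Sx - f x) + ((u - x)%R * (Dx - df x) - (Su - f u))))%C by ring.
    eapply Rle_trans; [apply Cmod_triangle |]. apply Rplus_le_compat; [exact Hfin |].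
    eapply Rle_trans; [apply Cmod_triangle |].
    pose proof (Cmod_minus_le ((u - x)%R * (Dx - df x)) (Su - f u)) as h5.
    rewrite Cmod_mult, Cmod_R in h5.
    set (w := K / (1 - th) * th ^ N) in *.
    assert (hw : D * w <= e).
    { apply Rle_trans with (D * (e / D)); [apply Rmult_le_compat_l; lra | right; field; lra]. }
    assert (Rabs (u - x) * Cmod (Dx - df x) <= Rabs (u - x) * w)
      by (apply Rmult_le_compat_l; [apply Rabs_pos | exact f3]).
    unfold D in hw. lra.
  - intros x hx e he.
    assert (Lip : forall u, Cmod (df u - df x) <= 2 * (K / (1 - th)) * Rabs (u - x)).
    { intros u. apply le_of_le_plus_eps. intros e' he'.
      destruct (pow_small th (K / (1 - th)) (e' / 2) hth hK2) as [N HN]; [lra |].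
      specialize (HN N (le_n N)).
      pose proof (DF u N) as f1. pose proof (DF x N) as f2.
      set (Du := csum (fun k => (a k * (Ci * mu k * expi (mu k * u)))%C) N) in *.
      set (Dx := csum (fun k => (a k * (Ci * mu k * expi (mu k * x)))%C) N) in *.
      assert (Hfin : Cmod (Du - Dx) <= 2 * (K / (1 - th)) * Rabs (u - x)).
      { unfold Du, Dx. rewrite <- csum_minus. eapply Rle_trans.
        - apply (Cmod_csum_le _ (fun k => 2 * Rabs (u - x) * (K * th ^ k))). intros k _.
          replace (a k * (Ci * mu k * expi (mu k * u)) - a k * (Ci * mu k * expi (mu k * x)))%C
            with (a k * (Ci * mu k * (expi (mu k * x) * (expi (mu k * (u - x)) - 1))))%C.
          + rewrite !Cmod_mult, Cmod_expi, Cmod_Ci, Cmod_R, !Rmult_1_l.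
            pose proof (expi_lip (mu k * (u - x))) as hl. rewrite Rabs_mult in hl.
            pose proof (H k) as hk. pose proof (Cmod_ge_0 (a k)). pose proof (Rabs_pos (u - x)).
            pose proof (Rabs_pos (mu k)).
            apply Rle_trans with (Cmod (a k) * (Rabs (mu k) * (2 * (Rabs (mu k) * Rabs (u - x))))).
            * apply Rmult_le_compat_l; [assumption |]. apply Rmult_le_compat_l; assumption.
            * replace (Cmod (a k) * (Rabs (mu k) * (2 * (Rabs (mu k) * Rabs (u - x)))))
                with (2 * Rabs (u - x) * (Cmod (a k) * Rabs (mu k) ^ 2)) by ring.
              rewrite pow2_abs. apply Rmult_le_compat_l; nra.
          + replace (mu k * u) with (mu k * x + mu k * (u - x)) by ring. rewrite expi_plus. ring.
        - rewrite rsum_scal. pose proof (rsum_geom K th N hth hK). pose proof (Rabs_pos (u - x)). nra. }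
      replace (df u - df x)%C with ((Du - Dx) + ((Dx - df x) - (Du - df u)))%C by ring.
      eapply Rle_trans; [apply Cmod_triangle |]. apply Rplus_le_compat; [exact Hfin |].
      eapply Rle_trans; [apply Cmod_minus_le |]. lra. }
    set (c := 2 * (K / (1 - th)) + 1). assert (hc : 1 <= c) by (unfold c; lra).
    exists (e / c). split; [apply Rdiv_lt_0_compat; lra |]. intros u _ hu.
    eapply Rle_trans; [apply Lip |].
    apply Rle_trans with (c * Rabs (u - x)); [unfold c; pose proof (Rabs_pos (u - x)); lra |].
    apply Rle_trans with (c * (e / c)); [apply Rmult_le_compat_l; lra | right; field; lra].
Qed.

(** The enumeration 0, -1, 1, -2, ... of Z, under which exponential decay in |j| stays exponential
    in the position. *)
Definition zk (k : nat) : Z :=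
  if Nat.even k then Z.of_nat (Nat.div2 k) else (- Z.of_nat (S (Nat.div2 k)))%Z.
Definition idx (j : Z) : nat :=
  if (0 <=? j)%Z then (2 * Z.to_nat j)%nat else (2 * Z.to_nat (- j) - 1)%nat.

Lemma zk_idx k j : zk k = j <-> k = idx j.
Proof.
  unfold zk, idx. destruct (parity_cases k) as [[i [hi h]] | [i [hi h]]]; rewrite h, hi.
  - rewrite Nat.div2_double. destruct (Z.leb_spec 0 j); lia.
  - replace (2 * i + 1)%nat with (S (2 * i)) by lia. rewrite Nat.div2_succ_double.
    destruct (Z.leb_spec 0 j); lia.
Qed.

Lemma zk_size k : (k <= 2 * Z.abs_nat (zk k))%nat /\ (2 * Z.abs_nat (zk k) <= k + 1)%nat.
Proof.
  unfold zk. destruct (parity_cases k) as [[i [hi h]] | [i [hi h]]]; rewrite h, hi.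
  - rewrite Nat.div2_double. lia.
  - replace (2 * i + 1)%nat with (S (2 * i)) by lia. rewrite Nat.div2_succ_double. lia.
Qed.

Lemma sq_le_pow2 (j : nat) : (INR j + 1) ^ 2 <= 4 * 2 ^ j.
Proof.
  assert (P : forall j, (2 <= j)%nat -> (INR j + 1) ^ 2 <= 4 * 2 ^ j).
  { intros i hi. induction hi as [| i hi IH]; [simpl; lra |].
    rewrite S_INR. simpl pow in *. assert (2 <= INR i) by (apply (le_INR 2); lia). nra. }
  destruct j as [| [| j]]; [simpl; lra | simpl; lra | apply P; lia].
Qed.

Lemma synth_bound n (X : Z -> C) : growth (1 / 4) X ->
  exists K, forall k, Cmod (X (zk k)) * (1 + freq n (zk k) ^ 2) <= K * (3 / 4) ^ k.
Proof.
  intros [K H].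
  assert (hK : 0 <= K).
  { specialize (H 0%Z). simpl in H. pose proof (Cmod_ge_0 (X 0%Z)). lra. }
  set (A := 2 + Rabs (IZR n)). assert (hA : 2 <= A) by (unfold A; pose proof (Rabs_pos (IZR n)); lra).
  exists (K * (4 * A ^ 2)). intros k. set (j := zk k). set (i := Z.abs_nat j).
  assert (hj : Rabs (IZR j) = INR i).
  { rewrite <- abs_IZR. unfold i. rewrite INR_IZR_INZ. f_equal. lia. }
  assert (hf : 1 + freq n j ^ 2 <= A ^ 2 * (INR i + 1) ^ 2).
  { assert (h : Rabs (freq n j) <= 2 * INR i + Rabs (IZR n)).
    { unfold freq. eapply Rle_trans; [apply Rabs_triang |]. rewrite Rabs_Ropp, Rabs_mult, hj.
      rewrite (Rabs_pos_eq 2) by lra. lra. }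
    rewrite <- (pow2_abs (freq n j)). pose proof (Rabs_pos (freq n j)). pose proof (pos_INR i).
    rewrite <- Rpow_mult_distr.
    apply Rle_trans with ((1 + Rabs (freq n j)) ^ 2); [nra |].
    apply pow_incr. split; [lra |]. unfold A. pose proof (Rabs_pos (IZR n)). nra. }
  pose proof (sq_le_pow2 i) as h2. specialize (H j). fold i in H.
  assert (hp4 : (1 / 4) ^ i * 2 ^ i = (1 / 2) ^ i).
  { rewrite <- Rpow_mult_distr. f_equal. lra. }
  (* The position k is at most 2 |j|, and 1 / 2 < (3 / 4)^2. *)
  assert (h3 : (1 / 2) ^ i <= (3 / 4) ^ k).
  { apply Rle_trans with ((3 / 4) ^ (2 * i)).
    - rewrite pow_mult. apply pow_incr. lra.
    - pose proof (proj1 (zk_size k)) as hk. fold j in hk. fold i in hk.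
      replace (2 * i)%nat with (k + (2 * i - k))%nat by lia. rewrite pow_add.
      rewrite <- (Rmult_1_r ((3 / 4) ^ k)) at 2.
      apply Rmult_le_compat_l; [apply pow_le; lra |].
      apply Rle_trans with (1 ^ (2 * i - k)); [apply pow_incr; lra | rewrite pow1; lra]. }
  assert (hp : 0 < (1 / 4) ^ i) by (apply pow_lt; lra).
  assert (hp2 : 0 < 2 ^ i) by (apply pow_lt; lra).
  apply Rle_trans with (K * (1 / 4) ^ i * (A ^ 2 * (4 * 2 ^ i))).
  - apply Rmult_le_compat; [apply Cmod_ge_0 | pose proof (pow2_ge_0 (freq n j)); lra | exact H |].
    eapply Rle_trans; [exact hf |]. apply Rmult_le_compat_l; [nra | exact h2].
  - replace (K * (1 / 4) ^ i * (A ^ 2 * (4 * 2 ^ i))) with (K * (4 * A ^ 2) * ((1 / 4) ^ i * 2 ^ i)) by ring.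
    rewrite hp4. apply Rmult_le_compat_l; [apply Rmult_le_pos; nra | exact h3].
Qed.

Lemma Cint_one : Cint (fun _ => RtoC 1) = RtoC PI.
Proof.
  unfold Cint. apply injective_projections; cbn [fst snd RtoC Re Im].
  - rewrite RInt_const. unfold scal. simpl. unfold mult. simpl. ring.
  - rewrite RInt_const. unfold scal. simpl. unfold mult. simpl. ring.
Qed.

Lemma coef_expi n i j :
  coef n (fun x => expi (freq n i * x)) j = if Z.eq_dec i j then RtoC PI else RtoC 0.
Proof.
  unfold coef. rewrite (Cint_ext _ (fun x => expi (2 * IZR (i - j) * x))).
  2: { intros x _. rewrite <- expi_plus. f_equal. unfold freq. rewrite minus_IZR. ring. }
  destruct (Z.eq_dec i j) as [e | ne].
  - subst j. rewrite <- Cint_one. apply Cint_ext. intros x _.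
    rewrite Z.sub_diag. replace (2 * 0 * x) with 0 by ring. apply expi_0.
  - set (mu := 2 * IZR (i - j)).
    assert (hmu : mu <> 0).
    { unfold mu. assert (IZR (i - j) <> 0) by (apply not_0_IZR; lia). lra. }
    assert (nC : (Ci * mu)%C <> 0%C).
    { apply Cmod_gt_0. rewrite Cmod_mult, Cmod_Ci, Cmod_R, Rmult_1_l. now apply Rabs_pos_lt. }
    pose proof (Cint_FTC _ _ (cderiv_expi mu)
      (ccont_mult _ _ (ccont_const (Ci * mu)) (ccont_expi mu))) as E.
    rewrite Cint_scal in E by apply ccont_expi.
    rewrite Rmult_0_r, expi_0 in E. unfold mu at 3 in E. rewrite expi_period_even in E.
    replace (Cint (fun x => expi (mu * x))) with
      (/ (Ci * mu) * (Ci * mu * Cint (fun x => expi (mu * x))))%C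
      by (rewrite Cmult_assoc, Cinv_l by exact nC; ring).
    rewrite E. ring.
Qed.

Lemma ccont_csum (a : nat -> C) (mu : nat -> R) N :
  ccont (fun x => csum (fun k => (a k * expi (mu k * x))%C) N).
Proof.
  induction N as [| N IH]; [exact (ccont_const (RtoC 0)) |]. simpl. apply ccont_plus; [exact IH |].
  apply ccont_mult; [apply ccont_const | apply ccont_expi].
Qed.

Lemma coef_csum n (a : nat -> C) (mu : nat -> R) N j :
  coef n (fun x => csum (fun k => (a k * expi (mu k * x))%C) N) j
  = csum (fun k => (a k * coef n (fun x => expi (mu k * x)) j)%C) N.
Proof.
  induction N as [| N IH].
  - simpl. rewrite (coef_ext n _ (fun x => (0 * 1)%C)) by (intros; ring).
    rewrite (coef_scal n (RtoC 0) (fun _ => RtoC 1)) by apply ccont_const. ring.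
  - simpl. rewrite coef_plus, IH, coef_scal.
    + reflexivity.
    + apply ccont_expi.
    + apply ccont_csum.
    + apply ccont_mult; [apply ccont_const | apply ccont_expi].
Qed.

Lemma expi_freq_PI_pos n j : expi (freq n j * PI) = bc n.
Proof.
  rewrite <- (expi_freq_PI n (n - j)). f_equal. unfold freq. rewrite minus_IZR. ring.
Qed.

(** The factor PI is the squared norm of the exponentials on the interval. *)
Theorem synth_exists n (X : Z -> C) : growth (1 / 4) X ->
  exists f df : R -> C, cderiv f df /\ ccont df /\ f PI = (bc n * f 0)%C /\
    forall j, coef n f j = (PI * X j)%C.
Proof.
  intros HX. destruct (synth_bound n X HX) as [K HK].
  destruct (trig_series (fun k => X (zk k)) (fun k => freq n (zk k)) K (3 / 4) ltac:(lra) HK)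
    as [f [df [F [D Cd]]]].
  exists f, df. split; [exact D | split; [exact Cd | split]].
  - assert (hK2 : 0 <= K / (1 - 3 / 4)).
    { pose proof (HK O) as h. simpl in h. pose proof (Cmod_ge_0 (X (zk 0))).
      pose proof (pow2_ge_0 (freq n (zk 0))) as h2. simpl in h2. nra. }
    apply Ceq_of_small. intros e he.
    destruct (pow_small (3 / 4) (K / (1 - 3 / 4)) (e / 2) ltac:(lra) hK2) as [N HN]; [lra |].
    specialize (HN N (le_n N)). pose proof (F PI N) as f1. pose proof (F 0 N) as f2.
    set (S1 := csum (fun k => (X (zk k) * expi (freq n (zk k) * PI))%C) N) in *.
    set (S0 := csum (fun k => (X (zk k) * expi (freq n (zk k) * 0))%C) N) in *.
    assert (E : S1 = (bc n * S0)%C).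
    { unfold S1, S0. rewrite <- csum_scal. apply csum_ext. intros k _.
      rewrite expi_freq_PI_pos, Rmult_0_r, expi_0. ring. }
    replace (f PI - bc n * f 0)%C with (- (S1 - f PI) + bc n * (S0 - f 0))%C by (rewrite E; ring).
    eapply Rle_trans; [apply Cmod_triangle |]. rewrite Cmod_opp, Cmod_mult.
    assert (Cmod (bc n) = 1) by (unfold bc; destruct (Z.even n); rewrite Cmod_R; unfold Rabs; destruct Rcase_abs; lra).
    rewrite H. lra.
  - intros j.
    assert (hK2 : 0 <= 2 * PI * (K / (1 - 3 / 4))).
    { pose proof (HK O) as h. simpl in h. pose proof (Cmod_ge_0 (X (zk 0))). pose proof PI_RGT_0.
      pose proof (pow2_ge_0 (freq n (zk 0))) as h2. simpl in h2. apply Rmult_le_pos; nra. }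
    apply Ceq_of_small. intros e he.
    destruct (pow_small (3 / 4) (2 * PI * (K / (1 - 3 / 4))) e ltac:(lra) hK2 he) as [N0 HN].
    set (N := (N0 + S (idx j))%nat). specialize (HN N ltac:(unfold N; lia)).
    set (SN := fun x => csum (fun k => (X (zk k) * expi (freq n (zk k) * x))%C) N).
    assert (ES : coef n SN j = (PI * X j)%C).
    { unfold SN. rewrite (coef_csum n (fun k => X (zk k)) (fun k => freq n (zk k))).
      rewrite (csum_ext _ (fun k => if (S k =? S (idx j))%nat then (PI * X j)%C else RtoC 0)).
      - apply csum_single. unfold N. lia.
      - intros k _. rewrite coef_expi. destruct (Z.eq_dec (zk k) j) as [e1 | e1].
        + pose proof (proj1 (zk_idx k j) e1) as e2. rewrite e2, Nat.eqb_refl.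
          rewrite <- e2, e1. ring.
        + destruct (Nat.eqb_spec (S k) (S (idx j))) as [e2 | e2]; [| ring].
          exfalso. apply e1. apply zk_idx. lia. }
    rewrite <- ES.
    assert (cf : ccont f) by apply (cderiv_ccont _ _ D).
    assert (cs : ccont SN) by (unfold SN; apply (ccont_csum (fun k => X (zk k)) (fun k => freq n (zk k)))).
    assert (cs' : ccont (fun x => (- (1) * SN x)%C)) by (apply ccont_mult; [apply ccont_const | exact cs]).
    replace (coef n f j - coef n SN j)%C with (coef n (fun x => (f x + - (1) * SN x)%C) j)
      by (rewrite coef_plus, coef_scal by assumption; ring).
    eapply Rle_trans; [| exact HN]. rewrite Rmult_assoc.
    apply Cint_bound; [apply ccont_coef; now apply ccont_plus |].
    intros x _. rewrite Cmod_mult, Cmod_expi, Rmult_1_r.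
    replace (f x + - (1) * SN x)%C with (- (SN x - f x))%C by ring. rewrite Cmod_opp. apply F.
Qed.

(** * Eigenvalues and root vectors in terms of coefficients *)

Section Operator.
Context (a A b B : C) (n : Z).
Let P := trig_pot a A.
Let Q := trig_pot b B.
Let s := bc n.

Lemma trig_pot_expi c0 c1 x :
  trig_pot c0 c1 x = (c0 * expi (2 * (-1) * x) + c1 * expi (2 * 1 * x))%C.
Proof.
  unfold trig_pot. replace (2 * (-1) * x) with (- (2 * x)) by ring.
  replace (2 * 1 * x) with (2 * x) by ring. reflexivity.
Qed.

Lemma ccont_trig_pot c0 c1 : ccont (trig_pot c0 c1).
Proof.
  apply ccont_ext with (f := fun x => (c0 * expi (2 * (-1) * x) + c1 * expi (2 * 1 * x))%C).
  - intros x _. now rewrite trig_pot_expi.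
  - apply ccont_plus; apply ccont_mult; try apply ccont_const; apply ccont_expi.
Qed.

Lemma coef_trig_pot c0 c1 f j : ccont f ->
  coef n (fun x => (trig_pot c0 c1 x * f x)%C) j
  = (c0 * coef n f (j + 1) + c1 * coef n f (j - 1))%C.
Proof.
  intros Hf.
  assert (C1 : ccont (fun x => (expi (2 * (-1) * x) * f x)%C))
    by (apply ccont_mult; [apply ccont_expi | exact Hf]).
  assert (C2 : ccont (fun x => (expi (2 * 1 * x) * f x)%C))
    by (apply ccont_mult; [apply ccont_expi | exact Hf]).
  rewrite (coef_ext n _ (fun x => (c0 * (expi (2 * (-1) * x) * f x)
    + c1 * (expi (2 * 1 * x) * f x))%C)) by (intros x _; rewrite trig_pot_expi; ring).
  rewrite coef_plus, !coef_scal by (try assumption; apply ccont_mult; try apply ccont_const; assumption).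
  pose proof (coef_shift n f j 1) as S1. pose proof (coef_shift n f j (-1)) as S2.
  simpl IZR in S1, S2. rewrite S1, S2. replace (j - -1)%Z with (j + 1)%Z by lia. reflexivity.
Qed.

Definition c2_cont (y : R -> C * C) : Prop :=
  ccont (fun x => fst (y x)) /\ ccont (fun x => snd (y x)).

Lemma dirac_cont y f : dirac P Q s y f -> c2_cont y /\ c2_cont f.
Proof.
  intros [dy [Hd [Hc [Hbc Hf]]]].
  apply is_derive_0pi_cderiv in Hd. destruct Hd as [D1 D2].
  apply continuous_on_ccont in Hc. destruct Hc as [E1 E2].
  pose proof (cderiv_ccont _ _ D1) as Y1. pose proof (cderiv_ccont _ _ D2) as Y2.
  split; split; try assumption.
  - apply ccont_ext with (f := fun x => (Ci * fst (dy x) + P x * snd (y x))%C).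
    + intros x hx. now rewrite Hf.
    + apply ccont_plus; apply ccont_mult; try apply ccont_const; try apply ccont_trig_pot; assumption.
  - apply ccont_ext with (f := fun x => (- Ci * snd (dy x) + Q x * fst (y x))%C).
    + intros x hx. now rewrite Hf.
    + apply ccont_plus; apply ccont_mult; try apply ccont_const; try apply ccont_trig_pot; assumption.
Qed.

Definition coef1 (y : R -> C * C) : Z -> C := coef n (fun x => fst (y x)).
Definition coef2 (y : R -> C * C) : Z -> C := coef n (fun x => snd (y x)).

Lemma scal_C2 (c : C) (y : C * C) : @scal C_Ring C2_C c y = ((c * fst y)%C, (c * snd y)%C).
Proof. reflexivity. Qed.

Lemma Ci_sq (z : C) : (Ci * (Ci * z) = - z)%C.
Proof. rewrite Cmult_assoc. replace (Ci * Ci)%C with (- (1))%C; [ring |].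
  apply injective_projections; simpl; ring. Qed.

Lemma dirac_coefs y f j : dirac P Q s y f ->
  (coef1 f j = - freq n j * coef1 y j + (a * coef2 y (j + 1)%Z + A * coef2 y (j - 1)%Z))%C /\
  (coef2 f j = freq n j * coef2 y j + (b * coef1 y (j + 1)%Z + B * coef1 y (j - 1)%Z))%C.
Proof.
  intros H. destruct (dirac_cont y f H) as [[Y1 Y2] _].
  destruct H as [dy [Hd [Hc [Hbc Hf]]]].
  apply is_derive_0pi_cderiv in Hd. destruct Hd as [D1 D2].
  apply continuous_on_ccont in Hc. destruct Hc as [E1 E2].
  rewrite scal_C2 in Hbc.
  assert (B1 : fst (y PI) = (bc n * fst (y 0))%C) by (rewrite Hbc; reflexivity).
  assert (B2 : snd (y PI) = (bc n * snd (y 0))%C) by (rewrite Hbc; reflexivity).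
  unfold coef1, coef2. split.
  - rewrite (coef_ext n _ (fun x => (Ci * fst (dy x) + trig_pot a A x * snd (y x))%C))
      by (intros x hx; now rewrite Hf).
    rewrite coef_plus, coef_scal, coef_trig_pot, (coef_derive n _ _ j D1 E1 B1); try assumption.
    + replace (Ci * (Ci * freq n j * coef n (fun x => fst (y x)) j))%C
        with (Ci * (Ci * (freq n j * coef n (fun x => fst (y x)) j)))%C by ring.
      rewrite Ci_sq. ring.
    + apply ccont_mult; [apply ccont_const | exact E1].
    + apply ccont_mult; [apply ccont_trig_pot | exact Y2].
  - rewrite (coef_ext n _ (fun x => (- Ci * snd (dy x) + trig_pot b B x * fst (y x))%C))
      by (intros x hx; now rewrite Hf).
    rewrite coef_plus, coef_scal, coef_trig_pot, (coef_derive n _ _ j D2 E2 B2); try assumption.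
    + replace (- Ci * (Ci * freq n j * coef n (fun x => snd (y x)) j))%C
        with (- (Ci * (Ci * (freq n j * coef n (fun x => snd (y x)) j))))%C by ring.
      rewrite Ci_sq. ring.
    + apply ccont_mult; [apply ccont_const | exact E2].
    + apply ccont_mult; [apply ccont_trig_pot | exact Y1].
Qed.

Lemma coef_zero f j : (forall x, I0pi x -> f x = RtoC 0) -> coef n f j = RtoC 0.
Proof.
  intros H. rewrite (coef_ext n f (fun x => (0 * 1)%C)).
  - rewrite (coef_scal n (RtoC 0) (fun _ => RtoC 1)) by apply ccont_const. ring.
  - intros x hx. rewrite H by exact hx. ring.
Qed.

Lemma coef_zbounded f : ccont f -> zbounded (coef n f).
Proof. intros H. destruct (coef_bounded n f H) as [K HK]. now exists K. Qed.

Lemma shifted_coefs y f (z : C) : dirac P Q s y f ->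
  let g : R -> C * C := fun x => @minus C2_C (f x) (@scal C_Ring C2_C (IZR n + z)%C (y x)) in
  c2_cont g /\
  dsol a A b B n z (coef1 y) (coef2 y) (fun j => (- coef1 g j)%C) (fun j => (- coef2 g j)%C).
Proof.
  intros H g. destruct (dirac_cont y f H) as [[Y1 Y2] [F1 F2]].
  set (lam := (IZR n + z)%C) in *.
  assert (G1 : forall x, fst (g x) = (fst (f x) + (- lam) * fst (y x))%C).
  { intros x. unfold g. rewrite scal_C2. change (fst (f x) - lam * fst (y x)
      = fst (f x) + (- lam) * fst (y x))%C. ring. }
  assert (G2 : forall x, snd (g x) = (snd (f x) + (- lam) * snd (y x))%C).
  { intros x. unfold g. rewrite scal_C2. change (snd (f x) - lam * snd (y x)
      = snd (f x) + (- lam) * snd (y x))%C. ring. }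
  assert (L1 : ccont (fun x => (- lam * fst (y x))%C)) by (apply ccont_mult; [apply ccont_const | exact Y1]).
  assert (L2 : ccont (fun x => (- lam * snd (y x))%C)) by (apply ccont_mult; [apply ccont_const | exact Y2]).
  split.
  - split.
    + apply ccont_ext with (f := fun x => (fst (f x) + (- lam) * fst (y x))%C);
        [intros; now rewrite G1 | now apply ccont_plus].
    + apply ccont_ext with (f := fun x => (snd (f x) + (- lam) * snd (y x))%C);
        [intros; now rewrite G2 | now apply ccont_plus].
  - intros j. destruct (dirac_coefs y f j H) as [E1 E2].
    assert (g1 : coef1 g j = (coef1 f j + (- lam) * coef1 y j)%C).
    { unfold coef1.
      rewrite (coef_ext n (fun x => fst (g x)) (fun x => (fst (f x) + - lam * fst (y x))%C) j
        (fun x _ => G1 x)).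
      rewrite coef_plus, coef_scal by assumption. reflexivity. }
    assert (g2 : coef2 g j = (coef2 f j + (- lam) * coef2 y j)%C).
    { unfold coef2.
      rewrite (coef_ext n (fun x => snd (g x)) (fun x => (snd (f x) + - lam * snd (y x))%C) j
        (fun x _ => G2 x)).
      rewrite coef_plus, coef_scal by assumption. reflexivity. }
    rewrite g1, g2, E1, E2. unfold freq, lam. rewrite !RtoC_mult, !RtoC_minus, !RtoC_mult.
    split; ring.
Qed.

Lemma zbounded_opp v : zbounded v -> zbounded (fun j => (- v j)%C).
Proof. intros [K H]. exists K. intros j. now rewrite Cmod_opp. Qed.

(** Induction on the rank: the coefficients of (L - lam) y belong to the kernel by induction and to
    the image of the chain operator, hence vanish by simplicity. So every root vector is an
    eigenvector. *)
Lemma root_vector_coefs (z : C) : dsimple a A b B n z ->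
  forall y, root_vector P Q s (IZR n + z)%C y ->
  c2_cont y /\ dsol a A b B n z (coef1 y) (coef2 y) zero_seq zero_seq.
Proof.
  intros HS y [k Hk]. revert y Hk. induction k as [| k IH]; intros y Hk.
  - simpl in Hk.
    assert (Z1 : forall x, I0pi x -> fst (y x) = RtoC 0) by (intros x hx; now rewrite Hk).
    assert (Z2 : forall x, I0pi x -> snd (y x) = RtoC 0) by (intros x hx; now rewrite Hk).
    split.
    + split; [apply ccont_ext with (f := fun _ => RtoC 0) | apply ccont_ext with (f := fun _ => RtoC 0)];
        try apply ccont_const; intros x hx; symmetry; auto.
    + intros j. unfold coef1, coef2. rewrite !(coef_zero _ _ Z1), !(coef_zero _ _ Z2).
      unfold zero_seq. split; ring.
  - destruct Hk as [f [Hd Hk]]. destruct (IH _ Hk) as [Gc G0].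
    destruct (dirac_cont y f Hd) as [Yc _]. destruct (shifted_coefs y f z Hd) as [_ HD].
    set (g := (fun x => @minus C2_C (f x) (@scal C_Ring C2_C (IZR n + z)%C (y x))) : R -> C * C) in *.
    split; [exact Yc |].
    assert (Z0 : forall j, (- coef1 g j)%C = RtoC 0 /\ (- coef2 g j)%C = RtoC 0).
    { apply (HS (coef1 y) (coef2 y)).
      - apply coef_zbounded, Yc.
      - apply coef_zbounded, Yc.
      - apply zbounded_opp, coef_zbounded, Gc.
      - apply zbounded_opp, coef_zbounded, Gc.
      - intros j. destruct (G0 j) as [h1 h2]. unfold zero_seq in *. split.
        + replace (RtoC 0) with (- (0))%C by ring. rewrite <- h1 at 1. ring.
        + replace (RtoC 0) with (- (0))%C by ring. rewrite <- h2 at 1. ring.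
      - exact HD. }
    intros j. destruct (HD j) as [h1 h2]. destruct (Z0 j) as [z1 z2]. rewrite h1, h2, z1, z2.
    split; reflexivity.
Qed.

(** The function with these coefficients satisfies the boundary condition. Its residual is
    continuous with zero coefficients and vanishes by completeness. *)
Lemma eigenfunction_exists (z : C) (X Y : Z -> C) : dmode a A b B n z X Y ->
  exists y : R -> C * C, ker_pow P Q s (IZR n + z)%C 1 y /\ c2_cont y /\
    forall j, coef1 y j = (PI * X j)%C /\ coef2 y j = (PI * Y j)%C.
Proof.
  intros [GX [GY H]].
  destruct (synth_exists n X GX) as [f1 [df1 [D1 [C1 [B1 K1]]]]].
  destruct (synth_exists n Y GY) as [f2 [df2 [D2 [C2 [B2 K2]]]]].
  set (y := fun x => (f1 x, f2 x)). set (dy := fun x => (df1 x, df2 x)).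
  set (f := fun x => ((Ci * df1 x + P x * f2 x)%C, (- Ci * df2 x + Q x * f1 x)%C)).
  assert (Hd : dirac P Q s y f).
  { exists dy. split; [| split; [| split]].
    - apply is_derive_0pi_cderiv. split; assumption.
    - apply continuous_on_ccont. split; assumption.
    - rewrite scal_C2. unfold y. simpl. now rewrite B1, B2.
    - intros x _. reflexivity. }
  destruct (shifted_coefs y f z Hd) as [[G1 G2] HD].
  set (g := (fun x => @minus C2_C (f x) (@scal C_Ring C2_C (IZR n + z)%C (y x))) : R -> C * C) in *.
  assert (Z0 : forall j, coef1 g j = RtoC 0 /\ coef2 g j = RtoC 0).
  { intros j. destruct (HD j) as [h1 h2]. destruct (H j) as [e1 e2]. unfold zero_seq in *.
    assert (k1 : forall i, coef1 y i = (PI * X i)%C) by apply K1.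
    assert (k2 : forall i, coef2 y i = (PI * Y i)%C) by apply K2.
    rewrite (k1 j), (k2 (j + 1)%Z), (k2 (j - 1)%Z) in h1.
    rewrite (k2 j), (k1 (j + 1)%Z), (k1 (j - 1)%Z) in h2. split.
    - replace (coef1 g j) with (- - coef1 g j)%C by ring. rewrite <- h1.
      match goal with |- ?t = _ => replace t with (- PI * ((z + RtoC (2 * IZR j)) * X j
        - a * Y (j + 1)%Z - A * Y (j - 1)%Z))%C by ring end. rewrite e1. ring.
    - replace (coef2 g j) with (- - coef2 g j)%C by ring. rewrite <- h2.
      match goal with |- ?t = _ => replace t with (- PI * ((z + RtoC (2 * (IZR n - IZR j))) * Y j
        - b * X (j + 1)%Z - B * X (j - 1)%Z))%C by ring end. rewrite e2. ring. }
  exists y. split; [| split].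
  - exists f. split; [exact Hd |]. intros x hx.
    apply injective_projections.
    + exact (coef_complete n (fun x => fst (g x)) G1 (fun j => proj1 (Z0 j)) x hx).
    + exact (coef_complete n (fun x => snd (g x)) G2 (fun j => proj2 (Z0 j)) x hx).
  - apply (dirac_cont y f Hd).
  - intros j. split; [apply K1 | apply K2].
Qed.

Lemma coef_inj f g : ccont f -> ccont g -> (forall j, coef n f j = coef n g j) ->
  forall x, I0pi x -> f x = g x.
Proof.
  intros Hf Hg H x hx.
  assert (Hg' : ccont (fun x => (- (1) * g x)%C)) by (apply ccont_mult; [apply ccont_const | exact Hg]).
  assert (E : (f x + - (1) * g x)%C = RtoC 0).
  { apply (coef_complete n (fun x => (f x + - (1) * g x)%C)); [now apply ccont_plus | | exact hx].
    intros j. rewrite coef_plus, coef_scal, H by assumption. ring. }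
  replace (f x) with ((f x + - (1) * g x) + g x)%C by ring. rewrite E. ring.
Qed.

Lemma eigenvalue_coefs (z : C) : eigenvalue P Q s (IZR n + z)%C ->
  exists X Y, zbounded X /\ zbounded Y /\ dsol a A b B n z X Y zero_seq zero_seq /\
    ~ (forall j, X j = RtoC 0 /\ Y j = RtoC 0).
Proof.
  intros [y [Hy Hd]]. destruct (dirac_cont _ _ Hd) as [[Y1 Y2] _].
  destruct (shifted_coefs _ _ z Hd) as [_ HD]. cbv beta in HD.
  exists (coef1 y), (coef2 y).
  split; [now apply coef_zbounded |]. split; [now apply coef_zbounded |]. split.
  - intros j. destruct (HD j) as [h1 h2].
    assert (Z1 : coef1 (fun x => @minus C2_C (@scal C_Ring C2_C (IZR n + z)%C (y x))
        (@scal C_Ring C2_C (IZR n + z)%C (y x))) j = RtoC 0).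
    { apply coef_zero. intros x _. now rewrite minus_eq_zero. }
    assert (Z2 : coef2 (fun x => @minus C2_C (@scal C_Ring C2_C (IZR n + z)%C (y x))
        (@scal C_Ring C2_C (IZR n + z)%C (y x))) j = RtoC 0).
    { apply coef_zero. intros x _. now rewrite minus_eq_zero. }
    rewrite h1, h2, Z1, Z2. unfold zero_seq. split; ring.
  - intros H0. apply Hy. intros x hx. apply injective_projections.
    + exact (coef_complete n (fun x => fst (y x)) Y1 (fun j => proj1 (H0 j)) x hx).
    + exact (coef_complete n (fun x => snd (y x)) Y2 (fun j => proj2 (H0 j)) x hx).
Qed.

Lemma lin_comb_1 c e x : lin_comb 1 c e x = @scal C_Ring C2_C (c 1%nat) (e 1%nat x).
Proof. exact (sum_n_n (G := C2_C) (fun j => @scal C_Ring C2_C (c j) (e j x)) 1). Qed.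

Lemma lin_comb_2 c e x : lin_comb 2 c e x =
  @plus C2_C (@scal C_Ring C2_C (c 1%nat) (e 1%nat x)) (@scal C_Ring C2_C (c 2%nat) (e 2%nat x)).
Proof.
  unfold lin_comb. rewrite sum_n_Sm by lia.
  now rewrite (sum_n_n (G := C2_C) (fun j => @scal C_Ring C2_C (c j) (e j x)) 1).
Qed.

Lemma PI_C : RtoC PI <> 0%C.
Proof. apply RtoC_neq_0. pose proof PI_RGT_0. lra. Qed.

Lemma alg_mult_one (z : C) (X Y : Z -> C) :
  dmode a A b B n z X Y -> X 0%Z = RtoC 1 -> dsimple a A b B n z ->
  (forall X' Y', zbounded X' -> zbounded Y' -> dsol a A b B n z X' Y' zero_seq zero_seq ->
     exists c : C, forall j, X' j = (c * X j)%C /\ Y' j = (c * Y j)%C) ->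
  alg_mult P Q s (IZR n + z)%C 1.
Proof.
  intros Hm X0 HS Hspan.
  destruct (eigenfunction_exists z X Y Hm) as [y [Hk [[Y1 Y2] Hc]]].
  exists (fun _ => y). split; [| split].
  - intros j _. now exists 1%nat.
  - intros c H j hj. replace j with 1%nat by lia.
    assert (E : (c 1%nat * coef1 y 0)%C = RtoC 0).
    { unfold coef1. rewrite <- coef_scal by exact Y1. apply coef_zero. intros x hx.
      specialize (H x hx). rewrite lin_comb_1, scal_C2 in H. exact (f_equal fst H). }
    rewrite (proj1 (Hc 0%Z)), X0 in E.
    replace (c 1%nat) with (c 1%nat * (PI * 1) / PI)%C by (field; apply PI_C).
    rewrite E. unfold Cdiv. ring.
  - intros y' Hy'. destruct (root_vector_coefs z HS y' Hy') as [[Y1' Y2'] Hd].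
    destruct (Hspan (coef1 y') (coef2 y')) as [k Hkk]; try (now apply coef_zbounded); [exact Hd |].
    exists (fun _ => (k / PI)%C). intros x hx. rewrite lin_comb_1, scal_C2.
    apply injective_projections; cbn [fst snd].
    + apply (coef_inj (fun x => fst (y' x)) (fun x => (k / PI * fst (y x))%C)); try assumption.
      * apply ccont_mult; [apply ccont_const | exact Y1].
      * intros j. rewrite coef_scal by exact Y1. fold (coef1 y' j). 
        change (coef n (fun x => fst (y x)) j) with (coef1 y j).
        change (coef n (fun x => fst (y' x)) j) with (coef1 y' j).
        rewrite (proj1 (Hkk j)), (proj1 (Hc j)). field. apply PI_C.
    + apply (coef_inj (fun x => snd (y' x)) (fun x => (k / PI * snd (y x))%C)); try assumption.
      * apply ccont_mult; [apply ccont_const | exact Y2].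
      * intros j. rewrite coef_scal by exact Y2.
        change (coef n (fun x => snd (y x)) j) with (coef2 y j).
        change (coef n (fun x => snd (y' x)) j) with (coef2 y' j).
        rewrite (proj2 (Hkk j)), (proj2 (Hc j)). field. apply PI_C.
Qed.

(** The values of X at 0 and of Y at n separate the two modes, which makes the eigenfunctions
    linearly independent. *)
Lemma alg_mult_two (z : C) (X1 Y1 X2 Y2 : Z -> C) :
  dmode a A b B n z X1 Y1 -> dmode a A b B n z X2 Y2 ->
  X1 0%Z = RtoC 1 -> Y1 n = RtoC 0 -> X2 0%Z = RtoC 0 -> Y2 n = RtoC 1 ->
  dsimple a A b B n z ->
  (forall X' Y', zbounded X' -> zbounded Y' -> dsol a A b B n z X' Y' zero_seq zero_seq ->
     exists c1 c2 : C, forall j, X' j = (c1 * X1 j + c2 * X2 j)%C /\ Y' j = (c1 * Y1 j + c2 * Y2 j)%C) ->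
  alg_mult P Q s (IZR n + z)%C 2.
Proof.
  intros Hm1 Hm2 e1 e2 e3 e4 HS Hspan.
  destruct (eigenfunction_exists z X1 Y1 Hm1) as [y1 [Hk1 [[A1 A2] Hc1]]].
  destruct (eigenfunction_exists z X2 Y2 Hm2) as [y2 [Hk2 [[B1 B2] Hc2]]].
  assert (Lin : forall (f g : R -> C) (c1 c2 : C) j, ccont f -> ccont g ->
     ccont (fun x => (c1 * f x + c2 * g x)%C) /\
     coef n (fun x => (c1 * f x + c2 * g x)%C) j = (c1 * coef n f j + c2 * coef n g j)%C).
  { intros f g c1 c2 j Hf Hg.
    assert (F : ccont (fun x => (c1 * f x)%C)) by (apply ccont_mult; [apply ccont_const | exact Hf]).
    assert (G : ccont (fun x => (c2 * g x)%C)) by (apply ccont_mult; [apply ccont_const | exact Hg]).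
    split; [now apply ccont_plus |]. now rewrite coef_plus, !coef_scal. }
  exists (fun k => if (k =? 1)%nat then y1 else y2). split; [| split].
  - intros j _. exists 1%nat. destruct (j =? 1)%nat; assumption.
  - intros c H.
    assert (E : forall x, I0pi x ->
      (c 1%nat * fst (y1 x) + c 2%nat * fst (y2 x))%C = RtoC 0 /\
      (c 1%nat * snd (y1 x) + c 2%nat * snd (y2 x))%C = RtoC 0).
    { intros x hx. specialize (H x hx). rewrite lin_comb_2, !scal_C2 in H.
      split; [exact (f_equal fst H) | exact (f_equal snd H)]. }
    assert (F1 : c 1%nat = RtoC 0).
    { pose proof (coef_zero _ 0 (fun x hx => proj1 (E x hx))) as Z.
      rewrite (proj2 (Lin _ _ _ _ 0%Z A1 B1)) in Z.
      change (coef n (fun x => fst (y1 x)) 0) with (coef1 y1 0) in Z.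
      change (coef n (fun x => fst (y2 x)) 0) with (coef1 y2 0) in Z.
      rewrite (proj1 (Hc1 0%Z)), (proj1 (Hc2 0%Z)), e1, e3 in Z.
      replace (c 1%nat) with ((c 1%nat * (PI * 1) + c 2%nat * (PI * 0)) / PI)%C by (field; apply PI_C).
      rewrite Z. unfold Cdiv. ring. }
    assert (F2 : c 2%nat = RtoC 0).
    { pose proof (coef_zero _ n (fun x hx => proj2 (E x hx))) as Z.
      rewrite (proj2 (Lin _ _ _ _ n A2 B2)) in Z.
      change (coef n (fun x => snd (y1 x)) n) with (coef2 y1 n) in Z.
      change (coef n (fun x => snd (y2 x)) n) with (coef2 y2 n) in Z.
      rewrite (proj2 (Hc1 n)), (proj2 (Hc2 n)), e2, e4 in Z.
      replace (c 2%nat) with ((c 1%nat * (PI * 0) + c 2%nat * (PI * 1)) / PI)%C by (field; apply PI_C).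
      rewrite Z. unfold Cdiv. ring. }
    intros j hj. assert (hj' : (j = 1 \/ j = 2)%nat) by lia. destruct hj'; subst j; assumption.
  - intros y' Hy'. destruct (root_vector_coefs z HS y' Hy') as [[Y1' Y2'] Hd].
    destruct (Hspan (coef1 y') (coef2 y')) as [k1 [k2 Hkk]]; try (now apply coef_zbounded); [exact Hd |].
    exists (fun k => if (k =? 1)%nat then (k1 / PI)%C else (k2 / PI)%C). intros x hx.
    rewrite lin_comb_2, !scal_C2. simpl Nat.eqb. cbv iota.
    apply injective_projections.
    + change (fst (y' x) = (k1 / PI * fst (y1 x) + k2 / PI * fst (y2 x))%C).
      apply (coef_inj (fun x => fst (y' x))
        (fun x => (k1 / PI * fst (y1 x) + k2 / PI * fst (y2 x))%C)); try assumption.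
      * apply (Lin _ _ _ _ 0%Z A1 B1).
      * intros j. rewrite (proj2 (Lin _ _ _ _ j A1 B1)).
        change (coef1 y' j = (k1 / PI * coef1 y1 j + k2 / PI * coef1 y2 j)%C).
        rewrite (proj1 (Hkk j)), (proj1 (Hc1 j)), (proj1 (Hc2 j)). field. apply PI_C.
    + change (snd (y' x) = (k1 / PI * snd (y1 x) + k2 / PI * snd (y2 x))%C).
      apply (coef_inj (fun x => snd (y' x))
        (fun x => (k1 / PI * snd (y1 x) + k2 / PI * snd (y2 x))%C)); try assumption.
      * apply (Lin _ _ _ _ 0%Z A2 B2).
      * intros j. rewrite (proj2 (Lin _ _ _ _ j A2 B2)).
        change (coef2 y' j = (k1 / PI * coef2 y1 j + k2 / PI * coef2 y2 j)%C).
        rewrite (proj2 (Hkk j)), (proj2 (Hc1 j)), (proj2 (Hc2 j)). field. apply PI_C.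
Qed.

End Operator.

(** * Eigenvalue pairs and gaps *)

Lemma harm_log_bound (m : nat) : (3 <= m)%nat ->
  harm m ^ 2 / INR (2 * m + 1) ^ 2 <= ln (INR m) ^ 2 / INR m ^ 2.
Proof.
  intros hm. assert (hm' : 3 <= INR m) by (replace 3 with (INR 3) by (simpl; lra); apply le_INR; lia).
  pose proof (harm_le_ln m ltac:(lia)) as h1. pose proof (harm_ge_1 m ltac:(lia)) as h2.
  assert (hl : 1 <= ln (INR m)).
  { pose proof exp_le_3. rewrite <- (ln_exp 1). apply ln_le; [apply exp_pos | lra]. }
  assert (hN : 2 * INR m <= INR (2 * m + 1)) by (inr; lra).
  apply Rle_trans with ((2 * ln (INR m)) ^ 2 / (2 * INR m) ^ 2).
  - apply Rmult_le_compat.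
    + apply pow2_ge_0.
    + left. apply Rinv_0_lt_compat. apply pow_lt. lra.
    + apply pow_incr. lra.
    + apply Rinv_le_contravar; [apply pow_lt; lra | apply pow_incr; lra].
  - right. field. lra.
Qed.

(** Two square roots of D differ by a sign, which the alternative between G and - G absorbs. *)
Lemma gap_formula_intro (gamma D W r : C) (m : nat) (eps : R) :
  (W ^ 2 = D)%C -> Cmod r <= eps ->
  (let G := (2 * (W / (4 ^ (2 * m) * INR (fact m) ^ 2)) * (1 + r))%C in
   gamma = G \/ gamma = (- G)%C) ->
  gap_formula gamma D m eps.
Proof.
  intros hW hr hg w hw. exists r. split; [exact hr |]. cbv zeta in *.
  assert (hs : w = W \/ w = (- W)%C).
  { assert (h : ((w - W) * (w + W) = 0)%C).
    { replace ((w - W) * (w + W))%C with (w ^ 2 - W ^ 2)%C by ring. rewrite hw, hW. ring. }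
    destruct (excluded_middle_informative ((w - W)%C = 0%C)) as [h0 | h0].
    - left. replace w with (w - W + W)%C by ring. rewrite h0. ring.
    - right. replace w with (((w - W) * (w + W)) / (w - W) - W)%C by (field; exact h0).
      rewrite h. unfold Cdiv. ring. }
  destruct hs as [-> | ->]; [exact hg |].
  set (G := (2 * (W / (4 ^ (2 * m) * INR (fact m) ^ 2)) * (1 + r))%C) in *.
  assert (E : (2 * (- W / (4 ^ (2 * m) * INR (fact m) ^ 2)) * (1 + r))%C = (- G)%C)
    by (unfold G, Cdiv; ring).
  rewrite E. replace (- - G)%C with G by ring. tauto.
Qed.

Lemma order_pair (x y : C) :
  exists u v, ((u = x /\ v = y) \/ (u = y /\ v = x)) /\
    (Re u < Re v \/ (Re u = Re v /\ Im u <= Im v)).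
Proof.
  destruct (Rtotal_order (Re x) (Re y)) as [h | [h | h]].
  - exists x, y. auto.
  - destruct (Rle_lt_dec (Im x) (Im y)) as [g | g].
    + exists x, y. auto.
    + exists y, x. split; [now right |]. right. split; [now symmetry | lra].
  - exists y, x. auto.
Qed.

(** All constants that depend on a, A, b, B only. The choice th = 1 / (4 R0) makes the modes decay
    like 4^(-|j|) after undoing the change of variables, and X is the threshold for |n|. *)
Record setting (a A b B c d : C) (R0 th Ma M X : R) (om om' : Z -> C) : Prop := {
  st_c : (c ^ 2 = a * B)%C;
  st_d : (d ^ 2 = A * b)%C;
  st_nc : c <> 0%C;
  st_nd : d <> 0%C;
  st_ga : gauge a A b B c d R0 om;
  st_ga' : gauge B b A a c d R0 om';
  st_R0 : 1 <= R0;
  st_th : R0 * th = 1 / 4;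
  st_Ma : 1 <= Ma;
  st_a : Cmod a <= Ma;
  st_A : Cmod A <= Ma;
  st_b : Cmod b <= Ma;
  st_B : Cmod B <= Ma;
  st_M : 1 <= M;
  st_cM : Cmod c <= M;
  st_dM : Cmod d <= M;
  st_X1 : 100 * M ^ 2 / th ^ 2 <= X;
  st_X2 : 3000 * M ^ 10 <= X;
  st_X3 : 200 * Ma ^ 2 <= X
}.

Arguments st_c {a A b B c d R0 th Ma M X om om'}.
Arguments st_d {a A b B c d R0 th Ma M X om om'}.
Arguments st_nc {a A b B c d R0 th Ma M X om om'}.
Arguments st_nd {a A b B c d R0 th Ma M X om om'}.
Arguments st_ga {a A b B c d R0 th Ma M X om om'}.
Arguments st_ga' {a A b B c d R0 th Ma M X om om'}.
Arguments st_R0 {a A b B c d R0 th Ma M X om om'}.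
Arguments st_th {a A b B c d R0 th Ma M X om om'}.
Arguments st_Ma {a A b B c d R0 th Ma M X om om'}.
Arguments st_a {a A b B c d R0 th Ma M X om om'}.
Arguments st_A {a A b B c d R0 th Ma M X om om'}.
Arguments st_b {a A b B c d R0 th Ma M X om om'}.
Arguments st_B {a A b B c d R0 th Ma M X om om'}.
Arguments st_M {a A b B c d R0 th Ma M X om om'}.
Arguments st_cM {a A b B c d R0 th Ma M X om om'}.
Arguments st_dM {a A b B c d R0 th Ma M X om om'}.
Arguments st_X1 {a A b B c d R0 th Ma M X om om'}.
Arguments st_X2 {a A b B c d R0 th Ma M X om om'}.
Arguments st_X3 {a A b B c d R0 th Ma M X om om'}.

Lemma setting_exists (a A b B : C) : a <> 0%C -> A <> 0%C -> b <> 0%C -> B <> 0%C ->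
  exists c d R0 th Ma M X om om', setting a A b B c d R0 th Ma M X om om'.
Proof.
  intros na nA nb nB.
  destruct (Csqrt_exists (a * B)%C) as [c hc]. destruct (Csqrt_exists (A * b)%C) as [d hd].
  assert (nc : c <> 0%C).
  { intros h. apply (Cmult_neq_0 a B na nB). rewrite <- hc, h. ring. }
  assert (nd : d <> 0%C).
  { intros h. apply (Cmult_neq_0 A b nA nb). rewrite <- hd, h. ring. }
  set (R0 := 1 + (Cmod (c / a) + Cmod (a / c) + Cmod (d / b) + Cmod (b / d)
    + Cmod (c / B) + Cmod (B / c) + Cmod (d / A) + Cmod (A / d))).
  pose proof (Cmod_ge_0 (c / a)). pose proof (Cmod_ge_0 (a / c)).
  pose proof (Cmod_ge_0 (d / b)). pose proof (Cmod_ge_0 (b / d)).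
  pose proof (Cmod_ge_0 (c / B)). pose proof (Cmod_ge_0 (B / c)).
  pose proof (Cmod_ge_0 (d / A)). pose proof (Cmod_ge_0 (A / d)).
  destruct (symmetrize a A b B c d na nb nc nd) with (R0 := R0) as [om [o1 [o2 [o3 [o4 o5]]]]];
    try (unfold R0; lra); [exact hc | rewrite hd; ring |].
  destruct (symmetrize B b A a c d nB nA nc nd) with (R0 := R0) as [om' [p1 [p2 [p3 [p4 p5]]]]];
    try (unfold R0; lra); [rewrite hc; ring | exact hd |].
  assert (hR0 : 1 <= R0) by (unfold R0; lra).
  pose proof (Cmod_ge_0 a). pose proof (Cmod_ge_0 A). pose proof (Cmod_ge_0 b).
  pose proof (Cmod_ge_0 B). pose proof (Cmod_ge_0 c). pose proof (Cmod_ge_0 d).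
  set (th := 1 / (4 * R0)). set (Ma := 1 + (Cmod a + Cmod A + Cmod b + Cmod B)).
  set (M := 1 + (Cmod c + Cmod d)).
  assert (hth : 0 < th) by (apply Rdiv_lt_0_compat; lra).
  assert (hM : 1 <= M) by (unfold M; lra).
  assert (h1 : 0 <= 100 * M ^ 2 / th ^ 2) by (left; apply Rdiv_lt_0_compat; nra).
  assert (h2 : 0 <= 3000 * M ^ 10) by (assert (0 < M ^ 10) by (apply pow_lt; lra); lra).
  assert (h3 : 0 <= 200 * Ma ^ 2) by (pose proof (pow2_ge_0 Ma); lra).
  exists c, d, R0, th, Ma, M, (100 * M ^ 2 / th ^ 2 + 3000 * M ^ 10 + 200 * Ma ^ 2), om, om'.
  constructor; try assumption; try (unfold M; lra); try (unfold Ma; lra); try lra.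
  - constructor; assumption.
  - constructor; assumption.
  - unfold th. field. lra.
Qed.

Section Final.
Context (a A b B c d : C) (R0 th Ma M X : R) (om om' : Z -> C)
  (St : setting a A b B c d R0 th Ma M X om om').

Let P := trig_pot a A.
Let Q := trig_pot b B.
Definition Kfin : R := 28 * M ^ 10 + Kgap M th.

Lemma setting_big (N : nat) : X < INR N -> big M th R0 N.
Proof.
  intros hN. destruct St. constructor; try assumption.
  - split.
    + nra.
    + assert (0 < R0) by lra. assert (0 < th) by nra. nra.
  - lra.
  - assert (0 < th) by nra.
    apply Rle_trans with (100 * M ^ 2 / th ^ 2 * th ^ 2); [right; field; lra |].
    apply Rmult_le_compat_r; [apply pow2_ge_0 | lra].
Qed.

Lemma lambda_zeta n z : 
  (IZR n + z - lambda_approx a A b B n)%C = (z - zeta_approx c d n)%C.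
Proof.
  unfold lambda_approx, zeta_approx. rewrite (st_c St),
    (st_d St). unfold Cdiv. ring.
Qed.

Lemma M_powers : M ^ 4 <= M ^ 10 /\ 1 <= M ^ 4.
Proof.
  pose proof (st_M St). split.
  - apply Rle_pow; [assumption | lia].
  - rewrite <- (pow1 4). apply pow_incr. lra.
Qed.

Lemma Kfin_bounds : 28 * M ^ 10 <= Kfin /\ Kgap M th <= Kfin /\ 0 <= Kgap M th.
Proof.
  pose proof M_powers. unfold Kfin, Kgap.
  assert (0 < th) by (pose proof (st_th St);
    pose proof (st_R0 St); nra).
  assert (0 < 64 * M ^ 4 / th ^ 2) by (apply Rdiv_lt_0_compat; nra).
  lra.
Qed.

Lemma opp_opp_modes n L : modes (- - c) (- - d) th R0 n L -> modes c d th R0 n L.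
Proof. now replace (- - c)%C with c by ring; replace (- - d)%C with d by ring. Qed.

Definition near (n : Z) (z : C) : Prop :=
  Cmod (z - zeta_approx c d n) <= Kfin / IZR (Z.abs n) ^ 3.

Lemma near_flip n z : n <> 0%Z ->
  Cmod (z - zeta_approx (- d) (- c) (- n)) <= Kfin / IZR (Z.abs n) ^ 3 -> near n (- z).
Proof.
  intros hn h. unfold near. rewrite zeta_approx_flip in h by exact hn.
  replace (- z - zeta_approx c d n)%C with (- (z - - zeta_approx c d n))%C by ring.
  now rewrite Cmod_opp.
Qed.

Lemma bound_pow3 (N : nat) n (x : R) : IZR (Z.abs n) = INR N -> X < INR N ->
  x <= 28 * M ^ 10 / INR N ^ 3 -> x <= Kfin / IZR (Z.abs n) ^ 3.
Proof.
  intros e hN hx. rewrite e. eapply Rle_trans; [exact hx |].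
  assert (0 < INR N).
  { pose proof (st_X3 St). pose proof (pow2_ge_0 Ma). lra. }
  apply Rmult_le_compat_r; [left; apply Rinv_0_lt_compat, pow_lt; assumption | apply Kfin_bounds].
Qed.

Lemma chain_even n : Z.even n = true -> X < IZR (Z.abs n) ->
  exists z g, modes c d th R0 n ((z, g) :: nil) /\ near n z.
Proof.
  intros hn hX. pose proof M_powers as hM.
  pose proof (st_cM St) as hc.
  pose proof (st_dM St) as hd.
  pose proof (st_X2 St) as hX2.
  assert (hn0 : n <> 0%Z).
  { intros e. rewrite e in hX. simpl in hX. lra. }
  apply Z.even_spec in hn. destruct hn as [k hk].
  set (p := Z.abs_nat k).
  assert (hp : Z.of_nat (2 * p) = Z.abs n) by (unfold p; lia).
  assert (hN : IZR (Z.abs n) = INR (2 * p)) by (rewrite <- hp; now rewrite <- INR_IZR_INZ).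
  rewrite hN in hX. pose proof (setting_big _ hX) as hb.
  assert (h400 : 400 * M ^ 4 <= INR (2 * p)) by lra.
  destruct (Z_le_gt_dec 0 n) as [h | h].
  - destruct (modes_even c d M th R0 p hb hc hd h400) as [z [g [Hm Ha]]].
    exists z, g. rewrite hp, Z.abs_eq in Hm by lia. split; [exact Hm |].
    unfold near. apply (bound_pow3 _ _ _ hN hX). unfold zeta_approx.
    rewrite Z.abs_eq in hN by lia. rewrite hN. exact Ha.
  - rewrite <- Cmod_opp in hc, hd.
    destruct (modes_even (- d) (- c) M th R0 p hb hd hc h400) as [z [g [Hm Ha]]].
    apply modes_flip, opp_opp_modes in Hm. rewrite hp, Z.abs_neq, Z.opp_involutive in Hm by lia.
    exists (- z)%C, (fun j => g (- j)%Z). split; [exact Hm |].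
    apply near_flip; [exact hn0 |]. apply (bound_pow3 _ _ _ hN hX). unfold zeta_approx.
    rewrite Z.abs_neq in hN by lia. rewrite hN. exact Ha.
Qed.

(** Square roots of the two products under the radicals, one for positive and one for negative n. *)
Definition Wpos (m : nat) : C := (c ^ (m + 1) * d ^ m)%C.
Definition Wneg (m : nat) : C := ((- d) ^ (m + 1) * (- c) ^ m)%C.

Lemma Wpos_sq m : (Wpos m ^ 2 = (A * b) ^ m * (a * B) ^ (m + 1))%C.
Proof.
  unfold Wpos. rewrite <- (st_c St), <- (st_d St).
  rewrite <- !Cpow_mult_r, Cpow_mult_l, <- !Cpow_mult_r.
  rewrite (Nat.mul_comm (m + 1)), (Nat.mul_comm m). ring.
Qed.

Lemma Wneg_sq m : (Wneg m ^ 2 = (A * b) ^ (m + 1) * (a * B) ^ m)%C.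
Proof.
  unfold Wneg. rewrite <- (st_c St), <- (st_d St).
  replace (c ^ 2)%C with ((- c) ^ 2)%C by ring. replace (d ^ 2)%C with ((- d) ^ 2)%C by ring.
  rewrite <- !Cpow_mult_r, Cpow_mult_l, <- !Cpow_mult_r.
  rewrite (Nat.mul_comm (m + 1)), (Nat.mul_comm m). reflexivity.
Qed.

Lemma chain_odd n m : (n = Z.of_nat (2 * m + 1) \/ n = - Z.of_nat (2 * m + 1))%Z ->
  X < IZR (Z.abs n) ->
  exists zp gp zm gm r, modes c d th R0 n ((zp, gp) :: (zm, gm) :: nil) /\ zp <> zm /\
    near n zp /\ near n zm /\ Cmod r <= Kfin * (ln (INR m) ^ 2 / INR m ^ 2) /\
    let G := (fun W : C => 2 * (W / (4 ^ (2 * m) * INR (fact m) ^ 2)) * (1 + r))%C in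
    ((0 < n)%Z -> (zp - zm)%C = G (Wpos m)) /\
    ((n < 0)%Z -> (zp - zm)%C = (- G (Wneg m))%C).
Proof.
  intros hn hX. pose proof M_powers as hM.
  pose proof (st_cM St) as hc.
  pose proof (st_dM St) as hd.
  pose proof (st_nc St) as nc.
  pose proof (st_nd St) as nd.
  pose proof (st_X2 St) as hX2.
  assert (hp : Z.abs n = Z.of_nat (2 * m + 1)) by lia.
  assert (hN : IZR (Z.abs n) = INR (2 * m + 1)) by (rewrite hp; now rewrite <- INR_IZR_INZ).
  rewrite hN in hX. pose proof (setting_big _ hX) as hb.
  assert (hbig : 3000 * M ^ 10 <= INR (2 * m + 1)) by lra.
  assert (hm3 : (3 <= m)%nat).
  { apply INR_le. replace (INR 3) with 3 by (simpl; lra). inr. lra. }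
  assert (hr : forall r, Cmod r <= Kgap M th * (harm m ^ 2 / INR (2 * m + 1) ^ 2) ->
     Cmod r <= Kfin * (ln (INR m) ^ 2 / INR m ^ 2)).
  { intros r h. eapply Rle_trans; [exact h |]. destruct Kfin_bounds as [k1 [k2 k3]].
    apply Rmult_le_compat; [exact k3 | | exact k2 | now apply harm_log_bound].
    apply Rmult_le_pos; [apply pow2_ge_0 | left; apply Rinv_0_lt_compat, pow_lt; lra]. }
  destruct hn as [hn | hn].
  - destruct (modes_odd_pos c d M th R0 m hb hc hd hbig nc nd)
      as [zp [gp [zm [gm [Hm [Hne [Ap [Am [r [Hr Hg]]]]]]]]]].
    rewrite <- hn in Hm, Ap, Am.
    exists zp, gp, zm, gm, r. split; [exact Hm |]. split; [exact Hne |].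
    split; [| split; [| split; [| split]]].
    + now apply (bound_pow3 _ _ _ hN hX).
    + now apply (bound_pow3 _ _ _ hN hX).
    + now apply hr.
    + intros _. exact Hg.
    + intros. lia.
  - assert (nc' : (- c)%C <> 0%C) by (intros h; apply nc; replace c with (- - c)%C by ring; rewrite h; ring).
    assert (nd' : (- d)%C <> 0%C) by (intros h; apply nd; replace d with (- - d)%C by ring; rewrite h; ring).
    rewrite <- Cmod_opp in hc, hd.
    destruct (modes_odd_pos (- d) (- c) M th R0 m hb hd hc hbig nd' nc')
      as [zp [gp [zm [gm [Hm [Hne [Ap [Am [r [Hr Hg]]]]]]]]]].
    apply modes_flip, opp_opp_modes in Hm.
    replace (Z.of_nat (2 * m + 1)) with (- n)%Z in Hm, Ap, Am by lia.
    rewrite Z.opp_involutive in Hm.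
    exists (- zp)%C, (fun j => gp (- j)%Z), (- zm)%C, (fun j => gm (- j)%Z), r.
    split; [exact Hm |]. split; [| split; [| split; [| split; [| split]]]].
    + intros h. apply Hne. replace zp with (- - zp)%C by ring. rewrite h. ring.
    + apply near_flip; [lia |]. now apply (bound_pow3 _ _ _ hN hX).
    + apply near_flip; [lia |]. now apply (bound_pow3 _ _ _ hN hX).
    + now apply hr.
    + intros. lia.
    + intros _. replace (- zp - - zm)%C with (- (zp - zm))%C by ring. rewrite Hg. reflexivity.
Qed.

Lemma eigenvalue_shift n lam : eigenvalue P Q (bc n) lam ->
  exists z, lam = (IZR n + z)%C /\ Cmod z = Cmod (lam - IZR n) /\
  eigenvalue P Q (bc n) (IZR n + z)%C.
Proof.
  intros h. exists (lam - IZR n)%C. assert (E : (IZR n + (lam - IZR n))%C = lam) by ring.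
  rewrite E. auto.
Qed.

Lemma shift_sub n z : (IZR n + z - IZR n)%C = z.
Proof. ring. Qed.

Definition good (n : Z) (lm lp : C) : Prop :=
  eigen_pair P Q n lm lp /\
  Cmod (lm - lambda_approx a A b B n) <= Kfin / IZR (Z.abs n) ^ 3 /\
  Cmod (lp - lambda_approx a A b B n) <= Kfin / IZR (Z.abs n) ^ 3 /\
  (Z.even n = true -> (lp - lm)%C = 0%C) /\
  (forall m : nat, let eps := Kfin * (ln (INR m) ^ 2 / INR m ^ 2) in
    (n = 2 * Z.of_nat m + 1 -> 
      gap_formula (lp - lm) ((A * b) ^ m * (a * B) ^ (m + 1)) m eps)%Z /\
    (n = - (2 * Z.of_nat m + 1) -> 
      gap_formula (lp - lm) ((A * b) ^ (m + 1) * (a * B) ^ m) m eps)%Z).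

Lemma good_even n : Z.even n = true -> X < IZR (Z.abs n) -> exists lm lp, good n lm lp.
Proof.
  intros hn hX. destruct (chain_even n hn hX) as [z [g [Hm Hnear]]].
  pose proof (mode_z (proj1 Hm z g (or_introl eq_refl))) as hz.
  destruct (dirac_even a A b B c d R0 th om om' (st_ga St) (st_ga' St) (st_R0 St) (st_th St) n z g hn Hm)
    as [X1 [Y1 [X2 [Y2 [D1 [D2 [e1 [e2 [e3 [e4 [Span Simple]]]]]]]]]]].
  exists (IZR n + z)%C, (IZR n + z)%C.
  assert (Ap : Cmod (IZR n + z - lambda_approx a A b B n) <= Kfin / IZR (Z.abs n) ^ 3)
    by (rewrite lambda_zeta; exact Hnear).
  split; [| split; [exact Ap | split; [exact Ap | split]]].
  - split; [now rewrite shift_sub |]. split; [now rewrite shift_sub |]. split; [| split; [| split]].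
    + intros lam hlam Hev. destruct (eigenvalue_shift n lam Hev) as [z' [E1 [E2 E3]]].
      rewrite <- E2 in hlam.
      destruct (eigenvalue_coefs a A b B n z' E3) as [U [V [HU [HV [HD Hnz]]]]].
      destruct (Span z' U V ltac:(lra) HU HV HD) as [Z | [Ez _]]; [contradiction |].
      left. now rewrite E1, Ez.
    + intros h. exfalso. now apply h.
    + intros _. apply (alg_mult_two a A b B n z X1 Y1 X2 Y2); try assumption.
      intros U V HU HV HD. destruct (Span z U V ltac:(lra) HU HV HD) as [Z | [_ S]].
      * exists (RtoC 0), (RtoC 0). intros j. destruct (Z j) as [z1 z2]. rewrite z1, z2. split; ring.
      * exists (U 0%Z), (V n). exact S.
    + right. split; [reflexivity | lra].
  - intros _. ring.
  - intros m. cbv zeta. split; intros e; exfalso; rewrite e in hn;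
      rewrite ?Z.even_opp in hn; rewrite Z.add_comm, Z.even_add_mul_2 in hn; discriminate.
Qed.

Lemma good_odd n : Z.even n = false -> X < IZR (Z.abs n) -> exists lm lp, good n lm lp.
Proof.
  intros hn hX. assert (hodd : Z.odd n = true) by (rewrite <- Z.negb_even, hn; reflexivity).
  assert (hm : exists m : nat, (n = Z.of_nat (2 * m + 1) \/ n = - Z.of_nat (2 * m + 1))%Z).
  { apply Z.odd_spec in hodd. destruct hodd as [k hk]. destruct (Z_le_gt_dec 0 n).
    - exists (Z.to_nat k). left. lia.
    - exists (Z.to_nat (- k - 1)). right. lia. }
  destruct hm as [m hm].
  destruct (chain_odd n m hm hX) as [zp [gp [zm [gm [r [Hm [Hne [Np [Nm [Hr [Gp Gn]]]]]]]]]]].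
  pose proof (mode_z (proj1 Hm zp gp (or_introl eq_refl))) as hzp.
  pose proof (mode_z (proj1 Hm zm gm (or_intror (or_introl eq_refl)))) as hzm.
  pose proof (st_X3 St) as hX3.
  pose proof Wpos_sq as Wp. pose proof Wneg_sq as Wn.
  assert (hN : 200 * Ma ^ 2 <= IZR (Z.abs n)) by lra.
  assert (Dd : exists Xp Yp Xm Ym, dmode a A b B n zp Xp Yp /\ dmode a A b B n zm Xm Ym /\
    Xp 0%Z = RtoC 1 /\ Xm 0%Z = RtoC 1 /\
    (forall z' X Y, Cmod z' <= 1 / 2 -> zbounded X -> zbounded Y ->
      dsol a A b B n z' X Y zero_seq zero_seq ->
      (forall j, X j = RtoC 0 /\ Y j = RtoC 0) \/
      (z' = zp /\ forall j, X j = (X 0%Z * Xp j)%C /\ Y j = (X 0%Z * Yp j)%C) \/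
      (z' = zm /\ forall j, X j = (X 0%Z * Xm j)%C /\ Y j = (X 0%Z * Ym j)%C)) /\
    dsimple a A b B n zp /\ dsimple a A b B n zm).
  { now apply (dirac_odd a A b B c d R0 th Ma om (st_ga St) (st_R0 St) (st_th St) (st_Ma St)
      (st_a St) (st_A St) (st_b St) (st_B St) n zp zm gp gm). }
  destruct Dd as [Xp [Yp [Xm [Ym [D1 [D2 [e1 [e2 [Span [S1 S2]]]]]]]]]].
  assert (Mp : alg_mult P Q (bc n) (IZR n + zp)%C 1).
  { apply (alg_mult_one a A b B n zp Xp Yp); try assumption.
    intros U V HU HV HD. destruct (Span zp U V ltac:(lra) HU HV HD) as [Z | [[_ S] | [E _]]].
    - exists (RtoC 0). intros j. destruct (Z j) as [z1 z2]. rewrite z1, z2. split; ring.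
    - now exists (U 0%Z).
    - contradiction. }
  assert (Mm : alg_mult P Q (bc n) (IZR n + zm)%C 1).
  { apply (alg_mult_one a A b B n zm Xm Ym); try assumption.
    intros U V HU HV HD. destruct (Span zm U V ltac:(lra) HU HV HD) as [Z | [[E _] | [_ S]]].
    - exists (RtoC 0). intros j. destruct (Z j) as [z1 z2]. rewrite z1, z2. split; ring.
    - exfalso. apply Hne. now symmetry.
    - now exists (U 0%Z). }
  assert (Loc : forall lam, Cmod (lam - IZR n) < 1 / 2 -> eigenvalue P Q (bc n) lam ->
     lam = (IZR n + zp)%C \/ lam = (IZR n + zm)%C).
  { intros lam hlam Hev. destruct (eigenvalue_shift n lam Hev) as [z' [E1 [E2 E3]]].
    rewrite <- E2 in hlam.
    destruct (eigenvalue_coefs a A b B n z' E3) as [U [V [HU [HV [HD Hnz]]]]].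
    destruct (Span z' U V ltac:(lra) HU HV HD) as [Z | [[Ez _] | [Ez _]]]; [contradiction | |].
    - left. now rewrite E1, Ez.
    - right. now rewrite E1, Ez. }
  assert (Ap : Cmod (IZR n + zp - lambda_approx a A b B n) <= Kfin / IZR (Z.abs n) ^ 3)
    by (rewrite lambda_zeta; exact Np).
  assert (Am : Cmod (IZR n + zm - lambda_approx a A b B n) <= Kfin / IZR (Z.abs n) ^ 3)
    by (rewrite lambda_zeta; exact Nm).
  assert (Hne' : (IZR n + zp)%C <> (IZR n + zm)%C).
  { intros h. apply Hne. replace zp with (IZR n + zp - IZR n)%C by ring. rewrite h. ring. }
  assert (hzp' : Cmod (IZR n + zp - IZR n) < 1 / 2) by now rewrite shift_sub.
  assert (hzm' : Cmod (IZR n + zm - IZR n) < 1 / 2) by now rewrite shift_sub.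
  destruct (order_pair (IZR n + zp)%C (IZR n + zm)%C) as [lm [lp [Huv Hord]]].
  exists lm, lp.
  assert (Hgap : (lp - lm)%C = (zp - zm)%C \/ (lp - lm)%C = (- (zp - zm))%C).
  { destruct Huv as [[-> ->] | [-> ->]]; [right | left]; ring. }
  split; [| split; [| split; [| split]]].
  - destruct Huv as [[-> ->] | [-> ->]].
    + split; [exact hzp' |]. split; [exact hzm' |]. split; [exact Loc |].
      split; [intros _; now split |]. split; [intros h; contradiction | exact Hord].
    + split; [exact hzm' |]. split; [exact hzp' |].
      split; [intros lam h1 h2; destruct (Loc lam h1 h2); auto |].
      split; [intros _; now split |].
      split; [intros h; exfalso; apply Hne'; now symmetry | exact Hord].
  - destruct Huv as [[-> ->] | [-> ->]]; assumption.
  - destruct Huv as [[-> ->] | [-> ->]]; assumption.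
  - rewrite hn. discriminate.
  - intros m' eps. split; intros e.
    + assert (m' = m) by lia. subst m'.
      apply gap_formula_intro with (Wpos m) r; [apply Wp | exact Hr |].
      cbv zeta. rewrite (Gp ltac:(lia)) in Hgap. exact Hgap.
    + assert (m' = m) by lia. subst m'.
      apply gap_formula_intro with (Wneg m) r; [apply Wn | exact Hr |].
      cbv zeta. rewrite (Gn ltac:(lia)) in Hgap.
      match goal with |- _ = ?G \/ _ => replace (- - G)%C with G in Hgap by ring end. tauto.
Qed.

End Final.

Theorem theorem17 :
  forall a A b B : C,
    a <> 0 -> A <> 0 -> b <> 0 -> B <> 0 ->
    exists (lm lp : Z -> C) (N0 : Z) (K : R),
      (forall n : Z, (N0 < Z.abs n)%Z ->
         eigen_pair (trig_pot a A) (trig_pot b B) n (lm n) (lp n) /\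
         Cmod (lm n - lambda_approx a A b B n) <= K / IZR (Z.abs n) ^ 3 /\
         Cmod (lp n - lambda_approx a A b B n) <= K / IZR (Z.abs n) ^ 3 /\
         (Z.even n = true -> (lp n - lm n)%C = 0)) /\
      (forall m : nat, (N0 < 2 * Z.of_nat m + 1)%Z ->
         let n := (2 * Z.of_nat m + 1)%Z in
         let eps := K * (ln (INR m) ^ 2 / INR m ^ 2) in
         gap_formula (lp n - lm n)
           ((A * b) ^ m * (a * B) ^ (m + 1)) m eps /\
         gap_formula (lp (- n)%Z - lm (- n)%Z)
           ((A * b) ^ (m + 1) * (a * B) ^ m) m eps).
Proof.
  intros a A b B na nA nb nB.
  destruct (setting_exists a A b B na nA nb nB)
    as [c [d [R0 [th [Ma [M [X [om [om' St]]]]]]]]].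
  assert (H : forall n : Z, exists l : C * C, (up X < Z.abs n)%Z ->
    good a A b B th M n (fst l) (snd l)).
  { intros n. destruct (Z_lt_dec (up X) (Z.abs n)) as [h | h].
    - assert (hX : X < IZR (Z.abs n)).
      { apply IZR_lt in h. pose proof (archimed X). lra. }
      destruct (Z.even n) eqn:hn.
      + destruct (good_even a A b B c d R0 th Ma M X om om' St n hn hX) as [lm [lp G]].
        now exists (lm, lp).
      + destruct (good_odd a A b B c d R0 th Ma M X om om' St n hn hX) as [lm [lp G]].
        now exists (lm, lp).
    - exists (RtoC 0, RtoC 0). intros h'. contradiction. }
  set (l := fun n => proj1_sig (constructive_indefinite_description _ (H n))).
  assert (Hl : forall n, (up X < Z.abs n)%Z -> good a A b B th M n (fst (l n)) (snd (l n))).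
  { intros n. exact (proj2_sig (constructive_indefinite_description _ (H n))). }
  exists (fun n => fst (l n)), (fun n => snd (l n)), (up X), (Kfin th M). split.
  - intros n hn. destruct (Hl n hn) as [g1 [g2 [g3 [g4 _]]]]. auto.
  - intros m hm n eps. split.
    + destruct (Hl n ltac:(unfold n; lia)) as [_ [_ [_ [_ g]]]].
      now apply (proj1 (g m)).
    + destruct (Hl (- n)%Z ltac:(unfold n; lia)) as [_ [_ [_ [_ g]]]].
      now apply (proj2 (g m)).
Qed.
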